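(* For each $N\in\mathbb N$ let $x_{N,1}<\dots<x_{N,N}$ be real numbers, $M_N\in\mathbb N\cup\{0\}$, $s_{N,1},\dots,s_{N,M_N}\in\mathbb H$ and $\alpha_{N,1},\dots,\alpha_{N,M_N}\in\mathbb Z$. Let $g_{N,t}$ and $V_{N,1},\dots,V_{N,N}$ solve $$\frac{d}{dt}g_{N,t}(z)=\sum_{k=1}^N\frac{2/N}{g_{N,t}(z)-V_{N,k}(t)},\qquad g_{N,0}(z)=z\in\mathbb H,$$ $$\frac{d}{dt}V_{N,k}(t)=\sum_{j\ne k}\frac{2/N}{V_{N,k}(t)-V_{N,j}(t)}+\sum_{j=1}^{M_N}\frac{\alpha_{N,j}/N}{V_{N,k}(t)-S_{N,j}(t)}+\sum_{j=1}^{M_N}\frac{\alpha_{N,j}/N}{V_{N,k}(t)-\overline{S_{N,j}(t)}},\qquad V_{N,k}(0)=x_{N,k},$$ where $S_{N,j}(t)=g_{N,t}(s_{N,j})$. Put $\mu_{N,t}=\sum_{k=1}^N\frac1N\delta_{V_{N,k}(t)}$ and $\sigma_{N,t}=\sum_{j=1}^{M_N}\frac{\alpha_{N,j}}{N}\delta_{S_{N,j}(t)}$. Assume: $\mu_{N,0}$ converges weakly to a probability measure $\mu$, and there is a $C^2$ function $\varphi:\mathbb R\to[1,\infty)$ with $\varphi',\varphi''$ bounded and $\varphi(x)\to\infty$ as $x\to\pm\infty$ such that $\sup_N\int\varphi\,d\mu_{N,0}<\infty$; there is a compact set $K\subset\mathbb H$ with $\operatorname{supp}\sigma_{N,0}\subset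 K$ for all $N$; and $\sigma_{N,0}$ converges weakly to a finite signed measure $\sigma$. Then there exists $T>0$ such that $\{\mu_{N,\cdot}\}_N$ is tight in $\mathcal M(T)$. Moreover, if $\mu_{N_k,\cdot}$ is a converging subsequence with limit $\mu_t$, then: (i) $\sigma_{N_k,t}$ converges to a process $\sigma_t$, and $$\frac{d}{dt}\int_{\mathbb R}f\,d\mu_t=\int_{\mathbb R^2}\frac{f'(x)-f'(y)}{x-y}\,d\mu_t(x)\,d\mu_t(y)+2\operatorname{Re}\left(\int_{\mathbb H}\int_{\mathbb R}\frac{f'(x)}{x-z}\,d\mu_t(x)\,d\sigma_t(z)\right),$$ $$\frac{d}{dt}\int_{\mathbb H}h\,d\sigma_t=\int_{\mathbb R}\int_{\mathbb H}\frac{2h'(z)}{z-y}\,d\sigma_t(z)\,d\mu_t(y),$$ for every $f\in C^2_b(\mathbb R,\mathbb C)$ and every continuously differentiable $h:\mathbb H\to\mathbb C$ with $h'$ bounded; (ii) with $M_t(z)=\int_{\mathbb R}\frac{2}{z-x}\,d\mu_t(x)$, $g_{N_k,t}$ converges locally uniformly to $g_t$, which satisfies $$\frac{d}{dt}g_t(z)=M_t(g_t(z)),$$ $$\frac{\partial}{\partial t}M_t(z)=-\frac{\partial M_t(z)}{\partial z}M_t(z)+2\operatorname{Re}\left(\int_{\mathbb H}\frac{M_t(z)}{(z-g_t(w))^2}-\frac{M_t(g_t(w))}{(z-g_t(w))^2}-\frac{\frac{\partial}{\partial z}M_t(z)}{z-g_t(w)}\,d\sigma(w)\right).$$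
   Context: $\mathbb H$ is the upper half-plane and $\delta_x$ the unit point mass at $x$. These equations describe the growth of the $N$ trajectories (orthogonal to $\mathbb R$ at $x_{N,k}$) of the quadratic differential $\prod_{k}(z-x_{N,k})^2\prod_j(z-s_{N,j})^{\alpha_{N,j}}(z-\overline{s_{N,j}})^{\alpha_{N,j}}dz^2$. $\mathcal M(T)=C([0,T],\mathcal P(\mathbb R))$ with the topology of uniform convergence, $\mathcal P(\mathbb R)$ carrying the weak topology; a sequence there is tight if it has a subsequence converging in distribution. $C^2_b(\mathbb R,\mathbb C)$ is the set of twice continuously differentiable $f:\mathbb R\to\mathbb C$ with $f,f',f''$ bounded.
   Formalization: ''2Re(∫…dσ)'' is read as the sum of the integrand at the charge and at its conjugate, since literal 2Re fails for complex f and for M_t; the M_t equation is stated for z outside g_t(K) and its conjugate, where the integrand is defined; all s_{N,j} are taken in K. *)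

(* Defs.v *)
From HB Require Import structures.
From mathcomp Require Import all_boot all_order all_algebra.
From mathcomp Require Import all_classical all_reals all_analysis.
From mathcomp Require Export complex.
Import Order.TTheory GRing.Theory Num.Theory.
Import numFieldNormedType.Exports.

Set Implicit Arguments.
Unset Strict Implicit.
Unset Printing Implicit Defensive.

Local Open Scope ring_scope.
Local Open Scope classical_set_scope.

(* R[i] as a normed module over itself, so that complex derivatives
   (derivable / derive1) of functions R[i] -> R[i] make sense. *)
Section ComplexNormed.
Variable R : rcfType.
HB.instance Definition _ := GRing.ComAlgebra.copy R[i] (R[i])^o.
HB.instance Definition _ := Vector.copy R[i] (R[i])^o.
HB.instance Definition _ := NormedModule.copy R[i] (R[i])^o.
End ComplexNormed.

Section Defs.
Variable R : realType.
Local Notation C := R[i].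

Definition cR (x : R) : C := @Complex R x 0.
Definition ReC (z : C) : R := @complex.Re R z.
Definition ImC (z : C) : R := @complex.Im R z.
Definition cconj (z : C) : C := @Complex R (ReC z) (- ImC z).
Definition inH (z : C) : Prop := 0 < ImC z.
Definition ofpair (p : R * R) : C := @Complex R p.1 p.2.

Definition is_cderiv (f : R -> C) (t : R) (l : C) : Prop :=
  (fun h : R => (f (t + h) - f t) / cR h) @ (0 : R)^' --> l.

Definition cint d (T : measurableType d) (mu : measure T R) (f : T -> C) : C :=
  @Complex R (Rintegral mu setT (fun x => ReC (f x)))
          (Rintegral mu setT (fun x => ImC (f x))).

(* finite signed measures on H: differences of two finite measures on
   R*R (identified with C via ofpair) which do not charge {Im <= 0} *)
Record smeasH := SMeasH {
  smp : {finite_measure set (R * R)%type -> \bar R};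
  smn : {finite_measure set (R * R)%type -> \bar R} }.

Definition supported_in_H (s : smeasH) : Prop :=
  smp s [set p | p.2 <= 0] = 0%E /\ smn s [set p | p.2 <= 0] = 0%E.

Definition sintR (s : smeasH) (f : C -> R) : R :=
  Rintegral (smp s) setT (f \o ofpair) - Rintegral (smn s) setT (f \o ofpair).

Definition sint (s : smeasH) (f : C -> C) : C :=
  cint (smp s) (f \o ofpair) - cint (smn s) (f \o ofpair).

Definition bcontR (f : R -> R) : Prop :=
  (exists M : R, forall x, `|f x| <= M) /\ continuous f.
Definition bcontH (f : C -> R) : Prop :=
  (exists M : R, forall z, inH z -> `|f z| <= M) /\
  (forall z, inH z -> {for z, continuous f}).

Definition BL1 (f : R -> R) : Prop :=
  (forall x, `|f x| <= 1) /\ (forall x y, `|f x - f y| <= `|x - y|).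

(* empirical measure (1/N) sum_k delta_{W k}, N = n.+1, integrated *)
Definition empR (n : nat) (W : 'I_n.+1 -> R) (f : R -> R) : R :=
  (\sum_k f (W k)) / n.+1%:R.

(* sum_j alpha_j/N delta_{S_j}, N = n.+1, integrated *)
Definition atomsH (n m : nat) (a : 'I_m -> int) (S : 'I_m -> C) (f : C -> R) : R :=
  \sum_j ((a j)%:~R / n.+1%:R) * f (S j).

Definition loewnerSol (n : nat) (W : R -> 'I_n.+1 -> R) (t1 : R) (z : C)
    (gam : R -> C) : Prop :=
  gam 0 = z /\ (forall u, 0 <= u <= t1 -> inH (gam u)) /\
  {within `[0, t1], continuous gam} /\
  (forall u, 0 < u < t1 ->
     is_cderiv gam u (\sum_k cR (2 / n.+1%:R) / (gam u - cR (W u k)))).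

Definition Vdrift (n m : nat) (a : 'I_m -> int) (Wu : 'I_n.+1 -> R)
    (Su : 'I_m -> C) (k : 'I_n.+1) : C :=
  (\sum_(l | l != k) cR (2 / n.+1%:R) / cR (Wu k - Wu l))
  + (\sum_j ((a j)%:~R / cR n.+1%:R) / (cR (Wu k) - Su j))
  + (\sum_j ((a j)%:~R / cR n.+1%:R) / (cR (Wu k) - cconj (Su j))).

Definition drivingSol (n m : nat) (x : 'I_n.+1 -> R) (s : 'I_m -> C)
    (a : 'I_m -> int) (t1 : R) (W : R -> 'I_n.+1 -> R) (S : R -> 'I_m -> C)
    : Prop :=
  (forall k, W 0 k = x k) /\
  (forall u, 0 <= u <= t1 -> forall k l, k != l -> W u k != W u l) /\
  (forall k, {within `[0, t1], continuous (fun u => W u k)}) /\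
  (forall j, loewnerSol W t1 (s j) (fun u => S u j)) /\
  (forall u, 0 < u < t1 -> forall k,
     is_cderiv (fun v => cR (W v k)) u (Vdrift a (W u) (S u) k)).

Definition weakly_continuous (T : R) (mu : R -> probability R R) : Prop :=
  forall f, bcontR f ->
    {within `[0, T], continuous (fun t => Rintegral (mu t) setT f)}.

(* convergence in M(T) of the subsequence n = nk k of the empirical processes
   t |-> mu_{N,t} (N = n.+1) to mu: mu is in M(T) and
   sup_{t in [0,T]} d_BL(mu_{N_k,t}, mu_t) --> 0 *)
Definition MT_conv (T : R) (nk : nat -> nat) (V : forall n, R -> 'I_n.+1 -> R)
    (mu : R -> probability R R) : Prop :=
  weakly_continuous T mu /\
  forall e : R, 0 < e -> \forall k \near \oo,
    forall t, 0 <= t <= T -> forall f, BL1 f ->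
      `|empR (V (nk k) t) f - Rintegral (mu t) setT f| <= e.

Definition strictly_incr (nk : nat -> nat) : Prop :=
  forall a b, (a < b)%N -> (nk a < nk b)%N.

Definition C2b (f : R -> R) : Prop :=
  (forall x, derivable f x 1) /\ (forall x, derivable (derive1 f) x 1) /\
  continuous (derive1 (derive1 f)) /\
  (exists M : R, forall x,
     `|f x| <= M /\ `|derive1 f x| <= M /\ `|derive1 (derive1 f) x| <= M).

Definition C2bC (f : R -> C) : Prop :=
  C2b (fun x => ReC (f x)) /\ C2b (fun x => ImC (f x)).
Definition cder1 (f : R -> C) (x : R) : C :=
  @Complex R (derive1 (fun y => ReC (f y)) x) (derive1 (fun y => ImC (f y)) x).
Definition cder2 (f : R -> C) (x : R) : C :=
  @Complex R (derive1 (derive1 (fun y => ReC (f y))) x)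
          (derive1 (derive1 (fun y => ImC (f y))) x).

(* (f'(x)-f'(y))/(x-y), with its continuous extension f''(x) on the diagonal *)
Definition dquot (f : R -> C) (x y : R) : C :=
  if x == y then cder2 f x else (cder1 f x - cder1 f y) / cR (x - y).

Definition holoH (h : C -> C) : Prop :=
  (forall z, inH z -> derivable h z 1) /\
  (forall z, inH z -> {for z, continuous (derive1 h)}) /\
  (exists M : R, forall z, inH z -> `|derive1 h z| <= cR M).

Definition Mfun (mu : probability R R) (z : C) : C :=
  cint mu (fun x => cR 2 / (z - cR x)).

Definition limLoewnerSol (mu : R -> probability R R) (t1 : R) (z : C)
    (gam : R -> C) : Prop :=
  gam 0 = z /\ (forall u, 0 <= u <= t1 -> inH (gam u)) /\
  {within `[0, t1], continuous gam} /\
  (forall u, 0 < u < t1 -> is_cderiv gam u (Mfun (mu u) (gam u))).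

End Defs.

(* Main.v *)
(* Points of K have imaginary part at least 2 delta, and the vertical speed of a Loewner flow
   above height delta is at most 2/delta, so for T = delta^2/2 the points of K stay above delta
   up to time T; a logarithmic energy keeps the V_{N,k} apart.  By the uniform boundedness
   principle the total action of sigma_N on continuous functions is bounded, hence so is the
   drift b of the V_{N,k} exerted by the S_{N,j}; t |-> int f dmu_{N,t} is then equi-Lipschitz for
   smooth f, int phi dmu_{N,t} is bounded, and compactness in M(T) follows, limit measures being
   built from limits along an ultrafilter.  The equations pass to the limit through the joint
   convergence of all terms in (N, t); sigma_t is the image of sigma under the limiting flow.
   The equation for M_t is (i) applied to f(x) = 2/(z - x), together with an a priori bound
   of M_t on the half-plane that makes the integral against sigma meaningful. *)
Require Import Defs.
From HB Require Import structures.
From mathcomp Require Import all_boot all_order all_algebra.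
From mathcomp Require Import all_classical all_reals all_analysis.
From mathcomp Require Import measurable_realfun complex.
From mathcomp Require Import ring lra.
Import Order.TTheory GRing.Theory Num.Theory.
Import numFieldNormedType.Exports.
Local Open Scope ring_scope.
Local Open Scope classical_set_scope.

Set Implicit Arguments.
Unset Strict Implicit.
Unset Printing Implicit Defensive.

(** * Derivatives and differential inequalities *)

(** The repulsion 1/(V_k - V_l) is singular and nothing bounds it uniformly in N, so no limit is
    taken in the system itself: antisymmetry turns the singular drift in the derivative of an
    average of f into difference quotients of f', which f'' bounds. Convergence at fixed times does
    not yield a limit equation. The derivative at t of a limit is identified once the derivatives
    are close to their limit for all large N and all times near t, which explains the joint form of
    the convergences. Signs and sizes of the weights of sigma_N are free, so no total variation is
    at hand; the constant [Cb] acts on continuous functions only, and each pole term has to be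
    written as the action of sigma_N on one continuous function before it is estimated. The two
    finite measures representing sigma need not be its Jordan decomposition: they may share mass
    anywhere in the half-plane, also at points whose trajectory under the limiting flow has ended.
    The difference cancels this mass, but each of the two integrals has to make sense alone, and
    this is where control of M_t down to the real line is called for. *)

Section RealDerivatives.
Variable R : realType.
Implicit Types f g : R -> R.

Lemma is_derive_eps f (t l : R) : is_derive t 1 f l <->
  forall e : R, 0 < e -> exists2 d : R, 0 < d &
    forall h : R, `|h| < d -> `|f (t + h) - f t - h * l| <= e * `|h|.
Proof.
split.
  move=> [dv <-] e e0; set L := 'D_1 f t.
  have dv' : h^-1 *: (f (h *: 1 + t) - f t) @[h --> 0^'] --> L := dv.
  have /cvgrPdist_le/(_ _ e0) := dv'.
  move=> -[d /= d0 H]; exists d => // h hd.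
  have [->|hn0] := eqVneq h 0; first by rewrite addr0 subrr mul0r subrr normr0 mulr0.
  have := H h; rewrite /= (_ : 0 - h = - h :> R) ?sub0r // normrN => /(_ hd hn0).
  rewrite -[h *: 1]/(h * 1) mulr1 -[_ *: (_ - _)]/(_ * _) (addrC h) => H1.
  have -> : f (t + h) - f t - h * L = - (h * (L - h^-1 * (f (t + h) - f t))).
    by rewrite mulrBr mulrA mulfV // mul1r; ring.
  by rewrite normrN normrM mulrC ler_wpM2r.
move=> H.
have C : h^-1 *: (f (h *: 1 + t) - f t) @[h --> 0^'] --> l.
  apply/cvgrPdist_le => e e0; have [d d0 Hd] := H e e0.
  exists d => // h; rewrite /ball_ /= sub0r normrN => hd hn0.
  have h0 : 0 < `|h| by rewrite normr_gt0.
  rewrite -(ler_pM2r h0) -normrM -[h *: 1]/(h * 1) mulr1 -[_ *: _]/(_ * _) mulrBl.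
  rewrite mulrAC mulVf // mul1r (addrC h t) distrC.
  by rewrite (mulrC l) Hd.
by apply: DeriveDef; [apply/cvg_ex; exists l | apply/cvg_lim].
Qed.

(* [is_derive] is a class, which [apply:] would try to solve by resolution. *)
Definition der f (t l : R) : Prop := is_derive t 1 f l.

Lemma der_eps f (t l : R) : der f t l <->
  forall e : R, 0 < e -> exists2 d : R, 0 < d &
    forall h : R, `|h| < d -> `|f (t + h) - f t - h * l| <= e * `|h|.
Proof. exact: is_derive_eps. Qed.

Lemma der_near f g (t l l' : R) : (\forall s \near t, f s = g s) -> l = l' ->
  der f t l -> der g t l'.
Proof.
move=> [d0 /= d0p E] <- /der_eps H; apply/der_eps => e e0.
have [d dp Hd] := H e e0; exists (Num.min d d0); first by rewrite lt_min dp.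
move=> h; rewrite lt_min => /andP[h1 h2].
rewrite -E; last by rewrite /= opprD addrA subrr add0r normrN.
by rewrite -E ?Hd //= subrr normr0.
Qed.

Lemma der_ext f g (t l l' : R) : f =1 g -> l = l' ->
  der f t l -> der g t l'.
Proof. by move=> /funext -> <-. Qed.

Lemma der_eq f (t l l' : R) : der f t l -> l = l' -> der f t l'.
Proof. by move=> H <-. Qed.

Lemma derC (c t : R) : der (fun=> c) t 0.
Proof. exact: is_derive_cst. Qed.
Lemma derI (t : R) : der (fun s => s) t 1.
Proof. exact: is_derive_id. Qed.
Lemma derD f g (t a b : R) : der f t a -> der g t b ->
  der (fun s => f s + g s) t (a + b).
Proof. by move=> ? ?; exact: is_deriveD. Qed.
Lemma derN f (t a : R) : der f t a -> der (fun s => - f s) t (- a).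
Proof. by move=> ?; exact: is_deriveN. Qed.
Lemma derB f g (t a b : R) : der f t a -> der g t b ->
  der (fun s => f s - g s) t (a - b).
Proof. by move=> ? ?; exact: is_deriveB. Qed.
Lemma derM f g (t a b : R) : der f t a -> der g t b ->
  der (fun s => f s * g s) t (a * g t + f t * b).
Proof.
move=> Ha Hb; apply: der_ext (is_deriveM Ha Hb); first by [].
by rewrite -![_ *: _]/(_ * _) addrC mulrC.
Qed.
Lemma derZ f (c t a : R) : der f t a -> der (fun s => c * f s) t (c * a).
Proof. by move=> H; apply: der_eq; [exact: derM (derC c t) H | rewrite mul0r add0r]. Qed.
Lemma derV f (t a : R) : f t != 0 -> der f t a ->
  der (fun s => (f s)^-1) t (- a / f t ^+ 2).
Proof.
move=> n0 H; apply: der_ext (is_deriveV n0 H) => //.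
by rewrite -[_ *: _]/(_ * _) !mulNr mulrC.
Qed.
Lemma der_comp f g (t a b : R) : der f (g t) a -> der g t b ->
  der (fun s => f (g s)) t (a * b).
Proof. by move=> Ha Hb; apply: der_ext (is_derive1_comp Ha Hb). Qed.
Lemma der_sum (I : Type) (r : seq I) (P : pred I) (F : I -> R -> R) (t : R) (dF : I -> R) :
  (forall i, P i -> der (F i) t (dF i)) ->
  der (fun s => \sum_(i <- r | P i) F i s) t (\sum_(i <- r | P i) dF i).
Proof.
move=> H; elim: r => [|i r IH].
  by rewrite big_nil; apply: (der_ext _ (erefl _) (derC 0 t)) => // s; rewrite big_nil.
rewrite big_cons; case: (boolP (P i)) => Pi.
  by apply: (der_ext _ (erefl _) (derD (H i Pi) IH)) => // s; rewrite big_cons Pi.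
by apply: (der_ext _ (erefl _) IH) => // s; rewrite big_cons (negbTE Pi).
Qed.

Lemma der_cont f (t l : R) : der f t l -> {for t, continuous f}.
Proof. by move=> [H _]; apply: differentiable_continuous; exact/derivable1_diffP. Qed.

Lemma within_cont (a b : R) f : (forall x, a <= x <= b -> {for x, continuous f}) ->
  {within `[a, b], continuous f}.
Proof.
move=> H; apply: continuous_in_subspaceT => x; rewrite inE /= in_itv /= => xab.
exact: H.
Qed.

Lemma within_contP (a b : R) f : {within `[a, b], continuous f} <->
  forall x, a <= x <= b -> forall e : R, 0 < e -> exists2 d : R, 0 < d &
    forall y, a <= y <= b -> `|y - x| < d -> `|f y - f x| <= e.
Proof.
split.
  move=> /subspace_continuousP H x xab e e0.
  have /(_ x) := H; rewrite /= in_itv /= => /(_ xab)/cvgrPdist_le/(_ _ e0) [d /= d0 Hd].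
  exists d => // y yab yx; rewrite distrC; apply: Hd => //=; first by rewrite distrC.
move=> H; apply/subspace_continuousP => x; rewrite /= in_itv /= => xab.
apply/cvgrPdist_le => e e0; have [d d0 Hd] := H x xab e e0.
exists d => //= y yx; rewrite in_itv /= => yab; rewrite distrC Hd // distrC //.
Qed.

Lemma within_sub (a b c d : R) f : a <= c -> d <= b -> {within `[a, b], continuous f} ->
  {within `[c, d], continuous f}.
Proof.
move=> ac db /within_contP H; apply/within_contP => x /andP[cx xd] e e0.
have [|d0 d0p Hd] := H x _ e e0; first by rewrite (le_trans ac) ?(le_trans xd).
exists d0 => // y /andP[cy yd]; apply: Hd.
by rewrite (le_trans ac cy) (le_trans yd).
Qed.

Lemma within_comp2 (a b : R) f (h : R -> R) : continuous h ->
  {within `[a, b], continuous f} -> {within `[a, b], continuous (fun t => h (f t))}.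
Proof.
move=> hc /within_contP H; apply/within_contP => x xab e e0.
have /cvgrPdist_le/(_ _ e0)[d1 /= d1p H1] := hc (f x).
have [|d0 d0p Hd] := H x xab (d1 / 2); first by rewrite divr_gt0.
exists d0 => // y yab yx; rewrite distrC; apply: H1 => /=.
rewrite distrC; apply: le_lt_trans (Hd _ yab yx) _; lra.
Qed.

Lemma nonincr (f df : R -> R) (a b : R) : a <= b ->
  {within `[a, b], continuous f} ->
  (forall x, a < x < b -> der f x (df x)) ->
  (forall x, a < x < b -> df x <= 0) -> f b <= f a.
Proof.
move=> ab fc H H0.
have [<-//|nab] := eqVneq a b; have altb : a < b by rewrite lt_neqAle nab.
have Hd x : x \in `]a, b[%R -> is_derive x 1 f (df x) by rewrite in_itv /= => /H.
have [c cab E] := MVT altb Hd fc.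
rewrite -subr_le0 E mulr_le0_ge0 ?subr_ge0 // H0 //.
Qed.

Lemma le_compare (f df g dg : R -> R) (a b : R) : a <= b ->
  {within `[a, b], continuous f} -> {within `[a, b], continuous g} ->
  (forall x, a < x < b -> der f x (df x)) ->
  (forall x, a < x < b -> der g x (dg x)) ->
  (forall x, a < x < b -> df x <= dg x) -> f b - f a <= g b - g a.
Proof.
move=> ab fc gc df_ dg_ le.
have := @nonincr (fun s => f s - g s) (fun s => df s - dg s) a b ab.
move=> H; have {H} : f b - g b <= f a - g a; last by lra.
apply: H => [||x xab]; last by rewrite subr_le0 le.
  by move=> x; apply: continuousB; [exact: fc|exact: gc].
by move=> x xab; apply: derB; [exact: df_|exact: dg_].
Qed.

Lemma lip_bound (f df : R -> R) (a b B : R) : a <= b ->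
  {within `[a, b], continuous f} ->
  (forall x, a < x < b -> der f x (df x)) ->
  (forall x, a < x < b -> `|df x| <= B) -> `|f b - f a| <= B * (b - a).
Proof.
move=> ab fc H HB.
have gc (c : R) : {within `[a, b], continuous (fun s => c * s)}.
  by apply: within_cont => x _; apply: der_cont; exact: derZ (derI x).
have gd (c x : R) : der (fun s => c * s) x (c * 1) by exact: derZ (derI x).
have h1 : f b - f a <= B * b - B * a.
  apply: (@le_compare f df _ (fun=> B * 1) a b) => // x xab.
  by rewrite mulr1 (le_trans _ (HB x xab)) // ler_norm.
have h2 : (- B) * b - (- B) * a <= f b - f a.
  apply: (@le_compare (fun s => - B * s) (fun=> - B * 1) f df a b) => // x xab.
  by rewrite mulr1; have := HB x xab; rewrite ler_norml => /andP[].
rewrite ler_norml; apply/andP; split; move: h1 h2; rewrite mulrBr !mulNr; lra.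
Qed.

Lemma lip_bound_all (f df : R -> R) (B : R) :
  (forall x, der f x (df x)) -> (forall x, `|df x| <= B) ->
  forall x y, `|f x - f y| <= B * `|x - y|.
Proof.
move=> H HB x y.
wlog xy : x y / y <= x.
  move=> W; case: (leP y x) => [|/ltW] xy; first exact: W.
  by rewrite distrC (distrC x) W.
rewrite (ger0_norm (_ : 0 <= x - y)) ?subr_ge0 //.
apply: (@lip_bound f df) => //.
by apply: within_cont => z _; exact: der_cont (H z).
Qed.

(** The integrating factor [expR (- c * s)] is nonincreasing, so its product with [w] has derivative
    at most [e * E a]; the comparison function is linear, and dividing by [E b] gives the bound. *)
Lemma gronwall (w dw : R -> R) (a b c e : R) : a <= b -> 0 <= c -> 0 <= e ->
  {within `[a, b], continuous w} ->
  (forall x, a < x < b -> der w x (dw x)) ->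
  (forall x, a < x < b -> dw x <= c * w x + e) ->
  w b <= (w a + e * (b - a)) * expR (c * (b - a)).
Proof.
move=> ab c0 e0 wc wd wle.
pose E s := expR (- c * s).
have dE x : der E x (E x * (- c * 1)).
  apply: (@der_comp expR (fun s => - c * s)); last exact: derZ (derI x).
  exact: is_derive_expR.
have := @le_compare (fun s => w s * E s) (fun s => dw s * E s + w s * (E s * (- c * 1)))
   (fun s => e * E a * s) (fun=> e * E a * 1) a b ab.
move=> H; have {}H : w b * E b - w a * E a <= e * E a * b - e * E a * a.
  apply: H.
  - move=> x; apply: continuousM; first exact: wc.
    by move: x; apply: within_cont => y _; exact: der_cont (dE y).
  - by apply: within_cont => y _; apply: der_cont; exact: derZ (derI y).
  - by move=> x xab; apply: derM; [exact: wd|exact: dE].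
  - by move=> x _; exact: derZ (derI x).
  - move=> x /andP[ax xb].
    have E0 : 0 < E x by exact: expR_gt0.
    have h := wle x; rewrite ax xb in h; have {}h := h isT.
    have : E x <= E a by rewrite ler_expR !mulNr lerN2 ler_wpM2l // ltW.
    move=> EE; rewrite !mulr1.
    have -> : dw x * E x + w x * (E x * - c) = (dw x - c * w x) * E x by ring.
    apply: (@le_trans _ _ (e * E x)); last by rewrite ler_wpM2l.
    by apply: ler_wpM2r; [exact: ltW|lra].
have Eb0 : 0 < E b by exact: expR_gt0.
rewrite -(ler_pM2r Eb0).
have -> : (w a + e * (b - a)) * expR (c * (b - a)) * E b = (w a + e * (b - a)) * E a.
  by rewrite -mulrA -expRD; congr (_ * expR _); ring.
by move: H; lra.
Qed.

(** The fundamental theorem of calculus yields a primitive to the right of each base point.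
    Normalised at 0, the primitives with base points [- m] and [- n] agree where both are defined;
    the global one uses at x a base point to the left of x. *)
Lemma primitive (f : R -> R) : continuous f ->
  exists F : R -> R, F 0 = 0 /\ forall x, der F x (f x).
Proof.
move=> fc.
have P (a : R) : exists F : R -> R, forall x, a < x -> der F x (f x).
  exists (fun x => (\int[lebesgue_measure]_(t in `[a, x]) f t)%R) => x ax.
  have [||d E] := @continuous_FTC1_closed R f a x (x + 1) _ _ ax (fc x).
  - by rewrite ltrDl.
  - apply: continuous_compact_integrable; first exact: segment_compact.
    exact: continuous_subspaceT.
  - by apply: DeriveDef => //; rewrite -derive1E.
have [F HF] := choice P.
pose G (n : nat) x := F (- n%:R) x - F (- n%:R) 0.
have GE (m n : nat) (x : R) : (0 < m)%N -> (0 < n)%N -> - m%:R < x -> - n%:R < x -> G m x = G n x.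
  move=> m0 n0 mx nx.
  have HG k y : - k%:R < y -> der (G k) y (f y).
    by move=> ky; apply: der_eq; [apply: derB; [exact: HF|exact: derC]|rewrite subr0].
  have D (a b : R) : a <= b -> - m%:R < a -> - n%:R < a -> G m b - G n b = G m a - G n a.
    move=> ab ma na.
    apply/eqP; rewrite -subr_eq0 -normr_le0 -[leRHS](mul0r (b - a)).
    apply: (@lip_bound (fun s => G m s - G n s) (fun=> 0)) => //.
    - apply: within_cont => y /andP[ay _]; apply: (@der_cont _ y (f y - f y)).
      by apply: derB; apply: HG; apply: lt_le_trans ay.
    - move=> y /andP[ay _]; apply: der_eq.
        by apply: derB; apply: HG; [exact: lt_trans ay|exact: lt_trans ay].
      by rewrite subrr.
    - by move=> y _; rewrite normr0.
  have G0 k : G k 0 = 0 by rewrite /G subrr.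
  apply/eqP; rewrite -subr_eq0; apply/eqP.
  have [x0|x0] := leP 0 x.
    by rewrite (D 0 x) ?G0 ?subrr // oppr_lt0 ltr0n.
  by rewrite -(D x 0) ?G0 ?subrr // ltW.
exists (fun x => G (Num.bound `|x|).+1 x); split; first by rewrite /G subrr.
move=> x; pose n := (Num.bound `|x|).+2.
have lb (y : R) (k : nat) : (Num.bound `|y| <= k)%N -> - k.+1%:R < y.
  move=> nk; have := archi_boundP (normr_ge0 y) => h.
  have : (Num.bound `|y|)%:R <= k%:R :> R by rewrite ler_nat.
  have := ler_norm (- y); rewrite normrN -natr1 => ? ?; lra.
have bx : `|x| < (Num.bound `|x|)%:R by exact: archi_boundP.
apply: (@der_near (G n)) (erefl (f x)) _.
  have : \forall s \near x, - n%:R < s.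
    by apply: lt_nbhsr; apply: lb.
  by move=> near_; near=> s; apply: GE => //; [near: s|exact: lb].
apply: der_eq; first by apply: derB; [apply: HF; exact: lb|exact: derC].
by rewrite subr0.
Unshelve. all: by end_near. Qed.

End RealDerivatives.

(** * Limits of derivatives and Picard iteration *)

Section LimitDerivative.
Variable R : realType.

Lemma lim_near_le (u : nat -> R) (l a e : R) :
  u @ \oo --> l -> (\forall n \near \oo, `|u n - a| <= e) -> `|l - a| <= e.
Proof.
move=> ul H.
have /cvgrPdist_le ul' := ul.
apply/ler_addgt0Pr => d d0.
near \oo => n.
have h1 : `|l - u n| <= d by near: n; exact: ul'.
have h2 : `|u n - a| <= e by near: n.
by have := ler_normD (l - u n) (u n - a); rewrite addrA subrK; lra.
Unshelve. all: by end_near. Qed.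

(** Mean value inequality for [u n s - s * l], whose derivative is small near t for all large n. The
    increments converge, while the derivatives only have to approach [l] jointly as n grows and s
    tends to t. *)
Lemma der_lim (u r : nat -> R -> R) (v : R -> R) (t l d0 : R) : 0 < d0 ->
  (forall n (s : R), `|s - t| < d0 -> der (u n) s (r n s)) ->
  (forall s : R, `|s - t| < d0 -> (fun n => u n s) @ \oo --> v s) ->
  (forall e : R, 0 < e -> exists2 d : R, 0 < d &
     \forall n \near \oo, forall s : R, `|s - t| < d -> `|r n s - l| <= e) ->
  der v t l.
Proof.
move=> d00 Hu Hv Hr; apply/der_eps => e e0.
have [d d1 Hd] := Hr e e0.
exists (Num.min d0 d); first by rewrite lt_min d00.
move=> h; rewrite lt_min => /andP[h0 h1].
have ht : `|t + h - t| < d0 by rewrite addrAC subrr add0r.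
have tt : `|t - t| < d0 by rewrite subrr normr0.
have : (fun n => u n (t + h) - u n t) @ \oo --> v (t + h) - v t.
  by apply: cvgB; exact: Hv.
move=> /lim_near_le; apply; near=> n.
have Hn : forall s : R, `|s - t| < d -> `|r n s - l| <= e by near: n.
pose w s := u n s - s * l.
have dw s : `|s - t| < d0 -> der w s (r n s - l).
  move=> st; apply: der_eq; first by apply: derB; [exact: Hu|exact: derM (derI s) (derC l s)].
  by rewrite mul1r mulr0 addr0.
have -> : u n (t + h) - u n t - h * l = w (t + h) - w t by rewrite /w; ring.
have seg (a b s : R) : `|a - t| <= `|h| -> `|b - t| <= `|h| -> a <= s <= b -> `|s - t| <= `|h|.
  rewrite !ler_norml => /andP[? ?] /andP[? ?] /andP[? ?]; apply/andP; split; lra.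
have key (a b : R) : `|a - t| <= `|h| -> `|b - t| <= `|h| -> a <= b -> `|w b - w a| <= e * (b - a).
  move=> ah bh ab; apply: (@lip_bound _ w (fun s => r n s - l)) => //.
  - apply: within_cont => s sab; apply: (@der_cont _ w s (r n s - l)); apply: dw.
    exact: le_lt_trans (seg _ _ _ ah bh sab) h0.
  - move=> s /andP[sa sb]; apply: dw; apply: le_lt_trans h0; apply: (seg a b) => //.
    by rewrite !ltW.
  - move=> s /andP[sa sb]; apply: Hn; apply: le_lt_trans h1; apply: (seg a b) => //.
    by rewrite !ltW.
have th : `|t + h - t| <= `|h| by rewrite addrAC subrr add0r.
have t0 : `|t - t| <= `|h| by rewrite subrr normr0.
have [h2|h2] := leP 0 h.
  apply: le_trans (key t (t + h) t0 th _) _; first by rewrite lerDl.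
  by rewrite addrAC subrr add0r ger0_norm.
rewrite distrC; apply: le_trans (key (t + h) t th t0 _) _; first by rewrite gerDl ltW.
by rewrite opprD addrA subrr add0r ltr0_norm.
Unshelve. all: by end_near. Qed.

(** The intervals of radius [2 * C / 2 ^+ n] around [u n] are nested, and the supremum of their left
    ends lies in all of them; the rate comes together with the limit. *)
Lemma geo_lim (u : nat -> R) (C : R) : (forall n, `|u n.+1 - u n| <= C / 2 ^+ n) ->
  exists l : R, forall n, `|u n - l| <= 2 * C / 2 ^+ n.
Proof.
move=> H.
pose a n := u n - 2 * C / 2 ^+ n; pose b n := u n + 2 * C / 2 ^+ n.
have h2 n : C / 2 ^+ n = C / 2 ^+ n.+1 + C / 2 ^+ n.+1.
  by rewrite exprS; field; rewrite expf_neq0.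
have aS n : a n <= a n.+1.
  have := H n; rewrite /a ler_norml -!mulrA => /andP[]; have := h2 n; lra.
have bS n : b n.+1 <= b n.
  have := H n; rewrite /b ler_norml -!mulrA => /andP[]; have := h2 n; lra.
have C0 n : 0 <= C / 2 ^+ n := le_trans (normr_ge0 _) (H n).
have am m n : (m <= n)%N -> a m <= a n.
  by move=> /subnK <-; elim: (n - m)%N => //= k IH; rewrite addSn (le_trans IH).
have bm m n : (m <= n)%N -> b n <= b m.
  by move=> /subnK <-; elim: (n - m)%N => //= k IH; rewrite addSn (le_trans _ IH).
have ab m n : a m <= b n.
  have abn k : a k <= b k by rewrite /a /b -!mulrA; have := C0 k; lra.
  by case: (leqP m n) => [/am h|/ltnW /bm h]; [exact: le_trans h (abn n)|exact: le_trans (abn m) h].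
have ubS : has_sup (range a).
  by split; [exists (a 0%N), 0%N|exists (b 0%N) => _ [m _ <-]].
exists (sup (range a)) => n.
have h1 : a n <= sup (range a) by apply: ub_le_sup; [case: ubS|exists n].
have h3 : sup (range a) <= b n by apply: ge_sup; [case: ubS|move=> _ [m _ <-]].
by rewrite ler_norml; move: h1 h3; rewrite /a /b => ? ?; apply/andP; split; lra.
Qed.

End LimitDerivative.

(** * Picard iteration in finitely many real unknowns *)

Section Picard.
Variables (R : realType) (I : finType) (F : R -> (I -> R) -> I -> R) (B L : R).
Hypothesis L0 : 0 <= L.
Hypothesis FB : forall t x i, `|F t x i| <= B.
Hypothesis FL : forall t x y (d : R) i, (forall j, `|x j - y j| <= d) -> `|F t x i - F t y i| <= L * d.
Hypothesis Fc : forall x i, continuous (fun t => F t x i).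
Variable x0 : I -> R.

Let lipB (y : R -> I -> R) := forall i s t, `|y s i - y t i| <= B * `|s - t|.

Let Fy_cont (y : R -> I -> R) i : lipB y -> continuous (fun t => F t (y t) i).
Proof.
move=> ly t; apply/cvgrPdist_le => e e0.
have /cvgrPdist_le/(_ (e / 2))[|d /= d0 Hd] := @Fc (y t) i t; first by rewrite divr_gt0.
have B0 : 0 <= B.
  by apply: le_trans (FB 0 x0 i); exact: normr_ge0.
have LB : 0 < L * B + 1 by rewrite ltr_wpDl ?mulr_ge0.
pose d' := Num.min d (e / 2 / (L * B + 1)).
have d'0 : 0 < d' by rewrite lt_min d0 !divr_gt0.
exists d' => // s; rewrite /ball_ /= lt_min => /andP[s1 s2].
have h1 := Hd s s1.
have h2 : `|F s (y t) i - F s (y s) i| <= L * (B * `|t - s|) by apply: FL => j; exact: ly.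
move: s2; rewrite ltr_pdivlMr // => s2.
have h3 : L * (B * `|t - s|) <= e / 2.
  by move: s2; rewrite mulrDr mulr1 => ?; have := normr_ge0 (t - s); lra.
have := ler_normD (F t (y t) i - F s (y t) i) (F s (y t) i - F s (y s) i).
by rewrite addrA subrK => h; lra.
Qed.

(** The implication under the existential makes the Picard step total, so that [choice] turns it
    into a map that can be iterated. Its properties hold on Lipschitz functions, a class that it
    preserves. *)
Let step_ex (y : R -> I -> R) : exists y', lipB y ->
  [/\ y' 0 = x0, forall t i, der (fun s => y' s i) t (F t (y t) i) & lipB y'].
Proof.
have [ly|nl] := EM (lipB y); last by exists y.
have P i := primitive (@Fy_cont y i ly).
have [G HG] := choice P.
exists (fun t i => x0 i + G i t) => _; split.
- by apply/funext => i; rewrite (HG i).1 addr0.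
- move=> t i; apply: der_eq; first by apply: derD (derC _ _) ((HG i).2 t).
  by rewrite add0r.
- move=> i s t.
  have -> : x0 i + G i s - (x0 i + G i t) = G i s - G i t by ring.
  exact: (lip_bound_all (HG i).2).
Qed.

Let step := projT1 (choice step_ex).
Let stepP := projT2 (choice step_ex).
Let it n := iter n step (fun _ => x0).

Let it_lip n : lipB (it n).
Proof.
elim: n => [|n IH] /=; last by have [] := stepP IH.
move=> i s t; rewrite /it /= subrr normr0 mulr_ge0 //.
by apply: le_trans (FB 0 x0 i); exact: normr_ge0.
Qed.

Let it0 n : it n 0 = x0.
Proof. by case: n => //= n; have [] := stepP (it_lip n). Qed.

Let it_der n t i : der (fun s => it n.+1 s i) t (F t (it n t) i).
Proof. by have [_ H _] := stepP (it_lip n); exact: H. Qed.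

Let M := L + 1.
Let M0 : 0 < M. Proof. by rewrite ltr_wpDl. Qed.

(** The weight [expR (2 * M * t)] absorbs the Lipschitz constant: integrating [M * expR (2 * M * s)]
    gains a factor 1/2, so the error halves at each step on the whole half-line at once. Taking
    [M = L + 1] keeps the weight from degenerating when L is 0. *)
Let it_bound n i t : 0 <= t ->
  `|it n.+1 t i - it n t i| <= B / (2 * M) / 2 ^+ n * expR (2 * M * t).
Proof.
elim: n i t => [|n IH] i t t0.
  have B0 : 0 <= B by apply: le_trans (FB 0 x0 i); exact: normr_ge0.
  have := @it_lip 1 i t 0; rewrite (it0 1) subr0 => h.
  have -> : it 0%N t i = x0 i by []. rewrite expr0 divr1; apply: le_trans h _.
  rewrite ger0_norm // -mulrA ler_wpM2l // mulrC ler_pdivlMr ?mulr_gt0 //.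
  rewrite mulrC; apply: le_trans (expR_ge1Dx _); lra.
pose c := B / (2 * M) / 2 ^+ n.
pose g (a s : R) := a * (c / 2) * expR (2 * M * s).
have dg a s : der (g a) s (a * (c * M * expR (2 * M * s))).
  apply: der_eq; first apply: derZ.
    apply: (@der_comp _ expR (fun s => 2 * M * s)); last exact: derZ (derI s).
    exact: is_derive_expR.
  by rewrite /=; field.
pose D s := it n.+2 s i - it n.+1 s i.
have dD s : der D s (F s (it n.+1 s) i - F s (it n s) i) by apply: derB; exact: it_der.
have D0 : D 0 = 0 by rewrite /D !it0 subrr.
have bD s : 0 < s < t -> `|F s (it n.+1 s) i - F s (it n s) i| <= c * M * expR (2 * M * s).
  move=> /andP[s0 _].
  apply: (@le_trans _ _ (L * (c * expR (2 * M * s)))).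
    by apply: FL => j; apply: IH; exact: ltW.
  rewrite [leRHS]mulrAC mulrC ler_wpM2l ?lerDl //.
  exact: le_trans (normr_ge0 _) (IH i s (ltW s0)).
have gc a : {within `[0, t], continuous (g a)} by apply: within_cont => s _; exact: der_cont (dg a s).
have Dc : {within `[0, t], continuous D} by apply: within_cont => s _; exact: der_cont (dD s).
have g0 : 0 <= g 1 0.
  rewrite /g mul1r mulr0 expR0 mulr1 divr_ge0 //.
  by have := le_trans (normr_ge0 _) (IH i 0 (lexx 0)); rewrite mulr0 expR0 mulr1.
have h1 : D t - D 0 <= g 1 t - g 1 0.
  apply: le_compare t0 Dc (gc 1) (fun x _ => dD x) (fun x _ => dg 1 x) _ => s st.
  by rewrite mul1r; apply: le_trans (bD s st); exact: ler_norm.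
have h2 : g (-1) t - g (-1) 0 <= D t - D 0.
  apply: le_compare t0 (gc (-1)) Dc (fun x _ => dg (-1) x) (fun x _ => dD x) _ => s st.
  by have := bD s st; rewrite ler_norml mulN1r => /andP[].
have gN s : g (-1) s = - g 1 s by rewrite /g !mulN1r mul1r mulNr.
have -> : B / (2 * M) / 2 ^+ n.+1 * expR (2 * M * t) = g 1 t.
  by rewrite /g /c mul1r exprS; field; rewrite expf_neq0 //= gt_eqF.
rewrite -/(D t) ler_norml; move: h1 h2; rewrite !gN D0 => ? ?; apply/andP; split; lra.
Qed.

Theorem picard : exists y : R -> I -> R,
  [/\ y 0 = x0, forall t i, 0 < t -> der (fun s => y s i) t (F t (y t) i) & lipB y].
Proof.
have P (q : R * I) : exists l, 0 <= q.1 -> forall n,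
    `|it n q.1 q.2 - l| <= 2 * (B / (2 * M) * expR (2 * M * q.1)) / 2 ^+ n.
  have [t0|t0] := leP 0 q.1; last by exists 0.
  have [|l Hl] := @geo_lim R (fun n => it n q.1 q.2) (B / (2 * M) * expR (2 * M * q.1)).
    by move=> n; apply: le_trans (it_bound n q.2 t0) _; rewrite mulrAC.
  by exists l.
have [l Hl] := choice P.
have lc t i : 0 <= t -> (fun n => it n t i) @ \oo --> l (t, i).
  move=> t0; apply/cvgrPdist_le => e e0.
  have := Hl (t, i) t0 => /= H.
  pose C := 2 * (B / (2 * M) * expR (2 * M * t)).
  have : (fun n => C * (2^-1) ^+ n) @ \oo --> C * 0.
    by apply: cvgMr; apply: cvg_expr; rewrite ger0_norm ?invr_ge0 // invf_lt1 // ltr1n.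
  rewrite mulr0 => /cvgrPdist_le/(_ _ e0); apply: filterS => n.
  rewrite sub0r normrN => h; rewrite distrC; apply: le_trans (H n) _.
  by rewrite -exprVn; apply: le_trans h; exact: ler_norm.
(* The iterates are controlled for nonnegative times; freezing the limit at time 0 on the left keeps
   it Lipschitz on the whole line. *)
pose y t i := l (Num.max t 0, i).
have mx t : 0 <= Num.max t 0 :> R by rewrite le_max lexx orbT.
have ly : lipB y.
  move=> i s t.
  have h : (fun n => it n (Num.max s 0) i - it n (Num.max t 0) i) @ \oo --> y s i - y t i.
    by apply: cvgB; exact: lc.
  rewrite -[y s i - y t i]subr0; apply: (lim_near_le h); apply: nearW => n; rewrite subr0.
  apply: le_trans (@it_lip _ _ _ _) _.
  rewrite ler_wpM2l //; first by apply: le_trans (FB 0 x0 i); exact: normr_ge0.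
  by rewrite /Num.max; case: ltP => ?; case: ltP => ?; rewrite ?subrr ?normr0 ?normr_ge0 // ?subr0 ?sub0r ?normrN;
    (rewrite ler_norml; apply/andP; split; have := ler_norm (s - t); have := ler_norm (t - s); rewrite (distrC t s); lra).
exists y; split => //.
  apply/funext => i; rewrite /y maxxx.
  have h := lc 0 i (lexx 0).
  apply/eqP; rewrite -subr_eq0 -normr_le0; apply: (lim_near_le h).
  by apply: nearW => n; rewrite it0 subrr normr0.
move=> t i t0.
have hd n (s : R) : `|s - t| < t -> der (fun s => it n.+1 s i) s (F s (it n s) i).
  by move=> _; exact: it_der.
apply: (der_lim t0 hd).
- move=> s st.
  have s0 : 0 <= s by move: st; rewrite ltr_norml => /andP[]; lra.
  rewrite /y (max_idPl s0).
  by have := lc s i s0; rewrite -(cvg_shiftS (fun n => it n s i)).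
move=> e e0.
have B0 : 0 <= B by apply: le_trans (FB 0 x0 i); exact: normr_ge0.
have /cvgrPdist_le/(_ (e / 3))[|d1 /= d10 Hd1] := @Fc (y t) i t; first by rewrite divr_gt0.
have LB : 0 < L * B + 1 by rewrite ltr_wpDl ?mulr_ge0.
exists (Num.min (Num.min t 1) (Num.min d1 (e / 3 / (L * B + 1)))).
  by rewrite !lt_min t0 ltr01 d10 !divr_gt0.
pose C := 2 * (B / (2 * M) * expR (2 * M * (t + 1))).
have C0 : 0 <= C by rewrite !mulr_ge0 ?expR_ge0 // invr_ge0 mulr_ge0 // ltW.
have : (fun n => L * C * (2^-1) ^+ n) @ \oo --> L * C * 0.
  by apply: cvgMr; apply: cvg_expr; rewrite ger0_norm ?invr_ge0 // invf_lt1 // ltr1n.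
rewrite mulr0 => /cvgrPdist_le/(_ (e / 3)) => h.
have : \forall n \near \oo, `|0 - L * C * 2^-1 ^+ n| <= e / 3 by apply: h; rewrite divr_gt0.
apply: filterS => n; rewrite sub0r normrN => hn s.
rewrite !lt_min => /andP[/andP[st s1] /andP[sd sL]].
have s0 : 0 <= s by move: st; rewrite ltr_norml => /andP[]; lra.
have h1 : `|F t (y t) i - F s (y t) i| <= e / 3 by apply: Hd1; rewrite /ball_ /= distrC.
have h2 : `|F s (it n s) i - F s (y s) i| <= L * (C * 2^-1 ^+ n).
  apply: FL => j; rewrite /y (max_idPl s0).
  apply: le_trans (Hl (s, j) s0 n) _; rewrite exprVn ler_wpM2r ?invr_ge0 ?exprn_ge0 //=.
  rewrite /C ler_wpM2l // ler_wpM2l //; first by rewrite divr_ge0 // mulr_ge0 // ltW.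
  rewrite ler_expR ler_wpM2l //; first by rewrite mulr_ge0 // ltW.
  by move: s1; rewrite ltr_norml => /andP[_]; lra.
have h3 : `|F s (y s) i - F s (y t) i| <= L * (B * `|s - t|) by apply: FL => j; exact: ly.
have h4 : L * (B * `|s - t|) <= e / 3.
  by move: sL; rewrite ltr_pdivlMr // mulrDr mulr1 => ?; have := normr_ge0 (s - t); lra.
have h5 : L * (C * 2^-1 ^+ n) <= e / 3 by rewrite mulrA; apply: le_trans hn; exact: ler_norm.
have -> : F s (it n s) i - F t (y t) i = (F s (it n s) i - F s (y s) i) +
   (F s (y s) i - F s (y t) i) - (F t (y t) i - F s (y t) i) by ring.
apply: le_trans (ler_normB _ _) _; have := ler_normD (F s (it n s) i - F s (y s) i) (F s (y s) i - F s (y t) i).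
lra.
Qed.

End Picard.

(** * Complex numbers in coordinates *)

Section ComplexTools.
Variable R : realType.
Local Notation C := R[i].
Implicit Types (z w : C) (x y : R).

(** The modulus as a real number; the norm of [R[i]] takes its values in [R[i]]. *)
Definition nc z : R := Normc.normc z.

Lemma complexP z w : ReC z = ReC w -> ImC z = ImC w -> z = w.
Proof. by case: z => a b; case: w => c d /= -> ->. Qed.
Lemma ReD z w : ReC (z + w) = ReC z + ReC w. Proof. by case: z; case: w. Qed.
Lemma ImD z w : ImC (z + w) = ImC z + ImC w. Proof. by case: z; case: w. Qed.
Lemma ReN z : ReC (- z) = - ReC z. Proof. by case: z. Qed.
Lemma ImN z : ImC (- z) = - ImC z. Proof. by case: z. Qed.
Lemma ReB z w : ReC (z - w) = ReC z - ReC w. Proof. by rewrite ReD ReN. Qed.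
Lemma ImB z w : ImC (z - w) = ImC z - ImC w. Proof. by rewrite ImD ImN. Qed.
Lemma ReM z w : ReC (z * w) = ReC z * ReC w - ImC z * ImC w. Proof. by case: z; case: w. Qed.
Lemma ImM z w : ImC (z * w) = ReC z * ImC w + ImC z * ReC w.
Proof. by case: z => a b; case: w. Qed.
Lemma Re_cR x : ReC (cR x) = x. Proof. by []. Qed.
Lemma Im_cR x : ImC (cR x) = 0. Proof. by []. Qed.
Lemma ReV z : ReC z^-1 = ReC z / (ReC z ^+ 2 + ImC z ^+ 2). Proof. by case: z. Qed.
Lemma ImV z : ImC z^-1 = - ImC z / (ReC z ^+ 2 + ImC z ^+ 2). Proof. by case: z => a b; rewrite mulNr. Qed.
Lemma Re_sum I (r : seq I) (P : pred I) (F : I -> C) :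
  ReC (\sum_(i <- r | P i) F i) = \sum_(i <- r | P i) ReC (F i).
Proof. by elim/big_rec2: _ => // i a b _ <-; rewrite ReD. Qed.
Lemma Im_sum I (r : seq I) (P : pred I) (F : I -> C) :
  ImC (\sum_(i <- r | P i) F i) = \sum_(i <- r | P i) ImC (F i).
Proof. by elim/big_rec2: _ => // i a b _ <-; rewrite ImD. Qed.
Lemma cRe z : cR (ReC z) + cR (ImC z) * 'i%C = z.
Proof. by apply: complexP; rewrite ?ReD ?ImD ?ReM ?ImM /= ?mulr0 ?mulr1 ?mul0r; ring. Qed.

Lemma cRD x y : cR (x + y) = cR x + cR y. Proof. exact: (rmorphD (real_complex R)). Qed.
Lemma cRN x : cR (- x) = - cR x. Proof. exact: (rmorphN (real_complex R)). Qed.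
Lemma cRB x y : cR (x - y) = cR x - cR y. Proof. exact: (rmorphB (real_complex R)). Qed.
Lemma cRM x y : cR (x * y) = cR x * cR y. Proof. exact: (rmorphM (real_complex R)). Qed.
Lemma cRV x : cR x^-1 = (cR x)^-1. Proof. exact: (fmorphV (real_complex R)). Qed.
Lemma cR0 : cR 0 = 0 :> C. Proof. by []. Qed.
Lemma cR1 : cR 1 = 1 :> C. Proof. by []. Qed.
Lemma cR_int (n : int) : cR n%:~R = n%:~R :> C. Proof. exact: (rmorph_int (real_complex R)). Qed.
Lemma cR_sum I (r : seq I) (P : pred I) (F : I -> R) :
  cR (\sum_(i <- r | P i) F i) = \sum_(i <- r | P i) cR (F i).
Proof. exact: (rmorph_sum (real_complex R)). Qed.
Lemma cR_eq0 x : (cR x == 0) = (x == 0).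
Proof. exact: (fmorph_eq0 (real_complex R)). Qed.
Lemma ReZ x z : ReC (cR x * z) = x * ReC z. Proof. by rewrite ReM Im_cR mul0r subr0. Qed.
Lemma ImZ x z : ImC (cR x * z) = x * ImC z. Proof. by rewrite ImM Im_cR mul0r addr0. Qed.

Lemma ncE z : nc z = Num.sqrt (ReC z ^+ 2 + ImC z ^+ 2). Proof. by case: z. Qed.
Lemma nc_ge0 z : 0 <= nc z. Proof. by rewrite ncE sqrtr_ge0. Qed.
Lemma nc_sq z : nc z ^+ 2 = ReC z ^+ 2 + ImC z ^+ 2.
Proof. by rewrite ncE sqr_sqrtr // addr_ge0 ?sqr_ge0. Qed.
Lemma normE z : `|z| = cR (nc z). Proof. by []. Qed.
Lemma ncD z w : nc (z + w) <= nc z + nc w. Proof. exact: le_normcD. Qed.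
Lemma ncN z : nc (- z) = nc z. Proof. exact: normcN. Qed.
Lemma ncB z w : nc (z - w) <= nc z + nc w. Proof. by rewrite -(ncN w) ncD. Qed.
Lemma ncBC z w : nc (z - w) = nc (w - z). Proof. by rewrite -ncN opprB. Qed.
Lemma ncM z w : nc (z * w) = nc z * nc w. Proof. exact: Normc.normcM. Qed.
Lemma ncV z : nc z^-1 = (nc z)^-1. Proof. exact: Normc.normcV. Qed.
Lemma nc0 : nc 0 = 0. Proof. exact: Normc.normc0. Qed.
Lemma nc_eq0 z : (nc z == 0) = (z == 0).
Proof. by apply/eqP/eqP => [/Normc.eq0_normc|->]; rewrite ?nc0. Qed.
Lemma nc_gt0 z : (0 < nc z) = (z != 0).
Proof. by rewrite lt_neqAle eq_sym nc_eq0 nc_ge0 andbT. Qed.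
Lemma nc_cR x : nc (cR x) = `|x|.
Proof. by rewrite ncE /= expr0n /= addr0 sqrtr_sqr. Qed.
Lemma Re_le_nc z : `|ReC z| <= nc z.
Proof. by rewrite -(sqrtr_sqr (ReC z)) ncE ler_sqrt ?lerDl ?sqr_ge0 // addr_ge0 ?sqr_ge0. Qed.
Lemma Im_le_nc z : `|ImC z| <= nc z.
Proof. by rewrite -(sqrtr_sqr (ImC z)) ncE ler_sqrt ?lerDr ?sqr_ge0 // addr_ge0 ?sqr_ge0. Qed.
Lemma nc_le z : nc z <= `|ReC z| + `|ImC z|.
Proof.
rewrite -{1}(cRe z); apply: le_trans (ncD _ _) _; rewrite ncM !nc_cR.
have -> : nc 'i%C = 1 by rewrite ncE /= expr0n /= expr1n add0r sqrtr1.
by rewrite mulr1.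
Qed.
Lemma nc_sum I (r : seq I) (P : pred I) (F : I -> C) :
  nc (\sum_(i <- r | P i) F i) <= \sum_(i <- r | P i) nc (F i).
Proof.
elim/big_rec2: _ => [|i a b _ H]; first by rewrite nc0.
by apply: le_trans (ncD _ _) _; rewrite lerD2l.
Qed.
Lemma nc_tri z w u : nc (z - u) <= nc (z - w) + nc (w - u).
Proof. by apply: le_trans (ncD _ _); rewrite addrA subrK. Qed.

Lemma conjE z : cconj z = conjc z. Proof. by case: z. Qed.
Lemma cconjB z w : cconj (z - w) = cconj z - cconj w.
Proof. by rewrite !conjE rmorphB. Qed.
Lemma cconjM z w : cconj (z * w) = cconj z * cconj w.
Proof. by rewrite !conjE rmorphM. Qed.
Lemma cconjV z : cconj z^-1 = (cconj z)^-1.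
Proof. by rewrite !conjE fmorphV. Qed.
Lemma cconj_cR x : cconj (cR x) = cR x.
Proof. by apply: complexP; rewrite //= oppr0. Qed.
Lemma cconjK z : cconj (cconj z) = z.
Proof. by apply: complexP; rewrite //= opprK. Qed.
Lemma nc_conj z : nc (cconj z) = nc z.
Proof. by rewrite !ncE /= sqrrN. Qed.

Lemma gt0_complex (e : C) : 0 < e -> 0 < ReC e /\ e = cR (ReC e).
Proof.
rewrite ltcE /= => /andP[/eqP h1 h2]; split => //.
by apply: complexP => //=; rewrite -h1.
Qed.
Lemma ltcRR x y : (cR x < cR y) = (x < y). Proof. exact: ltcR. Qed.
Lemma lecRR x y : (cR x <= cR y) = (x <= y). Proof. exact: lecR. Qed.

Lemma cvgCP (T : Type) (F : set_system T) (FF : Filter F) (f : T -> C) (l : C) :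
  f @ F --> l <-> forall e : R, 0 < e -> \forall x \near F, nc (f x - l) <= e.
Proof.
split.
  move=> /cvgrPdist_le H e e0.
  have := H (cR e); rewrite ltcRR => /(_ e0); apply: filterS => t.
  by rewrite normE lecRR ncBC.
move=> H; apply/cvgrPdist_le => e /gt0_complex[e0 ->].
by apply: filterS (H _ e0) => t; rewrite normE lecRR ncBC.
Qed.

Lemma nbhsCP (z : C) (P : set C) :
  nbhs z P <-> exists2 d : R, 0 < d & forall w, nc (w - z) < d -> P w.
Proof.
split.
  move=> [d /= d0 H]; have [d1 dE] := gt0_complex d0.
  exists (ReC d) => // w wz; apply: H; rewrite /ball_ /= normE dE ltcRR //.
  by rewrite ncBC.
move=> [d d0 H]; exists (cR d) => /=; first by rewrite ltcRR.
by move=> w; rewrite /ball_ /= normE ltcRR ncBC => /H.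
Qed.

Lemma contCRP (f : C -> R) z : {for z, continuous f} <->
  forall e : R, 0 < e -> exists2 d : R, 0 < d & forall w, nc (w - z) < d -> `|f w - f z| <= e.
Proof.
split.
  move=> /cvgrPdist_le H e e0; have /nbhsCP[d d0 Hd] := H e e0.
  by exists d => // w /Hd; rewrite distrC.
move=> H; have FF : Filter (nbhs z) by exact: nbhs_filter.
apply: (@cvgrPdist_le _ _ _ _ FF f (f z)).2 => e e0; have [d d0 Hd] := H e e0.
by apply/nbhsCP; exists d => // w /Hd; rewrite distrC.
Qed.

Lemma contCCP (f : C -> C) z : {for z, continuous f} <->
  forall e : R, 0 < e -> exists2 d : R, 0 < d & forall w, nc (w - z) < d -> nc (f w - f z) <= e.
Proof.
split.
  by move=> H e e0; apply/nbhsCP; exact: (((cvgCP (nbhs_filter z) f (f z)).1 H) e e0).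
by move=> H; apply: (cvgCP (nbhs_filter z) f (f z)).2 => e e0; apply/nbhsCP; exact: H.
Qed.

(** Coordinatewise form of [is_cderiv], through which complex derivatives inherit the rules and
    inequalities of real calculus. *)
Definition cder (f : R -> C) (t : R) (l : C) : Prop :=
  der (fun s => ReC (f s)) t (ReC l) /\ der (fun s => ImC (f s)) t (ImC l).

Lemma cderP (f : R -> C) t l : is_cderiv f t l <-> cder f t l.
Proof.
have E h : h != 0 -> nc ((f (t + h) - f t) / cR h - l) * `|h| = nc (f (t + h) - f t - cR h * l).
  move=> h0; rewrite -nc_cR -ncM mulrBl -mulrA mulVf ?cR_eq0 // mulr1; congr nc; ring.
split.
  move=> /cvgCP H.
  suff K e : 0 < e -> exists2 d : R, 0 < d & forall h : R, `|h| < d ->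
      nc (f (t + h) - f t - cR h * l) <= e * `|h|.
    by split; apply/der_eps => e /K[d d0 Hd]; exists d => // h /Hd; apply: le_trans;
      [have := Re_le_nc (f (t + h) - f t - cR h * l); rewrite !ReB ReZ|
       have := Im_le_nc (f (t + h) - f t - cR h * l); rewrite !ImB ImZ].
  move=> e0; have [d /= d0 Hd] := H e e0.
  exists d => // h hd; have [->|h0] := eqVneq h 0.
    by rewrite addr0 subrr cR0 mul0r subrr nc0 normr0 mulr0.
  by rewrite -E // ler_wpM2r // Hd // /ball_ /= sub0r normrN.
move=> [/der_eps H1 /der_eps H2]; apply/cvgCP => e e0.
have [|d1 d10 Hd1] := H1 (e / 2); first by rewrite divr_gt0.
have [|d2 d20 Hd2] := H2 (e / 2); first by rewrite divr_gt0.
exists (Num.min d1 d2) => /=; first by rewrite lt_min d10.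
move=> h; rewrite /ball_ /= sub0r normrN lt_min => /andP[hd1 hd2] h0.
have hp : 0 < `|h| by rewrite normr_gt0.
rewrite -(ler_pM2r hp) E //; apply: le_trans (nc_le _) _.
by have := Hd1 h hd1; have := Hd2 h hd2; rewrite !ReB !ImB ReZ ImZ; lra.
Qed.

Lemma cder_eq f t l l' : cder f t l -> l = l' -> cder f t l'. Proof. by move=> ? <-. Qed.
Lemma cder_ext (f g : R -> C) t l : f =1 g -> cder f t l -> cder g t l.
Proof. by move=> /funext ->. Qed.
Lemma cder_near (f g : R -> C) t l : (\forall s \near t, f s = g s) -> cder f t l -> cder g t l.
Proof.
move=> H [H1 H2]; split; apply: der_near (erefl _) _ => //; [|exact: H1| |exact: H2];
  by apply: filterS H => s ->.
Qed.
Lemma cderC (c : C) t : cder (fun=> c) t 0. Proof. by split; exact: derC. Qed.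
Lemma cder_cR (f : R -> R) t l : der f t l -> cder (fun s => cR (f s)) t (cR l).
Proof. by move=> H; split => //; exact: derC. Qed.
Lemma cderD f g t a b : cder f t a -> cder g t b -> cder (fun s => f s + g s) t (a + b).
Proof.
move=> [f1 f2] [g1 g2]; split.
  by apply: (der_ext _ (esym (ReD a b)) (derD f1 g1)) => s; rewrite ReD.
by apply: (der_ext _ (esym (ImD a b)) (derD f2 g2)) => s; rewrite ImD.
Qed.
Lemma cderN f t a : cder f t a -> cder (fun s => - f s) t (- a).
Proof.
move=> [f1 f2]; split.
  by apply: (der_ext _ (esym (ReN a)) (derN f1)) => s; rewrite ReN.
by apply: (der_ext _ (esym (ImN a)) (derN f2)) => s; rewrite ImN.
Qed.
Lemma cderB f g t a b : cder f t a -> cder g t b -> cder (fun s => f s - g s) t (a - b).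
Proof. by move=> Hf Hg; apply: cderD Hf (cderN Hg). Qed.
Lemma cderM f g t a b : cder f t a -> cder g t b ->
  cder (fun s => f s * g s) t (a * g t + f t * b).
Proof.
move=> [f1 f2] [g1 g2]; split.
  apply: (der_ext _ _ (derB (derM f1 g1) (derM f2 g2))) => [s|]; first by rewrite ReM.
  by rewrite ReD !ReM; ring.
apply: (der_ext _ _ (derD (derM f1 g2) (derM f2 g1))) => [s|]; first by rewrite ImM.
by rewrite ImD !ImM; ring.
Qed.
Lemma cderZ f c t a : cder f t a -> cder (fun s => c * f s) t (c * a).
Proof. by move=> H; apply: cder_eq (cderM (cderC c t) H) _; rewrite mul0r add0r. Qed.
Lemma cderV f t a : f t != 0 -> cder f t a ->
  cder (fun s => (f s)^-1) t (- a * (f t)^-1 ^+ 2).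
Proof.
move=> n0 [f1 f2].
have N0 : ReC (f t) ^+ 2 + ImC (f t) ^+ 2 != 0 by rewrite -nc_sq expf_neq0 // nc_eq0.
have n1 : der (fun s => ReC (f s) ^+ 2 + ImC (f s) ^+ 2) t
   (2 * (ReC (f t) * ReC a + ImC (f t) * ImC a)).
  apply: (der_ext _ _ (derD (derM f1 f1) (derM f2 f2))) => [s|]; first by rewrite !expr2.
  ring.
have n2 := @derV _ (fun s => ReC (f s) ^+ 2 + ImC (f s) ^+ 2) t _ N0 n1.
split.
  apply: (der_ext _ _ (derM f1 n2)) => [s|]; first by rewrite ReV.
  by rewrite expr2 ReM ReN ReM ImN ImM ReV ImV; field.
apply: (der_ext _ _ (derM (derN f2) n2)) => [s|]; first by rewrite ImV.
by rewrite expr2 ImM ReN ReM ImN ImM ReV ImV; field.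
Qed.
Lemma cder_sum I (r : seq I) (P : pred I) (F : I -> R -> C) t (dF : I -> C) :
  (forall i, P i -> cder (F i) t (dF i)) ->
  cder (fun s => \sum_(i <- r | P i) F i s) t (\sum_(i <- r | P i) dF i).
Proof.
move=> H; split.
  by rewrite Re_sum; apply: (der_ext _ (erefl _) (der_sum r (fun i Pi => (H i Pi).1))) => s; rewrite Re_sum.
by rewrite Im_sum; apply: (der_ext _ (erefl _) (der_sum r (fun i Pi => (H i Pi).2))) => s; rewrite Im_sum.
Qed.

Lemma der_ncsq f t l : cder f t l ->
  der (fun s => nc (f s) ^+ 2) t (2 * (ReC (f t) * ReC l + ImC (f t) * ImC l)).
Proof.
move=> [f1 f2]; apply: (der_ext _ _ (derD (derM f1 f1) (derM f2 f2))) => [s|].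
  by rewrite nc_sq !expr2.
ring.
Qed.

Lemma re_dot_le z w : ReC z * ReC w + ImC z * ImC w <= nc z * nc w.
Proof.
have -> : ReC z * ReC w + ImC z * ImC w = ReC (cconj z * w) by rewrite ReM /=; ring.
by rewrite -(nc_conj z) -ncM; apply: le_trans (Re_le_nc _); exact: ler_norm.
Qed.

(* [x +i max(y, d)]: the truncation that makes the Loewner fields globally Lipschitz. *)
Definition liftIm (d : R) z : C := Complex (ReC z) (Num.max (ImC z) d).

Lemma max_lip (a b d : R) : `|Num.max a d - Num.max b d| <= `|a - b|.
Proof.
have := ler_norm (a - b); have := ler_norm (b - a); rewrite (distrC b a) => ? ?.
by rewrite ler_norml /Num.max; case: ltP => ?; case: ltP => ?; apply/andP; split; lra.
Qed.

Lemma lift_lip d z w : nc (liftIm d z - liftIm d w) <= nc (z - w).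
Proof.
rewrite -(ler_pXn2r (n := 2)) ?nnegrE ?nc_ge0 // !nc_sq !ReB !ImB /= lerD2l.
by rewrite -[leLHS](real_normK (num_real _)) -[leRHS](real_normK (num_real _)) ler_pXn2r ?nnegrE ?normr_ge0 // max_lip.
Qed.

Lemma lift_id d z : d <= ImC z -> liftIm d z = z.
Proof. by move=> h; apply: complexP => //=; apply/max_idPl. Qed.

Lemma lift_ge d z : d <= ImC (liftIm d z). Proof. by rewrite /= le_max lexx orbT. Qed.

Lemma nc_sub_ge d z y : 0 < d -> d <= `|ImC z| -> d <= nc (z - cR y).
Proof. by move=> d0 h; apply: le_trans h (le_trans _ (Im_le_nc _)); rewrite ImB subr0. Qed.

Lemma sub_neq0 z y : ImC z != 0 -> z - cR y != 0.
Proof.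
move=> h; apply/eqP => /(congr1 (@ImC R)); rewrite ImB subr0 => /eqP.
by rewrite (negbTE h).
Qed.

(* The resolvent identity 1/(z-x) - 1/(w-y) = ((w-z) - (y-x)) / ((z-x)(w-y)). *)
Lemma res_lip d z w x y : 0 < d -> d <= `|ImC z| -> d <= `|ImC w| ->
  nc ((z - cR x)^-1 - (w - cR y)^-1) <= (nc (z - w) + `|x - y|) / d ^+ 2.
Proof.
move=> d0 hz hw.
have z0 : z - cR x != 0 by apply: sub_neq0; rewrite -normr_gt0 (lt_le_trans d0).
have w0 : w - cR y != 0 by apply: sub_neq0; rewrite -normr_gt0 (lt_le_trans d0).
have -> : (z - cR x)^-1 - (w - cR y)^-1 =
  ((w - z) + cR (x - y)) * ((z - cR x)^-1 * (w - cR y)^-1).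
  by rewrite cRB; field; rewrite z0 w0.
rewrite !ncM !ncV; apply: ler_pM; rewrite ?nc_ge0 ?mulr_ge0 ?invr_ge0 ?nc_ge0 //.
  by apply: le_trans (ncD _ _) _; rewrite nc_cR ncBC.
rewrite expr2 invfM; apply: ler_pM; rewrite ?invr_ge0 ?nc_ge0 // lef_pV2 ?posrE ?nc_gt0 //;
  exact: nc_sub_ge.
Qed.

Lemma res_bound d z x : 0 < d -> d <= `|ImC z| -> nc (z - cR x)^-1 <= d^-1.
Proof.
move=> d0 hz; rewrite ncV lef_pV2 ?posrE ?nc_gt0 //; first exact: nc_sub_ge.
by apply: sub_neq0; rewrite -normr_gt0 (lt_le_trans d0).
Qed.

End ComplexTools.

(** * Flows of Loewner type *)

Section Flows.
Variable R : realType.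
Local Notation C := R[i].
Implicit Types (z w : C) (m : R -> C -> C) (p q : R -> C).

Lemma withinC_eps (a b : R) p : {within `[a, b], continuous p} <->
  forall x, a <= x <= b -> forall e : R, 0 < e -> exists2 d : R, 0 < d &
    forall y : R, a <= y <= b -> `|y - x| < d -> nc (p y - p x) <= e.
Proof.
have FF x : Filter (within `[a, b]%classic (nbhs (x : R))) by exact: within_filter.
split.
  move=> /subspace_continuousP H x xab e e0.
  have /(_ x) := H; rewrite /= in_itv /= => /(_ xab) h.
  have [d /= d0 Hd] := (cvgCP (FF x) p (p x)).1 h e e0.
  exists d => // y yab yx; apply: Hd; first by rewrite /ball_ /= distrC.
  by rewrite /= in_itv.
move=> H; apply/subspace_continuousP => x; rewrite /= in_itv /= => xab.
apply: (cvgCP (FF x) p (p x)).2 => e e0; have [d d0 Hd] := H x xab e e0.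
exists d => // y; rewrite /ball_ /= => yx; rewrite in_itv /= => yab.
by rewrite Hd // distrC.
Qed.

Lemma withinCP (a b : R) p : {within `[a, b], continuous p} <->
  {within `[a, b], continuous (fun t => ReC (p t))} /\
  {within `[a, b], continuous (fun t => ImC (p t))}.
Proof.
rewrite withinC_eps !within_contP; split.
  move=> H; split => x xab e e0; have [d d0 Hd] := H x xab e e0; exists d => // y yab yx.
    by rewrite -ReB; apply: le_trans (Re_le_nc _) (Hd _ yab yx).
  by rewrite -ImB; apply: le_trans (Im_le_nc _) (Hd _ yab yx).
move=> [H1 H2] x xab e e0.
have [|d1 d10 Hd1] := H1 x xab (e / 2); first by rewrite divr_gt0.
have [|d2 d20 Hd2] := H2 x xab (e / 2); first by rewrite divr_gt0.
exists (Num.min d1 d2); first by rewrite lt_min d10.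
move=> y yab; rewrite lt_min => /andP[y1 y2].
by apply: le_trans (nc_le _) _; have := Hd1 y yab y1; have := Hd2 y yab y2; rewrite ReB ImB; lra.
Qed.

Lemma within_add (A : set R) (f g : R -> R) : {within A, continuous f} ->
  {within A, continuous g} -> {within A, continuous (fun t => f t + g t)}.
Proof. by move=> fc gc x; apply: continuousD; [exact: fc|exact: gc]. Qed.

Lemma within_diff (A : set R) (f g : R -> R) : {within A, continuous f} ->
  {within A, continuous g} -> {within A, continuous (fun t => f t - g t)}.
Proof. by move=> fc gc x; apply: continuousB; [exact: fc|exact: gc]. Qed.

Lemma within_mul (A : set R) (f g : R -> R) : {within A, continuous f} ->
  {within A, continuous g} -> {within A, continuous (fun t => f t * g t)}.
Proof. by move=> fc gc x; apply: continuousM; [exact: fc|exact: gc]. Qed.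

Lemma withinC_ncsq (a b : R) p : {within `[a, b], continuous p} ->
  {within `[a, b], continuous (fun t => nc (p t) ^+ 2)}.
Proof.
move=> /withinCP[H1 H2].
have -> : (fun t => nc (p t) ^+ 2) = (fun t => ReC (p t) * ReC (p t) + ImC (p t) * ImC (p t)).
  by apply/funext => t; rewrite nc_sq !expr2.
by apply: within_add; apply: within_mul.
Qed.

Lemma withinCB (a b : R) p q : {within `[a, b], continuous p} -> {within `[a, b], continuous q} ->
  {within `[a, b], continuous (fun t => p t - q t)}.
Proof.
move=> /withinCP[H1 H2] /withinCP[H3 H4]; apply/withinCP; split.
  have -> : (fun t => ReC (p t - q t)) = (fun t => ReC (p t) - ReC (q t)) by apply/funext => t; rewrite ReB.
  exact: within_diff.
have -> : (fun t => ImC (p t - q t)) = (fun t => ImC (p t) - ImC (q t)) by apply/funext => t; rewrite ImB.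
exact: within_diff.
Qed.

Lemma withinC_sub (a b c d : R) p : a <= c -> d <= b -> {within `[a, b], continuous p} ->
  {within `[c, d], continuous p}.
Proof. by move=> ac db /withinCP[h1 h2]; apply/withinCP; split; [exact: within_sub h1|exact: within_sub h2]. Qed.

(** Gronwall for the squared distance, which is differentiable even where the curves meet. With a
    the distance, its derivative is at most 2 (L a^2 + a eta), and 2 a eta <= a^2 + eta^2 accounts
    for the rate [2 * L + 1]. *)
Lemma ode_stab m1 m2 p q (T L eta : R) (D : set C) : 0 <= L -> 0 <= eta ->
  {within `[0, T], continuous p} -> {within `[0, T], continuous q} ->
  (forall t, 0 < t < T -> D (p t) /\ D (q t)) ->
  (forall t, 0 < t < T -> cder p t (m1 t (p t))) ->
  (forall t, 0 < t < T -> cder q t (m2 t (q t))) ->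
  (forall t, 0 < t < T -> forall z w, D z -> D w -> nc (m1 t z - m1 t w) <= L * nc (z - w)) ->
  (forall t, 0 < t < T -> forall z, D z -> nc (m1 t z - m2 t z) <= eta) ->
  forall t, 0 <= t <= T ->
  nc (p t - q t) ^+ 2 <= (nc (p 0 - q 0) ^+ 2 + eta ^+ 2 * t) * expR ((2 * L + 1) * t).
Proof.
move=> L0 eta0 pc qc Dpq dp dq mL mE t /andP[t0 tT].
have sT (s : R) : 0 < s < t -> 0 < s < T by move=> /andP[-> st] /=; exact: lt_le_trans st tT.
have W := @gronwall R (fun s => nc (p s - q s) ^+ 2)
  (fun s => 2 * (ReC (p s - q s) * ReC (m1 s (p s) - m2 s (q s)) +
                 ImC (p s - q s) * ImC (m1 s (p s) - m2 s (q s))))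
  0 t (2 * L + 1) (eta ^+ 2) t0.
rewrite !subr0 in W; apply: W; rewrite ?sqr_ge0 ?addr_ge0 ?mulr_ge0 //.
- by apply: withinC_ncsq; apply: withinCB; apply: (withinC_sub (lexx 0) tT).
- move=> s /sT st; apply: (@der_ncsq R (fun s => p s - q s)); apply: cderB; [exact: dp|exact: dq].
move=> s /sT st.
have := re_dot_le (p s - q s) (m1 s (p s) - m2 s (q s)).
have [Dp Dq] := Dpq s st.
have h : nc (m1 s (p s) - m2 s (q s)) <= L * nc (p s - q s) + eta.
  by apply: le_trans (nc_tri _ (m1 s (q s)) _) _; apply: lerD; [exact: mL|exact: mE].
set a := nc (p s - q s) in h *; have a0 : 0 <= a by exact: nc_ge0.
move=> h2; have h3 := ler_wpM2l a0 h.
have h4 : 2 * (a * eta) <= a ^+ 2 + eta ^+ 2 by have := sqr_ge0 (a - eta); rewrite sqrrB; lra.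
move: h2 h3 h4; rewrite !mulrDr mulrDl mul1r !expr2; lra.
Qed.

Lemma ode_uniq m p q (T L : R) (D : set C) : 0 <= L ->
  {within `[0, T], continuous p} -> {within `[0, T], continuous q} ->
  (forall t, 0 < t < T -> D (p t) /\ D (q t)) ->
  (forall t, 0 < t < T -> cder p t (m t (p t))) ->
  (forall t, 0 < t < T -> cder q t (m t (q t))) ->
  (forall t, 0 < t < T -> forall z w, D z -> D w -> nc (m t z - m t w) <= L * nc (z - w)) ->
  p 0 = q 0 -> forall t, 0 <= t <= T -> p t = q t.
Proof.
move=> L0 pc qc DD dp dq mL e0 t tT.
have := @ode_stab m m p q T L 0 D L0 (lexx 0) pc qc DD dp dq mL _ t tT.
rewrite e0 subrr nc0 expr0n /= mul0r addr0 mul0r => h.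
have {}h : nc (p t - q t) ^+ 2 <= 0 by apply: h => s _ z _; rewrite subrr nc0.
have : nc (p t - q t) ^+ 2 == 0 by rewrite eq_le h sqr_ge0.
by rewrite expf_eq0 /= nc_eq0 subr_eq0 => /eqP.
Qed.

(** Estimates shared by the Cauchy transforms, with kernel 2/(z - x), of all probability measures on
    the line. As far as the space variable is concerned, existence, uniqueness and stability of
    flows rest on them alone, so the finite systems and the limit are instances of one theory. *)
Definition good m := forall (t d : R) z w, 0 < d -> d <= ImC z -> d <= ImC w ->
  nc (m t z) <= 2 / d /\ nc (m t z - m t w) <= 2 / d ^+ 2 * nc (z - w).

(** Convertible to [loewnerSol] when [m] is [Mw W], and to [limLoewnerSol] when [m u] is
    [Mfun (mu u)]. *)
Definition gsol m (t1 : R) z (gam : R -> C) : Prop :=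
  gam 0 = z /\ (forall u, 0 <= u <= t1 -> inH (gam u)) /\
  {within `[0, t1], continuous gam} /\
  (forall u, 0 < u < t1 -> is_cderiv gam u (m u (gam u))).

Lemma cont_min (f : R -> R) (T : R) : 0 <= T -> {within `[0, T], continuous f} ->
  (forall u, 0 <= u <= T -> 0 < f u) -> exists2 d : R, 0 < d & forall u, 0 <= u <= T -> d <= f u.
Proof.
move=> T0 fc fp; have [c] := EVT_min T0 fc.
rewrite in_itv /= => cT Hc; exists (f c); first exact: fp.
by move=> u uT; apply: Hc; rewrite in_itv.
Qed.

Lemma gsol_minIm m t1 z p : 0 <= t1 -> gsol m t1 z p ->
  exists2 d : R, 0 < d & forall u, 0 <= u <= t1 -> d <= ImC (p u).
Proof.
move=> t10 [_ [ph [pc _]]]; apply: cont_min t10 _ _ => //.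
by have /withinCP[] := pc.
Qed.

Lemma gsol_sub m t1 t2 z p : t2 <= t1 -> gsol m t1 z p -> gsol m t2 z p.
Proof.
move=> t21 [p0 [ph [pc pd]]]; split => //; split; [|split].
- by move=> u /andP[u0 u2]; apply: ph; rewrite u0 (le_trans u2).
- exact: withinC_sub pc.
- by move=> u /andP[u0 u2]; apply: pd; rewrite u0 (lt_le_trans u2).
Qed.

Lemma gsol_eq m t1 z p q : (forall u, 0 <= u <= t1 -> p u = q u) -> 0 <= t1 ->
  gsol m t1 z p -> gsol m t1 z q.
Proof.
move=> E t10 [p0 [ph [pc pd]]]; split; [|split; [|split]].
- by rewrite -E ?lexx.
- by move=> u ut; rewrite -E //; exact: ph.
- apply/withinC_eps => x xt e e0; have [d d0 Hd] := (withinC_eps _ _ _).1 pc x xt e e0.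
  by exists d => // y yt yx; rewrite -!E //; exact: Hd.
- move=> u /andP[u0 u1]; rewrite -E ?ltW //.
  apply/cderP; have := pd u; rewrite u0 u1 => /(_ isT)/cderP; apply: cder_near.
  near=> s; apply: E; apply/andP; split; apply: ltW; near: s; [exact: lt_nbhsr|exact: lt_nbhsl].
Unshelve. all: by end_near. Qed.

(** Each solution stays above a positive height on the compact time interval, and the field is
    Lipschitz above the smaller of the two heights. *)
Lemma gsol_uniq m t1 z p q : good m -> gsol m t1 z p -> gsol m t1 z q ->
  forall u, 0 <= u <= t1 -> p u = q u.
Proof.
move=> gm Hp Hq u /andP[u0 u1].
have t10 := le_trans u0 u1.
have [d1 d10 Hd1] := gsol_minIm t10 Hp; have [d2 d20 Hd2] := gsol_minIm t10 Hq.
pose d := Num.min d1 d2; have d0 : 0 < d by rewrite lt_min d10.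
move: Hp Hq => [p0 [ph [pc pd]]] [q0 [qh [qc qd]]].
have L0 : 0 <= 2 / d ^+ 2 by rewrite divr_ge0 // exprn_ge0 // ltW.
apply: (@ode_uniq m p q t1 (2 / d ^+ 2) (fun z => d <= ImC z) L0 pc qc) => //.
- by move=> t /andP[t0 tt]; split; rewrite ge_min ?Hd1 ?Hd2 ?orbT // ?ltW // (ltW t0) ltW.
- by move=> t /pd /cderP.
- by move=> t /qd /cderP.
- by move=> t _ z0 w0 dz dw; have [] := gm t d z0 w0 d0 dz dw.
- by rewrite p0.
- by rewrite u0.
Qed.

(** Time frozen outside [0, T]: a field continuous on [0, T] becomes continuous on the line, as
    Picard iteration requires. *)
Definition clampT (T t : R) : R := Num.min (Num.max t 0) T.

Lemma clampT_in T t : 0 <= T -> 0 <= clampT T t <= T.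
Proof. by move=> T0; rewrite le_min T0 le_max lexx orbT /= ge_min lexx orbT. Qed.

Lemma clampT_id T t : 0 <= t <= T -> clampT T t = t.
Proof. by move=> /andP[t0 tT]; rewrite /clampT (max_idPl t0) (min_idPl tT). Qed.

Lemma clampT_lip T s t : `|clampT T s - clampT T t| <= `|s - t|.
Proof.
have min_lip (a b d : R) : `|Num.min a d - Num.min b d| <= `|a - b|.
  have := ler_norm (a - b); have := ler_norm (b - a); rewrite (distrC b a) => ? ?.
  by rewrite ler_norml /Num.min; case: ltP => ?; case: ltP => ?; apply/andP; split; lra.
exact: le_trans (min_lip _ _ _) (max_lip _ _ _).
Qed.

Lemma clampT_cont (T : R) (f : R -> R) : 0 <= T -> {within `[0, T], continuous f} ->
  continuous (fun t => f (clampT T t)).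
Proof.
move=> T0 /within_contP H t; apply/cvgrPdist_le => e e0.
have [d d0 Hd] := H (clampT T t) (clampT_in t T0) e e0.
exists d => // s; rewrite /ball_ /= => st; rewrite distrC; apply: Hd; first exact: clampT_in.
by apply: le_lt_trans (clampT_lip _ _ _) _; rewrite distrC.
Qed.

Definition tcont m (T : R) := forall z, inH z ->
  {within `[0, T], continuous (fun t => m t z)}.

(* The state (x, y) is encoded as a function on [bool], [true] being the real part. *)
Lemma flow_ex m (T d : R) z : good m -> 0 <= T -> tcont m T -> 0 < d ->
  exists p : R -> C, [/\ p 0 = z,
    forall t, 0 < t < T -> cder p t (m t (liftIm d (p t))) &
    forall s t, nc (p s - p t) <= 4 / d * `|s - t|].
Proof.
move=> gm T0 mc d0.
pose st (x : bool -> R) : C := Complex (x true) (x false).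
pose part (b : bool) (w : C) : R := if b then ReC w else ImC w.
have part_le b w : `|part b w| <= nc w by case: b; [exact: Re_le_nc|exact: Im_le_nc].
have partB b w1 w2 : part b (w1 - w2) = part b w1 - part b w2 by case: b; rewrite /= ?ReB ?ImB.
pose F (t : R) (x : bool -> R) (b : bool) : R := part b (m (clampT T t) (liftIm d (st x))).
have g t x y := gm (clampT T t) d (liftIm d (st x)) (liftIm d (st y)) d0 (lift_ge d _) (lift_ge d _).
have L0 : 0 <= 2 * (2 / d ^+ 2) by rewrite !mulr_ge0 // invr_ge0 exprn_ge0 // ltW.
have [||x b|y [y0 dy ly]] := @picard R bool F (2 / d) (2 * (2 / d ^+ 2)) L0 _ _ _ (fun b => part b z).
- by move=> t x b; apply: le_trans (part_le _ _) _; have [] := g t x x.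
- move=> t x y e b xy; rewrite /F -partB; apply: le_trans (part_le _ _) _.
  have [_ h] := g t x y; apply: le_trans h _.
  have -> : 2 * (2 / d ^+ 2) * e = 2 / d ^+ 2 * (2 * e) by ring.
  apply: ler_wpM2l; first by rewrite divr_ge0 // exprn_ge0 // ltW.
  apply: le_trans (lift_lip _ _ _) _; apply: le_trans (nc_le _) _; rewrite ReB ImB /=.
  by have := xy true; have := xy false; lra.
- have := mc (liftIm d (st x)); have : inH (liftIm d (st x)) by apply: lt_le_trans d0 (lift_ge d _).
  move=> h /(_ h) /withinCP[c1 c2].
  by case: b; [exact: (clampT_cont T0 c1)|exact: (clampT_cont T0 c2)].
exists (fun t => st (y t)); split.
- by rewrite y0; apply: complexP.
- move=> t /andP[t0 tT].
  have h b : der (fun s => y s b) t (part b (m t (liftIm d (st (y t))))).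
    by apply: der_eq (dy t b t0) _; rewrite /F clampT_id // !ltW.
  by split; [exact: (h true)|exact: (h false)].
- move=> s t; apply: le_trans (nc_le _) _; rewrite ReB ImB /=.
  by have := ly true s t; have := ly false s t; lra.
Qed.

Lemma lip_within (a b K : R) p : 0 <= K -> (forall s t, nc (p s - p t) <= K * `|s - t|) ->
  {within `[a, b], continuous p}.
Proof.
move=> K0 H; apply/withinC_eps => x xab e e0.
have K1 : 0 < K + 1 by rewrite ltr_wpDl.
exists (e / (K + 1)); first by rewrite divr_gt0.
move=> y _; rewrite ltr_pdivlMr // => h; apply: le_trans (H y x) _.
by move: h; rewrite mulrDr mulr1; have := normr_ge0 (y - x); lra.
Qed.

Lemma flow_Im m (T d : R) p : good m -> 0 < d -> {within `[0, T], continuous p} ->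
  (forall t, 0 < t < T -> cder p t (m t (liftIm d (p t)))) ->
  forall t, 0 <= t <= T -> ImC (p 0) - 2 / d * t <= ImC (p t).
Proof.
move=> gm d0 pc pd t /andP[t0 tT].
have := @lip_bound R (fun s => ImC (p s)) (fun s => ImC (m s (liftIm d (p s)))) 0 t (2 / d) t0.
rewrite subr0 => W.
have : `|ImC (p t) - ImC (p 0)| <= 2 / d * t.
  apply: W.
  - by have /withinCP[_] := withinC_sub (lexx 0) tT pc.
  - by move=> s /andP[s0 st]; have [] := pd s; rewrite ?s0 ?(lt_le_trans st).
  - move=> s _; apply: le_trans (Im_le_nc _) _.
    by have [] := gm s d _ _ d0 (lift_ge d (p s)) (lift_ge d (p s)).
by rewrite ler_norml => /andP[]; lra.
Qed.

Lemma flow_gsol m (t1 d : R) p : 0 < d -> {within `[0, t1], continuous p} ->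
  (forall t, 0 < t < t1 -> cder p t (m t (liftIm d (p t)))) ->
  (forall t, 0 <= t <= t1 -> d <= ImC (p t)) -> gsol m t1 (p 0) p.
Proof.
move=> d0 pc pd pI; split => //; split; [|split] => //.
- by move=> u /pI; exact: lt_le_trans.
- move=> u u1; apply/cderP; apply: cder_eq (pd u u1) _; rewrite lift_id // pI //.
  by move/andP: u1 => [? ?]; rewrite !ltW.
Qed.

Lemma gsol_lift m (t1 d : R) z p : (forall t, 0 <= t <= t1 -> d <= ImC (p t)) ->
  gsol m t1 z p -> forall t, 0 < t < t1 -> cder p t (m t (liftIm d (p t))).
Proof.
move=> pI [_ [_ [_ pd]]] t tt; rewrite lift_id; first exact/cderP/pd.
by apply: pI; move/andP: tt => [? ?]; rewrite !ltW.
Qed.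

Lemma lift_stab m1 m2 p q (T d eta : R) : 0 < d -> 0 <= eta -> good m1 ->
  {within `[0, T], continuous p} -> {within `[0, T], continuous q} ->
  (forall t, 0 < t < T -> cder p t (m1 t (liftIm d (p t)))) ->
  (forall t, 0 < t < T -> cder q t (m2 t (liftIm d (q t)))) ->
  (forall t, 0 < t < T -> forall z, d <= ImC z -> nc (m1 t z - m2 t z) <= eta) ->
  forall t, 0 <= t <= T ->
  nc (p t - q t) ^+ 2 <= (nc (p 0 - q 0) ^+ 2 + eta ^+ 2 * T) * expR ((2 * (2 / d ^+ 2) + 1) * T).
Proof.
move=> d0 eta0 gm pc qc pd qd mE t tT.
have L0 : 0 <= 2 / d ^+ 2 by rewrite divr_ge0 // exprn_ge0 // ltW.
have := @ode_stab (fun t z => m1 t (liftIm d z)) (fun t z => m2 t (liftIm d z)) p q T (2 / d ^+ 2) eta setT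
   L0 eta0 pc qc _ pd qd _ _ t tT.
move=> h; apply: le_trans (h _ _ _) _ => //.
- move=> s _ z w _ _; have [_ hh] := gm s d (liftIm d z) (liftIm d w) d0 (lift_ge _ _) (lift_ge _ _).
  by apply: le_trans hh _; rewrite ler_wpM2l // lift_lip.
- by move=> s sT z _; apply: mE => //; exact: lift_ge.
move/andP: tT => [t0 tT].
apply: ler_pM.
- by rewrite addr_ge0 ?sqr_ge0 // mulr_ge0 ?sqr_ge0.
- exact: expR_ge0.
- by rewrite lerD2l ler_wpM2l ?sqr_ge0.
by rewrite ler_expR; apply: ler_wpM2l => //; rewrite addr_ge0 // mulr_ge0.
Qed.

End Flows.

(** * The driving system *)

Section Kernels.
Variable R : realType.
Local Notation C := R[i].

Definition Mw (n : nat) (W : R -> 'I_n.+1 -> R) (u : R) (z : C) : C :=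
  \sum_k cR (2 / n.+1%:R) / (z - cR (W u k)).

(** The sum of the kernels 1/(v - z) at z and at its conjugate. The drift exerted by the poles is
    therefore real and equals [atomsH n a S (bker v)]. *)
Definition bker (v : R) (z : C) : R := 2 * ReC (cR v - z)^-1.

Lemma conj_add (z : C) : z + cconj z = cR (2 * ReC z).
Proof. by apply: complexP; rewrite ?ReD ?ImD /=; ring. Qed.

Lemma bkerE (v : R) (z : C) : (cR v - z)^-1 + (cR v - cconj z)^-1 = cR (bker v z).
Proof. by rewrite -{2}(cconj_cR v) -cconjB -cconjV conj_add. Qed.

Lemma subVN (v : R) (z : C) : (cR v - z)^-1 = - (z - cR v)^-1.
Proof. by rewrite -opprB invrN. Qed.

Lemma bker_bound (d v : R) (z : C) : 0 < d -> d <= ImC z -> `|bker v z| <= 2 / d.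
Proof.
move=> d0 dz; rewrite /bker normrM ger0_norm // ler_wpM2l //.
apply: le_trans (Re_le_nc _) _; rewrite subVN ncN; apply: res_bound => //.
exact: le_trans (ler_norm _).
Qed.

Lemma bker_lip (d v w : R) (z z' : C) : 0 < d -> d <= ImC z -> d <= ImC z' ->
  `|bker v z - bker w z'| <= 2 / d ^+ 2 * (nc (z - z') + `|v - w|).
Proof.
move=> d0 dz dw; rewrite /bker -mulrBr normrM ger0_norm // -mulrA ler_wpM2l //.
rewrite -ReB; apply: le_trans (Re_le_nc _) _; rewrite !subVN -opprD ncN mulrC.
by apply: res_lip => //; exact: le_trans (ler_norm _).
Qed.

Lemma avg_le n (f : 'I_n.+1 -> R) (c : R) : (forall k, f k <= c / n.+1%:R) -> \sum_k f k <= c.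
Proof.
move=> H; apply: le_trans (ler_sum _ (fun k _ => H k)) _.
rewrite sumr_const card_ord. rewrite -[_ *+ _]mulr_natr divfK // pnatr_eq0.
Qed.

Lemma nc_kdiv (n : nat) (c : R) (z : C) : 0 <= c -> nc (cR (c / n.+1%:R) * z) = (c * nc z) / n.+1%:R.
Proof. by move=> c0; rewrite ncM nc_cR ger0_norm ?divr_ge0 // mulrAC. Qed.

Lemma Mw_good n (W : R -> 'I_n.+1 -> R) : good (Mw W).
Proof.
move=> t d z w d0 dz dw; split.
  apply: le_trans (nc_sum _ _ _) _; apply: avg_le => k.
  rewrite nc_kdiv // ler_wpM2r // ler_wpM2l //; apply: res_bound => //.
  exact: le_trans (ler_norm _).
rewrite -sumrB; apply: le_trans (nc_sum _ _ _) _; apply: avg_le => k.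
rewrite -mulrBr nc_kdiv // ler_wpM2r // -mulrA ler_wpM2l // mulrC.
apply: le_trans (res_lip (W t k) (W t k) d0 _ _) _; rewrite ?subrr ?normr0 ?addr0 //;
  exact: le_trans (ler_norm _).
Qed.

Lemma Mw_tlip n (W : R -> 'I_n.+1 -> R) (d e : R) (z : C) (s t : R) : 0 < d -> d <= ImC z ->
  (forall k, `|W s k - W t k| <= e) -> nc (Mw W s z - Mw W t z) <= 2 / d ^+ 2 * e.
Proof.
move=> d0 dz H; rewrite -sumrB; apply: le_trans (nc_sum _ _ _) _; apply: avg_le => k.
rewrite -mulrBr nc_kdiv // ler_wpM2r // -mulrA ler_wpM2l // mulrC.
have dz' : d <= `|ImC z| by exact: le_trans (ler_norm _).
apply: le_trans (res_lip (W s k) (W t k) d0 dz' dz') _.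
by rewrite subrr nc0 add0r ler_wpM2r // invr_ge0 exprn_ge0 // ltW.
Qed.

Lemma fin_near (I : finType) (T : Type) (F : set_system T) (FF : Filter F) (P : I -> T -> Prop) :
  (forall i, \forall x \near F, P i x) -> \forall x \near F, forall i, P i x.
Proof. by move=> H; exact: filter_forall. Qed.

Lemma fin_lb (I : finType) (f : I -> R) : (forall i, 0 < f i) ->
  exists2 e : R, 0 < e & forall i, e <= f i.
Proof.
move=> H; have : \forall e \near (0:R)^'+, forall i, e <= f i.
  by apply: fin_near => i; exact: nbhs_right_le.
move=> H'; near (0:R)^'+ => e; exists e; first by near: e; exact: nbhs_right_gt.
by near: e.
Unshelve. all: by end_near. Qed.

Lemma Mw_tcont n (W : R -> 'I_n.+1 -> R) (T : R) :
  (forall k, {within `[0, T], continuous (fun u => W u k)}) -> tcont (Mw W) T.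
Proof.
move=> Wc z z0; apply/withinC_eps => x xT e e0.
have c0 : 0 < 2 / ImC z ^+ 2 by rewrite divr_gt0 // exprn_gt0.
have P k : exists d : R, 0 < d /\ forall y, 0 <= y <= T -> `|y - x| < d ->
    `|W y k - W x k| <= e / (2 / ImC z ^+ 2).
  have [|d d0 Hd] := (within_contP _ _ _).1 (Wc k) x xT (e / (2 / ImC z ^+ 2)); first by rewrite divr_gt0.
  by exists d.
have [d Hd] := choice P.
have [d' d'0 H'] := fin_lb (fun k => (Hd k).1).
exists d' => // y yT yx.
apply: le_trans (Mw_tlip z0 (lexx _) (e := e / (2 / ImC z ^+ 2)) _) _.
  by move=> k; apply: (Hd k).2 => //; exact: lt_le_trans yx (H' k).
by rewrite mulrC divfK // gt_eqF.
Qed.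

Lemma Vdrift_real (n m : nat) (a : 'I_m -> int) (Wu : 'I_n.+1 -> R) (Su : 'I_m -> C) k :
  Vdrift a Wu Su k = cR (\sum_(l | l != k) (2 / n.+1%:R) / (Wu k - Wu l) + atomsH n a Su (bker (Wu k))).
Proof.
rewrite /Vdrift cRD -addrA; congr (_ + _).
  by rewrite cR_sum; apply: eq_bigr => l _; rewrite (cRM (2 / n.+1%:R)) cRV cRB.
rewrite -big_split /= /atomsH cR_sum; apply: eq_bigr => j _.
by rewrite -mulrDr bkerE (cRM (_ / _)) (cRM (a j)%:~R) cRV cR_int.
Qed.

End Kernels.

(** * Truncated repulsion and its logarithmic potential *)

Section Repulsion.
Variable R : realType.

(** Integrating [(Num.max v e)^-1] continues the logarithm affinely below [e]. Since [e <= 1],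
    normalising at 1 makes the two agree on all of [e, +oo[. *)
Lemma trunc_log_ex (e : R) : 0 < e -> e <= 1 -> exists l : R -> R,
  (forall v, der l v (Num.max v e)^-1) /\ (forall v, e <= v -> l v = ln v).
Proof.
move=> e0 e1.
have mx (v : R) : 0 < Num.max v e by rewrite lt_max e0 orbT.
have fc : continuous (fun v : R => (Num.max v e)^-1).
  move=> v; apply: cvgV; first by rewrite gt_eqF.
  apply/cvgrPdist_le => d d0; exists d => // w /= wv; apply: le_trans (max_lip _ _ _) (ltW wv).
have [F [_ HF]] := primitive fc.
exists (fun v => F v - F 1); split.
  by move=> v; apply: der_eq (derB (HF v) (derC _ _)) _; rewrite subr0.
pose h v := F v - ln v.
have dh v : e <= v -> der h v 0.
  move=> ev; have v0 := lt_le_trans e0 ev.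
  apply: der_eq (derB (HF v) (is_derive1_ln v0)) _.
  by rewrite (max_idPl ev) subrr.
have key a b : e <= a -> a <= b -> h b = h a.
  move=> ea ab; apply/eqP; rewrite -subr_eq0 -normr_le0 -[leRHS](mul0r (b - a)).
  apply: (@lip_bound R h (fun=> 0)) => //.
  - apply: within_cont => x /andP[ax _]; apply: der_cont (dh x _); exact: le_trans ax.
  - by move=> x /andP[ax _]; apply: dh; apply: ltW; exact: le_lt_trans ax.
  - by move=> x _; rewrite normr0.
move=> v ev.
have : h v = h 1 by case: (leP v 1) => [|/ltW] ?; [rewrite (key v 1)|rewrite (key 1 v)].
by rewrite /h ln1 subr0 => <-; ring.
Qed.

Variables (n : nat) (e : R).
Let N := n.+1.
(** The force 1/v between two particles, truncated at distance e. Its sign is read off from the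
    indices, whose order the particles keep; a truncation according to the sign of v would jump at
    0. *)
Definition rr (k l : 'I_n.+1) (v : R) : R :=
  if (l < k)%N then (Num.max v e)^-1 else if (k < l)%N then - (Num.max (- v) e)^-1 else 0.

Lemma rr_anti k l v : rr l k (- v) = - rr k l v.
Proof. by rewrite /rr opprK; case: ltngtP => _; rewrite ?opprK ?oppr0. Qed.

Hypothesis e0 : 0 < e.
Let mx (v : R) : 0 < Num.max v e. Proof. by rewrite lt_max e0 orbT. Qed.

Lemma inv_max_lip (v w : R) : `|(Num.max v e)^-1 - (Num.max w e)^-1| <= `|v - w| / e ^+ 2.
Proof.
have -> : (Num.max v e)^-1 - (Num.max w e)^-1 =
    (Num.max w e - Num.max v e) * ((Num.max v e)^-1 * (Num.max w e)^-1).
  by field; rewrite !gt_eqF.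
rewrite normrM; apply: ler_pM => //; first by rewrite distrC max_lip.
have p (u : R) : 0 <= (Num.max u e)^-1 by rewrite invr_ge0 ltW.
rewrite ger0_norm ?mulr_ge0 // expr2 invfM.
by apply: ler_pM => //; rewrite lef_pV2 ?posrE // le_max lexx orbT.
Qed.

Lemma rr_bound k l v : `|rr k l v| <= e^-1.
Proof.
have h w : (Num.max w e)^-1 <= e^-1 by rewrite lef_pV2 ?posrE // le_max lexx orbT.
rewrite /rr; case: ifP => _; last case: ifP => _.
- by rewrite ger0_norm ?invr_ge0 ?(ltW (mx _)).
- by rewrite normrN ger0_norm ?invr_ge0 ?(ltW (mx _)).
- by rewrite normr0 invr_ge0 ltW.
Qed.

Lemma rr_lip k l v w : `|rr k l v - rr k l w| <= `|v - w| / e ^+ 2.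
Proof.
rewrite /rr; case: ifP => _; last case: ifP => _.
- exact: inv_max_lip.
- rewrite opprK addrC; apply: le_trans (inv_max_lip _ _) _.
  by rewrite opprK addrC.
- by rewrite subrr normr0 divr_ge0 // exprn_ge0 // ltW.
Qed.

Lemma rr_le1 k l v : rr k l v * v <= 1.
Proof.
have h w : (Num.max w e)^-1 * w <= 1.
  by rewrite mulrC ler_pdivrMr // mul1r le_max lexx.
rewrite /rr; case: ifP => _; last case: ifP => _.
- exact: h.
- by rewrite mulNr -mulrN.
- by rewrite mul0r.
Qed.

(** Exchange of the two summation indices. It serves for the sum of squares, for the logarithmic
    energy and for the averages of test functions. *)
Lemma antisym_sum (c : 'I_n.+1 -> 'I_n.+1 -> R) (a : 'I_n.+1 -> R) :
  (forall k l, c l k = - c k l) ->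
  \sum_k \sum_l c k l * (a k - a l) = 2 * \sum_k (\sum_l c k l) * a k.
Proof.
move=> ca.
have E1 : \sum_k \sum_l c k l * a l = - \sum_k \sum_l c k l * a k.
  rewrite exchange_big /= -sumrN; apply: eq_bigr => k _; rewrite -sumrN.
  by apply: eq_bigr => l _; rewrite ca mulNr.
rewrite (eq_bigr (fun k => \sum_l c k l * a k - \sum_l c k l * a l)); last first.
  by move=> k _; rewrite -sumrB; apply: eq_bigr => l _; rewrite mulrBr.
rewrite sumrB E1 opprK.
rewrite [in RHS](eq_bigr (fun k => \sum_l c k l * a k)) => [|k _]; last by rewrite mulr_suml.
by ring.
Qed.

End Repulsion.

Lemma lift_abs (R : realType) (d : R) (z : R[i]) : d <= `|ImC (liftIm d z)|.
Proof. exact: le_trans (lift_ge d z) (ler_norm _). Qed.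

(** * Existence of the driving system up to time d^2/2 *)

Section DrivingSystem.
Variables (R : realType) (n m : nat) (x : 'I_n.+1 -> R) (s : 'I_m -> R[i]) (a : 'I_m -> int).
Variables (d T : R).
Hypothesis d0 : 0 < d.
Hypothesis T0 : 0 <= T.
Local Notation C := R[i].
Local Notation st := ('I_n.+1 + 'I_m * bool)%type.

Let part (b : bool) (w : C) : R := if b then ReC w else ImC w.
Let Sof (u : st -> R) j : C := Complex (u (inr (j, true))) (u (inr (j, false))).
Let bb (u : st -> R) (v : R) : R := atomsH n a (fun j => liftIm d (Sof u j)) (bker v).
(** The right-hand side of the system with its singularities removed: forces truncated at distance
    e, poles lifted to height d. On [0, T] neither truncation acts once e is small enough. The state
    lists the positions and then the two coordinates of each pole. *)
Let F (e : R) (t : R) (u : st -> R) (i : st) : R :=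
  match i with
  | inl k => \sum_l 2 / n.+1%:R * rr e k l (u (inl k) - u (inl l)) + bb u (u (inl k))
  | inr (j, c) => part c (\sum_k cR (2 / n.+1%:R) / (liftIm d (Sof u j) - cR (u (inl k))))
  end.

Let A := \sum_j `|(a j)%:~R| / n.+1%:R : R.
Let A0 : 0 <= A. Proof. by apply: sumr_ge0 => j _; rewrite divr_ge0. Qed.

Let atomsH_le (f g : C -> R) (S S' : 'I_m -> C) (c : R) : (forall j, `|f (S j) - g (S' j)| <= c) ->
  `|atomsH n a S f - atomsH n a S' g| <= A * c.
Proof.
move=> H; rewrite -sumrB; apply: le_trans (ler_norm_sum _ _ _) _.
rewrite /A mulr_suml; apply: ler_sum => j _; rewrite -mulrBr normrM.
by rewrite normrM [`|_^-1|]ger0_norm // ler_wpM2l // divr_ge0.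
Qed.

Let bb_bound u v : `|bb u v| <= A * (2 / d).
Proof.
have := @atomsH_le (bker v) (fun=> 0) (fun j => liftIm d (Sof u j)) (fun j => liftIm d (Sof u j)) (2 / d).
have -> : atomsH n a (fun j => liftIm d (Sof u j)) (fun=> 0 : R) = 0.
  by rewrite /atomsH big1 // => j _; rewrite mulr0.
rewrite subr0; apply => j; rewrite subr0; apply: bker_bound => //; exact: lift_ge.
Qed.

Let liftS_lip u u' (c : R) j : (forall i, `|u i - u' i| <= c) ->
  nc (liftIm d (Sof u j) - liftIm d (Sof u' j)) <= 2 * c.
Proof.
move=> H; apply: le_trans (lift_lip _ _ _) _; apply: le_trans (nc_le _) _.
rewrite ReB ImB /=.
by have := H (inr (j, true)); have := H (inr (j, false)); lra.
Qed.

Let part_le b w : `|part b w| <= nc w.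
Proof. by case: b; [exact: Re_le_nc|exact: Im_le_nc]. Qed.
Let partB b w1 w2 : part b (w1 - w2) = part b w1 - part b w2.
Proof. by case: b; rewrite /= ?ReB ?ImB. Qed.

Let d2 : 0 <= 2 / d ^+ 2. Proof. by rewrite divr_ge0 // exprn_ge0 // ltW. Qed.

Let F_bound e (e0 : 0 < e) t u i : `|F e t u i| <= 2 / e + A * (2 / d) + 2 / d.
Proof.
have d0' : 0 <= 2 / d by rewrite divr_ge0 // ltW.
have e0' : 0 <= 2 / e by rewrite divr_ge0 // ltW.
have Ad : 0 <= A * (2 / d) by rewrite mulr_ge0.
case: i => [k|[j c]] /=.
  apply: le_trans (ler_normD _ _) _.
  have h1 : `|\sum_l 2 / n.+1%:R * rr e k l (u (inl k) - u (inl l))| <= 2 / e.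
    apply: le_trans (ler_norm_sum _ _ _) _; apply: avg_le => l.
    rewrite normrM ger0_norm ?divr_ge0 // mulrAC ler_wpM2r // ler_wpM2l //.
    exact: rr_bound.
  by have := bb_bound u (u (inl k)); lra.
apply: le_trans (part_le _ _) _.
have h : nc (\sum_k cR (2 / n.+1%:R) / (liftIm d (Sof u j) - cR (u (inl k)))) <= 2 / d.
  apply: le_trans (nc_sum _ _ _) _; apply: avg_le => k.
  rewrite nc_kdiv // ler_wpM2r // ler_wpM2l //; apply: res_bound => //.
  exact: lift_abs.
lra.
Qed.

Let F_lip e (e0 : 0 < e) t u u' (c : R) i : (forall i, `|u i - u' i| <= c) ->
  `|F e t u i - F e t u' i| <= (4 / e ^+ 2 + A * (6 / d ^+ 2) + 6 / d ^+ 2) * c.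
Proof.
move=> H.
have c0 : 0 <= c by case: i => [k|p]; [exact: le_trans (normr_ge0 _) (H (inl k))|exact: le_trans (normr_ge0 _) (H (inr p))].
have i1 : 0 <= 4 / e ^+ 2 * c by rewrite mulr_ge0 // divr_ge0 // exprn_ge0 // ltW.
have i2 : 0 <= 6 / d ^+ 2 * c by rewrite mulr_ge0 // divr_ge0 // exprn_ge0 // ltW.
have i3 : 0 <= A * (6 / d ^+ 2) * c by rewrite -mulrA mulr_ge0.
case: i => [k|[j b]] /=.
  have -> (p q r w : R) : p + q - (r + w) = (p - r) + (q - w) by ring.
  apply: le_trans (ler_normD _ _) _.
  have h1 : `|\sum_l 2 / n.+1%:R * rr e k l (u (inl k) - u (inl l)) -
     \sum_l 2 / n.+1%:R * rr e k l (u' (inl k) - u' (inl l))| <= 4 / e ^+ 2 * c.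
    rewrite -sumrB; apply: le_trans (ler_norm_sum _ _ _) _; apply: avg_le => l.
    rewrite -mulrBr normrM ger0_norm ?divr_ge0 // mulrAC ler_wpM2r //.
    have -> : 4 / e ^+ 2 * c = 2 * ((2 * c) / e ^+ 2) by ring.
    rewrite ler_wpM2l //; apply: le_trans (rr_lip e0 _ _ _ _) _.
    apply: ler_wpM2r; first by rewrite invr_ge0 exprn_ge0 // ltW.
    have -> : u (inl k) - u (inl l) - (u' (inl k) - u' (inl l)) =
       (u (inl k) - u' (inl k)) - (u (inl l) - u' (inl l)) by ring.
    by apply: le_trans (ler_normB _ _) _; have := H (inl k); have := H (inl l); lra.
  have h2 : `|bb u (u (inl k)) - bb u' (u' (inl k))| <= A * (2 / d ^+ 2 * (3 * c)).
    apply: atomsH_le => j.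
    apply: le_trans (bker_lip _ _ d0 (lift_ge d _) (lift_ge d _)) _.
    rewrite ler_wpM2l //.
    by have := @liftS_lip u u' c j H; have := H (inl k); lra.
  have -> : (4 / e ^+ 2 + A * (6 / d ^+ 2) + 6 / d ^+ 2) * c =
    4 / e ^+ 2 * c + A * (2 / d ^+ 2 * (3 * c)) + 6 / d ^+ 2 * c by ring.
  lra.
rewrite -partB; apply: le_trans (part_le _ _) _.
have h : nc (\sum_k cR (2 / n.+1%:R) / (liftIm d (Sof u j) - cR (u (inl k))) -
   \sum_k cR (2 / n.+1%:R) / (liftIm d (Sof u' j) - cR (u' (inl k)))) <= 6 / d ^+ 2 * c.
  rewrite -sumrB; apply: le_trans (nc_sum _ _ _) _; apply: avg_le => k.
  rewrite -mulrBr nc_kdiv // ler_wpM2r //.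
  have -> : 6 / d ^+ 2 * c = 2 * ((3 * c) / d ^+ 2) by ring.
  rewrite ler_wpM2l //.
  apply: le_trans (res_lip _ _ d0 (lift_abs d _) (lift_abs d _)) _.
  apply: ler_wpM2r; first by rewrite invr_ge0 exprn_ge0 // ltW.
  by have := @liftS_lip u u' c j H; have := H (inl k); lra.
by apply: le_trans h _; rewrite !mulrDl; lra.
Qed.

Let x0 (i : st) : R := match i with inl k => x k | inr (j, c) => part c (s j) end.

Let sys_ex e (e0 : 0 < e) : exists y : R -> st -> R,
  [/\ y 0 = x0, forall t i, 0 < t -> der (fun u => y u i) t (F e t (y t) i) &
      forall i u t, `|y u i - y t i| <= (2 / e + A * (2 / d) + 2 / d) * `|u - t|].
Proof.
apply: (@picard R _ (F e) _ (4 / e ^+ 2 + A * (6 / d ^+ 2) + 6 / d ^+ 2)).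
- have h (c q : R) : 0 <= c -> 0 < q -> 0 <= c / q ^+ 2.
    by move=> c0 q0; rewrite divr_ge0 // exprn_ge0 // ltW.
  by apply: addr_ge0; [apply: addr_ge0; [exact: h|apply: mulr_ge0 => //; exact: h]|exact: h].
- by move=> t u i; exact: F_bound.
- by move=> t u u' c i; exact: F_lip.
- by move=> u [k|[j c]] t; exact: cvg_cst.
Qed.

Section Apriori.
Variables (e : R) (y : R -> st -> R).
Hypothesis e0 : 0 < e.
Hypothesis e1 : e <= 1.
Hypothesis y0 : y 0 = x0.
Hypothesis dy : forall t i, 0 < t -> der (fun u => y u i) t (F e t (y t) i).
Hypothesis yc : forall i (c b : R), {within `[c, b], continuous (fun t => y t i)}.

Let V t k := y t (inl k).
Let beta := A * (2 / d).
Let pp t k := \sum_l rr e k l (V t k - V t l).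
Let N : R := n.+1%:R.
Let N0 : 0 < N. Proof. by rewrite /N ltr0n. Qed.

Let dV t k : 0 < t -> der (fun u => V u k) t (2 / N * pp t k + bb (y t) (V t k)).
Proof. by move=> t0; apply: der_eq (dy (inl k) t0) _; rewrite /F /pp mulr_sumr. Qed.

Let within_sum (I : finType) (f : I -> R -> R) (c b : R) : (forall i, {within `[c, b], continuous (f i)}) ->
  {within `[c, b], continuous (fun t => \sum_i f i t)}.
Proof.
move=> H; elim: (index_enum I) => [|i r IH].
  have -> : (fun t => \sum_(i <- [::]) f i t) = fun=> 0 by apply/funext => t; rewrite big_nil.
  by apply: within_cont => t _; exact: cvg_cst.
have -> : (fun t => \sum_(j <- i :: r) f j t) = fun t => f i t + \sum_(j <- r) f j t.
  by apply/funext => t; rewrite big_cons.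
exact: within_add.
Qed.

(** Gronwall bound on [0, T] for the sum of squares of the positions. Its derivative exceeds the sum
    itself by at most [2 * N + N * beta ^+ 2]: the pair forces contribute 2/N for each of the
    [N * N] ordered pairs, the drift gives the rest. *)
Let Qstar := (\sum_k x k ^+ 2 + (2 * N + N * beta ^+ 2) * T) * expR (1 * T).

Let N0' : 0 <= N. Proof. exact: ltW N0. Qed.
Let c0' : 0 <= 2 * N + N * beta ^+ 2.
Proof.
by apply: addr_ge0; apply: mulr_ge0 => //; exact: sqr_ge0.
Qed.

Let V_bound t k : 0 <= t <= T -> `|V t k| <= 1 + Qstar.
Proof.
move=> /andP[t0 tT].
pose Q u := \sum_k V u k * V u k.
pose dQ u := \sum_k ((2 / N * pp u k + bb (y u) (V u k)) * V u k + V u k * (2 / N * pp u k + bb (y u) (V u k))).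
have Qc : {within `[0, t], continuous Q}.
  by apply: within_sum => l; apply: within_mul; exact: yc.
have dQE u : 0 < u < t -> der Q u (dQ u).
  by move=> /andP[u0 _]; apply: der_sum => l _; apply: derM; exact: dV.
have c0 : 0 <= 2 * N + N * beta ^+ 2 := c0'.
have dQle u : 0 < u < t -> dQ u <= 1 * Q u + (2 * N + N * beta ^+ 2).
  move=> _.
  have S1 : \sum_k \sum_l rr e k l (V u k - V u l) * (V u k - V u l) = 2 * \sum_k pp u k * V u k.
    by apply: antisym_sum => k' l'; rewrite -rr_anti opprB.
  have S2 : \sum_k \sum_l rr e k l (V u k - V u l) * (V u k - V u l) <= N * N.
    apply: (@le_trans _ _ (\sum_(k : 'I_n.+1) \sum_(l : 'I_n.+1) 1)).
      by apply: ler_sum => k' _; apply: ler_sum => l' _; exact: rr_le1.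
    by rewrite !sumr_const card_ord -[leLHS]mulr_natr.
  have S3 k' : 2 * (bb (y u) (V u k') * V u k') <= V u k' * V u k' + beta ^+ 2.
    have := sqr_ge0 (bb (y u) (V u k') - V u k').
    have : bb (y u) (V u k') ^+ 2 <= beta ^+ 2.
      rewrite -[leLHS](real_normK (num_real _)) ler_pXn2r ?nnegrE // ?bb_bound //.
      by apply: mulr_ge0 => //; rewrite divr_ge0 // ltW.
    rewrite sqrrB !expr2; lra.
  have -> : dQ u = 2 / N * (2 * \sum_k pp u k * V u k) + \sum_k 2 * (bb (y u) (V u k) * V u k).
    by rewrite !mulr_sumr -big_split /=; apply: eq_bigr => k' _; ring.
  rewrite -S1 mul1r.
  have S4 : \sum_k 2 * (bb (y u) (V u k) * V u k) <= Q u + N * beta ^+ 2.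
    apply: le_trans (ler_sum _ (fun k' _ => S3 k')) _.
    by rewrite big_split /= lerD2l sumr_const card_ord -[leLHS]mulr_natl.
  have S5 : 2 / N * (\sum_k \sum_l rr e k l (V u k - V u l) * (V u k - V u l)) <= 2 * N.
    apply: (@le_trans _ _ (2 / N * (N * N))); first by rewrite ler_wpM2l // divr_ge0 // ltW.
    by rewrite mulrA divfK ?gt_eqF.
  by rewrite addrCA; exact: lerD S5 S4.
have := gronwall t0 ler01 c0 Qc dQE dQle; rewrite subr0 => h.
have Q0 : Q 0 = \sum_k x k ^+ 2.
  by apply: eq_bigr => l _; rewrite /V y0 expr2.
have hQ : Q t <= Qstar.
  apply: le_trans h _; rewrite Q0; apply: ler_pM.
  - by rewrite addr_ge0 ?mulr_ge0 // sumr_ge0 // => l _; exact: sqr_ge0.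
  - exact: expR_ge0.
  - by rewrite lerD2l ler_wpM2l.
  - by rewrite ler_expR !mul1r.
have hk : V t k ^+ 2 <= Q t.
  by rewrite /Q (bigD1 k) //= expr2 lerDl sumr_ge0 // => l _; rewrite -expr2 sqr_ge0.
have := sqr_ge0 (`|V t k| - 1); rewrite sqrrB real_normK ?num_real //; have := normr_ge0 (V t k); lra.
Qed.

Hypothesis xgap : forall k l : 'I_n.+1, (l < k)%N -> e <= x k - x l.
Let e_ini := \sum_(p : 'I_n.+1 * 'I_n.+1) (if p.1 == p.2 then 0 else ln `|x p.1 - x p.2|).

(** The truncated forces derive from the truncated logarithm, so the energy estimate holds before
    any separation of the particles is known. The energy decreases at most linearly in time, and
    every pair term is bounded above because the positions are; a single gap below e would push the
    energy under its lower bound. The condition on [ln e] says how small e has to be for this. *)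
Let gap t : 0 <= t <= T ->
  ln e < e_ini - T * (N * (N / 4 * beta ^+ 2)) - N * N * (2 + 2 * Qstar) ->
  forall k l : 'I_n.+1, (l < k)%N -> e <= V t k - V t l.
Proof.
move=> /andP[t0 tT] he.
have [ell [dl ll]] := trunc_log_ex e0 e1.
pose lam (k l : 'I_n.+1) (v : R) := if (l < k)%N then ell v else if (k < l)%N then ell (- v) else 0.
have dlam k l v : der (lam k l) v (rr e k l v).
  rewrite /lam /rr; case: ifP => _ //; case: ifP => _; last exact: derC.
  by apply: der_eq (der_comp (dl (- v)) (derN (derI v))) _; rewrite mulrN1.
have elle : {homo ell : u v / u <= v}.
  move=> u v uv.
  have [uv'|] := ltP u v; last by move=> vu; have -> : u = v by apply/eqP; rewrite eq_le uv.
  have : - ell v <= - ell u.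
    apply: (@nonincr R (fun w => - ell w) (fun w => - (Num.max w e)^-1) u v uv).
    - by apply: within_cont => w _; exact: der_cont (derN (dl w)).
    - by move=> w _; exact: derN (dl w).
    - by move=> w _; rewrite oppr_le0 invr_ge0 le_max (ltW e0) orbT.
  by rewrite lerN2.
(* Two positions differ by at most B, and [ln B <= B] bounds every pair term. *)
pose B := 2 + 2 * Qstar.
have Qs0 : 0 <= Qstar.
  apply: mulr_ge0; last exact: expR_ge0.
  by apply: addr_ge0; [apply: sumr_ge0 => l _; exact: sqr_ge0|apply: mulr_ge0].
have ellB v : v <= B -> ell v <= B.
  move=> vB; apply: le_trans (elle _ _ vB) _.
  rewrite ll; last by rewrite (le_trans e1) // /B; lra.
  by apply/ltW/ln_sublinear; rewrite /B; lra.
pose E u := \sum_k \sum_l lam k l (V u k - V u l).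
have tin : 0 <= t <= T by rewrite t0.
have lamB k l : lam k l (V t k - V t l) <= B.
  have := V_bound k tin; have := V_bound l tin; rewrite !ler_norml => /andP[? ?] /andP[? ?].
  by rewrite /lam; case: ifP => _; [|case: ifP => _]; [apply: ellB|apply: ellB|]; rewrite /B; lra.
have E0 : E 0 = e_ini.
  rewrite /E pair_bigA /=; apply: eq_bigr => -[k l] _ /=; rewrite /V y0 /= /lam.
  case: (ltngtP l k) => [lk|kl|kl].
  - rewrite ll ?xgap // ger0_norm; last by rewrite (le_trans (ltW e0)) ?xgap.
    by case: eqP lk => // ->; rewrite ltnn.
  - rewrite opprB ll ?xgap // distrC ger0_norm; last by rewrite (le_trans (ltW e0)) ?xgap.
    by case: eqP kl => // ->; rewrite ltnn.
  - by rewrite (val_inj kl) eqxx.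
pose v' u k := 2 / N * pp u k + bb (y u) (V u k).
pose dE u := \sum_k \sum_l rr e k l (V u k - V u l) * (v' u k - v' u l).
have dEE u : 0 < u < t -> der E u (dE u).
  move=> /andP[u0 _]; apply: der_sum => k _; apply: der_sum => l _.
  by apply: (der_comp (dlam k l _)); apply: derB; exact: dV.
have Ec : {within `[0, t], continuous E}.
  apply: within_sum => k; apply: within_sum => l.
  apply: within_comp2; last by apply: within_diff; exact: yc.
  by move=> w; exact: der_cont (dlam k l w).
have dEge u : - (N * (N / 4 * beta ^+ 2)) * 1 <= dE u.
  rewrite /dE antisym_sum; last by move=> k l; rewrite -rr_anti opprB.
  rewrite mulr1 mulr_sumr.
  have -> : - (N * (N / 4 * beta ^+ 2)) = \sum_(k : 'I_n.+1) - (N / 4 * beta ^+ 2).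
    by rewrite sumr_const card_ord mulNrn -[X in _ = - X]mulr_natl.
  apply: ler_sum => k _; rewrite -/(pp u k) /v'.
  have : bb (y u) (V u k) ^+ 2 <= beta ^+ 2.
    rewrite -[leLHS](real_normK (num_real _)) ler_pXn2r ?nnegrE // ?bb_bound //.
    by apply: mulr_ge0 => //; rewrite divr_ge0 // ltW.
  set p := pp u k; set b := bb _ _ => hb.
  (* Completing the square: the quadratic repulsion term dominates the drift up to a quantity
     independent of the positions. *)
  have -> : 2 * (p * (2 / N * p + b)) = (2 * p + b * N / 2) ^+ 2 / N - N / 4 * b ^+ 2.
    by field; rewrite gt_eqF.
  have h1 : 0 <= (2 * p + b * N / 2) ^+ 2 / N by rewrite divr_ge0 ?sqr_ge0 // ltW.
  have h2 : N / 4 * b ^+ 2 <= N / 4 * beta ^+ 2 by rewrite ler_wpM2l // divr_ge0 // ltW.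
  by apply: (@le_trans _ _ (- (N / 4 * b ^+ 2))); [rewrite lerN2|rewrite lerDr].
have Et : e_ini - T * (N * (N / 4 * beta ^+ 2)) <= E t.
  have := @le_compare R (fun u => - (N * (N / 4 * beta ^+ 2)) * u) (fun=> - (N * (N / 4 * beta ^+ 2)) * 1) E dE 0 t t0.
  rewrite mulr0 E0 subr0 => h.
  have {h}: - (N * (N / 4 * beta ^+ 2)) * t <= E t - e_ini.
    apply: h => //.
    - by apply: within_cont => w _; exact: der_cont (derZ _ (derI w)).
    - by move=> w _; exact: derZ (derI w).
  have : t * (N * (N / 4 * beta ^+ 2)) <= T * (N * (N / 4 * beta ^+ 2)).
    by apply: ler_wpM2r => //; apply: mulr_ge0 => //; apply: mulr_ge0; [rewrite divr_ge0|exact: sqr_ge0].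
  lra.
move=> k l lk; rewrite leNgt; apply/negP => gp.
have : E t <= ln e + N * N * B.
  rewrite /E pair_bigA /= (bigD1 (k, l)) //=.
  apply: lerD.
    rewrite /lam lk; apply: le_trans (elle _ _ (ltW gp)) _.
    by rewrite ll.
  apply: (@le_trans _ _ (\sum_(p : 'I_n.+1 * 'I_n.+1) B)).
    rewrite [leRHS](bigD1 (k, l)) //=; apply: ler_wpDl; first by rewrite /B; lra.
    by apply: ler_sum => p _; exact: lamB.
  by rewrite sumr_const card_prod card_ord -[leLHS]mulr_natl natrM.
by move: he Et; rewrite -/B; lra.
Qed.

Lemma apriori_gap : ln e < e_ini - T * (N * (N / 4 * beta ^+ 2)) - N * N * (2 + 2 * Qstar) ->
  forall t, 0 <= t <= T -> forall k l : 'I_n.+1, (l < k)%N -> e <= V t k - V t l.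
Proof. by move=> h t tT; exact: gap. Qed.

End Apriori.

Hypothesis xlt : forall i j : 'I_n.+1, (i < j)%N -> x i < x j.
Hypothesis sI : forall j, 2 * d <= ImC (s j).
Hypothesis Td : T <= d ^+ 2 / 2.

Theorem driving_exists : exists W S, drivingSol x s a T W S.
Proof.
have [g0 g0p Hg] : exists2 g0 : R, 0 < g0 & forall k l : 'I_n.+1, (l < k)%N -> g0 <= x k - x l.
  have [|g g0 Hg] := @fin_lb R ('I_n.+1 * 'I_n.+1)%type (fun p => if (p.2 < p.1)%N then x p.1 - x p.2 else 1).
    by move=> [k l] /=; case: ifP => // lk; rewrite subr_gt0 xlt.
  by exists g => // k l lk; have := Hg (k, l); rewrite /= lk.
set c := \sum_(p : 'I_n.+1 * 'I_n.+1) (if p.1 == p.2 then 0 else ln `|x p.1 - x p.2|)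
  - T * (n.+1%:R * (n.+1%:R / 4 * (A * (2 / d)) ^+ 2)) - n.+1%:R * n.+1%:R *
  (2 + 2 * ((\sum_k x k ^+ 2 + (2 * n.+1%:R + n.+1%:R * (A * (2 / d)) ^+ 2) * T) * expR (1 * T))).
(* [c] is the threshold of [apriori_gap] and [g0] a lower bound of the initial gaps, so this e meets
   all conditions at once. *)
pose e := Num.min g0 (Num.min 1 (expR (c - 1))).
have e0 : 0 < e by rewrite !lt_min g0p ltr01 expR_gt0.
have e1 : e <= 1 by rewrite !ge_min lexx !orbT.
have ec : ln e < c.
  apply: (@le_lt_trans _ _ (c - 1)); last by rewrite gtrBl.
  by rewrite -[leRHS]expRK ler_ln ?posrE ?expR_gt0 // !ge_min lexx !orbT.
have [y [y0 dy ly]] := sys_ex e0.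
have B0 : 0 <= 2 / e + A * (2 / d) + 2 / d.
  by rewrite !addr_ge0 ?mulr_ge0 ?invr_ge0 ?(ltW e0) ?(ltW d0).
have yc i (c' b : R) : {within `[c', b], continuous (fun t => y t i)}.
  apply: (@within_cont R c' b (fun t => y t i)) => t _; apply/cvgrPdist_le => r r0.
  have K1 : 0 < 2 / e + A * (2 / d) + 2 / d + 1 by rewrite ltr_wpDl.
  exists (r / (2 / e + A * (2 / d) + 2 / d + 1)); first by rewrite /= divr_gt0.
  move=> t' /=; rewrite ltr_pdivlMr // => h; apply: le_trans (ly i t t') _.
  by move: h; rewrite mulrDr mulr1; have := normr_ge0 (t - t'); lra.
have gap := @apriori_gap e y e0 e1 y0 dy yc _ ec.
have {}gap : forall t, 0 <= t <= T -> forall k l : 'I_n.+1, (l < k)%N -> e <= y t (inl k) - y t (inl l).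
  by apply: gap => k l /Hg; apply: le_trans; rewrite !ge_min lexx.
pose W t k := y t (inl k); pose S t j := Sof (y t) j.
have rrE t : 0 <= t <= T -> forall k l, k != l -> rr e k l (W t k - W t l) = (W t k - W t l)^-1.
  move=> tT k l kl; rewrite /rr; case: (ltngtP l k) => [lk|lk|lk].
  - by rewrite (max_idPl _) // gap.
  - by rewrite opprB (max_idPl _) ?gap // -opprB invrN opprK.
  - by move: kl; rewrite (val_inj lk) eqxx.
have dS t j : 0 < t -> cder (fun u => S u j) t (Mw W t (liftIm d (S t j))).
  by move=> t0; split; [exact: (dy t (inr (j, true)) t0)|exact: (dy t (inr (j, false)) t0)].
have Sc j (b : R) : {within `[0, b], continuous (fun u => S u j)}.
  by apply/withinCP; split; exact: yc.
have S0 j : S 0 j = s j by apply: complexP; rewrite /S /= y0.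
have SI t j : 0 <= t <= T -> d <= ImC (S t j).
  move=> tT; have := flow_Im (@Mw_good R n W) d0 (Sc j T) (fun t h => dS t j (proj1 (andP h))) tT.
  rewrite S0; have := sI j; move/andP: tT => [_ tT] h1.
  have : 2 / d * t <= d.
    rewrite mulrAC ler_pdivrMr // -expr2; have := Td; lra.
  lra.
exists W, S; split; [|split; [|split; [|split]]].
- by move=> k; rewrite /W y0.
- move=> t tT k l kl; rewrite -subr_eq0.
  case: (ltngtP l k) => [lk|lk|lk].
  - by rewrite gt_eqF // (lt_le_trans e0) // gap.
  - by rewrite -oppr_eq0 opprB gt_eqF // (lt_le_trans e0) // gap.
  - by move: kl; rewrite (val_inj lk) eqxx.
- by move=> k; exact: yc.
- move=> j; rewrite -S0; apply: (@flow_gsol R (Mw W) T d) => //.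
  + by move=> t /andP[t0 _]; exact: dS.
  + by move=> t tT; exact: SI.
move=> t /andP[t0 tT] k; apply/cderP; rewrite Vdrift_real; apply: cder_cR.
have tin : 0 <= t <= T by rewrite !ltW.
apply: der_eq (dy t (inl k) t0) _; rewrite /F; congr (_ + _).
  rewrite (bigD1 k) //= /rr ltnn mulr0 add0r; apply: eq_bigr => l lk.
  by have := rrE t tin k l; rewrite eq_sym lk => /(_ isT); rewrite /rr /W => ->.
by rewrite /bb /atomsH; apply: eq_bigr => j _; rewrite lift_id // SI.
Qed.

End DrivingSystem.

(** * Weak convergence tested on smooth steps *)

Section SmoothStep.
Variable R : realType.
Implicit Types (v a h : R).

(** The derivative of the cubic 3 v^2 - 2 v^3 on [0, 1], extended by 0. *)
Let g v : R := 6 * clampT 1 v * (1 - clampT 1 v).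

Let c01 v : 0 <= clampT 1 v <= 1. Proof. exact: clampT_in. Qed.

Lemma clampT_cst (T v : R) : 0 <= T -> (v <= 0 -> clampT T v = 0) /\ (T <= v -> clampT T v = T).
Proof.
move=> T0; split => h; first by rewrite /clampT (max_idPr h) (min_idPl T0).
by rewrite /clampT (max_idPl (le_trans T0 h)); apply/min_idPr.
Qed.

Let g_lip v w : `|g v - g w| <= 6 * `|v - w|.
Proof.
have -> : g v - g w = 6 * (clampT 1 v - clampT 1 w) * (1 - clampT 1 v - clampT 1 w) by rewrite /g; ring.
rewrite !normrM ger0_norm // -mulrA ler_wpM2l //.
apply: le_trans (clampT_lip 1 v w); rewrite -[leRHS]mulr1 ler_wpM2l //.
by have /andP[? ?] := c01 v; have /andP[? ?] := c01 w; rewrite ler_norml; apply/andP; split; lra.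
Qed.

Let gc : continuous g.
Proof.
move=> v; apply/cvgrPdist_le => e e0; exists (e / 6); first by rewrite /= divr_gt0.
move=> w; rewrite /ball_ /= ltr_pdivlMr // => h; apply: le_trans (g_lip v w) _; lra.
Qed.

Let g_ge0 v : 0 <= g v.
Proof. by have /andP[? ?] := c01 v; rewrite /g mulr_ge0 ?mulr_ge0 // subr_ge0. Qed.

Let g_le v : g v <= 6.
Proof.
have /andP[? ?] := c01 v; rewrite /g -mulrA -[leRHS]mulr1 ler_wpM2l //.
by rewrite mulr_ile1 // ?subr_ge0 // lerBlDr lerDl.
Qed.

(** A C^1 step with Lipschitz derivative, the regularity under which averages are Lipschitz in time
    with a constant independent of N. *)
Definition step : R -> R := projT1 (cid (primitive gc)).
Definition dstep v : R := 6 * clampT 1 v * (1 - clampT 1 v).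

Lemma step_der v : der step v (dstep v).
Proof. by rewrite /step; case: cid => F [] /= _ H; exact: H. Qed.

Lemma dstep_lip v w : `|dstep v - dstep w| <= 6 * `|v - w|. Proof. exact: g_lip. Qed.
Lemma dstep_bound v : `|dstep v| <= 6.
Proof. by rewrite ger0_norm ?g_le // g_ge0. Qed.

Lemma step_mono : {homo step : v w / v <= w}.
Proof.
move=> v w vw.
have : - step w <= - step v.
  apply: (@nonincr R (fun u => - step u) (fun u => - dstep u) v w vw).
  - by apply: within_cont => u _; exact: der_cont (derN (step_der u)).
  - by move=> u _; exact: derN (step_der u).
  - by move=> u _; rewrite oppr_le0; exact: g_ge0.
by rewrite lerN2.
Qed.

Let step_eq (f df : R -> R) (a b : R) : a <= b -> (forall u, der f u (df u)) ->
  (forall u, a < u < b -> df u = dstep u) -> step b - step a = f b - f a.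
Proof.
move=> ab Hf E.
have : `|(step b - f b) - (step a - f a)| <= 0 * (b - a).
  apply: (@lip_bound R (fun u => step u - f u) (fun u => dstep u - df u)) => //.
  - by apply: within_cont => u _; exact: der_cont (derB (step_der u) (Hf u)).
  - by move=> u _; exact: derB (step_der u) (Hf u).
  - by move=> u /E ->; rewrite subrr normr0.
rewrite mul0r normr_le0 => /eqP; lra.
Qed.

Lemma step_le0 v : v <= 0 -> step v = 0.
Proof.
move=> v0; have S0 : step 0 = 0 by rewrite /step; case: cid => F [].
have := @step_eq (fun=> 0) (fun=> 0) v 0 v0 (fun u => derC 0 u).
rewrite S0 subrr => h; apply/eqP; rewrite -oppr_eq0 -sub0r; apply/eqP; apply: h.
by move=> u /andP[_ u0]; rewrite /dstep (clampT_cst u ler01).1 ?mulr0 ?mul0r // ltW.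
Qed.

Lemma step_ge1 v : 1 <= v -> step v = 1.
Proof.
move=> v1.
have S1 : step 1 = 1.
  pose f (u : R) := 3 * (u * u) - 2 * (u * u * u).
  have df u : der f u (6 * u * (1 - u)).
    have h := derM (derI u) (derI u).
    by apply: der_eq (derB (derZ 3 h) (derZ 2 (derM h (derI u)))) _; ring.
  have := @step_eq f _ 0 1 ler01 df.
  rewrite (step_le0 (lexx 0)) subr0 => -> => [|u /andP[u0 u1]]; first by rewrite /f; ring.
  by rewrite /dstep clampT_id // !ltW.
have := @step_eq (fun=> 0) (fun=> 0) 1 v v1 (fun u => derC 0 u).
rewrite S1 subrr => h; apply/eqP; rewrite -subr_eq0; apply/eqP; apply: h.
by move=> u /andP[u1 _]; rewrite /dstep (clampT_cst u ler01).2 ?subrr ?mulr0 // ltW.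
Qed.

Lemma step_01 v : 0 <= step v <= 1.
Proof.
apply/andP; split.
  by case: (leP v 0) => [/step_le0 ->//|/ltW v0]; rewrite -(step_le0 (lexx 0)) step_mono.
by case: (leP 1 v) => [/step_ge1 ->//|/ltW v0]; rewrite -(step_ge1 (lexx 1)) step_mono.
Qed.

Definition theta a h v : R := step ((v - a) / h).

Lemma theta_01 a h v : 0 <= theta a h v <= 1. Proof. exact: step_01. Qed.
Lemma theta_0 a h v : 0 < h -> v <= a -> theta a h v = 0.
Proof. by move=> h0 va; apply: step_le0; rewrite mulr_le0_ge0 ?subr_le0 // invr_ge0 ltW. Qed.
Lemma theta_1 a h v : 0 < h -> a + h <= v -> theta a h v = 1.
Proof. by move=> h0 va; apply: step_ge1; rewrite ler_pdivlMr // mul1r lerBrDl. Qed.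
Lemma theta_mono a h : 0 < h -> {homo theta a h : v w / v <= w}.
Proof. by move=> h0 v w vw; apply: step_mono; rewrite ler_wpM2r ?invr_ge0 ?(ltW h0) // lerB. Qed.
Lemma theta_anti a b h v : 0 < h -> a <= b -> theta b h v <= theta a h v.
Proof. by move=> h0 ab; apply: step_mono; rewrite ler_wpM2r ?invr_ge0 ?(ltW h0) // lerB. Qed.

Lemma theta_der a h v : der (theta a h) v (dstep ((v - a) / h) / h).
Proof.
apply: (@der_comp R step (fun v => (v - a) / h)); first exact: step_der.
apply: der_eq (derM (derB (derI v) (derC a v)) (derC h^-1 v)) _.
by rewrite mulr0 addr0 subr0 mul1r.
Qed.

Lemma dtheta_bound a h v : 0 < h -> `|dstep ((v - a) / h) / h| <= 6 / h.
Proof.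
move=> h0; rewrite normrM [`|h^-1|]ger0_norm ?invr_ge0 ?(ltW h0) //.
by rewrite ler_wpM2r ?invr_ge0 ?(ltW h0) // dstep_bound.
Qed.

Lemma dtheta_lip a h v w : 0 < h ->
  `|dstep ((v - a) / h) / h - dstep ((w - a) / h) / h| <= 6 / h ^+ 2 * `|v - w|.
Proof.
move=> h0; have hi : 0 <= h^-1 by rewrite invr_ge0 ltW.
rewrite -mulrBl normrM [`|h^-1|]ger0_norm //.
have -> : 6 / h ^+ 2 * `|v - w| = 6 * (`|v - w| / h) / h by field; rewrite gt_eqF.
rewrite ler_wpM2r //; apply: le_trans (dstep_lip _ _) _; rewrite ler_wpM2l //.
have -> : (v - a) / h - (w - a) / h = (v - w) / h by ring.
by rewrite normrM [`|h^-1|]ger0_norm.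
Qed.

Lemma theta_lip a h v w : 0 < h -> `|theta a h v - theta a h w| <= 6 / h * `|v - w|.
Proof. by move=> h0; apply: lip_bound_all (fun u => theta_der a h u) (fun u => dtheta_bound a u h0) v w. Qed.

Definition bump a h v : R := theta a h v - theta (a + h) h v.

Lemma bump_ge0 a h v : 0 < h -> 0 <= bump a h v.
Proof. by move=> h0; rewrite subr_ge0 theta_anti // lerDl ltW. Qed.

Lemma bump_supp a h v : 0 < h -> bump a h v != 0 -> a <= v <= a + 2 * h.
Proof.
move=> h0; apply: contraR; rewrite negb_and -!ltNge => /orP[/ltW va|/ltW va]; rewrite /bump.
  by rewrite !theta_0 ?subrr // (le_trans va) // lerDl ltW.
by rewrite !theta_1 ?subrr //; lra.
Qed.

(** Since the bumps telescope to a partition of unity, this interpolant keeps the sup bound of f and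
    differs from f, on the range covered, by at most its oscillation at scale 2 h. *)
Definition app (f : R -> R) a h (n : nat) v : R := \sum_(i < n) f (a + i%:R * h) * bump (a + i%:R * h) h v.

Lemma bump_sum a h n v : \sum_(i < n) bump (a + i%:R * h) h v = theta a h v - theta (a + n%:R * h) h v.
Proof.
elim: n => [|n IH]; first by rewrite big_ord0 mul0r addr0 subrr.
have -> : a + n.+1%:R * h = a + n%:R * h + h by rewrite -natr1; ring.
by rewrite big_ord_recr /= IH /bump; ring.
Qed.

Lemma app_bound f a h n v (M : R) : 0 < h -> 0 <= M -> (forall u, `|f u| <= M) -> `|app f a h n v| <= M.
Proof.
move=> h0 M0 fM; apply: le_trans (ler_norm_sum _ _ _) _.
apply: (@le_trans _ _ (\sum_(i < n) M * bump (a + i%:R * h) h v)).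
  by apply: ler_sum => i _; rewrite normrM [`|bump _ _ _|]ger0_norm ?bump_ge0 // ler_wpM2r ?bump_ge0 // fM.
rewrite -mulr_sumr bump_sum -[leRHS]mulr1 ler_wpM2l //.
by have /andP[? ?] := theta_01 a h v; have /andP[? ?] := theta_01 (a + n%:R * h) h v; lra.
Qed.

Lemma app_close f a h n v (w : R) : 0 < h -> 0 <= w -> a + h <= v <= a + n%:R * h ->
  (forall u, a <= u <= v -> `|v - u| <= 2 * h -> `|f v - f u| <= w) ->
  `|f v - app f a h n v| <= w.
Proof.
move=> h0 w0 /andP[av va] H.
have S1 : \sum_(i < n) bump (a + i%:R * h) h v = 1 by rewrite bump_sum theta_1 // theta_0 // subr0.
have -> : f v - app f a h n v = \sum_(i < n) (f v - f (a + i%:R * h)) * bump (a + i%:R * h) h v.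
  by rewrite -[f v in LHS]mulr1 -[X in f v * X]S1 mulr_sumr -sumrB; apply: eq_bigr => i _; rewrite mulrBl.
apply: le_trans (ler_norm_sum _ _ _) _; rewrite -[leRHS]mulr1 -[X in w * X]S1 mulr_sumr.
apply: ler_sum => i _; rewrite normrM [`|bump _ _ _|]ger0_norm ?bump_ge0 //.
have [->|bn] := eqVneq (bump (a + i%:R * h) h v) 0; first by rewrite !mulr0.
rewrite ler_wpM2r ?bump_ge0 // H //; have /andP[u1 u2] := bump_supp h0 bn.
  by rewrite u1 andbT lerDl mulr_ge0 // ltW.
by rewrite ger0_norm ?subr_ge0 // lerBlDl.
Qed.

(** A smooth majorant of the indicator of |v| >= A that vanishes for |v| <= A - 1. Tightness is
    expressed through it because its averages are combinations of averages of steps. *)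
Definition tl (A v : R) : R := 1 - theta (- A) 1 v + theta (A - 1) 1 v.

Lemma tl_ge0 A v : 0 <= tl A v.
Proof.
by have /andP[? ?] := theta_01 (- A) 1 v; have /andP[? ?] := theta_01 (A - 1) 1 v; rewrite /tl; lra.
Qed.
Lemma tl_out A v : A <= `|v| -> 1 <= tl A v.
Proof.
rewrite /tl; have /andP[? ?] := theta_01 (- A) 1 v; have /andP[? ?] := theta_01 (A - 1) 1 v.
rewrite ler_normr => /orP[h|h].
  by rewrite (@theta_1 (A - 1)) //; lra.
by rewrite (@theta_0 (- A)) //; lra.
Qed.
Lemma tl_in A v : `|v| <= A - 1 -> tl A v = 0.
Proof.
rewrite ler_norml => /andP[? ?]; rewrite /tl (@theta_1 (- A)) ?(@theta_0 (A - 1)) ?subrr ?addr0 //; lra.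
Qed.
Lemma tl_le1 A v : 0 <= A -> tl A v <= 2.
Proof.
by move=> _; have /andP[? ?] := theta_01 (- A) 1 v; have /andP[? ?] := theta_01 (A - 1) 1 v; rewrite /tl; lra.
Qed.
End SmoothStep.

(** * Positive functionals on bounded measurable functions *)

Section PositiveFunctionals.
Context (R : realType) d (T : measurableType d).
Implicit Types (f g : T -> R) (E : (T -> R) -> R).

Definition bm f : Prop := measurable_fun setT f /\ exists M : R, forall x, `|f x| <= M.

Lemma bm_cst (c : R) : bm (fun _ : T => c).
Proof. by split; [exact: measurable_cst|exists `|c|]. Qed.
Lemma bmD f g : bm f -> bm g -> bm (fun x => f x + g x).
Proof.
move=> [mf [M HM]] [mg [M' HM']]; split; first exact: measurable_funD.
by exists (M + M') => x; apply: le_trans (ler_normD _ _) _; exact: lerD.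
Qed.
Lemma bmM f g : bm f -> bm g -> bm (fun x => f x * g x).
Proof.
move=> [mf [M HM]] [mg [M' HM']]; split; first exact: measurable_funM.
by exists (M * M') => x; rewrite normrM ler_pM.
Qed.
Lemma bmZ (c : R) f : bm f -> bm (fun x => c * f x).
Proof. by move=> h; apply: bmM => //; exact: bm_cst. Qed.
Lemma bmN f : bm f -> bm (fun x => - f x).
Proof.
move=> h; have := bmZ (-1) h; have -> : (fun x => -1 * f x) = (fun x => - f x) => //.
by apply/funext => x; rewrite mulN1r.
Qed.
Lemma bmB f g : bm f -> bm g -> bm (fun x => f x - g x).
Proof. by move=> hf hg; apply: bmD => //; exact: bmN. Qed.
Lemma bm_sum I (r : seq I) (F : I -> T -> R) : (forall i, bm (F i)) ->
  bm (fun x => \sum_(i <- r) F i x).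
Proof.
move=> H; elim: r => [|i r IH].
  have -> : (fun x => \sum_(i <- [::]) F i x) = fun=> 0 by apply/funext => x; rewrite big_nil.
  exact: bm_cst.
have -> : (fun x => \sum_(j <- i :: r) F j x) = fun x => F i x + \sum_(j <- r) F j x.
  by apply/funext => x; rewrite big_cons.
exact: bmD.
Qed.

(** Positive linear functionals of total mass m. Sigma-additivity is left out, so that integrals,
    empirical averages and limits along an ultrafilter obey the same rules. *)
Definition pf (m : R) E : Prop :=
  [/\ forall f g, bm f -> bm g -> E (fun x => f x + g x) = E f + E g,
      forall (c : R) f, bm f -> E (fun x => c * f x) = c * E f,
      forall f g, bm f -> bm g -> (forall x, f x <= g x) -> E f <= E g &
      E (fun=> 1) = m].

Section Theory.
Variables (m : R) (E : (T -> R) -> R).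
Hypothesis pE : pf m E.

Lemma pfD f g : bm f -> bm g -> E (fun x => f x + g x) = E f + E g.
Proof. by case: pE => h _ _ _; exact: h. Qed.
Lemma pfZ (c : R) f : bm f -> E (fun x => c * f x) = c * E f.
Proof. by case: pE => _ h _ _; exact: h. Qed.
Lemma pf_le f g : bm f -> bm g -> (forall x, f x <= g x) -> E f <= E g.
Proof. by case: pE => _ _ h _; exact: h. Qed.
Lemma pf_cst (c : R) : E (fun=> c) = c * m.
Proof.
case: pE => _ _ _ <-; rewrite -pfZ; last exact: bm_cst.
by congr E; apply/funext => x; rewrite mulr1.
Qed.
Lemma pfN f : bm f -> E (fun x => - f x) = - E f.
Proof.
move=> h; rewrite -mulN1r -pfZ //; congr E; apply/funext => x; by rewrite mulN1r.
Qed.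
Lemma pfB f g : bm f -> bm g -> E (fun x => f x - g x) = E f - E g.
Proof. by move=> hf hg; rewrite pfD ?pfN //; exact: bmN. Qed.
Lemma pf_sum I (r : seq I) (F : I -> T -> R) : (forall i, bm (F i)) ->
  E (fun x => \sum_(i <- r) F i x) = \sum_(i <- r) E (F i).
Proof.
move=> H; elim: r => [|i r IH].
  rewrite big_nil -[RHS](mul0r m) -pf_cst; congr E.
  by apply/funext => x; rewrite big_nil.
rewrite big_cons -IH -pfD //; last exact: bm_sum.
by congr E; apply/funext => x; rewrite big_cons.
Qed.
Lemma pf_abs f g : bm f -> bm g -> (forall x, `|f x| <= g x) -> `|E f| <= E g.
Proof.
move=> hf hg H; rewrite ler_norml -pfN //; apply/andP; split.
  by apply: pf_le => //; [exact: bmN|move=> x; have := H x; rewrite ler_norml => /andP[]].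
by apply: pf_le => // x; exact: le_trans (ler_norm _) (H x).
Qed.
Lemma pf_bound f (M : R) : bm f -> (forall x, `|f x| <= M) -> `|E f| <= M * m.
Proof. by move=> hf H; rewrite -pf_cst; apply: pf_abs => //; exact: bm_cst. Qed.
Lemma pf_diff f g h : bm f -> bm g -> bm h -> (forall x, `|f x - g x| <= h x) ->
  `|E f - E g| <= E h.
Proof. by move=> hf hg hh H; rewrite -pfB //; apply: pf_abs => //; exact: bmB. Qed.
Lemma pf_mass_ge0 : 0 <= m.
Proof.
rewrite -[leRHS]mul1r -pf_cst -[leLHS](mul0r m) -(pf_cst 0).
by apply: pf_le; [exact: bm_cst|exact: bm_cst|move=> _; exact: ler01].
Qed.
End Theory.

Lemma bm_integrable (mu : {finite_measure set T -> \bar R}) f : bm f ->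
  mu.-integrable setT (EFin \o f).
Proof.
move=> [mf [M HM]]; apply: measurable_bounded_integrable => //.
  by rewrite -ge0_fin_numE // fin_num_measure.
exists M; split; first exact: num_real.
by move=> M' MM' x _; exact: le_trans (HM x) (ltW MM').
Qed.

Lemma pf_Rintegral (mu : {finite_measure set T -> \bar R}) :
  pf (fine (mu setT)) (Rintegral mu setT).
Proof.
split.
- by move=> f g hf hg; rewrite RintegralD //; exact: bm_integrable.
- by move=> c f hf; rewrite RintegralZl //; exact: bm_integrable.
- by move=> f g hf hg H; apply: le_Rintegral => //; exact: bm_integrable.
- by rewrite Rintegral_cst // mul1r.
Qed.
End PositiveFunctionals.

Section RealFunctionals.
Variable R : realType.
Implicit Types (f g : R -> R).

Lemma bm_cont f (M : R) : continuous f -> (forall x, `|f x| <= M) -> bm f.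
Proof. by move=> cf H; split; [exact: continuous_measurable_fun|exists M]. Qed.

Lemma bm_der f df (M : R) : (forall x, der f x (df x)) -> (forall x, `|f x| <= M) -> bm f.
Proof. by move=> h H; apply: bm_cont H => x; exact: der_cont (h x). Qed.

Lemma lip_cont f (L : R) : (forall x y, `|f x - f y| <= L * `|x - y|) -> continuous f.
Proof.
move=> H x; apply/cvgrPdist_le => e e0.
have L0 : 0 <= L by have := le_trans (normr_ge0 _) (H 1 0); rewrite subr0 normr1 mulr1.
have L1 : 0 < L + 1 by rewrite ltr_wpDl.
exists (e / (L + 1)); first by rewrite /= divr_gt0.
move=> y; rewrite /ball_ /= ltr_pdivlMr // mulrDr mulr1 => h; apply: le_trans (H x y) _.
by have := normr_ge0 (x - y); lra.
Qed.

Lemma bm_lip f (L M : R) : (forall x y, `|f x - f y| <= L * `|x - y|) ->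
  (forall x, `|f x| <= M) -> bm f.
Proof. by move=> h; apply: bm_cont; exact: lip_cont h. Qed.

Lemma theta_bm a h : 0 < h -> bm (@theta R a h).
Proof.
move=> h0; apply: (bm_der (theta_der a h) (M := 1)) => x.
by have /andP[t0 t1] := theta_01 a h x; rewrite ger0_norm.
Qed.
Lemma bump_bm a h : 0 < h -> bm (@bump R a h).
Proof. by move=> h0; apply: bmB; exact: theta_bm. Qed.
Lemma tl_bm A : bm (@tl R A).
Proof. by apply: bmD; [apply: bmB; [exact: bm_cst|]|]; exact: theta_bm. Qed.
Lemma app_bm f a h n : 0 < h -> bm (app f a h n).
Proof. by move=> h0; apply: bm_sum => i; apply: bmZ; exact: bump_bm. Qed.

Lemma pf_prob (mu : probability R R) : pf 1 (Rintegral mu setT).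
Proof.
by have E : fine (mu setT) = 1 :> R; [rewrite probability_setT|rewrite -E; exact: pf_Rintegral].
Qed.

Lemma pf_emp n (W : 'I_n.+1 -> R) : pf 1 (empR W).
Proof.
split; rewrite /empR.
- by move=> f g _ _; rewrite big_split mulrDl.
- by move=> c f _; rewrite -mulr_sumr mulrA.
- by move=> f g _ _ H; rewrite ler_wpM2r ?invr_ge0 //; exact: ler_sum.
- by rewrite sumr_const card_ord mulfV // pnatr_eq0.
Qed.

(** Inside [-A, A] the limiting test function is replaced by an interpolant made of finitely many
    bumps, with coefficients bounded by M and nodes independent of the parameter x; outside,
    everything is controlled by [tl A]. Convergence on single steps together with tightness thus
    carries over to families equicontinuous on compact sets, and to test functions that themselves
    converge locally uniformly. Compactness, continuity in time and the limit equations all use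
    it. *)
Theorem weak_unif (I X : Type) (FF : set_system I) (FFF : Filter FF) (P : X -> Prop)
  (e : I -> X -> (R -> R) -> R) (E : X -> (R -> R) -> R)
  (Di : I -> X -> R -> R) (D : X -> R -> R) (M : R) : 0 <= M ->
  (forall i x, pf 1 (e i x)) -> (forall x, pf 1 (E x)) ->
  (forall a h r : R, 0 < h -> 0 < r -> \forall i \near FF, forall x, P x ->
     `|e i x (theta a h) - E x (theta a h)| <= r) ->
  (forall r : R, 0 < r -> exists2 A : R, 0 <= A & (\forall i \near FF, forall x, P x -> e i x (tl A) <= r)
     /\ forall x, P x -> E x (tl A) <= r) ->
  (\forall i \near FF, forall x, P x -> bm (Di i x) /\ forall y, `|Di i x y| <= M) ->
  (forall x, P x -> bm (D x) /\ forall y, `|D x y| <= M) ->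
  (forall A r : R, 0 < r -> exists2 dl : R, 0 < dl &
     forall x, P x -> forall y y', `|y| <= A -> `|y'| <= A -> `|y - y'| <= dl -> `|D x y - D x y'| <= r) ->
  (forall A r : R, 0 < r -> \forall i \near FF, forall x, P x -> forall y, `|y| <= A -> `|Di i x y - D x y| <= r) ->
  forall r : R, 0 < r -> \forall i \near FF, forall x, P x -> `|e i x (Di i x) - E x (D x)| <= r.
Proof.
move=> M0 pe pE cth ctl hDi hD eqc cD r r0.
have M1 : 0 < M + 1 by rewrite ltr_wpDl.
(* Three replacements cost 3 r1 each and the comparison of the interpolants r1, in all 10 r1. *)
pose r1 := r / 16; have r10 : 0 < r1 by rewrite divr_gt0.
have [A A0 [tle tlE]] := ctl (r1 / (M + 1)) (divr_gt0 r10 M1).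
have [dl dl0 Hdl] := eqc (A + 2) r1 r10.
pose h := Num.min 1 (dl / 2).
have h0 : 0 < h by rewrite lt_min ltr01 divr_gt0.
have h1 : h <= 1 by rewrite ge_min lexx.
have h2 : 2 * h <= dl by have : h <= dl / 2 by [rewrite ge_min lexx orbT]; lra.
pose a := - A - h.
(* The bumps start one step to the left of [- A], and n of them cover [-A, A]. *)
pose n := Num.bound ((2 * A + h) / h).
have nh : 2 * A + h <= n%:R * h.
  have : (2 * A + h) / h < n%:R.
    by apply: archi_boundP; rewrite divr_ge0 ?(ltW h0) // addr_ge0 ?mulr_ge0 // ltW.
  by rewrite ltr_pdivrMr // => /ltW.
pose q x := app (D x) a h n.
have qb x y : P x -> `|q x y| <= M by move=> Px; apply: app_bound => //; exact: (hD x Px).2.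
have tail (f g : R -> R) (w : R) (y : R) : 0 <= w -> `|f y| <= M -> `|g y| <= M ->
    (`|y| <= A -> `|f y - g y| <= w) -> `|f y - g y| <= w + 2 * M * tl A y.
  move=> w0 fM gM H; have t0 := tl_ge0 A y; have [yA|yA] := leP `|y| A.
    by apply: le_trans (H yA) _; rewrite lerDl !mulr_ge0.
  have t1 := tl_out (ltW yA).
  apply: le_trans (ler_normB _ _) _; apply: (@le_trans _ _ (2 * M * 1)); first by lra.
  by apply: (@le_trans _ _ (2 * M * tl A y)); [rewrite ler_wpM2l // mulr_ge0|rewrite lerDr].
have tb (w : R) : bm (fun y => w + 2 * M * tl A y).
  by apply: bmD; [exact: bm_cst|apply: bmZ; exact: tl_bm].
have tE (F : (R -> R) -> R) (w : R) : pf 1 F -> F (tl A) <= r1 / (M + 1) ->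
    F (fun y => w + 2 * M * tl A y) <= w + 2 * r1.
  move=> pF Ft; rewrite (pfD pF) ?(pf_cst pF) ?mulr1 ?(pfZ pF) //; last 3 first.
  - exact: tl_bm.
  - exact: bm_cst.
  - by apply: bmZ; exact: tl_bm.
  rewrite lerD2l -mulrA ler_wpM2l //.
  apply: (@le_trans _ _ (M * (r1 / (M + 1)))); first by rewrite ler_wpM2l.
  rewrite mulrCA -[leRHS]mulr1 ler_wpM2l ?(ltW r10) //.
  by rewrite ler_pdivrMr // mul1r lerDl.
have Dq x y : P x -> `|y| <= A -> `|D x y - q x y| <= r1.
  move=> Px yA; move: (yA); rewrite ler_norml => /andP[yA1 yA2].
  apply: app_close => //; first exact: ltW.
    by apply/andP; split; rewrite /a; lra.
  move=> u /andP[au uy] yu; apply: Hdl => //; last exact: le_trans yu h2.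
  - by apply: le_trans yA _; lra.
  - by rewrite ler_norml; apply/andP; split; move: au; rewrite /a; lra.
(* Accuracy per bump: n bumps with coefficients up to M then cost at most r1. *)
pose c := (r1 / (M + 1)) / (n%:R + 1).
have n1 : 0 < n%:R + 1 :> R by rewrite ltr_wpDl.
have c0 : 0 < c by rewrite !divr_gt0.
have cb : \forall i \near FF, forall (j : 'I_n), forall x, P x ->
   `|e i x (bump (a + j%:R * h) h) - E x (bump (a + j%:R * h) h)| <= c.
  apply: fin_near => j.
  have H1 := cth (a + j%:R * h) h (c / 2) h0 (divr_gt0 c0 (ltr0n _ 2)).
  have H2 := cth (a + j%:R * h + h) h (c / 2) h0 (divr_gt0 c0 (ltr0n _ 2)).
  apply: filterS2 H1 H2 => i H1 H2 x Px.
  rewrite (pfB (pe i x)) ?(pfB (pE x)); try exact: theta_bm.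
  have -> (u v w z : R) : u - v - (w - z) = (u - w) - (v - z) by ring.
  by apply: le_trans (ler_normB _ _) _; have := H1 x Px; have := H2 x Px; lra.
have Q := cD A r1 r10.
near=> i => x Px.
have bDi : bm (Di i x) /\ forall y, `|Di i x y| <= M.
  by move: x Px; near: i; exact: hDi.
have [bD DM] := hD x Px.
have qm : bm (q x) by exact: app_bm.
have s1 : `|e i x (Di i x) - e i x (D x)| <= r1 + 2 * r1.
  apply: le_trans (pf_diff (pe i x) bDi.1 bD (tb r1) _) _.
    move=> y; apply: tail => //; [exact: ltW|exact: bDi.2|].
    by move: y; move: x Px {bDi bD DM qm}; near: i.
  by apply: tE => //; move: x Px {bDi bD DM qm}; near: i.
have s2 : `|e i x (D x) - e i x (q x)| <= r1 + 2 * r1.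
  apply: le_trans (pf_diff (pe i x) bD qm (tb r1) _) _.
    by move=> y; apply: tail => //; [exact: ltW|exact: qb|exact: Dq].
  by apply: tE => //; move: x Px {bDi bD DM qm s1}; near: i.
have s3 : `|E x (D x) - E x (q x)| <= r1 + 2 * r1.
  apply: le_trans (pf_diff (pE x) bD qm (tb r1) _) _.
    by move=> y; apply: tail => //; [exact: ltW|exact: qb|exact: Dq].
  by apply: tE => //; exact: tlE.
have s4 : `|e i x (q x) - E x (q x)| <= r1.
  have bb j : bm (fun y => D x (a + j%:R * h) * bump (a + j%:R * h) h y).
    by apply: bmZ; exact: bump_bm.
  rewrite /q /app (pf_sum (pe i x)) // (pf_sum (pE x)) // -sumrB.
  apply: le_trans (ler_norm_sum _ _ _) _.
  apply: (@le_trans _ _ (\sum_(j < n) M * c)).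
    apply: ler_sum => j _; rewrite (pfZ (pe i x)) ?(pfZ (pE x)); try exact: bump_bm.
    rewrite -mulrBr normrM; apply: ler_pM => //.
    by move: j; move: x Px {bDi bD DM qm s1 s2 s3 bb}; near: i; apply: filterS cb => ? H *; exact: H.
  rewrite sumr_const card_ord -[leLHS]mulr_natr /c.
  have -> : M * (r1 / (M + 1) / (n%:R + 1)) * n%:R = r1 * (M / (M + 1)) * (n%:R / (n%:R + 1)) by ring.
  have u1 : M / (M + 1) <= 1 by rewrite ler_pdivrMr // mul1r lerDl.
  have u2 : n%:R / (n%:R + 1) <= 1 :> R by rewrite ler_pdivrMr // mul1r lerDl.
  have u3 : 0 <= M / (M + 1) by rewrite divr_ge0 // ltW.
  have u4 : 0 <= n%:R / (n%:R + 1) :> R by rewrite divr_ge0 // ltW.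
  rewrite -mulrA -[leRHS]mulr1 ler_wpM2l ?(ltW r10) //.
  by rewrite mulr_ile1.
have -> : e i x (Di i x) - E x (D x) = (e i x (Di i x) - e i x (D x)) + (e i x (D x) - e i x (q x))
   + (e i x (q x) - E x (q x)) - (E x (D x) - E x (q x)) by ring.
apply: le_trans (ler_normB _ _) _.
have := ler_normD (e i x (Di i x) - e i x (D x) + (e i x (D x) - e i x (q x))) (e i x (q x) - E x (q x)).
have := ler_normD (e i x (Di i x) - e i x (D x)) (e i x (D x) - e i x (q x)).
have : r = 16 * r1 by rewrite /r1; field.
lra.
Unshelve. all: by end_near. Qed.

End RealFunctionals.

(** * Empirical measures *)

Section EmpiricalDerivative.
Variable R : realType.
Local Notation C := R[i].

(** The pair interaction after symmetrisation; its diagonal terms are 0/0, that is 0. *)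
Definition empD (n : nat) (f' : R -> R) (w : 'I_n.+1 -> R) : R :=
  (\sum_k \sum_l (f' (w k) - f' (w l)) / (w k - w l)) / n.+1%:R ^+ 2.

Lemma driving_der (n m : nat) x s (a : 'I_m -> int) t1 (W : R -> 'I_n.+1 -> R) S :
  drivingSol x s a t1 W S -> forall t k, 0 < t < t1 ->
  der (fun u => W u k) t (\sum_(l | l != k) (2 / n.+1%:R) / (W t k - W t l)
     + atomsH n a (S t) (bker (W t k))).
Proof.
move=> [_ [_ [_ [_ H]]]] t k tt; have /cderP[h _] := H t tt k.
by apply: der_eq h _; rewrite Vdrift_real.
Qed.

(** Antisymmetry of the pair force turns f' times the singular drift into difference quotients of
    f'; the distances between particles drop out of all estimates that follow from here. *)
Lemma emp_der (n m : nat) x s (a : 'I_m -> int) t1 (W : R -> 'I_n.+1 -> R) S (f f' : R -> R) :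
  drivingSol x s a t1 W S -> (forall v, der f v (f' v)) -> forall t, 0 < t < t1 ->
  der (fun u => empR (W u) f) t
    (empD f' (W t) + empR (W t) (fun v => f' v * atomsH n a (S t) (bker v))).
Proof.
move=> H df t tt.
have N0 : n.+1%:R != 0 :> R by rewrite pnatr_eq0.
have D : der (fun u => \sum_k f (W u k)) t (\sum_k f' (W t k) *
    (\sum_(l | l != k) (2 / n.+1%:R) / (W t k - W t l) + atomsH n a (S t) (bker (W t k)))).
  apply: der_sum => k _; apply: (@der_comp R f (fun u => W u k)); first exact: df.
  exact: (driving_der H).
have := derM D (derC n.+1%:R^-1 t); move=> /der_eq; apply; rewrite mulr0 addr0 /empR /empD.
have AS := @antisym_sum R n (fun k l => (W t k - W t l)^-1) (fun k => f' (W t k)).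
have {}AS : \sum_k \sum_l (f' (W t k) - f' (W t l)) / (W t k - W t l) =
    2 * \sum_k (\sum_l (W t k - W t l)^-1) * f' (W t k).
  rewrite -AS; last by move=> k l; rewrite -invrN opprB.
  by apply: eq_bigr => k _; apply: eq_bigr => l _; rewrite mulrC.
rewrite AS.
rewrite (eq_bigr (fun k => 2 / n.+1%:R * ((\sum_l (W t k - W t l)^-1) * f' (W t k)) +
   f' (W t k) * atomsH n a (S t) (bker (W t k)))); last first.
  move=> k _; rewrite mulrDr; congr (_ + _).
  rewrite [in RHS](bigD1 k) //= subrr invr0 add0r mulr_suml [in RHS]mulr_sumr mulr_sumr.
  by apply: eq_bigr => l _; ring.
rewrite big_split /= mulrDl -mulr_sumr; congr (_ + _).
by rewrite expr2; field; rewrite addrC natr1.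
Qed.

Lemma quot_le (L a b : R) : 0 <= L -> `|a| <= L * `|b| -> `|a / b| <= L.
Proof.
move=> L0 H; have [->|b0] := eqVneq b 0; first by rewrite invr0 mulr0 normr0.
by rewrite normrM normfV ler_pdivrMr // normr_gt0.
Qed.

Lemma empD_bound (n : nat) (f' : R -> R) (w : 'I_n.+1 -> R) (L : R) : 0 <= L ->
  (forall x y, `|f' x - f' y| <= L * `|x - y|) -> `|empD f' w| <= L.
Proof.
move=> L0 H; have N0 : 0 < n.+1%:R :> R by rewrite ltr0n.
rewrite /empD normrM [`|_^-1|]ger0_norm ?invr_ge0 ?exprn_ge0 // ler_pdivrMr ?exprn_gt0 //.
apply: le_trans (ler_norm_sum _ _ _) _.
apply: (@le_trans _ _ (\sum_(k < n.+1) \sum_(l < n.+1) L)).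
  apply: ler_sum => k _; apply: le_trans (ler_norm_sum _ _ _) _.
  by apply: ler_sum => l _; exact: quot_le.
by rewrite !sumr_const card_ord -[leLHS]mulr_natr -[L *+ _]mulr_natr expr2 mulrA.
Qed.

Lemma emp_bound (n : nat) (w : 'I_n.+1 -> R) (f : R -> R) (M : R) :
  (forall x, `|f x| <= M) -> `|empR w f| <= M.
Proof.
move=> H; rewrite /empR mulr_suml; apply: le_trans (ler_norm_sum _ _ _) _.
by apply: avg_le => k; rewrite normrM [`|_^-1|]ger0_norm // ler_wpM2r.
Qed.

Lemma within_sumf (I : finType) (f : I -> R -> R) (A : set R) : (forall i, {within A, continuous (f i)}) ->
  {within A, continuous (fun t => \sum_i f i t)}.
Proof.
move=> H; elim: (index_enum I) => [|i r IH].
  have -> : (fun t => \sum_(i <- [::]) f i t) = fun=> 0 by apply/funext => t; rewrite big_nil.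
  by apply: continuous_subspaceT => t; exact: cvg_cst.
have -> : (fun t => \sum_(j <- i :: r) f j t) = fun t => f i t + \sum_(j <- r) f j t.
  by apply/funext => t; rewrite big_cons.
exact: within_add.
Qed.

Lemma emp_cont (n m : nat) x s (a : 'I_m -> int) t1 (W : R -> 'I_n.+1 -> R) S (f : R -> R) :
  drivingSol x s a t1 W S -> continuous f -> {within `[0, t1], continuous (fun u => empR (W u) f)}.
Proof.
move=> [_ [_ [Wc _]]] fc; rewrite /empR.
apply: within_mul; last by apply: continuous_subspaceT => t; exact: cvg_cst.
by apply: within_sumf => k; apply: within_comp2.
Qed.

(** Both terms of the derivative are bounded without reference to N: the pair term by the Lipschitz
    constant of f', the pole term by [B * beta]. *)
Lemma emp_tlip (n m : nat) x s (a : 'I_m -> int) t1 (W : R -> 'I_n.+1 -> R) S (f f' : R -> R)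
  (L B beta : R) : 0 <= L ->
  drivingSol x s a t1 W S -> (forall v, der f v (f' v)) ->
  (forall v, `|f' v| <= B) -> (forall v w, `|f' v - f' w| <= L * `|v - w|) ->
  (forall t v, 0 < t < t1 -> `|atomsH n a (S t) (bker v)| <= beta) ->
  forall u t, 0 <= u <= t1 -> 0 <= t <= t1 ->
  `|empR (W u) f - empR (W t) f| <= (L + B * beta) * `|u - t|.
Proof.
move=> L0 H df fB fL Hb u t.
wlog ut : u t / t <= u.
  move=> W0; case: (leP t u) => [|/ltW] ut h1 h2; first exact: W0.
  by rewrite distrC (distrC u) W0.
move=> /andP[u0 u1] /andP[t0 tt1].
rewrite (ger0_norm (_ : 0 <= u - t)) ?subr_ge0 //.
have sub z : t < z < u -> 0 < z < t1.
  by move=> /andP[tz zu]; rewrite (le_lt_trans t0) // (lt_le_trans zu).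
apply: (lip_bound ut _ (fun z hz => emp_der H df (sub z hz))).
  apply: (@within_sub R 0 t1) => //; apply: emp_cont H _ => v; exact: der_cont (df v).
move=> z /sub hz; apply: le_trans (ler_normD _ _) _; apply: lerD; first exact: empD_bound.
by apply: emp_bound => v; rewrite normrM ler_pM // Hb.
Qed.

End EmpiricalDerivative.

(** * The uniform boundedness principle *)

Section UniformBoundedness.
Variable R : realType.
Local Notation C := R[i].

Lemma tele_lim (u e : nat -> R) : (forall n, `|u n.+1 - u n| <= e n - e n.+1) -> (forall n, 0 <= e n) ->
  exists l : R, forall n, `|u n - l| <= e n.
Proof.
move=> H e0.
pose a n := u n - e n; pose b n := u n + e n.
have aS n : a n <= a n.+1 by have := H n; rewrite /a ler_norml => /andP[]; lra.
have bS n : b n.+1 <= b n by have := H n; rewrite /b ler_norml => /andP[]; lra.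
have am m n : (m <= n)%N -> a m <= a n.
  by move=> /subnK <-; elim: (n - m)%N => //= k IH; rewrite addSn (le_trans IH).
have bm m n : (m <= n)%N -> b n <= b m.
  by move=> /subnK <-; elim: (n - m)%N => //= k IH; rewrite addSn (le_trans _ IH).
have ab m n : a m <= b n.
  have abn k : a k <= b k by rewrite /a /b; have := e0 k; lra.
  by case: (leqP m n) => [/am h|/ltnW /bm h]; [exact: le_trans h (abn n)|exact: le_trans (abn m) h].
have ubS : has_sup (range a).
  by split; [exists (a 0%N), 0%N|exists (b 0%N) => _ [m _ <-]].
exists (sup (range a)) => n.
have h1 : a n <= sup (range a) by apply: ub_le_sup; [case: ubS|exists n].
have h3 : sup (range a) <= b n by apply: ge_sup; [case: ubS|move=> _ [m _ <-]].
by rewrite ler_norml; move: h1 h3; rewrite /a /b => ? ?; apply/andP; split; lra.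
Qed.

Definition contC (f : C -> R) := forall z, {for z, continuous f}.

Lemma contC_lin (f g : C -> R) (c : R) : contC f -> contC g -> contC (fun z => f z + c * g z).
Proof.
move=> cf cg z.
have h1 : f x @[x --> z] --> f z := cf z.
have h2 : g x @[x --> z] --> g z := cg z.
exact: (cvgD h1 (cvgM (cvg_cst c) h2)).
Qed.

Lemma contC_cst (c : R) : contC (fun=> c).
Proof. by move=> z; apply/contCRP => e e0; exists 1 => // w _; rewrite subrr normr0 ltW. Qed.

Lemma contC_Z (f : C -> R) (c : R) : contC f -> contC (fun z => c * f z).
Proof.
move=> cf; have := @contC_lin (fun=> 0) f c (@contC_cst 0) cf.
by have -> : (fun z => 0 + c * f z) = (fun z => c * f z) by apply/funext => z; rewrite add0r.
Qed.

Variable l : nat -> (C -> R) -> R.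
Hypothesis l_lin : forall n f g (c : R), l n (fun z => f z + c * g z) = l n f + c * l n g.
Hypothesis l_bd : forall n, exists B : R, forall f (M : R), (forall z, `|f z| <= M) -> `|l n f| <= B * M.
Hypothesis l_pt : forall f (M : R), contC f -> (forall z, `|f z| <= M) ->
  exists D : R, forall n, `|l n f| <= D.

Let unit_ball n : set R := [set r | exists f : C -> R, [/\ contC f, forall z, `|f z| <= 1 & r = `|l n f|]].
Let nu n := sup (unit_ball n).

Let l0 n : l n (fun=> 0) = 0.
Proof.
have := l_lin n (fun=> 0) (fun=> 0) (-1).
have -> : (fun z : C => 0 + -1 * 0 : R) = (fun=> 0) by apply/funext => z; rewrite mulr0 addr0.
by move=> ->; rewrite mulN1r subrr.
Qed.

Let lZ n (c : R) f : l n (fun z => c * f z) = c * l n f.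
Proof.
have := l_lin n (fun=> 0) f c; rewrite l0 add0r => <-.
by congr (l n); apply/funext => z; rewrite add0r.
Qed.

Let c0 : contC (fun=> 0).
Proof. exact: contC_cst. Qed.

Let ball_sup n : has_sup (unit_ball n).
Proof.
split; first by exists `|l n (fun=> 0)|; exists (fun=> 0); split; [exact: c0|move=> z; rewrite normr0|].
by have [B HB] := l_bd n; exists B => _ [f [_ f1 ->]]; rewrite -[B]mulr1; exact: HB.
Qed.

Let nu_le n f (M : R) : contC f -> (forall z, `|f z| <= M) -> `|l n f| <= nu n * M.
Proof.
move=> cf fM; have M0 : 0 <= M := le_trans (normr_ge0 _) (fM 0).
have [M00|Mn] := eqVneq M 0.
  have -> : f = fun=> 0 by apply/funext => z; apply/eqP; rewrite -normr_le0 -M00.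
  by rewrite l0 normr0 M00 mulr0.
have Mp : 0 < M by rewrite lt_neqAle eq_sym Mn.
have -> : `|l n f| = `|l n (fun z => M^-1 * f z)| * M.
  by rewrite lZ normrM [`|M^-1|]ger0_norm ?invr_ge0 // mulrAC mulVf // mul1r.
rewrite ler_wpM2r //; apply: ub_le_sup; first by case: (ball_sup n).
exists (fun z => M^-1 * f z); split => //; first exact: contC_Z.
by move=> z; rewrite normrM [`|M^-1|]ger0_norm ?invr_ge0 // mulrC ler_pdivrMr // mul1r.
Qed.

Let nu0 n : 0 <= nu n.
Proof. by have := @nu_le n (fun=> 0) 1 c0; rewrite l0 normr0 mulr1; apply=> z; exact: ler01. Qed.

(* Gliding hump: the signs of the humps [3^-k f_k] are chosen so that no cancellation occurs. *)
Theorem unif_bound : exists K : R, forall n f (M : R), contC f -> (forall z, `|f z| <= M) ->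
  `|l n f| <= K * M.
Proof.
have [[K HK]|unb] := EM (exists K : R, forall n, nu n <= K).
  exists K => n f M cf fM; apply: le_trans (nu_le n cf fM) _.
  by rewrite ler_wpM2r //; exact: le_trans (normr_ge0 _) (fM 0).
exfalso.
(* The k-th hump has action at least 2/3 of the norm times 3^-k, and everything added later at most
   1/2 of the norm times 3^-k; by the factor 6 the remaining 1/6 exceeds k. *)
have P (k : nat) : exists q : nat * (C -> R), [/\ contC q.2, forall z, `|q.2 z| <= 1,
    6 * k%:R * 3 ^+ k < nu q.1 & 2 / 3 * nu q.1 <= `|l q.1 q.2|].
  have [n Hn] : exists n, 6 * k%:R * 3 ^+ k < nu n.
    apply: contrapT => H; apply: unb; exists (6 * k%:R * 3 ^+ k) => n.
    by rewrite leNgt; apply/negP => h; apply: H; exists n.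
  have np : 0 < nu n by apply: le_lt_trans Hn; rewrite !mulr_ge0 ?exprn_ge0.
  have [_ [f [cf f1 ->]] Hf] := sup_adherent (divr_gt0 np (ltr0n _ 3)) (ball_sup n).
  exists (n, f); split => //=; apply: le_trans (ltW Hf); rewrite -/(nu n); lra.
have [q Hq] := choice P.
pose h k z : R := (3 ^+ k)^-1 * (q k).2 z.
(* The actions on G + h and on G - h differ by twice the action on h, so one of the two signs gives
   at least the action on h alone. *)
pose stp (k : nat) (g : C -> R) : C -> R := fun z =>
  g z + (if `|l (q k).1 (h k)| <= `|l (q k).1 (fun z => g z + 1 * h k z)| then 1 else -1) * h k z.
pose G := fix G (k : nat) : C -> R := if k is k'.+1 then stp k' (G k') else fun=> 0.
have p3 k : 0 < (3 ^+ k)^-1 :> R by rewrite invr_gt0 exprn_gt0.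
have hc k : contC (h k) by apply: contC_Z; have [] := Hq k.
have h1 k z : `|h k z| <= (3 ^+ k)^-1.
  rewrite normrM ger0_norm ?(ltW (p3 k)) // -[leRHS]mulr1 ler_wpM2l ?(ltW (p3 k)) //.
  by have [_ c _ _] := Hq k; exact: c.
have Gc k : contC (G k).
  elim: k => [|k IH] /=; first exact: c0.
  exact: contC_lin.
have Gd k z : `|G k.+1 z - G k z| <= (3 ^+ k)^-1.
  rewrite /= /stp addrAC subrr add0r normrM.
  by case: ifP => _; rewrite ?normrN normr1 mul1r.
have lG k : `|l (q k).1 (h k)| <= `|l (q k).1 (G k.+1)|.
  rewrite /= /stp; case: ifP => // /negbT; rewrite -ltNge !l_lin mul1r mulN1r.
  set x := l _ (G k); set y := l _ (h k) => xy.
  have := ler_normB (x + y) (x - y).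
  have -> : x + y - (x - y) = 2 * y by ring.
  by rewrite normrM ger0_norm //; lra.
pose e (k : nat) : R := 3 / 2 * (3 ^+ k)^-1.
have eS k : e k - e k.+1 = (3 ^+ k)^-1.
  by rewrite /e exprS; field; rewrite expf_neq0.
have [g Hg] : exists g : C -> R, forall z k, `|G k z - g z| <= e k.
  have Q z : exists r : R, forall k, `|G k z - r| <= e k.
    by apply: tele_lim => k; [rewrite eS; exact: Gd|rewrite mulr_ge0 // ltW].
  by have [g Hg] := choice Q; exists g.
have e_small (r : R) : 0 < r -> exists k, e k <= r.
  move=> r0.
  have : (fun k => 3 / 2 * 3^-1 ^+ k) @ \oo --> (3 / 2 * 0 : R).
    by apply: cvgMr; apply: cvg_expr; rewrite ger0_norm ?invr_ge0 // invf_lt1 // ltr1n.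
  rewrite mulr0 => /cvgrPdist_le/(_ _ r0) H.
  have [k Hk] := filter_ex H.
  by exists k; apply: le_trans Hk; rewrite sub0r normrN exprVn; exact: ler_norm.
have gc : contC g.
  move=> z; apply/contCRP => r r0.
  have [k Hk] := e_small (r / 3) (divr_gt0 r0 (ltr0n _ 3)).
  have [|d d0 Hd] := (contCRP (G k) z).1 (Gc k z) (r / 3); first by rewrite divr_gt0.
  exists d => // w wz.
  have -> : g w - g z = (G k w - G k z) - (G k w - g w) + (G k z - g z) by ring.
  apply: le_trans (ler_normD _ _) _; have := ler_normB (G k w - G k z) (G k w - g w).
  by have := Hd w wz; have := Hg w k; have := Hg z k; lra.
have gb z : `|g z| <= 3 / 2.
  by have := Hg z 0%N; rewrite /= sub0r normrN /e expr0 invr1 mulr1.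
have [D HD] := l_pt gc gb.
pose k := Num.bound `|D|.
have Dk : D < k%:R by apply: le_lt_trans (ler_norm D) _; exact: archi_boundP.
have [_ _ n1 n2] := Hq k.
have a1 : (3 ^+ k)^-1 * (2 / 3 * nu (q k).1) <= `|l (q k).1 (G k.+1)|.
  apply: le_trans (lG k); rewrite lZ normrM ger0_norm ?(ltW (p3 k)) //.
  by rewrite ler_wpM2l ?(ltW (p3 k)).
have a2 : `|l (q k).1 (fun z => G k.+1 z + -1 * g z)| <= nu (q k).1 * e k.+1.
  apply: nu_le; first exact: contC_lin.
  by move=> z; rewrite mulN1r; exact: Hg.
move: a2; rewrite l_lin mulN1r => a2.
have a3 := HD (q k).1.
have a4 : k%:R < (3 ^+ k)^-1 * nu (q k).1 / 6.
  by rewrite ltr_pdivlMr // [ltRHS]mulrC ltr_pdivlMr ?exprn_gt0 // [k%:R * 6]mulrC.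
have e1 : nu (q k).1 * e k.+1 = (3 ^+ k)^-1 * nu (q k).1 / 2.
  by rewrite /e exprS; field; rewrite expf_neq0.
have := ler_norm (l (q k).1 (G k.+1)).
have := ler_normD (l (q k).1 (G k.+1) - l (q k).1 g) (l (q k).1 g).
rewrite subrK; move: a2; rewrite e1; lra.
Qed.

End UniformBoundedness.

(** * Compactness of measure-valued paths *)

Section FunctionalMeasure.
Variables (R : realType) (Phi : (R -> R) -> R).
Hypothesis pPhi : pf 1 Phi.
Hypothesis tPhi : forall r : R, 0 < r -> exists2 A : R, 0 <= A & Phi (tl A) <= r.

Let ind (x v : R) : R := if v <= x then 1 else 0.

Let indE x : ind x = \1_(`]-oo, x]).
Proof.
by apply/funext => v; rewrite /ind indicE /=; case: ifPn => h; [rewrite mem_set|rewrite memNset] => //=;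
  rewrite in_itv //=; apply/negP.
Qed.

Let ind_bm x : bm (ind x).
Proof.
split; first by rewrite indE; exact: measurable_indic.
by exists 1 => v; rewrite /ind; case: ifP => _; rewrite ?normr1 ?normr0.
Qed.

Let F0 x := Phi (ind x).
(** Without sigma-additivity the distribution function [F0] need not be right-continuous. Its right
    limit F is, and the two interlace: [F0 x <= F x <= F0 y] for x < y. *)
Let F x := inf [set F0 y | y in [set y | x < y]].

Let F0_mono : {homo F0 : x y / x <= y}.
Proof.
move=> x y xy; apply: (pf_le pPhi) => // v; rewrite /ind.
by case: ifP => [vx|_]; [rewrite (le_trans vx xy)|case: ifP].
Qed.

Let F0_ge0 x : 0 <= F0 x.
Proof.
rewrite -[leLHS](mul0r 1) -(pf_cst pPhi 0); apply: (pf_le pPhi) => //; first exact: bm_cst.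
by move=> v; rewrite /ind; case: ifP.
Qed.

Let F0_le1 x : F0 x <= 1.
Proof.
rewrite -[leRHS](mul1r 1) -(pf_cst pPhi 1); apply: (pf_le pPhi) => //; first exact: bm_cst.
by move=> v; rewrite /ind; case: ifP.
Qed.

Let F_inf x : has_inf [set F0 y | y in [set y | x < y]].
Proof.
split; first by exists (F0 (x + 1)), (x + 1) => //=; rewrite ltrDl.
by exists 0 => _ [y _ <-].
Qed.

Let F0F x : F0 x <= F x.
Proof. by apply: lb_le_inf; [case: (F_inf x)|move=> _ [y /= xy <-]; exact/F0_mono/ltW]. Qed.

Let FF0 x y : x < y -> F x <= F0 y.
Proof. by move=> xy; apply: ge_inf; [case: (F_inf x)|exists y]. Qed.

Let F_nd : nondecreasing F.
Proof.
move=> x y xy; apply: lb_le_inf; first by case: (F_inf y).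
by move=> _ [z /= yz <-]; apply: FF0; exact: le_lt_trans yz.
Qed.

Let F_rc : right_continuous F.
Proof.
move=> x; apply/cvgrPdist_le => e e0.
have [_ [y /= xy <-] Hy] := inf_adherent e0 (F_inf x).
near=> z.
have xz : x < z by near: z; exact: nbhs_right_gt.
have zy : z < y by near: z; exact: nbhs_right_lt.
have h1 : F x <= F z by apply: F_nd; exact: ltW.
have h2 : F z <= F0 y by exact: FF0.
by move: Hy; rewrite -/(F x) ler_norml => ?; apply/andP; split; lra.
Unshelve. all: by end_near. Qed.

#[local] HB.instance Definition _ := isCumulative.Build R _ R F F_nd F_rc.

Let F_le1 x : F x <= 1.
Proof. by apply: le_trans (F0_le1 (x + 1)); apply: FF0; rewrite ltrDl. Qed.

Let F_Ny : F @ -oo --> (0 : R).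
Proof.
apply/cvgrPdist_le => e e0; have [A A0 HA] := tPhi e0.
near=> x.
have xA : x + 1 <= - A by rewrite -lerBrDr; near: x; apply: nbhs_ninfty_le; exact: num_real.
rewrite sub0r normrN ger0_norm; last exact: le_trans (F0_ge0 x) (F0F x).
have x1 : x < x + 1 by rewrite ltrDl.
apply: (le_trans (FF0 x1)); apply: (le_trans _ HA); apply: (pf_le pPhi _ (tl_bm A)) => // v.
rewrite /ind; case: ifP => [vx|_]; last exact: tl_ge0.
by apply: tl_out; rewrite ler_normr; apply/orP; right; lra.
Unshelve. all: by end_near. Qed.

Let F_y : F @ +oo --> (1 : R).
Proof.
apply/cvgrPdist_le => e e0; have [A A0 HA] := tPhi e0.
near=> x.
have xA : A <= x by near: x; apply: nbhs_pinfty_ge; exact: num_real.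
rewrite ger0_norm ?subr_ge0 ?F_le1 //.
have : 1 - F0 x <= Phi (tl A).
  have E1 : Phi (fun v => 1 - ind x v) = 1 - F0 x.
    by rewrite (pfB pPhi) // ?(pf_cst pPhi) ?mulr1 //; exact: bm_cst.
  rewrite -E1; apply: (pf_le pPhi); [by apply: bmB => //; exact: bm_cst|exact: tl_bm|].
  move=> v; rewrite /ind; case: ifPn => [_|]; first by rewrite subrr tl_ge0.
  by rewrite -ltNge subr0 => xv; apply: tl_out; rewrite ler_normr; apply/orP; left; lra.
by have := F0F x; lra.
Unshelve. all: by end_near. Qed.

#[local] HB.instance Definition _ := isCumulativeBounded.Build R 0 1 F F_Ny F_y.

(** Taking the distribution of the identity transports the Lebesgue-Stieltjes measure from
    [measurableTypeR R] to a probability on [R]. *)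
Let idTR : measurableTypeR R -> R := idfun.

#[local] HB.instance Definition _ :=
  @isMeasurableFun.Build _ _ _ _ idTR (@measurable_id _ _ setT).

Let lsf := lebesgue_stieltjes_measure F.

Let mu : probability R R := distribution lsf (idTR : {RV lsf >-> R}).

Let E : (R -> R) -> R := Rintegral mu setT.

Let pE : pf 1 E. Proof. exact: pf_prob. Qed.

Let E_ind x : E (ind x) = F x.
Proof.
rewrite /E /Rintegral indE integral_indic // setIT.
exact: (congr1 fine (cdf_lebesgue_stieltjes_id F x)).
Qed.

Let count (M : nat) (z : R) : 0 <= z <= M%:R ->
  z <= \sum_(i < M) (if z <= i%:R then 0 else 1) <= z + 1.
Proof.
elim: M => [|M IH] /andP[z0 zM].
  by rewrite big_ord0 zM; apply: addr_ge0.
rewrite big_ord_recr /=; case: (leP z M%:R) => h; first by rewrite addr0 IH // z0.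
have -> : \sum_(i < M) (if z <= i%:R then 0 else 1) = M%:R :> R.
  rewrite (eq_bigr (fun=> 1)); first by rewrite sumr_const card_ord.
  by move=> i _; rewrite leNgt (le_lt_trans _ h) // ler_nat ltnW.
by rewrite natr1 zM -natr1 lerD2r ltW.
Qed.

Section Level.
Variables (a h : R).
Hypothesis h0 : 0 < h.

Let lev (s : R) : 0 <= s < 1 -> exists x, forall v, (theta a h v <= s) = (v <= x).
Proof.
move=> /andP[s0 s1].
pose S := [set v | theta a h v <= s].
have sS : has_sup S.
  split; first by exists a; rewrite /S /= theta_0.
  exists (a + h) => v; rewrite /S /= => vs; rewrite leNgt; apply/negP => /ltW/(theta_1 h0) E1.
  by move: vs; rewrite E1 leNgt s1.
exists (sup S) => v; apply/idP/idP => [vs|vx].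
  by apply: ub_le_sup => //; case: sS.
apply/ler_addgt0Pr => e e0.
have e1 : 0 < e / (6 / h) by rewrite !divr_gt0.
have [u us ue] := sup_adherent e1 sS.
have [vu|uv] := leP v u.
  by apply: le_trans (theta_mono a h0 vu) _; apply: le_trans us _; rewrite lerDl ltW.
have := theta_lip a v u h0; rewrite (ger0_norm (_ : 0 <= v - u)) ?subr_ge0 ?(ltW uv) //.
have : 6 / h * (v - u) <= e.
  by rewrite mulrC -ler_pdivlMr ?divr_gt0 //; lra.
have := ler_norm (theta a h v - theta a h u); move: us; rewrite /S /=; lra.
Qed.

(** Layer-cake formula with M levels: each set where the step is at most i/M is a half-line, since
    the step is monotone and continuous. The thresholds move along with the step, so one family x
    serves for all shifts eta. *)
Let approx (M : nat) : (0 < M)%N -> exists x : 'I_M -> R, forall eta v,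
  theta (a + eta) h v <= M%:R^-1 * \sum_(i < M) (1 - ind (x i + eta) v) <= theta (a + eta) h v + M%:R^-1.
Proof.
move=> M0; have Mp : 0 < M%:R :> R by rewrite ltr0n.
have P (i : 'I_M) : exists x, forall v, (theta a h v <= i%:R / M%:R) = (v <= x).
  by apply: lev; rewrite divr_ge0 //= ltr_pdivrMr // mul1r ltr_nat.
have [x Hx] := choice P; exists x => eta v.
have -> : theta (a + eta) h v = theta a h (v - eta) by rewrite /theta; congr (step (_ / _)); ring.
have /andP[t0 t1] := theta_01 a h (v - eta).
have z01 : 0 <= theta a h (v - eta) * M%:R <= M%:R.
  by rewrite mulr_ge0 ?(ltW Mp) //= -[leRHS]mul1r ler_wpM2r // ltW.
have := count z01.
have -> : \sum_(i < M) (if theta a h (v - eta) * M%:R <= i%:R then 0 else 1) =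
    \sum_(i < M) (1 - ind (x i + eta) v).
  apply: eq_bigr => i _; rewrite -ler_pdivlMr // Hx /ind lerBlDr.
  by case: ifP => _; rewrite ?subrr ?subr0.
move=> /andP[c1 c2]; apply/andP; split.
  by rewrite mulrC ler_pdivlMr.
by rewrite mulrC ler_pdivrMr // mulrDl mulVf ?gt_eqF.
Qed.

Let level_sum (Psi : (R -> R) -> R) (M : nat) (x : 'I_M -> R) : pf 1 Psi ->
  Psi (fun v => M%:R^-1 * \sum_(i < M) (1 - ind (x i) v)) = M%:R^-1 * \sum_(i < M) (1 - Psi (ind (x i))).
Proof.
move=> pPsi.
have b i : bm (fun v => 1 - ind (x i) v) by apply: bmB => //; exact: bm_cst.
rewrite (pfZ pPsi) ?(pf_sum pPsi) //; last exact: bm_sum.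
congr (_ * _); apply: eq_bigr => i _; rewrite (pfB pPsi) //; last exact: bm_cst.
by rewrite (pf_cst pPsi) mulr1.
Qed.

Let ls_bm (M : nat) (x : 'I_M -> R) : bm (fun v => M%:R^-1 * \sum_(i < M) (1 - ind (x i) v)).
Proof. by apply: bmZ; apply: bm_sum => i; apply: bmB => //; exact: bm_cst. Qed.

(** Both functionals are evaluated on layer-cake sums of half-lines, where [F0] and F interlace. One
    inequality is immediate; for the other the step is shifted by eta in order to compare [F x] with
    [F0 (x + eta)], at a cost proportional to eta by its Lipschitz bound. *)
Lemma functional_theta : E (theta a h) = Phi (theta a h).
Proof.
apply/eqP; rewrite eq_le; apply/andP; split.
  apply/ler_addgt0Pr => e e0.
  pose M := (Num.bound e^-1).+1.
  have Me : M%:R^-1 <= e.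
    rewrite -[leRHS]invrK lef_pV2 ?posrE ?invr_gt0 ?ltr0n //.
    apply/ltW/(lt_le_trans (archi_boundP _)); first by rewrite invr_ge0 ltW.
    by rewrite ler_nat.
  have [x Hx] := @approx M isT.
  have H v := Hx 0 v; rewrite addr0 in H.
  have u1 : E (theta a h) <= E (fun v => M%:R^-1 * \sum_(i < M) (1 - ind (x i + 0) v)).
    apply: (pf_le pE); [exact: theta_bm|exact: ls_bm|].
    by move=> v; have /andP[] := H v.
  have u2 : Phi (fun v => M%:R^-1 * \sum_(i < M) (1 - ind (x i + 0) v)) <= Phi (theta a h) + M%:R^-1.
    have -> : Phi (theta a h) + M%:R^-1 = Phi (fun v => theta a h v + M%:R^-1).
      by rewrite (pfD pPhi) ?(pf_cst pPhi) ?mulr1 //; [exact: theta_bm|exact: bm_cst].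
    apply: (pf_le pPhi); [exact: ls_bm|apply: bmD; [exact: theta_bm|exact: bm_cst]|].
    by move=> v; have /andP[] := H v.
  rewrite (level_sum _ pE) in u1; rewrite (level_sum _ pPhi) in u2.
  have u3 : M%:R^-1 * \sum_(i < M) (1 - E (ind (x i + 0))) <= M%:R^-1 * \sum_(i < M) (1 - Phi (ind (x i + 0))).
    by rewrite ler_wpM2l // ler_sum // => i _; rewrite E_ind lerD2l lerN2; exact: F0F.
  lra.
apply/ler_addgt0Pr => e e0.
pose eta := e / 2 / (6 / h).
have eta0 : 0 < eta by rewrite !divr_gt0.
pose M := (Num.bound (e / 2)^-1).+1.
have Me : M%:R^-1 <= e / 2.
  rewrite -[leRHS]invrK lef_pV2 ?posrE ?invr_gt0 ?ltr0n ?divr_gt0 //.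
  apply/ltW/(lt_le_trans (archi_boundP _)); first by rewrite invr_ge0 ltW // divr_gt0.
  by rewrite ler_nat.
have [x Hx] := @approx M isT.
have s1 : Phi (theta a h) <= Phi (theta (a + eta) h) + e / 2.
  have -> : Phi (theta (a + eta) h) + e / 2 = Phi (fun v => theta (a + eta) h v + e / 2).
    by rewrite (pfD pPhi) ?(pf_cst pPhi) ?mulr1 //; [exact: theta_bm|exact: bm_cst].
  apply: (pf_le pPhi); [exact: theta_bm|apply: bmD; [exact: theta_bm|exact: bm_cst]|].
  move=> v.
  have -> : theta (a + eta) h v = theta a h (v - eta) by rewrite /theta; congr (step (_ / _)); ring.
  have := theta_lip a v (v - eta) h0; have -> : v - (v - eta) = eta by ring.
  rewrite (ger0_norm (ltW eta0)); have -> : 6 / h * eta = e / 2 by rewrite /eta; field; rewrite gt_eqF.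
  by have := ler_norm (theta a h v - theta a h (v - eta)); lra.
have s2 : Phi (theta (a + eta) h) <= Phi (fun v => M%:R^-1 * \sum_(i < M) (1 - ind (x i + eta) v)).
  apply: (pf_le pPhi); [exact: theta_bm|exact: ls_bm|].
  by move=> v; have /andP[] := Hx eta v.
have s3 : E (fun v => M%:R^-1 * \sum_(i < M) (1 - ind (x i + 0) v)) <= E (theta a h) + M%:R^-1.
  have -> : E (theta a h) + M%:R^-1 = E (fun v => theta a h v + M%:R^-1).
    by rewrite (pfD pE) ?(pf_cst pE) ?mulr1 //; [exact: theta_bm|exact: bm_cst].
  apply: (pf_le pE); [exact: ls_bm|apply: bmD; [exact: theta_bm|exact: bm_cst]|].
  by move=> v; have /andP[_] := Hx 0 v; rewrite addr0.
rewrite (level_sum _ pE) in s3; rewrite (level_sum _ pPhi) in s2.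
have s4 : M%:R^-1 * \sum_(i < M) (1 - Phi (ind (x i + eta))) <= M%:R^-1 * \sum_(i < M) (1 - E (ind (x i + 0))).
  rewrite ler_wpM2l // ler_sum // => i _; rewrite E_ind lerD2l lerN2 addr0.
  by apply: FF0; rewrite ltrDl.
lra.
Qed.

End Level.

Theorem functional_measure : exists nu : probability R R,
  forall a h : R, 0 < h -> Rintegral nu setT (theta a h) = Phi (theta a h).
Proof. by exists mu => a h h0; exact: functional_theta. Qed.

End FunctionalMeasure.

(** * Extraction of a convergent subsequence of paths *)

Section PathCompactness.
Variable R : realType.

(** One ultrafilter assigns limits to all bounded sequences at once, hence to the averages of all
    bounded functions at all times, with no countable dense family and no diagonal extraction. *)
Lemma ultra_lim (U : set_system nat) (UU : UltraFilter U) (u : nat -> R) (M : R) :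
  (forall n, `|u n| <= M) -> exists l : R, u @ U --> l.
Proof.
move=> uM.
have PF : ProperFilter (u @ U) by exact: fmap_proper_filter.
have FA : (u @ U) `[- M, M]%classic.
  by apply: (@filterS _ U _ setT) => [n _|]; [rewrite /= in_itv /= -ler_norml|exact: filterT].
have [p [_ cp]] := @segment_compact R (- M) M (u @ U) PF FA.
exists p; apply/cvgrPdist_le => e e0.
have [//|Hc] := in_ultra_setVsetC [set n | `|p - u n| <= e] UU.
exfalso.
have [|y [/= y1 y2]] := cp [set y | ~ (`|p - y| <= e)] (ball p e) Hc; first exact: nbhsx_ballx.
by apply: y1; apply: ltW.
Qed.

Variables (V : forall n, R -> 'I_n.+1 -> R) (T : R).
Arguments V : clear implicits.
Hypothesis T0 : 0 <= T.
Hypothesis V_lip : forall a h : R, 0 < h -> exists2 L : R, 0 <= L & forall n u t, 0 <= u <= T -> 0 <= t <= T ->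
  `|empR (V n u) (theta a h) - empR (V n t) (theta a h)| <= L * `|u - t|.
Hypothesis V_tail : forall r : R, 0 < r -> exists2 A : R, 0 <= A & forall n t, 0 <= t <= T ->
  empR (V n t) (tl A) <= r.

Let limex (U : set_system nat) (UU : UltraFilter U) : exists L : R -> (R -> R) -> R, forall t f (M : R),
  (forall x, `|f x| <= M) -> (fun n => empR (V n t) f) @ U --> L t f.
Proof.
have P (q : R * (R -> R)) : exists l : R, forall M : R, (forall x, `|q.2 x| <= M) ->
    (fun n => empR (V n q.1) q.2) @ U --> l.
  have [[M HM]|nM] := EM (exists M : R, forall x, `|q.2 x| <= M); last first.
    by exists 0 => M HM; exfalso; apply: nM; exists M.
  have [l Hl] := @ultra_lim U UU (fun n => empR (V n q.1) q.2) M (fun n => emp_bound _ HM).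
  by exists l => _ _.
have [L HL] := choice P.
by exists (fun t f => L (t, f)) => t f M; exact: HL (t, f) M.
Qed.

(** Convergence on a finite grid of times of mesh [dl], completed by the common Lipschitz constant
    in time: three errors of r/3. *)
Let theta_lim_unif (I : Type) (FF : set_system I) (FFF : Filter FF) (e : I -> R -> (R -> R) -> R)
  (L : R -> (R -> R) -> R) (a h K : R) : 0 <= K ->
  (forall i u t, 0 <= u <= T -> 0 <= t <= T -> `|e i u (theta a h) - e i t (theta a h)| <= K * `|u - t|) ->
  (forall u t, 0 <= u <= T -> 0 <= t <= T -> `|L u (theta a h) - L t (theta a h)| <= K * `|u - t|) ->
  (forall t, (fun i => e i t (theta a h)) @ FF --> L t (theta a h)) ->
  forall r : R, 0 < r -> \forall i \near FF, forall t, 0 <= t <= T ->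
     `|e i t (theta a h) - L t (theta a h)| <= r.
Proof.
move=> K0 eK LK cv r r0.
have K1 : 0 < K + 1 by rewrite ltr_wpDl.
pose dl := r / 3 / (K + 1); have dl0 : 0 < dl by rewrite !divr_gt0.
pose m := Num.bound (T / dl).
have mT : T < m%:R * dl.
  by rewrite -ltr_pdivrMr //; apply: archi_boundP; rewrite divr_ge0 // ltW.
pose tj (j : 'I_m.+1) := clampT T (j%:R * dl).
have H : \forall i \near FF, forall j : 'I_m.+1, `|e i (tj j) (theta a h) - L (tj j) (theta a h)| <= r / 3.
  apply: fin_near => j.
  have /cvgrPdist_le/(_ (r / 3) (divr_gt0 r0 (ltr0n _ 3))) := cv (tj j).
  by apply: filterS => i; rewrite distrC.
apply: filterS H => i Hi t tT.
have tT' := tT; move/andP: tT' => [t0 t1].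
have td0 : 0 <= t / dl by rewrite divr_ge0 // ltW.
pose k := Num.truncn (t / dl).
have /andP[k1 k2] : k%:R <= t / dl < k.+1%:R by apply: truncn_itv.
have km : (k < m.+1)%N.
  rewrite ltnS -(@ler_nat R); apply: le_trans k1 _.
  by rewrite ler_pdivrMr //; apply: le_trans t1 (ltW mT).
have kt : k%:R * dl <= t by rewrite -ler_pdivlMr.
have tk : t <= k%:R * dl + dl by move: k2; rewrite ltr_pdivrMr // -natr1 mulrDl mul1r => /ltW.
have tjE : tj (Ordinal km) = k%:R * dl.
  by rewrite /tj clampT_id //= mulr_ge0 ?(ltW dl0) //= (le_trans kt).
have h1 := Hi (Ordinal km).
have tjT : 0 <= tj (Ordinal km) <= T by exact: clampT_in.
have h2 := eK i t _ tT tjT; have h3 := LK t _ tT tjT.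
have dist : `|t - tj (Ordinal km)| <= dl.
  by rewrite tjE ger0_norm ?subr_ge0 //; lra.
have hh : K * `|t - tj (Ordinal km)| <= r / 3.
  apply: (@le_trans _ _ ((K + 1) * dl)); last by rewrite /dl mulrC divfK // gt_eqF.
  by apply: ler_pM => //; rewrite lerDl.
have -> : e i t (theta a h) - L t (theta a h) =
  (e i t (theta a h) - e i (tj (Ordinal km)) (theta a h)) + (e i (tj (Ordinal km)) (theta a h) - L (tj (Ordinal km)) (theta a h))
  - (L t (theta a h) - L (tj (Ordinal km)) (theta a h)) by ring.
apply: le_trans (ler_normB _ _) _.
have := ler_normD (e i t (theta a h) - e i (tj (Ordinal km)) (theta a h)) (e i (tj (Ordinal km)) (theta a h) - L (tj (Ordinal km)) (theta a h)).
lra.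
Qed.

(** The limits along one ultrafilter containing the tails of nat are represented by probabilities
    that agree with them on the steps. There the convergence is uniform in time, and [weak_unif],
    with the pairs (t, f) as parameters, extends it to all of [BL1]. A subsequence follows because
    each set of the ultrafilter meets every tail. *)
Theorem MT_compact : exists (nk : nat -> nat) (mu : R -> probability R R),
  strictly_incr nk /\ MT_conv T nk V mu.
Proof.
have [U [UU oU]] := ultraFilterLemma (F := \oo) _.
have PU : ProperFilter U by exact: ultra_proper.
have FU : Filter U by exact: (@filter_filter _ U PU).
have [L HL] := limex UU.
have eqlim (u v : nat -> R) (x y : R) : u @ U --> x -> v @ U --> y -> u = v -> x = y.
  by move=> ux vy uv; rewrite uv in ux; exact: (cvg_unique _ ux vy).
have lelim (u : nat -> R) (x y : R) : u @ U --> x -> (\forall n \near U, u n <= y) -> x <= y.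
  move=> /cvgrPdist_le ux H; apply/ler_addgt0Pr => e e0.
  have [n [n1 n2]] := filter_ex (filterI (ux e e0) H).
  by have := ler_norm (x - u n); lra.
have pL t : pf 1 (L t).
  split.
  - move=> f g [_ [M HM]] [_ [M' HM']].
    have bd x : `|f x + g x| <= M + M' by apply: le_trans (ler_normD _ _) _; exact: lerD.
    apply: (eqlim _ _ _ _ (HL t _ _ bd) (cvgD (HL t _ _ HM) (HL t _ _ HM'))).
    by apply/funext => n; rewrite /= /empR big_split mulrDl.
  - move=> c f [_ [M HM]].
    have bd x : `|c * f x| <= `|c| * M by rewrite normrM ler_wpM2l.
    apply: (eqlim _ _ _ _ (HL t _ _ bd) (cvgM (cvg_cst c) (HL t _ _ HM))).
    by apply/funext => n; rewrite /= /empR -mulr_sumr mulrA.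
  - move=> f g [_ [M HM]] [_ [M' HM']] fg; rewrite -subr_ge0 -oppr_le0 opprB.
    apply: (lelim _ _ _ (cvgB (HL t _ _ HM) (HL t _ _ HM'))); apply: nearW => n.
    rewrite subr_le0 /empR ler_wpM2r ?invr_ge0 //; exact: ler_sum.
  - have bd (x : R) : `|1| <= 1 :> R by rewrite normr1.
    apply: (eqlim _ (fun=> 1) _ _ (HL t (fun=> 1) _ bd) (cvg_cst _)).
    by apply/funext => n; rewrite /empR sumr_const card_ord mulfV // pnatr_eq0.
have tl2 A (x : R) : `|tl A x| <= 2.
  by rewrite ger0_norm ?tl_ge0 //; have /andP[? ?] := theta_01 (- A) 1 x; have /andP[? ?] := theta_01 (A - 1) 1 x; rewrite /tl; lra.
have th1 a h (x : R) : `|theta a h x| <= 1 by have /andP[? ?] := theta_01 a h x; rewrite ger0_norm.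
have tL t : 0 <= t <= T -> forall r : R, 0 < r -> exists2 A : R, 0 <= A & L t (tl A) <= r.
  move=> tT r r0; have [A A0 HA] := V_tail r0; exists A => //.
  by apply: (lelim _ _ _ (HL t _ _ (tl2 A))); apply: nearW => n; exact: HA.
(* Tightness is known on [0, T], so time is clamped to obtain a measure for each real t. *)
have mex t : exists nu : probability R R, forall a h : R, 0 < h ->
    Rintegral nu setT (theta a h) = L (clampT T t) (theta a h).
  by apply: functional_measure; [exact: pL|exact: tL (clampT_in t T0)].
have [mu Hmu] := choice mex.
pose E t := Rintegral (mu t) setT.
have pE t : pf 1 (E t) by exact: pf_prob.
have Eth t a h : 0 <= t <= T -> 0 < h -> E t (theta a h) = L t (theta a h).
  by move=> tT h0; rewrite /E Hmu // clampT_id.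
have Ltl A : tl A = (fun v => (1 - theta (- A) 1 v) + theta (A - 1) 1 v) by [].
have Etl t A : 0 <= t <= T -> E t (tl A) = L t (tl A).
  have D F : pf 1 F -> F (tl A) = (1 - F (theta (- A) 1)) + F (theta (A - 1) 1).
    move=> pF; rewrite Ltl (pfD pF) ?(pfB pF) ?(pf_cst pF) ?mulr1 //; try exact: theta_bm; try exact: bm_cst.
    by apply: bmB; [exact: bm_cst|exact: theta_bm].
  by move=> tT; rewrite (D _ (pE t)) (D _ (pL t)) !Eth.
have LK a h : 0 < h -> exists2 K : R, 0 <= K & (forall n u t, 0 <= u <= T -> 0 <= t <= T ->
     `|empR (V n u) (theta a h) - empR (V n t) (theta a h)| <= K * `|u - t|) /\
     (forall u t, 0 <= u <= T -> 0 <= t <= T -> `|L u (theta a h) - L t (theta a h)| <= K * `|u - t|).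
  move=> h0; have [K K0 HK] := V_lip a h0; exists K => //; split => // u t uT tT.
  apply: (lelim (fun n => `|empR (V n u) (theta a h) - empR (V n t) (theta a h)|)).
    by apply: cvg_norm; exact: cvgB (HL u _ _ (th1 a h)) (HL t _ _ (th1 a h)).
  by apply: nearW => n; exact: HK.
have cvU a h r : 0 < h -> 0 < r -> \forall n \near U, forall t, 0 <= t <= T ->
   `|empR (V n t) (theta a h) - E t (theta a h)| <= r.
  move=> h0 r0; have [K K0 [HK1 HK2]] := LK a h h0.
  have := @theta_lim_unif nat U FU (fun n t => empR (V n t)) L a h K K0 HK1 HK2
    (fun t => HL t _ _ (th1 a h)) r r0.
  by apply: filterS => n H t tT; rewrite Eth //; exact: H.
have tails r : 0 < r -> exists2 A : R, 0 <= A & (forall n t, 0 <= t <= T -> empR (V n t) (tl A) <= r) /\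
    forall t, 0 <= t <= T -> E t (tl A) <= r.
  move=> r0; have [A A0 HA] := V_tail r0; exists A => //; split => // t tT.
  rewrite Etl //; apply: (lelim _ _ _ (HL t _ _ (tl2 A))); apply: nearW => n; exact: HA.
have BLU : forall r : R, 0 < r -> \forall n \near U, forall q : R * (R -> R), 0 <= q.1 <= T /\ BL1 q.2 ->
    `|empR (V n q.1) q.2 - E q.1 q.2| <= r.
  apply: (@weak_unif R nat (R * (R -> R))%type U FU (fun q => 0 <= q.1 <= T /\ BL1 q.2)
    (fun n q => empR (V n q.1)) (fun q => E q.1) (fun _ q => q.2) (fun q => q.2) 1 ler01).
  - by move=> n q; exact: pf_emp.
  - by move=> q; exact: pE.
  - move=> a h r h0 r0; apply: filterS (cvU a h r h0 r0) => n H q [qT _]; exact: H.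
  - move=> r r0; have [A A0 [H1 H2]] := tails r r0; exists A => //; split.
      by apply: nearW => n q [qT _]; exact: H1.
    by move=> q [qT _]; exact: H2.
  - apply: nearW => n q [_ [b1 b2]]; split => //.
    by apply: (bm_lip (L := 1) (M := 1)) => // x y; rewrite mul1r.
  - move=> q [_ [b1 b2]]; split => //.
    by apply: (bm_lip (L := 1) (M := 1)) => // x y; rewrite mul1r.
  - move=> A r r0; exists r => // q [_ [b1 b2]] y y' _ _; exact: le_trans (b2 y y').
  - by move=> A r r0; apply: nearW => n q _ y _; rewrite subrr normr0 ltW.
have nkex (p : nat * nat) : exists n, (p.2 < n)%N /\ forall t f, 0 <= t <= T -> BL1 f ->
    `|empR (V n t) f - E t f| <= p.1.+1%:R^-1.
  have i0 : 0 < p.1.+1%:R^-1 :> R by rewrite invr_gt0 ltr0n.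
  have c1 : U [set n | (p.2 < n)%N] by apply: oU; exact: nbhs_infty_gt.
  have [n [n1 n2]] := filter_ex (filterI c1 (BLU _ i0)).
  by exists n; split => // t f tT bf; exact: n2 (t, f) (conj tT bf).
have [nx Hnx] := choice nkex.
pose nk := fix nk (k : nat) : nat := if k is k'.+1 then nx (k, nk k') else nx (0%N, 0%N).
have nkS k : (nk k < nk k.+1)%N by exact: (Hnx (k.+1, nk k)).1.
have nkP k t f : 0 <= t <= T -> BL1 f -> `|empR (V (nk k) t) f - E t f| <= k.+1%:R^-1.
  by case: k => [|k]; [exact: (Hnx (0%N, 0%N)).2|exact: (Hnx (k.+1, nk k)).2].
exists nk, mu; split; [|split].
- move=> a b; elim: b => // b IH; rewrite ltnS leq_eqVlt => /orP[/eqP->|/IH h]; first exact: nkS.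
  exact: ltn_trans h (nkS b).
- move=> f [[M HM] fc].
  apply/within_contP => t tT.
  have M0 : 0 <= M := le_trans (normr_ge0 _) (HM 0).
  have FW : Filter (within `[0, T]%classic (nbhs (t : R))) by exact: within_filter.
  have inW (P : R -> Prop) : (forall s, 0 <= s <= T -> P s) -> \forall s \near within `[0, T]%classic (nbhs (t : R)), P s.
    by move=> H; exists 1 => //= s _; rewrite in_itv /=; exact: H.
  have bf : bm f by exact: bm_cont HM.
  (* Weak continuity of the limit path is the same convergence result, with times tending to t in
     place of indices tending to infinity. *)
  have W := @weak_unif R R unit (within `[0, T]%classic (nbhs (t : R))) FW (fun _ => True)
    (fun s _ => E s) (fun _ => E t) (fun _ _ => f) (fun _ => f) M M0.
  move=> e e0.
  have : \forall s \near within `[0, T]%classic (nbhs (t : R)), forall x : unit, True -> `|E s f - E t f| <= e.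
    apply: W => //.
    + move=> a h r h0 r0; have [K K0 [_ HK]] := LK a h h0.
      have K1 : 0 < K + 1 by rewrite ltr_wpDl.
      exists (r / (K + 1)); first by rewrite /= divr_gt0.
      move=> s; rewrite /ball_ /= => st; rewrite in_itv /= => sT _ _; rewrite !Eth //.
      apply: le_trans (HK s t sT tT) _; move: st; rewrite ltr_pdivlMr // distrC mulrDr mulr1.
      by have := normr_ge0 (s - t); lra.
    + move=> r r0; have [A A0 [_ H2]] := tails r r0; exists A => //; split.
        by apply: inW => s sT _ _; exact: H2.
      by move=> _ _; exact: H2.
    + by apply: nearW.
    + move=> A r r0.
      have fu : {within `[- A, A], continuous f} by exact: continuous_subspaceT.
      have [dl dl0 Hd] : exists2 dl : R, 0 < dl & forall y y' : R, `|y| <= A -> `|y'| <= A ->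
         `|y - y'| <= dl -> `|f y - f y'| <= r.
        have /compact_near_coveringP cc := @segment_compact R (- A) A.
        have := cc R (0^'+) (fun dl y => forall y', `|y - y'| <= dl -> `|f y - f y'| <= r).
        have near0 : forall y, `[- A, A]%classic y -> \forall y' \near y & dl \near (0:R)^'+,
            forall z, `|y' - z| <= dl -> `|f y' - f z| <= r.
          move=> y _; have /cvgrPdist_le/(_ (r / 2) (divr_gt0 r0 (ltr0n _ 2))) [d /= d0 Hd] := fc y.
          exists (ball y (d / 2), [set dl | dl < d / 2]) => /=.
            split; first by apply: nbhsx_ballx; rewrite divr_gt0.
            by apply: nbhs_right_lt; rewrite divr_gt0.
          move=> [y' dl] /= [yy' dld] z zd.
          have h1 : `|f y - f y'| <= r / 2.
            by apply: Hd; rewrite /ball_ /=; apply: lt_le_trans yy' _; lra.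
          have h2 : `|f y - f z| <= r / 2.
            apply: Hd; rewrite /ball_ /=.
            have := ler_normD (y - y') (y' - z); rewrite addrA subrK.
            by move: yy'; rewrite /ball /=; lra.
          have -> : f y' - f z = (f y - f z) - (f y - f y') by ring.
          by apply: le_trans (ler_normB _ _) _; lra.
        move=> /(_ _ near0) H.
        near (0:R)^'+ => dl; exists dl; first by near: dl; exact: nbhs_right_gt.
        move=> y y' yA _ yy'.
        have Hdl : `[- A, A]%classic `<=` (fun y => forall y', `|y - y'| <= dl -> `|f y - f y'| <= r).
          by near: dl; exact: H.
        by apply: Hdl => //=; rewrite in_itv /= -ler_norml.
      by exists dl => // _ _.
    + by move=> A r r0; apply: nearW => s _ _ y _; rewrite subrr normr0 ltW.
  move=> [d /= d0 Hd]; exists d => // s sT st.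
  by apply: (Hd s _ _ tt) => //=; rewrite ?in_itv //= /ball_ /= distrC.
move=> e e0.
near=> k => t tT f bf.
apply: le_trans (nkP k t f tT bf) _.
near: k; have := @cvg_harmonic R => /cvgrPdist_le/(_ _ e0); apply: filterS => k.
by rewrite sub0r normrN /harmonic /= => h; apply: le_trans h; exact: ler_norm.
Unshelve. all: by end_near. Qed.

End PathCompactness.

(** * Signed measures on the half-plane *)

Section NullSets.
Context (R : realType) d (T : measurableType d) (mu : {measure set T -> \bar R}).
Import HBNNSimple.

(* No measurability is needed: the integral of a nonnegative function is a
   supremum over simple functions, which may be cut off on a null set. *)
Lemma ge0_le_integral_null (N : set T) (f g : T -> \bar R) : measurable N -> mu N = 0%E ->
  (forall x, 0 <= f x)%E -> (forall x, 0 <= g x)%E -> (forall x, ~ N x -> f x = g x) ->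
  (\int[mu]_x f x <= \int[mu]_x g x)%E.
Proof.
move=> mN N0 f0 g0 fg; rewrite !ge0_integralTE //.
apply: ge_ereal_sup => _ /= [h hf <-].
pose h' := proj_nnsfun h (measurableC mN).
have -> : sintegral mu h = sintegral mu h'.
  have E (k : {nnsfun T >-> R}) : sintegral mu k = (\int[mu]_x (k x)%:E)%E.
    by rewrite integral_nnsfun // patch_setT.
  rewrite !E; apply: ae_eq_integral => //.
  - by apply/measurable_EFinP; exact: measurable_funP.
  - by apply/measurable_EFinP; exact: measurable_funP.
  exists N; split => // x /= H; apply: contrapT => Nx; apply: H => _.
  by rewrite /h' /= mindicE mem_set // mulr1.
apply: ereal_sup_ubound; exists h' => //= x.
rewrite /= mindicE; case: (boolP (x \in ~` N)) => [/set_mem xN|_]; last by rewrite mulr0.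
by rewrite mulr1 -fg.
Qed.

Lemma integral_null (N : set T) (f g : T -> \bar R) : measurable N -> mu N = 0%E ->
  (forall x, ~ N x -> f x = g x) -> (\int[mu]_x f x = \int[mu]_x g x)%E.
Proof.
move=> mN N0 fg; rewrite integralE [RHS]integralE.
have gf x : ~ N x -> g x = f x by move=> /fg.
congr (_ - _)%E; apply/eqP; rewrite eq_le; apply/andP; split;
  apply: (ge0_le_integral_null mN N0) => // x Nx.
- by rewrite !funeposE fg.
- by rewrite !funeposE fg.
- by rewrite !funenegE fg.
- by rewrite !funenegE fg.
Qed.

(** Test functions are regular on the half-plane only, and their values elsewhere may destroy
    measurability; they can be modified on a null set all the same. *)
Lemma Rintegral_null (N : set T) (f g : T -> R) : measurable N -> mu N = 0%E ->
  (forall x, ~ N x -> f x = g x) -> Rintegral mu setT f = Rintegral mu setT g.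
Proof.
move=> mN N0 fg; rewrite /Rintegral; congr fine.
by apply: (integral_null mN N0) => x Nx; rewrite fg.
Qed.

End NullSets.

(** * Measures on the plane and their images *)

Section Plane.
Variable R : realType.
Local Notation C := R[i].
Local Notation R2 := (R * R)%type.

Definition open2 : set (set R2) := [set U | forall p, U p -> exists2 d : R, 0 < d &
  forall q, `|q.1 - p.1| < d -> `|q.2 - p.2| < d -> U q].

Lemma open2_measurable (U : set R2) : open2 U -> measurable U.
Proof.
move=> oU.
pose eps (k : nat) : R := k.+1%:R^-1.
pose box (q : rat * rat * nat) : set R2 :=
  [set p | ratr q.1.1 - eps q.2 < p.1 < ratr q.1.1 + eps q.2 /\
           ratr q.1.2 - eps q.2 < p.2 < ratr q.1.2 + eps q.2].
pose F q := if `[< box q `<=` U >] then box q else set0.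
have -> : U = \bigcup_q F q.
  rewrite eqEsubset; split => [p Up|p [q _]]; last by rewrite /F; case: asboolP => // bU bp; exact: bU.
  have [d d0 Hd] := oU p Up.
  pose k := Num.bound (2 / d).
  have k0 : 0 < eps k by rewrite /eps invr_gt0 ltr0n.
  have kd : 2 * eps k < d.
    have : 2 / d < k.+1%:R.
      by apply: lt_trans (archi_boundP _) _; rewrite ?divr_ge0 ?(ltW d0) // ltr_nat.
    by rewrite /eps ltr_pdivrMr // ltr_pdivrMr ?ltr0n // mulrC.
  have near_rat (x : R) : exists q : rat, `|x - ratr q| < eps k.
    have xy : x - eps k < x + eps k by lra.
    have [q] := rat_in_itvoo xy; rewrite in_itv /= => /andP[q1 q2]; exists q.
    by rewrite ltr_norml; apply/andP; split; lra.
  have [q1 Hq1] := near_rat p.1; have [q2 Hq2] := near_rat p.2.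
  exists (q1, q2, k) => //; rewrite /F; case: asboolP => [_|nb].
    by move: Hq1 Hq2; rewrite !ltr_norml => /andP[? ?] /andP[? ?]; split; apply/andP; split => /=; lra.
  exfalso; apply: nb => r [/= /andP[? ?] /andP[? ?]].
  by apply: Hd; move: Hq1 Hq2; rewrite !ltr_norml => /andP[? ?] /andP[? ?]; apply/andP; split; lra.
apply: countable_bigcupT_measurable; first exact: countableP.
move=> q; rewrite /F; case: asboolP => // _.
have -> : box q = `](ratr q.1.1 - eps q.2), (ratr q.1.1 + eps q.2)[%classic `*`
   `](ratr q.1.2 - eps q.2), (ratr q.1.2 + eps q.2)[%classic.
  by apply/seteqP; split => p /=; rewrite !in_itv.
exact: measurableX.
Qed.

Lemma open2_setI : setI_closed open2.
Proof.
move=> U V oU oV p [Up Vp].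
have [d d0 Hd] := oU p Up; have [e e0 He] := oV p Vp.
exists (Num.min d e); first by rewrite lt_min d0.
by move=> q; rewrite !lt_min => /andP[? ?] /andP[? ?]; split; [exact: Hd|exact: He].
Qed.

(** Open sets are stable under intersection, so they form a generating pi-system on which equality
    of finite measures can be tested. *)
Lemma measurable_open2E : @measurable _ R2 = <<s open2 >>.
Proof.
rewrite eqEsubset; split; last first.
  apply: smallest_sub; [exact: sigma_algebra_measurable|exact: open2_measurable].
apply: smallest_sub; first exact: smallest_sigma_algebra.
pose T2 := g_sigma_algebraType open2.
have op (f : R2 -> R) : (forall p q : R2, `|f q - f p| <= `|q.1 - p.1| + `|q.2 - p.2|) ->
    measurable_fun (setT : set T2) (f : T2 -> R).
  move=> Hf; apply: (measurability _ (RGenOInfty.measurableE R)).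
  move=> _ [_ [x ->] <-]; rewrite setTI; apply: sub_sigma_algebra => p /=.
  rewrite in_itv /= andbT => xp; exists ((f p - x) / 2); first by rewrite divr_gt0 // subr_gt0.
  move=> q q1 q2; rewrite in_itv /= andbT.
  have := Hf p q; rewrite ler_norml => /andP[? ?]; lra.
rewrite subUset; split => _ [A mA <-].
  have := op fst; apply => //.
  by move=> p q; rewrite lerDl.
have := op snd; apply => //.
by move=> p q; rewrite lerDr.
Qed.

Lemma ofpair_nc (p q : R2) : nc (ofpair q - ofpair p) <= `|q.1 - p.1| + `|q.2 - p.2|.
Proof. by apply: le_trans (nc_le _) _; rewrite ReB ImB. Qed.

Lemma contC_measurable (f : C -> R) : contC f -> measurable_fun setT (f \o @ofpair R).
Proof.
move=> fc; apply: (measurability _ (RGenOInfty.measurableE R)).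
move=> _ [_ [x ->] <-]; rewrite setTI; apply: open2_measurable => p /=.
rewrite in_itv /= andbT => xp.
have [|d d0 Hd] := (contCRP f (ofpair p)).1 (fc _) ((f (ofpair p) - x) / 2).
  by rewrite divr_gt0 // subr_gt0.
exists (d / 2); first by rewrite divr_gt0.
move=> q q1 q2; rewrite in_itv /= andbT.
have h : nc (ofpair q - ofpair p) < d by apply: le_lt_trans (ofpair_nc p q) _; lra.
by have := Hd _ h; rewrite ler_norml => /andP[? ?]; lra.
Qed.

Lemma contC_bm (f : C -> R) (M : R) : contC f -> (forall z, `|f z| <= M) -> bm (f \o @ofpair R).
Proof. by move=> fc H; split; [exact: contC_measurable|exists M => p; exact: H]. Qed.

Definition pairof (z : C) : R2 := (ReC z, ImC z).
Lemma pairofK z : ofpair (pairof z) = z. Proof. by case: z. Qed.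

Definition contCC (Psi : C -> C) := forall z, {for z, continuous Psi}.

Lemma contCC_Re (Psi : C -> C) : contCC Psi -> contC (fun z => ReC (Psi z)).
Proof.
move=> H z; apply/contCRP => e e0; have [d d0 Hd] := (contCCP Psi z).1 (H z) e e0.
by exists d => // w /Hd; rewrite -ReB; apply: le_trans (Re_le_nc _).
Qed.
Lemma contCC_Im (Psi : C -> C) : contCC Psi -> contC (fun z => ImC (Psi z)).
Proof.
move=> H z; apply/contCRP => e e0; have [d d0 Hd] := (contCCP Psi z).1 (H z) e e0.
by exists d => // w /Hd; rewrite -ImB; apply: le_trans (Im_le_nc _).
Qed.

Section Push.
Variable Psi : C -> C.
Hypothesis Pc : contCC Psi.

Definition pmap (p : R2) : R2 := pairof (Psi (ofpair p)).

Lemma pmap_measurable : measurable_fun setT pmap.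
Proof.
apply: measurable_fun_pair.
  exact: (contC_measurable (contCC_Re Pc)).
exact: (contC_measurable (contCC_Im Pc)).
Qed.

Variable m : {finite_measure set R2 -> \bar R}.

Lemma pre_measurable (A : set R2) : measurable A -> measurable (pmap @^-1` A).
Proof. by move=> mA; rewrite -[X in measurable X]setTI; exact: pmap_measurable. Qed.

Definition fpush : set R2 -> \bar R := fun A => m (pmap @^-1` A).

Let fpush0 : fpush set0 = 0%E. Proof. by rewrite /fpush preimage_set0 measure0. Qed.
Let fpush_ge0 A : (0 <= fpush A)%E. Proof. exact: measure_ge0. Qed.
Let fpush_sigma : semi_sigma_additive fpush.
Proof.
move=> F mF tF mUF; rewrite /fpush preimage_bigcup.
apply: measure_semi_sigma_additive.
- by move=> n; exact: pre_measurable.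
- apply/trivIsetP => /= i j _ _ ij; rewrite -preimage_setI.
  by move/trivIsetP : tF => /(_ _ _ _ _ ij) ->//; rewrite preimage_set0.
- by rewrite -preimage_bigcup; exact: pre_measurable.
Qed.
HB.instance Definition _ := isMeasure.Build _ _ _ fpush fpush0 fpush_ge0 fpush_sigma.
Let fpush_fin : fin_num_fun fpush.
Proof. by move=> A mA; apply: fin_num_measure; exact: pre_measurable. Qed.
HB.instance Definition _ := Measure_isFinite.Build _ _ _ fpush fpush_fin.

Definition push : {finite_measure set R2 -> \bar R} := fpush.

Lemma push_integral (f : R2 -> R) : bm f -> Rintegral push setT f = Rintegral m setT (f \o pmap).
Proof.
move=> [mf [M HM]]; rewrite /Rintegral; congr fine.
have mf' : measurable_fun [set: R2] (EFin \o f) by apply/measurable_EFinP.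
have If : m.-integrable (pmap @^-1` setT) ((EFin \o f) \o pmap).
  rewrite preimage_setT; apply: (@bm_integrable R _ R2 m (f \o pmap)); split; last by exists M => p; exact: HM.
  by apply: (measurableT_comp mf); exact: pmap_measurable.
have := integral_pushforward pmap_measurable mf' If measurableT.
rewrite preimage_setT => <-.
by apply: eq_measure_integral => [|mp A mA _]; first exact: pmap_measurable.
Qed.

(** [f] is controlled only through the map [r], which fixes the values of [Psi]. The set moved by
    [r] is null for the image measure, which allows [f] to be replaced by the measurable
    [f \o r]. *)
Lemma push_integral_gen (f : C -> R) (r : C -> C) (M : R) :
  contC (f \o r) -> contCC r -> (forall z, `|f (r z)| <= M) -> (forall z, r (Psi z) = Psi z) ->
  Rintegral push setT (f \o @ofpair R) = Rintegral m setT (f \o Psi \o @ofpair R).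
Proof.
move=> fc rc fM rP.
pose N : set R2 := [set p | r (ofpair p) <> ofpair p].
have mN : measurable N.
  have -> : N = (fun p : R2 => nc (r (ofpair p) - ofpair p)) @^-1` `]0, +oo[%classic.
    apply/seteqP; split => p; rewrite /N /= in_itv /= andbT nc_gt0 subr_eq0; first by move=> /eqP.
    by move=> /eqP.
  have h : contC (fun z => nc (r z - z)).
    move=> z; apply/contCRP => e e0.
    have [|d d0 Hd] := (contCCP r z).1 (rc z) (e / 2); first by rewrite divr_gt0.
    exists (Num.min d (e / 2)); first by rewrite lt_min d0 divr_gt0.
    move=> w; rewrite lt_min => /andP[w1 w2].
    have a1 := ncD (r w - r z - (w - z)) (r z - z).
    have a2 := ncD (- (r w - r z - (w - z))) (r w - w).
    have e1 : r w - r z - (w - z) + (r z - z) = r w - w by ring.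
    have e2 : - (r w - r z - (w - z)) + (r w - w) = r z - z by ring.
    rewrite e1 in a1; rewrite e2 ncN in a2.
    have a3 := ncB (r w - r z) (w - z); have := Hd w w1.
    by rewrite ler_norml => ?; apply/andP; split; lra.
  have := contC_measurable h; move=> /(_ measurableT _ (measurable_itv `]0, +oo[%R)).
  by rewrite setTI.
have N0 : push N = 0%E.
  rewrite /push /= /fpush; have -> : pmap @^-1` N = set0; last exact: measure0.
  by apply/seteqP; split => // p; rewrite /N /= /pmap pairofK rP.
have E := @Rintegral_null R _ R2 push N (f \o @ofpair R) ((f \o r) \o @ofpair R) mN N0.
rewrite E; last by move=> p /contrapT /= ->.
rewrite push_integral; last exact: contC_bm fc fM.
by congr Rintegral; apply/funext => p; rewrite /= /pmap pairofK rP.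
Qed.

End Push.
End Plane.

(** * The limit measure is carried by K *)

Section SigmaSupport.
Variable R : realType.
Local Notation C := R[i].
Local Notation R2 := (R * R)%type.
Variables (sg : smeasH R) (K : set C) (at_ : nat -> (C -> R) -> R).
Hypothesis cK : compact K.
Hypothesis sgH : supported_in_H sg.
Hypothesis at0 : forall n f, (forall z, K z -> f z = 0) -> at_ n f = 0.
Hypothesis at_cv : forall f, bcontH f -> (fun n => at_ n f) @ \oo --> sintR sg f.

Let W : set R2 := [set p | 0 < p.2 /\ ~ K (ofpair p)].

Let W_open : open2 W.
Proof.
move=> p [p0 pK].
have clK : closed K by apply: compact_closed => //; exact: norm_hausdorff.
have /nbhsCP[d d0 Hd] : nbhs (ofpair p) (~` K).
  by apply: open_nbhs_nbhs; split => //; rewrite openC.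
exists (Num.min (d / 2) p.2); first by rewrite lt_min divr_gt0.
move=> q; rewrite !lt_min => /andP[q1 _] /andP[q2 q3]; split.
  by move: q3; rewrite ltr_norml => /andP[]; lra.
by apply: Hd; apply: le_lt_trans (ofpair_nc p q) _; lra.
Qed.

Let W_meas : measurable W. Proof. exact: open2_measurable. Qed.

Section OpenSet.
Variable O : set R2.
Hypothesis O_open : open2 O.
Hypothesis OW : O `<=` W.

Let vals (z : C) : set R := [set nc (z - w) | w in [set w | ~ O (pairof w)]].
Let dO z := inf (vals z).

Let vals_inf z : has_inf (vals z).
Proof.
split; last by exists 0 => _ [w _ <-]; exact: nc_ge0.
by exists (nc (z - 0)), 0 => // /OW [] /=; rewrite ltxx.
Qed.

Let dO_ge0 z : 0 <= dO z.
Proof. by apply: lb_le_inf; [case: (vals_inf z)|move=> _ [w _ <-]; exact: nc_ge0]. Qed.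

Let dO_le z w : ~ O (pairof w) -> dO z <= nc (z - w).
Proof. by move=> Ow; apply: ge_inf; [case: (vals_inf z)|exists w]. Qed.

Let dO_lip z z' : dO z <= dO z' + nc (z - z').
Proof.
rewrite -lerBlDr; apply: lb_le_inf; first by case: (vals_inf z').
move=> _ [w Ow <-]; rewrite lerBlDr; apply: le_trans (dO_le z Ow) _.
by rewrite [leRHS]addrC; exact: nc_tri.
Qed.

Let dO_pos z : O (pairof z) -> 0 < dO z.
Proof.
move=> Oz; have [d d0 Hd] := O_open Oz.
apply: (lt_le_trans d0); apply: lb_le_inf; first by case: (vals_inf z).
move=> _ [w /= Ow <-]; rewrite leNgt; apply/negP => h; apply: Ow; apply: Hd.
  by rewrite /= -ReB; apply: le_lt_trans (Re_le_nc _) _; rewrite ncBC.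
by rewrite /= -ImB; apply: le_lt_trans (Im_le_nc _) _; rewrite ncBC.
Qed.

Let dO_out z : ~ O (pairof z) -> dO z = 0.
Proof. by move=> Oz; apply/eqP; rewrite eq_le dO_ge0 andbT -(nc0 R) -(subrr z) dO_le. Qed.

Let f (n : nat) z : R := Num.min 1 (n%:R * dO z).

Let f01 n z : 0 <= f n z <= 1.
Proof. by rewrite le_min ler01 mulr_ge0 //= ge_min lexx. Qed.

Let f_cont n : contC (f n).
Proof.
move=> z; apply/contCRP => e e0.
have n1 : 0 < n%:R + 1 :> R by rewrite ltr_wpDl.
exists (e / (n%:R + 1)); first by rewrite divr_gt0.
move=> w; rewrite ltr_pdivlMr // => h.
have h1 : `|f n w - f n z| <= `|n%:R * dO w - n%:R * dO z|.
  rewrite /f; set a := n%:R * dO w; set b := n%:R * dO z.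
  have := ler_norm (a - b); have := ler_norm (b - a); rewrite (distrC b a) => ? ?.
  by rewrite ler_norml /Num.min; case: ltP => ?; case: ltP => ?; apply/andP; split; lra.
apply: le_trans h1 _; rewrite -mulrBr normrM ger0_norm //.
have h2 : `|dO w - dO z| <= nc (w - z).
  by have := dO_lip w z; have := dO_lip z w; rewrite (ncBC z w) ler_norml => ? ?; apply/andP; split; lra.
apply: (@le_trans _ _ (n%:R * nc (w - z))); first by rewrite ler_wpM2l.
by move: h; rewrite mulrDr mulr1 mulrC; have := nc_ge0 (w - z); lra.
Qed.

Let f_bm n : bm (f n \o @ofpair R).
Proof. by apply: (contC_bm (M := 1)) => // z; have /andP[? ?] := f01 n z; rewrite ger0_norm. Qed.

Let f_bcontH n : bcontH (f n).
Proof.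
split; last by move=> z _; exact: f_cont.
by exists 1 => z _; have /andP[? ?] := f01 n z; rewrite ger0_norm.
Qed.

Let f_eq n : Rintegral (smp sg) setT (f n \o @ofpair R) = Rintegral (smn sg) setT (f n \o @ofpair R).
Proof.
apply/eqP; rewrite -subr_eq0; apply/eqP.
have H := at_cv (f_bcontH n).
have E : (fun k => at_ k (f n)) = fun=> 0.
  apply/funext => k; apply: at0 => z Kz; rewrite /f dO_out ?mulr0; last first.
    by move=> /OW [_]; rewrite pairofK.
  by apply/min_idPr; exact: ler01.
rewrite E in H; exact: (cvg_unique _ H (cvg_cst 0)).
Qed.

Let f_lim (m : {finite_measure set R2 -> \bar R}) :
  (fun n => \int[m]_p (f n (ofpair p))%:E)%E @ \oo --> m O.
Proof.
have := @cvg_monotone_convergence _ R2 R m setT measurableT (fun n p => (f n (ofpair p))%:E).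
have mf n : measurable_fun [set: R2] (fun p => (f n (ofpair p))%:E).
  by apply/measurable_EFinP; case: (f_bm n).
move=> /(_ mf) H.
have {}H := H _ _.
have h1 n (p : R2) : [set: R2] p -> (0 <= (f n (ofpair p))%:E)%E.
  by move=> _; rewrite lee_fin; have /andP[] := f01 n (ofpair p).
have h2 (p : R2) : [set: R2] p -> nondecreasing_seq (fun n => (f n (ofpair p))%:E).
  move=> _ a b ab; rewrite lee_fin /f le_min ge_min lexx /= ge_min ler_wpM2r ?orbT // ler_nat //.
have {}H := H h1 h2.
have E : (\int[m]_p limn (fun n => (f n (ofpair p))%:E) = m O)%E.
  rewrite -[in RHS](setIT O) -integral_indic //; last exact: open2_measurable.
  apply: eq_integral => p _; apply/cvg_lim => //.
  rewrite indicE; have [Op|Op] := EM (O p).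
    rewrite mem_set //=; apply/cvg_EFin; first by apply: nearW.
    have dp : 0 < dO (ofpair p) by apply: dO_pos; case: p Op.
    apply/cvgrPdist_le => e e0; near=> n; rewrite /=.
    have -> : f n (ofpair p) = 1; last by rewrite subrr normr0 ltW.
    apply/min_idPl.
    rewrite -ler_pdivrMr // mul1r.
    by near: n; exact: nbhs_infty_ger.
  rewrite memNset //=; apply: cvg_near_cst; apply: nearW => n.
  by rewrite /f dO_out ?mulr0 ?(min_idPr ler01) //; case: p Op.
by rewrite E in H.
Unshelve. all: by end_near. Qed.

(** The functions min(1, n d), with d the distance to the complement of O, vanish on K, so the limit
    of the actions on them is 0 and both measures integrate them equally. They increase to the
    indicator of O. *)
Lemma open_eq : smp sg O = smn sg O.
Proof.
have h1 := @f_lim (smp sg); have h2 := @f_lim (smn sg).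
have E : (fun n => \int[smp sg]_p (f n (ofpair p))%:E)%E = (fun n => \int[smn sg]_p (f n (ofpair p))%:E)%E.
  apply/funext => n.
  have F (m : {finite_measure set R2 -> \bar R}) : (\int[m]_p (f n (ofpair p))%:E \is a fin_num)%E.
    by apply: integrable_fin_num => //; exact: (bm_integrable m (f_bm n)).
  rewrite -(fineK (F (smp sg))) -(fineK (F (smn sg))).
  by congr EFin; exact: f_eq n.
rewrite E in h1.
by rewrite -(cvg_lim _ h1) // -(cvg_lim _ h2).
Qed.
End OpenSet.

Let W_eq A : measurable A -> A `<=` W -> smp sg A = smn sg A.
Proof.
move=> mA AW.
have o1 (i : nat) : open2 ([set: R2]) by move=> p _; exists 1.
have o2 : \bigcup_(k in [set: nat]) [set: R2] = setT by apply/seteqP; split => // x _; exists 0%N.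
have H := @measure_unique _ R R2 (@open2 R) (fun=> setT) (measurable_open2E R) (@open2_setI R) o1 o2
  (mrestr (smp sg) W_meas) (mrestr (smn sg) W_meas).
have {}H : mrestr (smp sg) W_meas A = mrestr (smn sg) W_meas A.
  apply: H => // [B oB|k].
    rewrite /mrestr; apply: open_eq; first exact: open2_setI.
    by move=> p [].
  have : smp sg ([set: R2] `&` W) \is a fin_num by apply: fin_num_measure; exact: measurableI.
  by rewrite ge0_fin_numE.
by move: H; rewrite /mrestr setIidl.
Qed.

(* Both parts of a decomposition of sigma may charge the complement of K, but there they coincide. *)
Theorem sigma_ext (F1 F2 : R2 -> R) : bm F1 -> bm F2 ->
  (forall p, K (ofpair p) -> F1 p = F2 p) ->
  Rintegral (smp sg) setT F1 - Rintegral (smn sg) setT F1 =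
  Rintegral (smp sg) setT F2 - Rintegral (smn sg) setT F2.
Proof.
move=> b1 b2 E.
pose F p := F1 p - F2 p.
have bF : bm F by exact: bmB.
have bFW : bm (F \_ W).
  have -> : F \_ W = fun p => \1_W p * F p.
    by apply/funext => p; rewrite patchE indicE; case: ifP => _; rewrite ?mul1r ?mul0r.
  apply: bmM => //; split; first exact: measurable_indic.
  by exists 1 => p; rewrite indicE; case: (_ \in _); rewrite ?normr1 ?normr0.
pose N : set R2 := [set p | p.2 <= 0].
have mN : measurable N.
  have -> : N = ~` [set p : R2 | 0 < p.2].
    by rewrite /N; apply/seteqP; split => p /=; rewrite leNgt => /negP.
  apply: measurableC; apply: open2_measurable => p /= p0; exists p.2 => // q _ h.
  by move: h; rewrite ltr_norml => /andP[]; lra.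
(* The lower closed half-plane is null and the difference vanishes on K; what remains is the part of
   the half-plane off K, where the two measures agree. *)
have key (m : {finite_measure set R2 -> \bar R}) : m N = 0%E ->
    Rintegral m setT F = Rintegral m W F.
  move=> m0; rewrite [RHS]Rintegral_mkcond; apply: (Rintegral_null mN m0) => p Np.
  rewrite patchE; case: ifPn => // /negP pW.
  have Kp : K (ofpair p).
    apply: contrapT => nK; apply: pW; rewrite inE; split => //.
    by rewrite ltNge; apply/negP.
  by rewrite /F E // subrr.
have := key _ sgH.1; have := key _ sgH.2.
have -> : Rintegral (smn sg) W F = Rintegral (smp sg) W F.
  rewrite /Rintegral; congr fine; apply: eq_measure_integral => A mA AW.
  exact: (esym (W_eq mA AW)).
move=> <-; rewrite (pfB (pf_Rintegral _)) // (pfB (pf_Rintegral _)) //; lra.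
Qed.

End SigmaSupport.

(** * Complex test functions *)

Section ComplexFunctionals.
Context (R : realType) d (T : measurableType d).
Local Notation C := R[i].

Definition bmC (f : T -> C) : Prop := bm (fun x => ReC (f x)) /\ bm (fun x => ImC (f x)).

Lemma bm_ext (f g : T -> R) : f =1 g -> bm f -> bm g.
Proof. by move=> /funext ->. Qed.

Lemma bmC_cst (c : C) : bmC (fun=> c). Proof. by split; exact: bm_cst. Qed.
Lemma bmC_B (f g : T -> C) : bmC f -> bmC g -> bmC (fun x => f x - g x).
Proof.
move=> [a b] [c e]; split; first by apply: bm_ext (bmB a c) => x; rewrite ReB.
by apply: bm_ext (bmB b e) => x; rewrite ImB.
Qed.
Lemma bmC_M (f g : T -> C) : bmC f -> bmC g -> bmC (fun x => f x * g x).
Proof.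
move=> [a b] [c e]; split; first by apply: bm_ext (bmB (bmM a c) (bmM b e)) => x; rewrite ReM.
by apply: bm_ext (bmD (bmM a e) (bmM b c)) => x; rewrite ImM.
Qed.

Definition cE (E : (T -> R) -> R) (f : T -> C) : C :=
  Complex (E (fun x => ReC (f x))) (E (fun x => ImC (f x))).

Variables (m : R) (E : (T -> R) -> R).
Hypothesis pE : pf m E.

Lemma cE_D f g : bmC f -> bmC g -> cE E (fun x => f x + g x) = cE E f + cE E g.
Proof.
move=> [a b] [c e]; apply: complexP; rewrite ?ReD ?ImD /= ?(pfD pE) //.
  by rewrite -(pfD pE) //; congr E; apply/funext => x; rewrite ReD.
by rewrite -(pfD pE) //; congr E; apply/funext => x; rewrite ImD.
Qed.
Lemma cE_B f g : bmC f -> bmC g -> cE E (fun x => f x - g x) = cE E f - cE E g.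
Proof.
move=> [a b] [c e]; apply: complexP; rewrite ?ReB ?ImB /=.
  by rewrite -(pfB pE) //; congr E; apply/funext => x; rewrite ReB.
by rewrite -(pfB pE) //; congr E; apply/funext => x; rewrite ImB.
Qed.
Lemma cE_Z (c : C) f : bmC f -> cE E (fun x => c * f x) = c * cE E f.
Proof.
move=> [a b]; apply: complexP; rewrite ?ReM ?ImM /=.
  rewrite -!(pfZ pE) // -(pfB pE) //; try exact: bmZ.
  by congr E; apply/funext => x; rewrite ReM.
rewrite -!(pfZ pE) // -(pfD pE) //; try exact: bmZ.
by congr E; apply/funext => x; rewrite ImM.
Qed.

(** Multiplication by the conjugate of the mean w of f makes the mean equal to |w|^2, to which
    positivity applies. Estimating the two coordinates separately would enlarge the constant. *)
Lemma nc_cE f (M : R) : 0 <= M -> bmC f -> (forall x, nc (f x) <= M) -> nc (cE E f) <= M * m.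
Proof.
move=> M0 bf hf; set w := cE E f.
have [w0|w0] := eqVneq w 0; first by rewrite w0 nc0 mulr_ge0 // (pf_mass_ge0 pE).
have nw : 0 < nc w by rewrite nc_gt0.
have e1 : nc w ^+ 2 = E (fun x => ReC (cconj w * f x)).
  have -> : E (fun x => ReC (cconj w * f x)) = ReC (cE E (fun x => cconj w * f x)) by [].
  rewrite cE_Z // -/w ReM nc_sq /ReC /ImC /=; ring.
have h : E (fun x => ReC (cconj w * f x)) <= nc w * M * m.
  rewrite -(pf_cst pE); apply: (pf_le pE); [|exact: bm_cst|].
    by case: (bmC_M (bmC_cst (cconj w)) bf).
  move=> x; apply: le_trans (ler_norm _) _; apply: le_trans (Re_le_nc _) _.
  by rewrite ncM nc_conj ler_wpM2l // nc_ge0.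
by move: h; rewrite -e1 expr2 -mulrA ler_pM2l.
Qed.
End ComplexFunctionals.

Section ComplexRealLine.
Variable R : realType.
Local Notation C := R[i].

Lemma bmC_lip (f : R -> C) (L M : R) : (forall x y, nc (f x - f y) <= L * `|x - y|) ->
  (forall x, nc (f x) <= M) -> bmC f.
Proof.
move=> hL hM; split.
  apply: (bm_lip (L := L) (M := M)) => [x y|x]; last exact: le_trans (Re_le_nc _) (hM x).
  by rewrite -ReB; exact: le_trans (Re_le_nc _) (hL x y).
apply: (bm_lip (L := L) (M := M)) => [x y|x]; last exact: le_trans (Im_le_nc _) (hM x).
by rewrite -ImB; exact: le_trans (Im_le_nc _) (hL x y).
Qed.

Lemma kern_lip (d : R) (z : C) (x y : R) : 0 < d -> d <= `|ImC z| ->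
  nc (cR 2 / (z - cR x) - cR 2 / (z - cR y)) <= 2 / d ^+ 2 * `|x - y|.
Proof.
move=> d0 zd; rewrite -mulrBr ncM nc_cR ger0_norm // -mulrA ler_wpM2l //.
by have := res_lip x y d0 zd zd; rewrite subrr nc0 add0r mulrC.
Qed.

Lemma kern_bound (d : R) (z : C) (x : R) : 0 < d -> d <= `|ImC z| ->
  nc (cR 2 / (z - cR x)) <= 2 / d.
Proof. by move=> d0 zd; rewrite ncM nc_cR ger0_norm // ler_wpM2l // res_bound. Qed.

Lemma kern_bmC (z : C) : ImC z != 0 -> bmC (fun x => cR 2 / (z - cR x)).
Proof.
rewrite -normr_gt0 => z0; apply: bmC_lip => [x y|x]; first exact: kern_lip z0 (lexx _).
exact: kern_bound z0 (lexx _).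
Qed.

Lemma ge_norm_Im (d : R) (z : C) : d <= ImC z -> d <= `|ImC z|.
Proof. by move=> h; apply: le_trans h (ler_norm _). Qed.

Definition ME (E : (R -> R) -> R) (z : C) : C := cE E (fun x => cR 2 / (z - cR x)).

Lemma ME_good (E : R -> (R -> R) -> R) : (forall t, pf 1 (E t)) -> good (fun t => ME (E t)).
Proof.
move=> pE t d z w d0 zd wd.
have [zd' wd'] := (ge_norm_Im zd, ge_norm_Im wd).
have z0 : ImC z != 0 by rewrite gt_eqF //; lra.
have w0 : ImC w != 0 by rewrite gt_eqF //; lra.
split.
  rewrite -[leRHS]mulr1; apply: (nc_cE (pE t)) => [||x]; [by rewrite divr_ge0 // ltW|exact: kern_bmC|exact: kern_bound].
rewrite /ME -(cE_B (pE t)); try exact: kern_bmC.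
rewrite -[leRHS]mulr1; apply: (nc_cE (pE t)) => [||x].
- by rewrite mulr_ge0 ?nc_ge0 // divr_ge0 // exprn_ge0 // ltW.
- by apply: bmC_B; exact: kern_bmC.
- rewrite -mulrBr ncM nc_cR ger0_norm // -mulrA ler_wpM2l //.
  by have := res_lip x x d0 zd' wd'; rewrite subrr normr0 addr0 mulrC.
Qed.

Lemma Mfun_ME (mu : probability R R) z : Mfun mu z = ME (Rintegral mu setT) z.
Proof. by []. Qed.

Lemma Mw_ME n (W : R -> 'I_n.+1 -> R) u z : Mw W u z = ME (empR (W u)) z.
Proof.
apply: complexP; rewrite /Mw ?Re_sum ?Im_sum /= /empR mulr_suml; apply: eq_bigr => k _.
  by rewrite !ReZ mulrAC.
by rewrite !ImZ mulrAC.
Qed.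
End ComplexRealLine.

(** * Compact subsets of the half-plane *)

Section Compactness.
Variable R : realType.
Local Notation C := R[i].

(** The local-to-global principle from which the heights, bounds and moduli of continuity common to
    a compact set are obtained. *)
Lemma compact_unif (K : set C) (P : R -> C -> Prop) : compact K ->
  (forall z, K z -> exists2 d : R, 0 < d & forall w, nc (w - z) < d -> forall r : R, 0 < r < d -> P r w) ->
  exists2 d : R, 0 < d & forall z, K z -> P d z.
Proof.
move=> /compact_near_coveringP cK H.
have := cK _ (0 : R)^'+ (fun r z => P r z) _.
have F : ProperFilter ((0:R)^'+) by exact: at_right_proper_filter.
move=> /(_ _) h.
have {}h : \forall r \near (0:R)^'+, K `<=` P r.
  apply: h => z Kz; have [d d0 Hd] := H z Kz.
  exists ([set w | nc (w - z) < d], [set r : R | 0 < r < d]) => /=; last by move=> [w r] /= [? ?]; exact: Hd.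
  split; first by apply/nbhsCP; exists d.
  near=> r; apply/andP; split; near: r; first exact: nbhs_right_gt.
  exact: nbhs_right_lt.
near (0:R)^'+ => r.
exists r; first by near: r; exact: nbhs_right_gt.
by near: r; exact: h.
Unshelve. all: by end_near. Qed.

Lemma compact_box (K : set C) : compact K -> K `<=` (@inH R) ->
  exists2 d : R, 0 < d & forall z, K z -> [/\ d <= ImC z, ImC z <= d^-1 & `|ReC z| <= d^-1].
Proof.
move=> cK KH; apply: compact_unif => // z Kz.
pose d := Num.min (ImC z / 2) (nc z + 1 + ImC z / 2)^-1.
have z0 := KH z Kz; rewrite /inH in z0.
have n0 := nc_ge0 z.
have d0 : 0 < d by rewrite lt_min invr_gt0; apply/andP; split; lra.
exists d => // w h r /andP[r0 rd].
have d1 : d <= ImC z / 2 by rewrite ge_min lexx.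
have hI := le_lt_trans (Im_le_nc _) h; rewrite ImB ltr_norml in hI; case/andP: hI => hI1 hI2.
have hw : nc w <= nc z + ImC z / 2.
  by have := nc_tri w z 0; rewrite !subr0; lra.
have hr : nc z + 1 + ImC z / 2 <= r^-1.
  rewrite -[leLHS]invrK lef_pV2 ?posrE // ?invr_gt0; [|lra].
  by apply: (le_trans (ltW rd)); rewrite ge_min lexx orbT.
split; first by lra.
  by have := Im_le_nc w; have := ler_norm (ImC w); lra.
by have := Re_le_nc w; lra.
Qed.

Lemma unif_cont (K : set C) (f : C -> C) : compact K -> (forall z, K z -> {for z, continuous f}) ->
  forall r : R, 0 < r -> exists2 d : R, 0 < d & forall z w, K z -> nc (w - z) <= d -> nc (f w - f z) <= r.
Proof.
move=> cK fc r r0.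
suff [d d0 Hd] : exists2 d : R, 0 < d & forall z, K z -> forall w, nc (w - z) <= d -> nc (f w - f z) <= r.
  by exists d => // z w Kz h; exact: Hd.
apply: (@compact_unif K (fun d z => forall w, nc (w - z) <= d -> nc (f w - f z) <= r) cK).
move=> z Kz; have [d d0 Hd] := (contCCP f z).1 (fc z Kz) (r / 2) (divr_gt0 r0 (ltr0n R 2)).
exists (d / 2); first by rewrite divr_gt0.
move=> z' h1 e /andP[e0 e1] w h2.
have a1 := Hd z' (ltac:(lra) : nc (z' - z) < d).
have a2 := Hd w (ltac:(have := nc_tri w z' z; lra) : nc (w - z) < d).
by have := nc_tri (f w) (f z) (f z'); rewrite (ncBC (f z)); lra.
Qed.

Definition boxC (a b : R) : set C := [set z | [/\ a <= ImC z, ImC z <= b & `|ReC z| <= b]].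

Lemma box_compact a b : compact (boxC a b).
Proof.
have -> : boxC a b = (@ofpair R) @` (`[- b, b] `*` `[a, b]).
  apply/seteqP; split => [z [h1 h2 h3]|_ [[x y] [/= hx hy] <-]].
    exists (ReC z, ImC z); last by case: z {h1 h2 h3}.
    by split; rewrite /= in_itv /= ?h1 ?h2 // -ler_norml.
  move: hx hy; rewrite !in_itv /= => /andP[? ?] /andP[? ?].
  by split; rewrite /ImC /ReC //= ler_norml; apply/andP.
apply: continuous_compact; last by apply: compact_setX; exact: segment_compact.
apply: continuous_subspaceT => p; apply/(cvgCP _) => e e0.
have e2 : 0 < e / 2 by rewrite divr_gt0.
near=> q.
apply: le_trans (ofpair_nc p q) _.
rewrite (splitr e); apply: lerD.
  near: q; exists (ball p.1 (e / 2), setT) => /=.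
    by split; [exact: nbhsx_ballx|exact: filterT].
  by move=> [q1 q2] /= [h _]; move: h; rewrite /ball /= distrC => /ltW.
near: q; exists (setT, ball p.2 (e / 2)) => /=.
  by split; [exact: filterT|exact: nbhsx_ballx].
by move=> [q1 q2] /= [_ h]; move: h; rewrite /ball /= distrC => /ltW.
Unshelve. all: by end_near. Qed.

(** A 1-Lipschitz retraction onto the box. For a > 0, composition with it turns a function
    continuous on the half-plane into a bounded continuous function on the plane, to which weak
    convergence and the bound [Cb] apply. *)
Definition clampC (a b : R) (z : C) : C :=
  Complex (Num.min (Num.max (ReC z) (- b)) b) (Num.min (Num.max (ImC z) a) b).

Lemma clampC_in a b z : 0 <= b -> a <= b -> boxC a b (clampC a b z).
Proof.
move=> b0 ab; rewrite /boxC /clampC /= /ImC /ReC /= !le_min !ge_min !le_max !lexx !orbT ab; split => //.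
by rewrite ler_norml le_min le_max lexx !orbT ge_min lexx orbT /=; lra.
Qed.

Lemma clampC_id a b z : boxC a b z -> clampC a b z = z.
Proof.
move=> [h1 h2]; rewrite ler_norml => /andP[h3 h4].
apply: complexP; rewrite /clampC /= /ImC /ReC /=.
  by rewrite (max_idPl h3) (min_idPl h4).
by rewrite (max_idPl h1) (min_idPl h2).
Qed.

Lemma min_lip (a b c : R) : `|Num.min a c - Num.min b c| <= `|a - b|.
Proof.
have := ler_norm (a - b); have := ler_norm (b - a); rewrite (distrC b a) => ? ?.
rewrite ler_norml /Num.min.
by case: ltP => ?; case: ltP => ?; apply/andP; split; lra.
Qed.

Lemma clampC_lip a b z w : nc (clampC a b z - clampC a b w) <= nc (z - w).
Proof.
have h (x y u v : R) : `|x| <= `|y| -> `|u| <= `|v| -> x ^+ 2 + u ^+ 2 <= y ^+ 2 + v ^+ 2.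
  by move=> h1 h2; rewrite lerD // -real_normK ?num_real // -[leRHS]real_normK ?num_real // lerXn2r ?nnegrE.
rewrite !ncE ler_sqrt ?addr_ge0 ?sqr_ge0 //; apply: h.
  by rewrite !ReB /ReC /=; apply: le_trans (min_lip _ _ _) (max_lip _ _ _).
by rewrite !ImB /ImC /=; apply: le_trans (min_lip _ _ _) (max_lip _ _ _).
Qed.

Lemma lip_contCC (Psi : C -> C) (k : R) : 0 <= k ->
  (forall z w, nc (Psi z - Psi w) <= k * nc (z - w)) -> contCC Psi.
Proof.
move=> k0 H z; apply/contCCP => e e0.
have k1 : 0 < k + 1 by rewrite ltr_wpDl.
exists (e / (k + 1)); first by rewrite divr_gt0.
move=> w; rewrite ltr_pdivlMr // => h; apply: le_trans (H w z) _.
by have := nc_ge0 (w - z); move: h; rewrite mulrDr mulr1 mulrC; lra.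
Qed.

Lemma clampC_cont a b : contCC (clampC a b).
Proof. by apply: (lip_contCC (k := 1)) => // z w; rewrite mul1r clampC_lip. Qed.

End Compactness.

Section ComplexDerivative.
Variable R : realType.
Local Notation C := R[i].

Definition hder (h : C -> C) (z l : C) : Prop := forall e : R, 0 < e -> exists2 d : R, 0 < d &
  forall k, nc k < d -> nc (h (z + k) - h z - k * l) <= e * nc k.

Lemma hderP (h : C -> C) z l : hder h z l <-> derivable h z 1 /\ derive1 h z = l.
Proof.
have key (l' : C) : (fun k : C => k^-1 *: ((h \o shift z) (k *: 1) - h z)) @ 0^' --> l' <-> hder h z l'.
  have E k : k^-1 *: ((h \o shift z) (k *: 1) - h z) = (h (z + k) - h z) / k.
    by rewrite /= [k *: 1]mulr1 [k + z]addrC mulrC.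
  split.
    move=> /(cvgCP _) H e e0; have := H e e0.
    rewrite /dnbhs /within /= => /nbhsCP[d d0 Hd]; exists d => // k kd.
    have [->|k0] := eqVneq k 0; first by rewrite addr0 subrr mul0r subrr nc0 mulr0.
    have := Hd k; rewrite subr0 => /(_ kd k0); rewrite E => hh.
    have -> : h (z + k) - h z - k * l' = k * ((h (z + k) - h z) / k - l').
      by rewrite mulrBr mulrCA divff // mulr1.
    by rewrite ncM [leLHS]mulrC ler_wpM2r // nc_ge0.
  move=> H; apply/(cvgCP _) => e e0; have [d d0 Hd] := H e e0.
  rewrite /dnbhs; apply/nbhsCP; exists d => // k; rewrite subr0 => kd k0; rewrite E.
  have -> : (h (z + k) - h z) / k - l' = (h (z + k) - h z - k * l') / k.
    by apply: (mulIf k0); rewrite mulrBl !divfK // [l' * _]mulrC.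
  by rewrite ncM ncV ler_pdivrMr ?nc_gt0 // Hd.
split => [H|[H1 H2]].
  have cv := (key l).2 H; split; first by apply/cvg_ex; exists l.
  by rewrite derive1E; exact: (cvg_lim _ cv).
by apply/key; rewrite -H2 derive1E; exact: H1.
Qed.

Lemma cder_eps (f : R -> C) t l : cder f t l <-> forall e : R, 0 < e -> exists2 d : R, 0 < d &
  forall h : R, `|h| < d -> nc (f (t + h) - f t - cR h * l) <= e * `|h|.
Proof.
split=> [[/der_eps H1 /der_eps H2] e e0|H].
  have e2 : 0 < e / 2 by rewrite divr_gt0.
  have [d1 d10 D1] := H1 _ e2; have [d2 d20 D2] := H2 _ e2.
  exists (Num.min d1 d2); first by rewrite lt_min d10 d20.
  move=> h; rewrite lt_min => /andP[h1 h2]; apply: le_trans (nc_le _) _.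
  rewrite !ReB !ImB ReZ ImZ.
  by have := D1 h h1; have := D2 h h2; lra.
split; apply/der_eps => e e0; have [d d0 Hd] := H e e0; exists d => // h hd.
  by apply: le_trans (Hd h hd); apply: le_trans (Re_le_nc _); rewrite !ReB ReZ.
by apply: le_trans (Hd h hd); apply: le_trans (Im_le_nc _); rewrite !ImB ImZ.
Qed.

Lemma hder_comp (h : C -> C) (f : R -> C) t l a : hder h (f t) l -> cder f t a ->
  cder (fun s => h (f s)) t (l * a).
Proof.
move=> Hh /cder_eps Hf; apply/cder_eps => e e0.
pose e1 := e / (2 * (nc a + 1)); pose e2 := Num.min 1 (e / (2 * (nc l + 1))).
have na := nc_ge0 a; have nl := nc_ge0 l.
have e10 : 0 < e1 by rewrite divr_gt0 // mulr_gt0 //; lra.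
have e20 : 0 < e2 by rewrite lt_min ltr01 divr_gt0 // mulr_gt0 //; lra.
have [d1 d10 D1] := Hh e1 e10; have [d2 d20 D2] := Hf e2 e20.
exists (Num.min d2 (d1 / (nc a + 1))); first by rewrite lt_min d20 divr_gt0 //; lra.
move=> k; rewrite lt_min => /andP[k1]; rewrite ltr_pdivlMr; last by lra.
move=> k2.
have h1 := D2 k k1; set w := f (t + k) - f t in h1.
have e21 : e2 <= 1 by rewrite ge_min lexx.
have k0 := normr_ge0 k.
have hw : nc w <= (nc a + 1) * `|k|.
  have -> : w = (w - cR k * a) + cR k * a by rewrite subrK.
  apply: le_trans (ncD _ _) _; rewrite ncM nc_cR.
  have : e2 * `|k| <= 1 * `|k| by apply: ler_wpM2r.
  lra.
have h2 : nc (h (f t + w) - h (f t) - w * l) <= e1 * nc w.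
  by apply: D1; apply: le_lt_trans hw _; rewrite mulrC.
have -> : h (f (t + k)) - h (f t) - cR k * (l * a) =
   (h (f t + w) - h (f t) - w * l) + l * (w - cR k * a).
  by rewrite /w [f t + _]addrC subrK; ring.
apply: le_trans (ncD _ _) _; rewrite ncM.
have a1 : e1 * nc w <= e / 2 * `|k|.
  apply: le_trans (ler_wpM2l (ltW e10) hw) _.
  have a0 : nc a + 1 != 0 by rewrite gt_eqF //; lra.
  by have -> : e1 * ((nc a + 1) * `|k|) = e / 2 * `|k| by rewrite /e1; field.
have a2 : nc l * nc (w - cR k * a) <= e / 2 * `|k|.
  apply: le_trans (ler_wpM2l nl h1) _; rewrite mulrA ler_wpM2r //.
  have e22 : e2 <= e / (2 * (nc l + 1)) by rewrite ge_min lexx orbT.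
  apply: (@le_trans _ _ ((nc l + 1) * (e / (2 * (nc l + 1))))).
    by apply: ler_pM => //; [exact: ltW|lra].
  have l0 : nc l + 1 != 0 by rewrite gt_eqF //; lra.
  by have -> : (nc l + 1) * (e / (2 * (nc l + 1))) = e / 2 by field.
lra.
Qed.

Lemma hder_cont (h : C -> C) z l : hder h z l -> {for z, continuous h}.
Proof.
move=> H; apply/contCCP => r r0; have [d d0 Hd] := H 1 ltr01.
have l0 := nc_ge0 l; have l1 : 0 < 1 + nc l by lra.
exists (Num.min d (r / (1 + nc l))); first by rewrite lt_min d0 divr_gt0.
move=> w; rewrite lt_min ltr_pdivlMr // => /andP[h1 h2].
have := Hd _ h1; rewrite [z + _]addrC subrK mul1r => h3.
have := ncD (h w - h z - (w - z) * l) ((w - z) * l); rewrite subrK ncM; lra.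
Qed.
End ComplexDerivative.

(** * Limits of empirical averages *)

Section Continuity.
Variable R : realType.

Definition luc1 (f : R -> R) := forall A r : R, 0 < r -> exists2 dl : R, 0 < dl &
  forall x x', `|x| <= A -> `|x'| <= A -> `|x - x'| <= dl -> `|f x - f x'| <= r.

Definition luc2 (D : R -> R -> R) := forall A r : R, 0 < r -> exists2 dl : R, 0 < dl &
  forall x x' y y', `|x| <= A -> `|x'| <= A -> `|y| <= A -> `|y'| <= A ->
    `|x - x'| <= dl -> `|y - y'| <= dl -> `|D x y - D x' y'| <= r.

Lemma luc1_cont f : luc1 f -> continuous f.
Proof.
move=> H x; apply/cvgrPdist_le => e e0.
have [dl dl0 Hd] := H (`|x| + 1) e e0.
near=> y.
have h1 : `|x - y| <= dl by near: y; apply: cvgr_dist_le.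
have h2 : `|x - y| <= 1 by near: y; apply: cvgr_dist_le.
apply: Hd => //; first by lra.
by have := ler_normB x (x - y); rewrite opprB addrCA subrr addr0; lra.
Unshelve. all: by end_near. Qed.

Lemma cont_luc1 f : continuous f -> luc1 f.
Proof.
move=> fc A r r0.
have cK : compact `[- A, A] by exact: segment_compact.
have /compact_near_coveringP cN := cK.
have F : ProperFilter ((0:R)^'+) by exact: at_right_proper_filter.
have H : \forall d \near (0:R)^'+, `[- A, A] `<=` [set x | forall x', `|x - x'| <= d -> `|f x - f x'| <= r].
  apply: (cN _ (0:R)^'+ (fun d x => forall x', `|x - x'| <= d -> `|f x - f x'| <= r)) => x _.
  have := fc x; move/cvgrPdist_le => /(_ (r / 2) (divr_gt0 r0 (ltr0n R 2))).
  rewrite -nbhs_nearE => /nbhs_ballP[d /= d0 Hd].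
  exists (ball x (d / 2), [set e : R | 0 < e < d / 2]) => /=.
    split; first by apply: nbhsx_ballx; rewrite divr_gt0.
    near=> e; apply/andP; split; near: e; first exact: nbhs_right_gt.
    by apply: nbhs_right_lt; rewrite divr_gt0.
  move=> [x1 e] /= [h1 /andP[e0 e1]] x' h2.
  rewrite /ball /= in h1.
  have a1 := Hd x1 (ltac:(rewrite /ball /=; lra)).
  have a2 := Hd x' (ltac:(rewrite /ball /=; have := ler_distD x1 x x'; lra)).
  by have := ler_distD (f x) (f x1) (f x'); rewrite (distrC (f x1) (f x)); move: a1 a2 => /=; lra.
near (0:R)^'+ => d.
exists d; first by near: d; exact: nbhs_right_gt.
have Hd : `[- A, A] `<=` [set x | forall x', `|x - x'| <= d -> `|f x - f x'| <= r] by near: d.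
move=> x x' hx _; apply: Hd => /=; by rewrite in_itv /= -ler_norml.
Unshelve. all: by end_near. Qed.

Lemma lip_luc1 f (L : R) : (forall x y, `|f x - f y| <= L * `|x - y|) -> luc1 f.
Proof. by move=> /lip_cont; exact: cont_luc1. Qed.

Lemma luc2_luc1 D x : luc2 D -> luc1 (D x).
Proof.
move=> H A r r0; have [dl dl0 Hd] := H (Num.max A `|x|) r r0; exists dl => // y y' h h' hy.
by apply: Hd => //; rewrite ?le_max ?h ?h' ?lexx ?orbT // subrr normr0 ltW.
Qed.

Lemma luc2_luc1' D y : luc2 D -> luc1 (D^~ y).
Proof.
move=> H A r r0; have [dl dl0 Hd] := H (Num.max A `|y|) r r0; exists dl => // x x' h h' hy.
by apply: Hd => //; rewrite ?le_max ?h ?h' ?lexx ?orbT // subrr normr0 ltW.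
Qed.

Definition dq (f' f'' : R -> R) (x y : R) : R := if x == y then f'' x else (f' x - f' y) / (x - y).

Section DifferenceQuotient.
Variables (f' f'' : R -> R) (M : R).
Hypothesis df : forall x, der f' x (f'' x).
Hypothesis f''c : continuous f''.
Hypothesis f''b : forall x, `|f'' x| <= M.

Lemma dq_bound x y : `|dq f' f'' x y| <= M.
Proof.
rewrite /dq; case: eqVneq => // xy.
have M0 : 0 <= M := le_trans (normr_ge0 _) (f''b 0).
by apply: quot_le => //; exact: lip_bound_all.
Qed.

(* the quotient is the average of f'' over the segment [x, y] *)
Let prim x y : exists2 G : R -> R, (forall s, der G s (f'' (y + s * (x - y)))) & G 1 - G 0 = dq f' f'' x y.
Proof.
have dl s : der (fun u : R => y + u * (x - y)) s (x - y).
  apply: der_ext (derD (derC y s) (derM (derI s) (derC (x - y) s))) => // ; ring.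
rewrite /dq; case: eqVneq => [<-|xy].
  exists (fun s => s * f'' x) => [s|]; last by ring.
  apply: der_ext (derM (derI s) (derC (f'' x) s)) => //.
  by rewrite subrr !mulr0 !addr0 mul1r.
exists (fun s => f' (y + s * (x - y)) / (x - y)) => [s|].
  apply: der_ext (derM (der_comp (df _) (dl s)) (derC (x - y)^-1 s)) => //.
  by rewrite mulr0 addr0 mulfK // subr_eq0.
by rewrite -mulrBl mul1r mul0r addr0 [y + _]addrC subrK.
Qed.

(** Two quotients are averages of f'' over segments inside [-A, A], compared at equal parameters
    s. *)
Lemma dq_luc2 : luc2 (dq f' f'').
Proof.
move=> A r r0; have [dl dl0 Hd] := cont_luc1 f''c A r0.
exists dl => //.
move=> x x' y y' hx hx' hy hy' h1 h2.
have [G dG <-] := prim x y; have [G' dG' <-] := prim x' y'.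
have -> : G 1 - G 0 - (G' 1 - G' 0) = (G 1 - G' 1) - (G 0 - G' 0) by ring.
rewrite -[leRHS]mulr1 -[X in r * X]subr0.
apply: (@lip_bound _ (fun s => G s - G' s) (fun s => f'' (y + s * (x - y)) - f'' (y' + s * (x' - y')))) => //.
- by apply: within_cont => s _; exact: der_cont (derB (dG s) (dG' s)).
- by move=> s _; exact: derB.
move=> s /andP[s0 s1].
have conv (a b c : R) : `|a| <= c -> `|b| <= c -> `|b + s * (a - b)| <= c.
  move=> ha hb; have -> : b + s * (a - b) = s * a + (1 - s) * b by ring.
  apply: le_trans (ler_normD _ _) _; rewrite !normrM (gtr0_norm s0) (gtr0_norm (ltac:(lra) : 0 < 1 - s)).
  have : s * `|a| <= s * c by apply: ler_wpM2l; first exact: ltW.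
  have : (1 - s) * `|b| <= (1 - s) * c by apply: ler_wpM2l; first lra.
  lra.
apply: Hd; [exact: conv|exact: conv|].
have -> : y + s * (x - y) - (y' + s * (x' - y')) = (y - y') + s * ((x - x') - (y - y')) by ring.
exact: conv.
Qed.

(** [empD] has 0 on the diagonal where [dq] has f''; the difference is the average of f'' divided by
    N. *)
Lemma empD_dq n (w : 'I_n.+1 -> R) : (forall k l, k != l -> w k != w l) ->
  `|empD f' w - empR w (fun a => empR w (dq f' f'' a))| <= M / n.+1%:R.
Proof.
move=> wi.
have M0 : 0 <= M := le_trans (normr_ge0 _) (f''b 0).
have n0 : n.+1%:R != 0 :> R by rewrite pnatr_eq0.
have -> : empD f' w - empR w (fun a => empR w (dq f' f'' a)) = - (empR w f'' / n.+1%:R).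
  rewrite /empD /empR -mulr_suml -mulrA -invfM -expr2 -mulrBl -mulrA -invfM -expr2 -mulNr; congr (_ * _).
  rewrite -sumrB -sumrN; apply: eq_bigr => k _.
  rewrite (bigD1 k) //= [X in _ - X](bigD1 k) //= subrr mul0r add0r /dq eqxx.
  rewrite opprD addrCA -sumrB big1 ?addr0 // => l lk.
  by rewrite eq_sym in lk; rewrite (negPf (wi _ _ lk)) subrr.
by rewrite normrN normrM [`|_^-1|]ger0_norm ?invr_ge0 // ler_wpM2r ?invr_ge0 //; exact: emp_bound.
Qed.
End DifferenceQuotient.

Lemma pf_param_luc (E : (R -> R) -> R) (D : R -> R -> R) (M : R) : pf 1 E ->
  (forall r : R, 0 < r -> exists2 A : R, 0 <= A & E (tl A) <= r) ->
  luc2 D -> (forall x y, `|D x y| <= M) -> luc1 (fun x => E (D x)).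
Proof.
move=> pE tE lD bD A r r0.
have M0 : 0 <= M := le_trans (normr_ge0 _) (bD 0 0).
have r2 : 0 < r / 2 by rewrite divr_gt0.
have M1 : 0 < 2 * M + 1 by rewrite ltr_wpDl // mulr_ge0.
have [B B0 HB] := tE (r / 2 / (2 * M + 1)) (divr_gt0 r2 M1).
have [dl dl0 Hd] := lD (Num.max A B) _ r2.
exists dl => // x x' hx hx' hxx.
have bmD1 u : bm (D u) by apply: (bm_cont (M := M)) => //; apply: luc1_cont; exact: luc2_luc1.
have bh : bm (fun y => r / 2 + 2 * M * tl B y) by apply: bmD; [exact: bm_cst|apply: bmZ; exact: tl_bm].
apply: le_trans (pf_diff pE (bmD1 x) (bmD1 x') bh _) _ => [y|].
  have t0 := tl_ge0 B y.
  have M2 : 0 <= 2 * M by lra.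
  have [hy|hy] := lerP `|y| B.
    apply: (@le_trans _ _ (r / 2)); last by rewrite lerDl mulr_ge0.
    by apply: Hd => //; rewrite ?le_max ?hx ?hx' ?hy ?orbT // subrr normr0 ltW.
  have t1 := tl_out (ltW hy).
  have : 2 * M * 1 <= 2 * M * tl B y by apply: ler_wpM2l.
  by have := ler_normB (D x y) (D x' y); have := bD x y; have := bD x' y; lra.
rewrite (pfD pE); [|exact: bm_cst|by apply: bmZ; exact: tl_bm].
rewrite (pf_cst pE) mulr1 (pfZ pE); last exact: tl_bm.
have : (2 * M + 1) * E (tl B) <= r / 2 by rewrite mulrC -ler_pdivlMr.
have : 0 <= E (tl B).
  rewrite -(mul0r 1) -(pf_cst pE); apply: (pf_le pE); [exact: bm_cst|exact: tl_bm|].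
  by move=> y; exact: tl_ge0.
lra.
Qed.
End Continuity.

(** * Joint limits in index and time *)

Section Limits.
Variable R : realType.
Local Notation C := R[i].
Variables (V : forall n : nat, R -> 'I_n.+1 -> R) (T : R) (nk : nat -> nat) (mu : R -> probability R R).
Arguments V : clear implicits.
Hypothesis T0 : 0 < T.
Hypothesis nkI : strictly_incr nk.
Hypothesis Vmu : MT_conv T nk V mu.
Hypothesis V_tail : forall r : R, 0 < r -> exists2 A : R, 0 <= A & forall n t, 0 <= t <= T ->
  empR (V n t) (tl A) <= r.

(** Tails of the index times neighbourhoods of t: the mode of convergence that [der_lim] asks of the
    derivatives. *)
Definition J (t : R) : set_system (nat * R) := filter_prod \oo (nbhs t).

Local Notation e k t := (empR (V (nk k) t)).
Local Notation E t := (Rintegral (mu t) setT).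

Lemma JP t (Q : nat -> R -> Prop) : (\forall i \near J t, Q i.1 i.2) ->
  exists2 d : R, 0 < d & \forall n \near \oo, forall s : R, `|s - t| < d -> Q n s.
Proof.
move=> [[A B] /= [hA /nbhs_ballP[d /= d0 hB]] H]; exists d => //.
near=> n => s hs; apply: (H (n, s)); split => /=; first by near: n.
by apply: hB; rewrite /ball /= distrC.
Unshelve. all: by end_near. Qed.

Lemma J_fst t (Q : nat -> Prop) : (\forall n \near \oo, Q n) -> \forall i \near J t, Q i.1.
Proof. by move=> h; exists (Q, setT) => /=; [split => //; exact: filterT|move=> [? ?] []]. Qed.

Lemma J_snd t (Q : R -> Prop) : (\forall s \near t, Q s) -> \forall i \near J t, Q i.2.
Proof. by move=> h; exists (setT, Q) => /=; [split => //; exact: filterT|move=> [? ?] []]. Qed.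

Lemma J_in t : 0 < t < T -> \forall i \near J t, 0 < i.2 < T.
Proof.
move=> /andP[t0 t1]; apply: (J_snd (Q := fun s => 0 < s < T)); near=> s.
by apply/andP; split; near: s; [exact: lt_nbhsr|exact: lt_nbhsl].
Unshelve. all: by end_near. Qed.

Lemma nk_ge k : (k <= nk k)%N.
Proof. by elim: k => // k IH; apply: leq_ltn_trans IH _; exact: nkI. Qed.

Lemma nk_inf (r : R) : 0 < r -> \forall k \near \oo, (nk k).+1%:R^-1 <= r.
Proof.
move=> r0; near=> k.
rewrite -[leRHS]invrK lef_pV2 ?posrE ?invr_gt0 //.
apply: (@le_trans _ _ k%:R); first by near: k; exact: nbhs_infty_ger.
by rewrite ler_nat; apply: leqW; exact: nk_ge.
Unshelve. all: by end_near. Qed.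

Lemma BLc (c r : R) : 0 < c -> 0 < r -> \forall k \near \oo, forall t, 0 <= t <= T -> forall f,
  (forall x, `|f x| <= c) -> (forall x y, `|f x - f y| <= c * `|x - y|) ->
  `|e k t f - E t f| <= r.
Proof.
move=> c0 r0; have := Vmu.2 (r / c) (divr_gt0 r0 c0).
apply: filterS => k H t tT f hf lf.
have bf : bm f := bm_lip lf hf.
have := H t tT (fun x => c^-1 * f x).
rewrite (pfZ (pf_emp _)) // (pfZ (pf_prob _)) // -mulrBr normrM gtr0_norm ?invr_gt0 //.
rewrite [r / c]mulrC ler_pM2l ?invr_gt0 // => h; apply: h; split => [x|x y].
  by rewrite normrM gtr0_norm ?invr_gt0 // mulrC ler_pdivrMr // mul1r.
by rewrite -mulrBr normrM gtr0_norm ?invr_gt0 // mulrC ler_pdivrMr // mulrC.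
Qed.

Lemma E_tail (r : R) : 0 < r -> exists2 A : R, 0 <= A & forall t, 0 <= t <= T -> E t (tl A) <= r.
Proof.
move=> r0; have r2 : 0 < r / 2 by rewrite divr_gt0.
have [A A0 HA] := V_tail r2; exists A => // t tT.
(* [tl A] is built from two steps of width 1 with Lipschitz constant 6 each; 14 dominates their sum
   12 as well as the values. *)
have := BLc (ltr0n R 14) r2; move=> H.
near \oo => k.
have Hk : forall t, 0 <= t <= T -> forall f, (forall x, `|f x| <= 14) ->
   (forall x y, `|f x - f y| <= 14 * `|x - y|) -> `|e k t f - E t f| <= r / 2 by near: k.
have := Hk t tT (tl A) _ _.
have h1 x : `|tl A x| <= 14 by rewrite ger0_norm ?tl_ge0 //; have := tl_le1 x A0; lra.
have h2 x y : `|tl A x - tl A y| <= 14 * `|x - y|.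
  have a1 := theta_lip (- A) x y ltr01; have a2 := theta_lip (A - 1) x y ltr01.
  have -> : tl A x - tl A y = (theta (A - 1) 1 x - theta (A - 1) 1 y) - (theta (- A) 1 x - theta (- A) 1 y).
    by rewrite /tl; ring.
  have := ler_normB (theta (A - 1) 1 x - theta (A - 1) 1 y) (theta (- A) 1 x - theta (- A) 1 y).
  by have := normr_ge0 (x - y); rewrite divr1 in a1 a2; lra.
move=> /(_ h1 h2); have := HA (nk k) t tT.
by rewrite ler_distl => h /andP[? ?]; lra.
Unshelve. all: by end_near. Qed.

Lemma E_cont f : bcontR f -> {within `[0, T], continuous (fun t => E t f)}.
Proof. exact: Vmu.1. Qed.

Lemma theta_conv t (a h r : R) : 0 < t < T -> 0 < h -> 0 < r ->
  \forall i \near J t, `|e i.1 i.2 (theta a h) - E t (theta a h)| <= r.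
Proof.
move=> tT h0 r0; have r2 : 0 < r / 2 by rewrite divr_gt0.
have c0 : 0 < 1 + 6 / h by rewrite addr_gt0 // divr_gt0.
have H := J_fst t (BLc c0 r2).
have h1 x : `|theta a h x| <= 1 by have /andP[? ?] := theta_01 a h x; rewrite ger0_norm.
have h6 : 0 <= 6 / h by rewrite divr_ge0 // ltW.
have h2 x y : `|theta a h x - theta a h y| <= (1 + 6 / h) * `|x - y|.
  by apply: le_trans (theta_lip a x y h0) _; rewrite ler_wpM2r //; lra.
have bc : bcontR (theta a h).
  by split; [exists 1|apply: lip_cont; exact: h2].
have [d d0 Hd] := (within_contP _ _ _).1 (E_cont bc) t (ltac:(case/andP: tT => ? ?; apply/andP; split; lra)) _ r2.
have H2 := J_snd (nbhsx_ballx t d d0).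
near=> i.
have iT : 0 < i.2 < T by near: i; exact: J_in.
have iT' : 0 <= i.2 <= T by case/andP: iT => ? ?; apply/andP; split; lra.
have a1 : `|e i.1 i.2 (theta a h) - E i.2 (theta a h)| <= r / 2.
  have Hi : forall t, 0 <= t <= T -> forall f, (forall x, `|f x| <= 1 + 6 / h) ->
   (forall x y, `|f x - f y| <= (1 + 6 / h) * `|x - y|) -> `|e i.1 t f - E t f| <= r / 2 by near: i.
  by apply: Hi => // x; apply: le_trans (h1 x) _; lra.
have bi : ball t d i.2 by near: i.
have := Hd i.2 iT' (ltac:(by move: bi; rewrite /ball /= distrC)).
by have := ler_distD (E i.2 (theta a h)) (e i.1 i.2 (theta a h)) (E t (theta a h)); lra.
Unshelve. all: by end_near. Qed.

Theorem weak_joint (X : Type) (P : X -> Prop) t (Di : nat * R -> X -> R -> R) (D : X -> R -> R) (M : R) :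
  0 < t < T -> 0 <= M ->
  (\forall i \near J t, forall x, P x -> bm (Di i x) /\ forall y, `|Di i x y| <= M) ->
  (forall x, P x -> bm (D x) /\ forall y, `|D x y| <= M) ->
  (forall A r : R, 0 < r -> exists2 dl : R, 0 < dl &
     forall x, P x -> forall y y', `|y| <= A -> `|y'| <= A -> `|y - y'| <= dl -> `|D x y - D x y'| <= r) ->
  (forall A r : R, 0 < r -> \forall i \near J t, forall x, P x -> forall y, `|y| <= A -> `|Di i x y - D x y| <= r) ->
  forall r : R, 0 < r -> \forall i \near J t, forall x, P x -> `|e i.1 i.2 (Di i x) - E t (D x)| <= r.
Proof.
move=> tT M0 h1 h2 h3 h4.
apply: (@weak_unif R (nat * R)%type X (J t) _ P (fun i _ => e i.1 i.2) (fun _ => E t) Di D M) => //.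
- by move=> i _; exact: pf_emp.
- by move=> _; exact: pf_prob.
- by move=> a h r h0 r0; apply: filterS (theta_conv a tT h0 r0) => i hi x _.
- move=> r r0; have [A A0 HA] := V_tail r0; have [B B0 HB] := E_tail r0.
  have tT' : 0 <= t <= T by case/andP: tT => ? ?; apply/andP; split; lra.
  have mono (A1 A2 : R) E : pf 1 E -> A1 <= A2 -> E (tl A2) <= E (tl A1).
    move=> pE A12; apply: (pf_le pE); [exact: tl_bm|exact: tl_bm|] => v.
    rewrite /tl; have := @theta_anti R (- A2) (- A1) 1 v ltr01 (ltac:(lra)).
    by have := @theta_anti R (A1 - 1) (A2 - 1) 1 v ltr01 (ltac:(lra)); lra.
  exists (Num.max A B); first by rewrite le_max A0.
  split; last first.
    move=> x _; apply: le_trans (HB t tT').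
    by apply: (mono _ _ _ (pf_prob _)); rewrite le_max lexx orbT.
  apply: filterS (J_in tT) => i iT x _.
  have iT' : 0 <= i.2 <= T by case/andP: iT => ? ?; apply/andP; split; lra.
  apply: le_trans (HA (nk i.1) i.2 iT').
  by apply: (mono _ _ _ (pf_emp _)); rewrite le_max lexx.
Qed.

Lemma Mfun_good : good (fun t => Mfun (mu t)).
Proof. by apply: (ME_good (E := fun t => E t)) => t; exact: pf_prob. Qed.

(** Above height d the kernels 2/(z - x) have a common bound and a common Lipschitz constant in x,
    so their two coordinates lie in one multiple of the bounded Lipschitz ball. *)
Lemma M_unif (d r : R) : 0 < d -> 0 < r -> \forall k \near \oo, forall t, 0 <= t <= T -> forall z,
  d <= ImC z -> nc (Mw (V (nk k)) t z - Mfun (mu t) z) <= r.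
Proof.
move=> d0 r0; have r2 : 0 < r / 2 by rewrite divr_gt0.
have h1 : 0 < 2 / d by rewrite divr_gt0.
have h2 : 0 < 2 / d ^+ 2 by rewrite divr_gt0 // exprn_gt0.
have c0 : 0 < 2 / d + 2 / d ^+ 2 by lra.
apply: filterS (BLc c0 r2) => k H t tT z zd.
rewrite Mw_ME Mfun_ME; apply: le_trans (nc_le _) _; rewrite ReB ImB (splitr r).
have zd' := ge_norm_Im zd.
have b x := kern_bound x d0 zd'.
have l x y := kern_lip x y d0 zd'.
apply: lerD; apply: H => //.
- by move=> x; apply: le_trans (Re_le_nc _) _; have := b x; lra.
- move=> x y; rewrite -ReB; apply: le_trans (Re_le_nc _) _; apply: le_trans (l x y) _.
  by rewrite ler_wpM2r //; lra.
- by move=> x; apply: le_trans (Im_le_nc _) _; have := b x; lra.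
- move=> x y; rewrite -ImB; apply: le_trans (Im_le_nc _) _; apply: le_trans (l x y) _.
  by rewrite ler_wpM2r //; lra.
Qed.

Lemma Mfun_tcont : tcont (fun t => Mfun (mu t)) T.
Proof.
move=> z zH; have zd := ge_norm_Im (lexx (ImC z)).
have b x := kern_bound x zH zd.
have l x y := kern_lip x y zH zd.
apply/withinCP; split; apply: E_cont; split.
- by exists (2 / ImC z) => x; apply: le_trans (Re_le_nc _) (b x).
- apply: (@lip_cont _ _ (2 / ImC z ^+ 2)) => x y.
  by rewrite -ReB; apply: le_trans (Re_le_nc _) (l x y).
- by exists (2 / ImC z) => x; apply: le_trans (Im_le_nc _) (b x).
- apply: (@lip_cont _ _ (2 / ImC z ^+ 2)) => x y.
  by rewrite -ImB; apply: le_trans (Im_le_nc _) (l x y).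
Qed.

(** [weak_joint] is used twice: with the outer variable as a parameter it shows that the inner
    averages converge locally uniformly, and then it is applied to these varying test functions. *)
Lemma double_lim t (D : R -> R -> R) (M : R) : 0 < t < T -> luc2 D -> (forall x y, `|D x y| <= M) ->
  forall r : R, 0 < r -> \forall i \near J t,
    `|e i.1 i.2 (fun a => e i.1 i.2 (D a)) - E t (fun a => E t (D a))| <= r.
Proof.
move=> tT lD bD r r0.
have M0 : 0 <= M := le_trans (normr_ge0 _) (bD 0 0).
have tT' : 0 <= t <= T by case/andP: tT => ? ?; apply/andP; split; lra.
have bmD1 u : bm (D u) by apply: (bm_cont (M := M)) => //; apply: luc1_cont; exact: luc2_luc1.
have tE s : 0 < s -> exists2 A : R, 0 <= A & E t (tl A) <= s.
  by move=> s0; have [A A0 HA] := E_tail s0; exists A => //; exact: HA.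
have lE := pf_param_luc (pf_prob (mu t)) tE lD bD.
have bE x : `|E t (D x)| <= M by rewrite -[leRHS]mulr1; exact: (pf_bound (pf_prob _)).
have H := @weak_joint unit (fun=> True) t (fun i _ a => e i.1 i.2 (D a)) (fun _ a => E t (D a)) M tT M0.
apply: filterS (H _ _ _ _ r r0) => [i h||||]; first exact: (h tt).
- apply: nearW => i _ _; split; last first.
    by move=> y; apply: emp_bound => x; exact: bD.
  rewrite /empR; apply: bm_ext (bmZ (_.+1%:R)^-1 (bm_sum (index_enum _) _)) => [y|]; first by rewrite mulrC.
  move=> k; apply: (bm_cont (M := M)) => //; apply: luc1_cont; exact: luc2_luc1'.
- by move=> _ _; split => //; apply: (bm_cont (M := M)) => //; exact: luc1_cont.
- move=> A s s0; have [dl dl0 Hd] := lE A s s0; exists dl => // _ _ y y' h1 h2 h3; exact: Hd.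
- move=> A s s0.
  have H2 := @weak_joint R (fun x => `|x| <= A) t (fun _ => D) D M tT M0.
  apply: filterS (H2 _ _ _ _ s s0) => [i h _ _ y hy||||]; first exact: h.
  + by apply: nearW => i x _; split.
  + by move=> x _; split.
  + move=> B u u0; have [dl dl0 Hd] := lD (Num.max A B) u u0; exists dl => // x hx y y' h1 h2 h3.
    by apply: Hd => //; rewrite ?le_max ?hx ?h1 ?h2 ?orbT // subrr normr0 ltW.
  + by move=> B u u0; apply: nearW => i x _ y _; rewrite subrr normr0 ltW.
Qed.
End Limits.

(** * Uniform bounds for the finite systems *)

Section FlowMaps.
Variable R : realType.
Local Notation C := R[i].
Variables (dl b T : R).
Hypothesis dl0 : 0 < dl.
Hypothesis dlb : 2 * dl <= b.
Hypothesis TE : T = dl ^+ 2 / 2.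

(* Starting points are first clamped to a box around K, so that the flow lives up to time T on the whole plane. *)
Definition isflow (m : R -> C -> C) (Phi : R -> C -> C) : Prop := forall z,
  [/\ Phi 0 z = clampC (2 * dl) b z,
      forall t, 0 < t < T -> cder (fun u => Phi u z) t (m t (liftIm dl (Phi t z))) &
      forall s t, nc (Phi s z - Phi t z) <= 4 / dl * `|s - t|].

(** Coordinates start in a box bounded by b and the flow moves at speed at most [4 / dl], so this
    bounds them up to time T. *)
Definition bigb : R := b + 4 / dl * T.

Let T0 : 0 < T. Proof. by rewrite TE divr_gt0 // exprn_gt0. Qed.
Let b0 : 0 <= b. Proof. by have := dl0; have := dlb; lra. Qed.
Let q0 : 0 <= 4 / dl. Proof. by rewrite divr_ge0 // ltW. Qed.

Lemma bigb_ge : dl <= bigb.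
Proof. by have := mulr_ge0 q0 (ltW T0); rewrite /bigb; have := dl0; have := dlb; lra. Qed.

Lemma bigb0 : 0 <= bigb.
Proof. by have := bigb_ge; have := dl0; lra. Qed.

Lemma isflow_ex m : good m -> tcont m T -> exists Phi, isflow m Phi.
Proof.
move=> gm tm.
have H z : exists p : R -> C, [/\ p 0 = clampC (2 * dl) b z,
    forall t, 0 < t < T -> cder p t (m t (liftIm dl (p t))) &
    forall s t, nc (p s - p t) <= 4 / dl * `|s - t|].
  exact: (flow_ex (clampC (2 * dl) b z) gm (ltW T0) tm dl0).
have [f Hf] := choice H.
by exists (fun t z => f z t) => z; have [? ? ?] := Hf z; split.
Qed.

Section OneFlow.
Variables (m : R -> C -> C) (Phi : R -> C -> C).
Hypothesis gm : good m.
Hypothesis fP : isflow m Phi.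

Lemma isflow_within z : {within `[0, T], continuous (fun t => Phi t z)}.
Proof. by have [_ _ h] := fP z; apply: (lip_within q0 h). Qed.

Lemma isflow_Im t z : 0 <= t <= T -> dl <= ImC (Phi t z).
Proof.
move=> tT; have [h0 h1 h2] := fP z.
have := flow_Im gm dl0 (@isflow_within z) h1 tT; rewrite h0.
have [h _ _] := clampC_in z b0 dlb; move=> h'.
have h3 : 2 / dl * t <= dl.
  rewrite mulrAC ler_pdivrMr // -expr2; case/andP: tT => _; rewrite TE; lra.
lra.
Qed.

Lemma isflow_box t z : 0 <= t <= T -> boxC dl bigb (Phi t z).
Proof.
move=> tT; have [h0 h1 h2] := fP z.
have h := h2 t 0; rewrite h0 in h.
have [g1 g2 g3] := clampC_in z b0 dlb.
have tq : 4 / dl * `|t - 0| <= 4 / dl * T.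
  by apply: ler_wpM2l => //; rewrite subr0 ger0_norm; case/andP: tT.
split; first exact: isflow_Im.
  by have := ler_norm (ImC (Phi t z - clampC (2 * dl) b z)); have := Im_le_nc (Phi t z - clampC (2 * dl) b z); rewrite /bigb ImB; lra.
have := Re_le_nc (Phi t z - clampC (2 * dl) b z); rewrite ReB /bigb.
have := ler_normD (ReC (Phi t z) - ReC (clampC (2 * dl) b z)) (ReC (clampC (2 * dl) b z)); rewrite subrK.
lra.
Qed.

Lemma isflow_clamp t z : 0 <= t <= T -> clampC dl bigb (Phi t z) = Phi t z.
Proof. by move=> tT; apply: clampC_id; exact: isflow_box. Qed.

Lemma isflow_gsol z : gsol m T (clampC (2 * dl) b z) (fun t => Phi t z).
Proof.
have [h0 h1 h2] := fP z; rewrite -h0; apply: (flow_gsol dl0 (@isflow_within z) h1) => t tT.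
exact: isflow_Im.
Qed.

Lemma isflow_uniq z t p : boxC (2 * dl) b z -> 0 <= t <= T -> gsol m t z p ->
  forall u, 0 <= u <= t -> p u = Phi u z.
Proof.
move=> bz /andP[t0 tT] gp u ut.
have h := gsol_sub tT (isflow_gsol z); rewrite clampC_id // in h.
exact: (gsol_uniq gm gp h ut).
Qed.
End OneFlow.

(** The growth factor of squared distances in [lift_stab]. Being at least 1, it can also be used for
    the distances themselves. *)
Definition flowK : R := expR ((2 * (2 / dl ^+ 2) + 1) * T).

Lemma flowK_ge1 : 1 <= flowK.
Proof.
rewrite /flowK -[leLHS]expR0 ler_expR; apply: mulr_ge0; last exact: ltW.
have d2 : 0 <= dl ^+ 2 by apply: exprn_ge0; exact: ltW.
by rewrite addr_ge0 // mulr_ge0 // divr_ge0.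
Qed.

Lemma isflow_close m1 m2 Phi1 Phi2 (eta : R) : good m1 -> isflow m1 Phi1 -> isflow m2 Phi2 -> 0 <= eta ->
  (forall t, 0 < t < T -> forall z, dl <= ImC z -> nc (m1 t z - m2 t z) <= eta) ->
  forall t z, 0 <= t <= T -> nc (Phi1 t z - Phi2 t z) <= eta * (T + 1) * flowK.
Proof.
move=> g1 f1 f2 e0 h t z tT.
have [a0 a1 a2] := f1 z; have [c0 c1 c2] := f2 z.
have := lift_stab dl0 e0 g1 (@isflow_within _ _ f1 z) (@isflow_within _ _ f2 z) a1 c1 h tT.
rewrite a0 c0 subrr nc0 expr0n /= add0r -/flowK => H.
have K1 := flowK_ge1.
have K0 : 0 <= flowK by lra.
have p0 : 0 <= eta * (T + 1) * flowK by rewrite !mulr_ge0 // addr_ge0 // ltW.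
rewrite -(@ler_pXn2r _ 2) ?nnegrE ?nc_ge0 //; apply: le_trans H _.
rewrite !exprMn; apply: ler_pM => //.
- by rewrite mulr_ge0 ?sqr_ge0 // ltW.
- rewrite ler_wpM2l ?sqr_ge0 //; have := sqr_ge0 T; have := T0.
  by rewrite sqrrD expr1n mulr1; lra.
- by rewrite expr2 ler_peMr.
Qed.

Lemma isflow_lip m Phi : good m -> isflow m Phi -> forall t z w, 0 <= t <= T ->
  nc (Phi t z - Phi t w) <= flowK * nc (z - w).
Proof.
move=> gm f t z w tT.
have [a0 a1 a2] := f z; have [c0 c1 c2] := f w.
have h (u : R) : 0 < u < T -> forall v, dl <= ImC v -> nc (m u v - m u v) <= 0.
  by move=> _ v _; rewrite subrr nc0.
have := lift_stab dl0 (lexx 0) gm (@isflow_within _ _ f z) (@isflow_within _ _ f w) a1 c1 h tT.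
rewrite a0 c0 expr0n /= mul0r addr0 -/flowK => H.
have K1 := flowK_ge1.
have K0 : 0 <= flowK by lra.
rewrite -(@ler_pXn2r _ 2) ?nnegrE ?mulr_ge0 ?nc_ge0 //; apply: le_trans H _.
rewrite exprMn mulrC; apply: ler_pM; rewrite ?sqr_ge0 //.
  by rewrite expr2 ler_peMr.
by rewrite lerXn2r ?nnegrE ?nc_ge0 // clampC_lip.
Qed.

Lemma isflow_cont m Phi : good m -> isflow m Phi -> forall t, 0 <= t <= T -> contCC (Phi t).
Proof.
move=> gm f t tT; apply: (lip_contCC (k := flowK)); first by have := flowK_ge1; lra.
by move=> z w; apply: (isflow_lip gm f).
Qed.
End FlowMaps.

(** * Estimates uniform in the number of particles *)

Section FiniteSystem.
Variable R : realType.
Local Notation C := R[i].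
Variables (x : forall n : nat, 'I_n.+1 -> R) (Mn : nat -> nat)
  (s : forall n : nat, 'I_(Mn n) -> C) (alpha : forall n : nat, 'I_(Mn n) -> int)
  (V : forall n : nat, R -> 'I_n.+1 -> R) (S : forall n : nat, R -> 'I_(Mn n) -> C).
Arguments x : clear implicits.
Arguments s : clear implicits.
Arguments alpha : clear implicits.
Arguments V : clear implicits.
Arguments S : clear implicits.
Variables (dl b T : R).
Hypothesis dl0 : 0 < dl.
Hypothesis dlb : 2 * dl <= b.
Hypothesis TE : T = dl ^+ 2 / 2.
Hypothesis sB : forall n j, boxC (2 * dl) b (s n j).

(** Weak convergence bounds the action on each test function, and the uniform boundedness principle
    makes the bound uniform. Large weights of opposite signs may cancel, so the sum of their
    absolute values over N need not stay bounded. *)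
Lemma atoms_unif (sigma : smeasH R) :
  (forall f, bcontH f -> (fun n => atomsH n (alpha n) (s n) f) @ \oo --> sintR sigma f) ->
  exists2 Cb : R, 0 <= Cb & forall n f (M : R), contC f -> (forall z, `|f z| <= M) ->
    `|atomsH n (alpha n) (s n) f| <= Cb * M.
Proof.
move=> cv.
have [n f g c|n|f M fc fM|Cb HC] := @unif_bound R (fun n f => atomsH n (alpha n) (s n) f).
- by rewrite /atomsH mulr_sumr -big_split; apply: eq_bigr => j _ /=; ring.
- exists (\sum_j `|(alpha n j)%:~R / n.+1%:R|) => f M fM.
  rewrite /atomsH mulr_suml; apply: le_trans (ler_norm_sum _ _ _) _; apply: ler_sum => j _.
  by rewrite normrM ler_wpM2l.
- have fb : bcontH f by split; [exists M|].
  have /cvg_seq_bounded [D [_ HD]] : cvgn (fun n => atomsH n (alpha n) (s n) f).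
    by apply/cvg_ex; exists (sintR sigma f); exact: cv.
  by exists (D + 1) => n; apply: HD => //; rewrite ltrDl.
exists (Num.max Cb 0); first by rewrite le_max lexx orbT.
move=> n f M fc fM; apply: le_trans (HC n f M fc fM) _.
by apply: ler_wpM2r; [exact: le_trans (normr_ge0 _) (fM 0)|rewrite le_max lexx].
Qed.

Hypothesis dr : forall n, drivingSol (x n) (s n) (alpha n) T (V n) (S n).

Let T0 : 0 < T. Proof. by rewrite TE divr_gt0 // exprn_gt0. Qed.

Lemma Mw_flow : exists Phi : nat -> R -> C -> C, forall n, isflow dl b T (Mw (V n)) (Phi n).
Proof.
have H n : exists Phi, isflow dl b T (Mw (V n)) Phi.
  apply: isflow_ex => //; first exact: Mw_good.
  by apply: Mw_tcont; case: (dr n) => _ [_ []].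
by have [f Hf] := choice H; exists f.
Qed.

Variable Phi : nat -> R -> C -> C.
Hypothesis PhiP : forall n, isflow dl b T (Mw (V n)) (Phi n).

Lemma S_flow n t j : 0 <= t <= T -> S n t j = Phi n t (s n j).
Proof.
move=> tT; have [_ [_ [_ [h _]]]] := dr n.
have h2 : 0 <= T <= T by rewrite lexx ltW.
have hg : gsol (Mw (V n)) T (s n j) (fun u => S n u j) := h j.
exact: (isflow_uniq dl0 dlb TE (@Mw_good R n (V n)) (PhiP n) (sB j) h2 hg tT).
Qed.

Lemma atoms_flow n t f : 0 <= t <= T ->
  atomsH n (alpha n) (S n t) f = atomsH n (alpha n) (s n) (fun z => f (Phi n t z)).
Proof. by move=> tT; apply: eq_bigr => j _; rewrite S_flow. Qed.

Variable Cb : R.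
Hypothesis HC : forall n f (M : R), contC f -> (forall z, `|f z| <= M) ->
    `|atomsH n (alpha n) (s n) f| <= Cb * M.

Local Notation Rb := (clampC dl (bigb dl b T)).

(** The flow stays in the box, so [f] may be replaced by [f \o Rb] and transported back to the
    initial poles, where the constant [Cb] applies. *)
Lemma atoms_le n t f (M : R) : 0 <= t <= T -> contC (f \o Rb) -> (forall z, `|f (Rb z)| <= M) ->
  `|atomsH n (alpha n) (S n t) f| <= Cb * M.
Proof.
move=> tT fc fM; rewrite atoms_flow //.
have -> : (fun z => f (Phi n t z)) = (f \o Rb) \o Phi n t.
  by apply/funext => z /=; rewrite (isflow_clamp dl0 dlb TE (@Mw_good R n (V n)) (PhiP n)).
apply: HC => [|z]; last exact: fM.
move=> z; apply: continuous_comp; last exact: fc.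
exact: (isflow_cont dl0 TE (@Mw_good R n (V n)) (PhiP n) tT).
Qed.

Lemma Rb_Im z : dl <= ImC (Rb z).
Proof. by have [] := clampC_in z (bigb0 dl0 dlb TE) (bigb_ge dl0 dlb TE). Qed.

Lemma lip_Rb_contC (f : C -> R) (L : R) : 0 <= L ->
  (forall z w, dl <= ImC z -> dl <= ImC w -> `|f z - f w| <= L * nc (z - w)) -> contC (f \o Rb).
Proof.
move=> L0 h z; apply/contCRP => e e0.
have L1 : 0 < L + 1 by rewrite ltr_wpDl.
exists (e / (L + 1)); first by rewrite divr_gt0.
move=> w; rewrite ltr_pdivlMr // => hw /=; apply: le_trans (h _ _ (Rb_Im _) (Rb_Im _)) _.
apply: (@le_trans _ _ (L * nc (w - z))); first by rewrite ler_wpM2l // clampC_lip.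
by have := nc_ge0 (w - z); move: hw; rewrite mulrDr mulr1 mulrC; lra.
Qed.

Lemma bker_contC (v : R) : contC (bker v \o Rb).
Proof.
apply: (lip_Rb_contC (L := 2 / dl ^+ 2)); first by rewrite divr_ge0 // exprn_ge0 // ltW.
by move=> z w hz hw; have := bker_lip v v dl0 hz hw; rewrite subrr normr0 addr0.
Qed.

Lemma atoms_bker n t v : 0 <= t <= T -> `|atomsH n (alpha n) (S n t) (bker v)| <= Cb * (2 / dl).
Proof.
move=> tT; apply: atoms_le => //; first exact: bker_contC.
by move=> z; apply: bker_bound => //; exact: Rb_Im.
Qed.

Lemma atoms_bker_lip n t v w : 0 <= t <= T ->
  `|atomsH n (alpha n) (S n t) (bker v) - atomsH n (alpha n) (S n t) (bker w)| <= Cb * (2 / dl ^+ 2 * `|v - w|).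
Proof.
move=> tT.
have -> : atomsH n (alpha n) (S n t) (bker v) - atomsH n (alpha n) (S n t) (bker w) =
  atomsH n (alpha n) (S n t) (fun z => bker v z + -1 * bker w z).
  by rewrite /atomsH -sumrB; apply: eq_bigr => j _; ring.
apply: atoms_le => //.
  exact: (contC_lin (f := bker v \o Rb) (g := bker w \o Rb) (c := -1) (@bker_contC v) (@bker_contC w)).
move=> z; rewrite mulN1r; have := bker_lip v w dl0 (Rb_Im z) (Rb_Im z).
by rewrite subrr nc0 add0r.
Qed.

Lemma emp_t_lip (f f' : R -> R) (L B : R) : 0 <= L -> (forall v, der f v (f' v)) ->
  (forall v, `|f' v| <= B) -> (forall v w, `|f' v - f' w| <= L * `|v - w|) ->
  forall n u t, 0 <= u <= T -> 0 <= t <= T ->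
  `|empR (V n u) f - empR (V n t) f| <= (L + B * (Cb * (2 / dl))) * `|u - t|.
Proof.
move=> L0 df fB fL n; apply: (emp_tlip L0 (dr n) df fB fL) => t v tT.
by apply: atoms_bker; case/andP: tT => ? ?; apply/andP; split; exact: ltW.
Qed.

Hypothesis Cb0 : 0 <= Cb.

Lemma V_lip (a h : R) : 0 < h -> exists2 L : R, 0 <= L & forall n u t, 0 <= u <= T -> 0 <= t <= T ->
  `|empR (V n u) (theta a h) - empR (V n t) (theta a h)| <= L * `|u - t|.
Proof.
move=> h0; have h6 : 0 <= 6 / h by rewrite divr_ge0 // ltW.
have h62 : 0 <= 6 / h ^+ 2 by rewrite divr_ge0 // exprn_ge0 // ltW.
have c0 : 0 <= Cb * (2 / dl) by rewrite mulr_ge0 // divr_ge0 // ltW.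
exists (6 / h ^+ 2 + 6 / h * (Cb * (2 / dl))); first by rewrite addr_ge0 // mulr_ge0.
apply: (emp_t_lip h62 (fun v => theta_der a h v)) => [v|v w]; first exact: dtheta_bound.
exact: dtheta_lip.
Qed.

(** The estimate in time sees a test function only through its first two derivatives and so applies
    to the unbounded phi, whose averages stay below Q on [0, T]. For large A, [tl A] is at most
    [r / (Q + 1)] times phi, because it is at most 2 and vanishes for |v| <= A - 1. *)
Lemma V_tail (phi : R -> R) :
  (forall y, derivable phi y 1) -> (forall y, derivable (derive1 phi) y 1) ->
  (forall y, 1 <= phi y) ->
  (exists B : R, forall y, `|derive1 phi y| <= B /\ `|derive1 (derive1 phi) y| <= B) ->
  (forall A : R, exists B : R, forall y, B <= `|y| -> A <= phi y) ->
  (exists B : R, forall n, empR (x n) phi <= B) ->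
  forall r : R, 0 < r -> exists2 A : R, 0 <= A & forall n t, 0 <= t <= T -> empR (V n t) (tl A) <= r.
Proof.
move=> d1 d2 p1 [B HB] pinf [B0 HB0] r r0.
have df v : der phi v (derive1 phi v) by rewrite derive1E; exact: derivableP (d1 v).
have ddf v : der (derive1 phi) v (derive1 (derive1 phi) v) by rewrite (derive1E (derive1 phi)); exact: derivableP (d2 v).
have Bg0 : 0 <= B := le_trans (normr_ge0 _) (HB 0).1.
have H := emp_t_lip Bg0 df (fun v => (HB v).1) (lip_bound_all ddf (fun v => (HB v).2)).
have B00 : 0 <= B0.
  apply: le_trans (HB0 0%N); rewrite /empR divr_ge0 // sumr_ge0 // => k _.
  by have := p1 (x 0%N k); lra.
pose Q := B0 + (B + B * (Cb * (2 / dl))) * T.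
have c0 : 0 <= Cb * (2 / dl) by rewrite mulr_ge0 // divr_ge0 // ltW.
have Q0 : 0 <= Q.
  by rewrite addr_ge0 // mulr_ge0 ?(ltW T0) // addr_ge0 // mulr_ge0.
have eQ n t : 0 <= t <= T -> empR (V n t) phi <= Q.
  move=> tT; have h00 : 0 <= (0:R) <= T by rewrite lexx ltW.
  have := H n t 0 tT h00; rewrite ler_distl => /andP[_].
  have -> : empR (V n 0) phi = empR (x n) phi.
    by rewrite /empR; congr (_ / _); apply: eq_bigr => k _; case: (dr n) => ->.
  have : (B + B * (Cb * (2 / dl))) * `|t - 0| <= (B + B * (Cb * (2 / dl))) * T.
    apply: ler_wpM2l; first by rewrite addr_ge0 // mulr_ge0.
    by rewrite subr0 ger0_norm; case/andP: tT.
  by have := HB0 n; rewrite /Q; lra.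
have [D HD] := pinf (2 * (Q + 1) / r).
pose A := Num.max D 0 + 1.
have A0 : 0 <= A by rewrite addr_ge0 // le_max lexx orbT.
exists A => // n t tT.
have h v : tl A v <= r / (Q + 1) * phi v.
  have Q1 : 0 < Q + 1 by lra.
  have [hv|hv] := lerP `|v| (A - 1).
    by rewrite tl_in // mulr_ge0 ?divr_ge0 ?ltW //; have := p1 v; lra.
  apply: le_trans (tl_le1 v A0) _.
  have : 2 * (Q + 1) / r <= phi v.
    apply: HD; apply: ltW; apply: le_lt_trans hv.
    by rewrite /A addrK le_max lexx.
  rewrite ler_pdivrMr // => hh.
  by rewrite mulrAC ler_pdivlMr // [r * _]mulrC.
apply: (@le_trans _ _ (r / (Q + 1) * empR (V n t) phi)).
  rewrite /empR mulrA ler_wpM2r ?invr_ge0 // mulr_sumr; apply: ler_sum => k _; exact: h.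
have Q1 : 0 < Q + 1 by lra.
rewrite mulrAC ler_pdivrMr // ler_wpM2l ?ltW //.
by have := eQ n t tT; lra.
Qed.
End FiniteSystem.

(** * The limiting signed measure and the limit equations *)

Section LipschitzNets.
Variable R : realType.

Lemma lip_net (I : Type) (FF : set_system I) (FFF : Filter FF) (F : I -> R -> R) (G : R -> R) (L : R) : 0 <= L ->
  (\forall i \near FF, forall y y', `|F i y - F i y'| <= L * `|y - y'|) ->
  (forall y y', `|G y - G y'| <= L * `|y - y'|) ->
  (forall y (r : R), 0 < r -> \forall i \near FF, `|F i y - G y| <= r) ->
  forall A r : R, 0 < r -> \forall i \near FF, forall y, `|y| <= A -> `|F i y - G y| <= r.
Proof.
move=> L0 hF hG hp A r r0.
have /compact_near_coveringP cN : compact `[- A, A] by exact: segment_compact.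
have H : \forall i \near FF, `[- A, A] `<=` [set y | `|F i y - G y| <= r].
  apply: (cN _ FF (fun i y => `|F i y - G y| <= r)) => y _.
  have L1 : 0 < 4 * (L + 1) by rewrite mulr_gt0 // ltr_wpDl.
  exists (ball y (r / (4 * (L + 1))), [set i | `|F i y - G y| <= r / 2 /\ forall y y', `|F i y - F i y'| <= L * `|y - y'|]) => /=.
    split; first by apply: nbhsx_ballx; rewrite divr_gt0.
    by apply: filterI => //; apply: hp; rewrite divr_gt0.
  move=> [y' i] /= [hy [h1 h2]]; move: hy; rewrite /ball /= ltr_pdivlMr // => hy.
  have a1 := h2 y' y; have a2 := hG y y'.
  have a3 : L * `|y' - y| <= r / 4.
    by rewrite distrC; have := normr_ge0 (y - y'); nra.
  have := ler_distD (F i y) (F i y') (G y'); have := ler_distD (G y) (F i y) (G y').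
  by rewrite (distrC y y') in a2; lra.
apply: filterS H => i Hi y hy; apply: Hi => /=.
by rewrite in_itv /= -ler_norml.
Qed.
End LipschitzNets.

Section SigmaLimit.
Variable R : realType.
Local Notation C := R[i].
Variables (x : forall n : nat, 'I_n.+1 -> R) (Mn : nat -> nat)
  (s : forall n : nat, 'I_(Mn n) -> C) (alpha : forall n : nat, 'I_(Mn n) -> int)
  (V : forall n : nat, R -> 'I_n.+1 -> R) (S : forall n : nat, R -> 'I_(Mn n) -> C).
Arguments x : clear implicits.
Arguments s : clear implicits.
Arguments alpha : clear implicits.
Arguments V : clear implicits.
Arguments S : clear implicits.
Variables (dl b T : R).
Hypothesis dl0 : 0 < dl.
Hypothesis dlb : 2 * dl <= b.
Hypothesis TE : T = dl ^+ 2 / 2.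
Hypothesis sB : forall n j, boxC (2 * dl) b (s n j).
Hypothesis dr : forall n, drivingSol (x n) (s n) (alpha n) T (V n) (S n).
Variable Cb : R.
Hypothesis Cb0 : 0 <= Cb.
Hypothesis HC : forall n f (M : R), contC f -> (forall z, `|f z| <= M) ->
    `|atomsH n (alpha n) (s n) f| <= Cb * M.
Variable sigma : smeasH R.
Hypothesis sigma_cv : forall f, bcontH f ->
  (fun n => atomsH n (alpha n) (s n) f) @ \oo --> sintR sigma f.
Variables (nk : nat -> nat) (mu : R -> probability R R).
Hypothesis nkI : strictly_incr nk.
Hypothesis Vmu : MT_conv T nk V mu.
Hypothesis V_tail : forall r : R, 0 < r -> exists2 A : R, 0 <= A & forall n t, 0 <= t <= T ->
  empR (V n t) (tl A) <= r.
Variable Phi : nat -> R -> C -> C.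
Hypothesis PhiP : forall n, isflow dl b T (Mw (V n)) (Phi n).
Variable Psi : R -> C -> C.
Hypothesis PsiP : isflow dl b T (fun t => Mfun (mu t)) Psi.

Local Notation Rb := (clampC dl (bigb dl b T)).
Local Notation at_ n t := (atomsH n (alpha n) (S n t)).
Local Notation e k t := (empR (V (nk k) t)).
Local Notation E t := (Rintegral (mu t) setT).

Let T0 : 0 < T. Proof. by rewrite TE divr_gt0 // exprn_gt0. Qed.
Let gM := Mfun_good mu.
Let gMw n := @Mw_good R n (V n).

Lemma flows_conv (r : R) : 0 < r -> \forall k \near \oo, forall t z, 0 <= t <= T ->
  nc (Phi (nk k) t z - Psi t z) <= r.
Proof.
move=> r0; have K1 := flowK_ge1 dl0 TE.
have q0 : 0 < (T + 1) * flowK dl T by rewrite mulr_gt0 // ?addr_gt0 //; lra.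
have e0 : 0 < r / ((T + 1) * flowK dl T) by rewrite divr_gt0.
apply: filterS (M_unif Vmu dl0 e0) => k H t z tT.
have h t' : 0 < t' < T -> forall z, dl <= ImC z ->
   nc (Mw (V (nk k)) t' z - Mfun (mu t') z) <= r / ((T + 1) * flowK dl T).
  by move=> /andP[? ?]; apply: H; apply/andP; split; exact: ltW.
have := isflow_close dl0 TE (gMw (nk k)) (PhiP (nk k)) PsiP (ltW e0) h z tT.
by rewrite -mulrA divfK // gt_eqF.
Qed.

Let Psi_cont t : contCC (Psi (clampT T t)).
Proof. by apply: (isflow_cont dl0 TE gM PsiP); exact: clampT_in (ltW T0). Qed.

(** The images of both parts of sigma under the limiting flow, with time clamped so that they are
    defined for all t. [Psi] first clamps starting points into the box, which contains the initial
    poles. *)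
Definition sigt t : smeasH R := SMeasH (push (@Psi_cont t) (smp sigma)) (push (@Psi_cont t) (smn sigma)).

(** Test functions judged by their values on the box that contains all trajectories; every function
    continuous on the half-plane qualifies. *)
Definition tf (f : C -> R) (M : R) := contC (f \o Rb) /\ forall z, `|f (Rb z)| <= M.

Lemma tf_bcontH f M : tf f M -> forall t, 0 <= t <= T -> bcontH (f \o Psi t).
Proof.
move=> [fc fM] t tT.
have EP : f \o Psi t = (f \o Rb) \o Psi t.
  by apply/funext => z /=; rewrite (isflow_clamp dl0 dlb TE gM PsiP).
rewrite EP; split; first by exists M => z _; exact: fM.
move=> z _; apply: continuous_comp; last exact: fc.
exact: (isflow_cont dl0 TE gM PsiP tT).
Qed.

Lemma bcontH_tf f : bcontH f -> exists M, tf f M.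
Proof.
move=> [[M fM] fc]; exists M.
have hI z : inH (Rb z) by apply: lt_le_trans dl0 (Rb_Im dl0 dlb TE z).
split => [z|z]; last exact: fM.
by apply: continuous_comp; [exact: clampC_cont|exact: fc].
Qed.

Lemma cont_tf f : (forall z, inH z -> {for z, continuous f}) -> exists M, tf f M.
Proof.
move=> fc.
have BH z : boxC dl (bigb dl b T) z -> inH z by case=> h _ _; exact: lt_le_trans dl0 h.
have [d d0 Hd] : exists2 d : R, 0 < d & forall z, boxC dl (bigb dl b T) z -> `|f z| <= d^-1.
  apply: compact_unif; first exact: box_compact.
  move=> z /BH zH; have [d d0 Hd] := (contCRP f z).1 (fc z zH) 1 ltr01.
  have n0 := normr_ge0 (f z).
  exists (Num.min d (`|f z| + 1)^-1); first by rewrite lt_min d0 invr_gt0; lra.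
  move=> w; rewrite lt_min => /andP[h1 _] r; rewrite lt_min => /andP[r0 /andP[_ r1]].
  have a1 := Hd w h1.
  have : `|f z| + 1 <= r^-1.
    by rewrite -[leLHS]invrK lef_pV2 ?posrE ?invr_gt0 // ?ltW //; lra.
  by have := ler_normD (f w - f z) (f z); rewrite subrK; lra.
exists d^-1; split=> z; last by apply: Hd; exact: clampC_in (bigb0 dl0 dlb TE) (bigb_ge dl0 dlb TE).
apply: continuous_comp; first exact: clampC_cont.
by apply: fc; apply: BH; exact: clampC_in (bigb0 dl0 dlb TE) (bigb_ge dl0 dlb TE).
Qed.

Lemma lip_tf (f : C -> R) (L M : R) : 0 <= L ->
  (forall z w, dl <= ImC z -> dl <= ImC w -> `|f z - f w| <= L * nc (z - w)) ->
  (forall z, dl <= ImC z -> `|f z| <= M) -> tf f M.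
Proof.
move=> L0 hL hM; split; first exact: (lip_Rb_contC dl0 dlb TE L0 hL).
by move=> z; apply: hM; exact: Rb_Im.
Qed.

Lemma sigt_int f M t : tf f M -> 0 <= t <= T -> sintR (sigt t) f = sintR sigma (f \o Psi t).
Proof.
move=> [fc fM] tT.
have h z : Rb (Psi (clampT T t) z) = Psi (clampT T t) z.
  by apply: (isflow_clamp dl0 dlb TE gM PsiP); exact: clampT_in (ltW T0).
rewrite /sintR /sigt /= !(push_integral_gen _ _ fc (@clampC_cont _ _ _) fM h).
by rewrite (clampT_id tT).
Qed.

Lemma sigt_supp t : supported_in_H (sigt t).
Proof.
have h (m : {finite_measure set (R * R)%type -> \bar R}) : push (@Psi_cont t) m [set p | p.2 <= 0] = 0%E.
  rewrite /push /= /fpush.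
  have -> : pmap (Psi (clampT T t)) @^-1` [set p | p.2 <= 0] = set0; last exact: measure0.
  apply/seteqP; split => // p /=; rewrite /pmap /pairof /=.
  have := isflow_Im dl0 dlb TE gM PsiP (ofpair p) (clampT_in t (ltW T0)).
  by move=> h1 h2; have := lt_le_trans dl0 h1; rewrite ltNge h2.
by split; exact: h.
Qed.

Lemma sigma_bound f M : contC f -> (forall z, `|f z| <= M) -> `|sintR sigma f| <= Cb * M.
Proof.
move=> fc fM; have fb : bcontH f by split; [exists M|].
rewrite -[sintR sigma f]subr0; apply: (lim_near_le (sigma_cv fb)).
by apply: nearW => n; rewrite subr0; exact: HC.
Qed.

Lemma sigt_bound f M t : tf f M -> 0 <= t <= T -> `|sintR (sigt t) f| <= Cb * M.
Proof.
move=> h tT; rewrite (sigt_int h tT); have [fc fM] := h.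
have -> : f \o Psi t = (f \o Rb) \o Psi t.
  by apply/funext => z /=; rewrite (isflow_clamp dl0 dlb TE gM PsiP).
apply: sigma_bound => [|z]; last exact: fM.
move=> z; apply: continuous_comp; last exact: fc.
exact: (isflow_cont dl0 TE gM PsiP tT).
Qed.

Lemma bcontH_bm f : contC f -> (exists M, forall z, `|f z| <= M) -> bm (f \o @ofpair R).
Proof. by move=> fc [M fM]; exact: (contC_bm fc fM). Qed.

Lemma sintR_B (sg : smeasH R) f g : bm (f \o @ofpair R) -> bm (g \o @ofpair R) ->
  sintR sg (fun z => f z - g z) = sintR sg f - sintR sg g.
Proof.
move=> bf bg; rewrite /sintR.
have h (m : {finite_measure set (R * R)%type -> \bar R}) :
   Rintegral m setT ((fun z => f z - g z) \o @ofpair R) =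
   Rintegral m setT (f \o @ofpair R) - Rintegral m setT (g \o @ofpair R).
  exact: (pfB (pf_Rintegral m) bf bg).
by rewrite !h; ring.
Qed.

Lemma sigt_B f g M M' t : tf f M -> tf g M' -> 0 <= t <= T ->
  sintR (sigt t) (fun z => f z - g z) = sintR (sigt t) f - sintR (sigt t) g.
Proof.
move=> hf hg tT.
have hfg : tf (fun z => f z - g z) (M + M').
  split => z; last by apply: le_trans (ler_normB _ _) _; apply: lerD; [exact: hf.2|exact: hg.2].
  by have := @contC_lin _ _ _ (-1) hf.1 hg.1; rewrite (_ : (fun z => _ + _) = (fun z => f z - g z) \o Rb) //; apply/funext => w /=; rewrite mulN1r.
rewrite (sigt_int hf tT) (sigt_int hg tT) (sigt_int hfg tT).
have h (u : C -> R) (N : R) : tf u N -> bm ((u \o Psi t) \o @ofpair R).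
  move=> hu; have -> : u \o Psi t = (u \o Rb) \o Psi t.
    by apply/funext => z /=; rewrite (isflow_clamp dl0 dlb TE gM PsiP).
  apply: bcontH_bm; last by exists N => z; exact: hu.2.
  move=> z; apply: continuous_comp; last exact: hu.1.
  exact: (isflow_cont dl0 TE gM PsiP tT).
exact: (sintR_B _ (h _ _ hf) (h _ _ hg)).
Qed.

Lemma at_B n t f g : at_ n t (fun z => f z - g z) = at_ n t f - at_ n t g.
Proof. by rewrite /atomsH -sumrB; apply: eq_bigr => j _; ring. Qed.

Lemma at_le n t f M : 0 <= t <= T -> tf f M -> `|at_ n t f| <= Cb * M.
Proof. by move=> tT [h1 h2]; exact: (atoms_le dl0 dlb TE sB dr PhiP HC). Qed.

(** At time u the poles are images of the initial ones under a flow uniformly close to the limiting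
    flow at time t. Replacing the one by the other costs [Cb] times a small oscillation of f; what
    remains is weak convergence at time 0 for the fixed function [f \o Psi t]. *)
Lemma sigt_conv f M t : tf f M -> 0 <= t <= T -> forall r : R, 0 < r ->
  exists2 d : R, 0 < d & \forall k \near \oo, forall u, 0 <= u <= T -> `|u - t| < d ->
    `|at_ (nk k) u f - sintR (sigt t) f| <= r.
Proof.
move=> hf tT r r0; have [fc fM] := hf.
have r2 : 0 < r / 2 by rewrite divr_gt0.
have C1 : 0 < Cb + 1 by rewrite ltr_wpDl.
have r3 : 0 < r / 2 / (Cb + 1) by rewrite divr_gt0.
have q0 : 0 < 4 / dl by rewrite divr_gt0.
have [eta eta0 Heta] := @unif_cont R (boxC dl (bigb dl b T)) (fun z => cR (f (Rb z))) (@box_compact _ _ _)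
  (fun z _ => (contCCP (fun z => cR (f (Rb z))) z).2 (fun e e0 => ltac:(
     have [d d0 Hd] := (contCRP (f \o Rb) z).1 (fc z) e e0;
     by exists d => // w hw; rewrite -cRB nc_cR; exact: Hd))) _ r3.
(* Within this time the limiting flow moves by at most [eta / 2]. *)
exists (eta / 2 / (4 / dl)); first by rewrite !divr_gt0.
have cv : (fun k => atomsH (nk k) (alpha (nk k)) (s (nk k)) (f \o Psi t)) @ \oo --> sintR sigma (f \o Psi t).
  apply: (@cvg_comp _ _ _ nk (fun n => atomsH n (alpha n) (s n) (f \o Psi t)) _ \oo); last first.
    by apply: sigma_cv; exact: (tf_bcontH hf).
  move=> A [N _ HN]; exists N => // k /= Nk; apply: HN => /=.
  exact: leq_trans Nk (nk_ge nkI k).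
have /cvgrPdist_le/(_ _ r2) cv' := cv.
near=> k => u uT ut.
have a1 : `|sintR sigma (f \o Psi t) - atomsH (nk k) (alpha (nk k)) (s (nk k)) (f \o Psi t)| <= r / 2.
  by near: k.
have a2 : forall t z, 0 <= t <= T -> nc (Phi (nk k) t z - Psi t z) <= eta / 2.
  by near: k; apply: flows_conv; rewrite divr_gt0.
rewrite (sigt_int hf tT) (atoms_flow dl0 dlb TE sB dr PhiP) //.
have a3 : `|atomsH (nk k) (alpha (nk k)) (s (nk k)) (fun z => f (Phi (nk k) u z) + -1 * f (Psi t z))|
    <= Cb * (r / 2 / (Cb + 1)).
  have e1 z : f (Phi (nk k) u z) = f (Rb (Phi (nk k) u z)).
    by rewrite (isflow_clamp dl0 dlb TE (gMw (nk k)) (PhiP (nk k))).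
  have e2 z : f (Psi t z) = f (Rb (Psi t z)) by rewrite (isflow_clamp dl0 dlb TE gM PsiP).
  apply: HC => [|z].
    have c1 : contC (fun z => f (Phi (nk k) u z)).
      rewrite (_ : (fun z => _) = (f \o Rb) \o Phi (nk k) u); last by apply/funext => z; exact: e1.
      move=> z; apply: continuous_comp; last exact: fc.
      exact: (isflow_cont dl0 TE (gMw (nk k)) (PhiP (nk k)) uT).
    have c2 : contC (fun z => f (Psi t z)).
      rewrite (_ : (fun z => _) = (f \o Rb) \o Psi t); last by apply/funext => z; exact: e2.
      move=> z; apply: continuous_comp; last exact: fc.
      exact: (isflow_cont dl0 TE gM PsiP tT).
    exact: (@contC_lin _ _ _ (-1) c1 c2).
  rewrite mulN1r e1 e2 -nc_cR cRB; apply: Heta; first exact: (isflow_box dl0 dlb TE gM PsiP).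
  have [_ _ h4] := PsiP z.
  have : 4 / dl * `|u - t| <= eta / 2.
    by move: ut; rewrite ltr_pdivlMr // => h; rewrite mulrC; exact: ltW.
  by have := nc_tri (Phi (nk k) u z) (Psi u z) (Psi t z); have := h4 u t; have := a2 u z uT; lra.
have a4 : Cb * (r / 2 / (Cb + 1)) <= r / 2.
  by rewrite mulrCA; apply: ler_piMr; [exact: ltW|rewrite ler_pdivrMr // mul1r lerDl].
have e3 : atomsH (nk k) (alpha (nk k)) (s (nk k)) (fun z => f (Phi (nk k) u z) + -1 * f (Psi t z)) =
   atomsH (nk k) (alpha (nk k)) (s (nk k)) (fun z => f (Phi (nk k) u z)) -
   atomsH (nk k) (alpha (nk k)) (s (nk k)) (f \o Psi t).
  by rewrite /atomsH -sumrB; apply: eq_bigr => j _ /=; ring.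
rewrite e3 in a3.
rewrite distrC in a1.
by have := ler_distD (atomsH (nk k) (alpha (nk k)) (s (nk k)) (f \o Psi t))
   (atomsH (nk k) (alpha (nk k)) (s (nk k)) (fun z => f (Phi (nk k) u z))) (sintR sigma (f \o Psi t)); lra.
Unshelve. all: by end_near. Qed.

Lemma sigt_cvg f M t : tf f M -> 0 <= t <= T ->
  (fun k => at_ (nk k) t f) @ \oo --> sintR (sigt t) f.
Proof.
move=> hf tT; apply/cvgrPdist_le => r r0; have [d d0 Hd] := sigt_conv hf tT r0.
by apply: filterS Hd => k H; rewrite distrC; apply: H => //; rewrite subrr normr0.
Qed.

Lemma sigt_J f M t : tf f M -> 0 < t < T -> forall r : R, 0 < r ->
  \forall i \near J t, `|at_ (nk i.1) i.2 f - sintR (sigt t) f| <= r.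
Proof.
move=> hf tT r r0.
have tT' : 0 <= t <= T by case/andP: tT => ? ?; apply/andP; split; exact: ltW.
have [d d0 Hd] := sigt_conv hf tT' r0.
have h2 := J_snd (nbhsx_ballx t d d0).
near=> i.
have hi : forall u, 0 <= u <= T -> `|u - t| < d -> `|at_ (nk i.1) u f - sintR (sigt t) f| <= r.
  by near: i; exact: (@J_fst R t (fun k => forall u, 0 <= u <= T -> `|u - t| < d -> `|at_ (nk k) u f - sintR (sigt t) f| <= r)).
have /andP[i1 i2] : 0 < i.2 < T by near: i; exact: J_in.
have bi : ball t d i.2 by near: i.
apply: hi; first by apply/andP; split; exact: ltW.
by move: bi; rewrite /ball /= distrC.
Unshelve. all: by end_near. Qed.
End SigmaLimit.

Section SignedIntegrals.
Variable R : realType.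
Lemma Re_sint (sg : smeasH R) F : ReC (sint sg F) = sintR sg (fun z => ReC (F z)).
Proof. by rewrite /sint ReB. Qed.
Lemma Im_sint (sg : smeasH R) F : ImC (sint sg F) = sintR sg (fun z => ImC (F z)).
Proof. by rewrite /sint ImB. Qed.
Lemma eq_sintR (sg : smeasH R) f g : f =1 g -> sintR sg f = sintR sg g.
Proof. by move=> /funext ->. Qed.
Lemma eq_sint (sg : smeasH R) f g : f =1 g -> sint sg f = sint sg g.
Proof. by move=> /funext ->. Qed.
End SignedIntegrals.

(** * Equations for the limiting measures *)

Section LimitEquations.
Variable R : realType.
Local Notation C := R[i].
Variables (x : forall n : nat, 'I_n.+1 -> R) (Mn : nat -> nat)
  (s : forall n : nat, 'I_(Mn n) -> C) (alpha : forall n : nat, 'I_(Mn n) -> int)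
  (V : forall n : nat, R -> 'I_n.+1 -> R) (S : forall n : nat, R -> 'I_(Mn n) -> C).
Arguments x : clear implicits.
Arguments s : clear implicits.
Arguments alpha : clear implicits.
Arguments V : clear implicits.
Arguments S : clear implicits.
Variables (dl b T : R).
Hypothesis dl0 : 0 < dl.
Hypothesis dlb : 2 * dl <= b.
Hypothesis TE : T = dl ^+ 2 / 2.
Hypothesis sB : forall n j, boxC (2 * dl) b (s n j).
Hypothesis dr : forall n, drivingSol (x n) (s n) (alpha n) T (V n) (S n).
Variable Cb : R.
Hypothesis Cb0 : 0 <= Cb.
Hypothesis HC : forall n f (M : R), contC f -> (forall z, `|f z| <= M) ->
    `|atomsH n (alpha n) (s n) f| <= Cb * M.
Variable sigma : smeasH R.
Hypothesis sigma_cv : forall f, bcontH f ->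
  (fun n => atomsH n (alpha n) (s n) f) @ \oo --> sintR sigma f.
Variables (nk : nat -> nat) (mu : R -> probability R R).
Hypothesis nkI : strictly_incr nk.
Hypothesis Vmu : MT_conv T nk V mu.
Hypothesis V_tail : forall r : R, 0 < r -> exists2 A : R, 0 <= A & forall n t, 0 <= t <= T ->
  empR (V n t) (tl A) <= r.
Variable Phi : nat -> R -> C -> C.
Hypothesis PhiP : forall n, isflow dl b T (Mw (V n)) (Phi n).
Variable Psi : R -> C -> C.
Hypothesis PsiP : isflow dl b T (fun t => Mfun (mu t)) Psi.

Local Notation Rb := (clampC dl (bigb dl b T)).
Local Notation at_ n t := (atomsH n (alpha n) (S n t)).
Local Notation e k t := (empR (V (nk k) t)).
Local Notation E t := (Rintegral (mu t) setT).

Let T0 : 0 < T. Proof. by rewrite TE divr_gt0 // exprn_gt0. Qed.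
Let gM := Mfun_good mu.
Let gMw n := @Mw_good R n (V n).

Local Notation sg t := (sigt dl0 TE sigma PsiP t).

Let interval t : 0 < t < T -> exists2 d : R, 0 < d & forall u : R, `|u - t| < d -> 0 < u < T.
Proof.
move=> /andP[t0 t1]; exists (Num.min t (T - t)); first by rewrite lt_min t0 subr_gt0.
by move=> u; rewrite lt_min ltr_norml ltr_norml => /andP[/andP[? ?] /andP[? ?]]; apply/andP; split; lra.
Qed.

Section RealTest.
Variables (f f' f'' : R -> R) (M : R).
Hypothesis df : forall y, der f y (f' y).
Hypothesis df' : forall y, der f' y (f'' y).
Hypothesis f''c : continuous f''.
Hypothesis fM : forall y, `|f y| <= M.
Hypothesis f'M : forall y, `|f' y| <= M.
Hypothesis f''M : forall y, `|f'' y| <= M.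

Let M0 : 0 <= M := le_trans (normr_ge0 _) (fM 0).
Let fz (z : C) (v : R) := f' v * bker v z.
Let d1 : 0 <= 2 / dl. Proof. by rewrite divr_ge0 // ltW. Qed.
Let d2 : 0 <= 2 / dl ^+ 2. Proof. by rewrite divr_ge0 // exprn_ge0 // ltW. Qed.
Let fz_bound z v : dl <= ImC z -> `|fz z v| <= M * (2 / dl).
Proof. by move=> zd; rewrite normrM; apply: ler_pM; rewrite ?normr_ge0 ?f'M ?bker_bound. Qed.

Let fz_lip z v w : dl <= ImC z -> `|fz z v - fz z w| <= M * (2 / dl + 2 / dl ^+ 2) * `|v - w|.
Proof.
move=> zd.
have -> : fz z v - fz z w = (f' v - f' w) * bker v z + f' w * (bker v z - bker w z) by rewrite /fz; ring.
apply: le_trans (ler_normD _ _) _; rewrite [X in _ <= X * _]mulrDr [leRHS]mulrDl; apply: lerD; rewrite normrM.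
  rewrite mulrAC; apply: ler_pM; rewrite ?normr_ge0 ?bker_bound //.
  exact: lip_bound_all df' f''M v w.
rewrite -mulrA; apply: ler_pM; rewrite ?normr_ge0 ?f'M //.
by have := bker_lip v w dl0 zd zd; rewrite subrr nc0 add0r.
Qed.

Let fz_zlip z z' v : dl <= ImC z -> dl <= ImC z' -> `|fz z v - fz z' v| <= M * (2 / dl ^+ 2) * nc (z - z').
Proof.
move=> h h'; rewrite /fz -mulrBr normrM -mulrA; apply: ler_pM; rewrite ?normr_ge0 ?f'M //.
by have := bker_lip v v dl0 h h'; rewrite subrr normr0 addr0.
Qed.

Let fz_bm z : dl <= ImC z -> bm (fz z).
Proof. by move=> zd; apply: bm_lip => [v w|v]; [exact: fz_lip|exact: fz_bound]. Qed.

Let FE_bound Ee z : pf 1 Ee -> dl <= ImC z -> `|Ee (fz z)| <= M * (2 / dl).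
Proof.
move=> pE zd; rewrite -[leRHS]mulr1; apply: (pf_bound pE); first exact: fz_bm.
by move=> v; exact: fz_bound.
Qed.

Let FE_lip Ee z z' : pf 1 Ee -> dl <= ImC z -> dl <= ImC z' ->
  `|Ee (fz z) - Ee (fz z')| <= M * (2 / dl ^+ 2) * nc (z - z').
Proof.
move=> pE zd zd'; rewrite -(pfB pE); try exact: fz_bm.
rewrite -[leRHS]mulr1; apply: (pf_bound pE); first by apply: bmB; exact: fz_bm.
by move=> v; exact: fz_zlip.
Qed.

(** [der_lim] for the averages of f, with four errors of r/4: the diagonal of the pair term, its
    double average, the inner average in the pole term, and the action of sigma_N on the limit of
    that average. *)
Theorem real_equation t : 0 < t < T ->
  der (fun u => E u f) t (E t (fun a => E t (dq f' f'' a)) + sintR (sg t) (fun z => E t (fz z))).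
Proof.
move=> tT; have [d0 d00 Hd] := interval tT.
have tT' : 0 <= t <= T by case/andP: tT => ? ?; apply/andP; split; exact: ltW.
have Md2 : 0 <= M * (2 / dl ^+ 2) by rewrite mulr_ge0.
apply: (@der_lim R (fun k u => e k u f) (fun k u => empD f' (V (nk k) u) +
   e k u (fun v => f' v * at_ (nk k) u (bker v))) _ _ _ d0) => //.
- by move=> k u /Hd uT; have := emp_der (dr (nk k)) df uT.
- move=> u /Hd uT; apply/cvgrPdist_le => r r0.
  have M1 : 0 < M + 1 by rewrite ltr_wpDl.
  apply: filterS (BLc Vmu M1 r0) => k H; rewrite distrC; apply: H.
  + by case/andP: uT => ? ?; apply/andP; split; exact: ltW.
  + by move=> v; apply: le_trans (fM v) _; rewrite lerDl.
  + move=> v w; apply: le_trans (lip_bound_all df f'M v w) _.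
    by rewrite ler_wpM2r // lerDl.
move=> r r0.
have r4 : 0 < r / 4 by rewrite divr_gt0.
have C1 : 0 < Cb + 1 by rewrite ltr_wpDl.
have rC : 0 < r / 4 / (Cb + 1) by rewrite divr_gt0.
have M1 : 0 < M + 1 by rewrite ltr_wpDl.
have p1 := J_fst t (nk_inf nkI (divr_gt0 r4 M1)).
have p2 := double_lim Vmu V_tail tT (dq_luc2 df' f''c) (dq_bound df' f''M) r4.
have p3 : \forall i \near J t, forall z, dl <= ImC z -> `|e i.1 i.2 (fz z) - E t (fz z)| <= r / 4 / (Cb + 1).
  apply: (@weak_joint R V T nk mu Vmu V_tail C (fun z => dl <= ImC z) t (fun _ => fz) fz (M * (2 / dl))) => //.
  - by rewrite mulr_ge0.
  - by apply: nearW => i z zd; split; [exact: fz_bm|move=> y; exact: fz_bound].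
  - by move=> z zd; split; [exact: fz_bm|move=> y; exact: fz_bound].
  - move=> A u u0; have L1 : 0 < M * (2 / dl + 2 / dl ^+ 2) + 1 by rewrite ltr_wpDl // mulr_ge0 // addr_ge0.
    exists (u / (M * (2 / dl + 2 / dl ^+ 2) + 1)); first by rewrite divr_gt0.
    move=> z zd y y' _ _; rewrite ler_pdivlMr // => h; apply: le_trans (fz_lip y y' zd) _.
    by have := normr_ge0 (y - y'); move: h; rewrite mulrDr mulr1 mulrC; lra.
  - by move=> A u u0; apply: nearW => i z _ y _; rewrite subrr normr0 ltW.
have tfF : tf dl b T (fun z => E t (fz z)) (M * (2 / dl)).
  apply: (lip_tf dl0 dlb TE Md2) => [z w hz hw|z hz]; last exact: FE_bound (pf_prob _) hz.
  exact: FE_lip (pf_prob _) hz hw.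
have p4 := sigt_J dl0 dlb TE sB dr Cb0 HC sigma_cv nkI Vmu PhiP PsiP tfF tT r4.
apply: (JP (Q := fun k u => `|empD f' (V (nk k) u) + e k u (fun v => f' v * at_ (nk k) u (bker v)) -
  (E t (fun a => E t (dq f' f'' a)) + sintR (sg t) (fun z => E t (fz z)))| <= r)).
near=> i.
have q1 : (nk i.1).+1%:R^-1 <= r / 4 / (M + 1) by near: i.
have q2 : `|e i.1 i.2 (fun a => e i.1 i.2 (dq f' f'' a)) - E t (fun a => E t (dq f' f'' a))| <= r / 4 by near: i.
have q3 : forall z, dl <= ImC z -> `|e i.1 i.2 (fz z) - E t (fz z)| <= r / 4 / (Cb + 1) by near: i.
have q4 : `|at_ (nk i.1) i.2 (fun z => E t (fz z)) - sintR (sg t) (fun z => E t (fz z))| <= r / 4 by near: i.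
have iT : 0 <= i.2 <= T.
  have /andP[? ?] : 0 < i.2 < T by near: i; exact: J_in.
  by apply/andP; split; exact: ltW.
have q5 : `|empD f' (V (nk i.1) i.2) - e i.1 i.2 (fun a => e i.1 i.2 (dq f' f'' a))| <= r / 4.
  apply: le_trans (empD_dq f' f''M _) _.
    by move=> k l kl; case: (dr (nk i.1)) => _ [h _]; exact: h.
  apply: le_trans (ler_wpM2l M0 q1) _.
  by rewrite mulrCA; apply: ler_piMr; [exact: ltW|rewrite ler_pdivrMr // mul1r lerDl].
(* The order of summation is exchanged so that the poles act on one Lipschitz function of z, to
   which the bound [Cb] applies. *)
have ex : e i.1 i.2 (fun v => f' v * at_ (nk i.1) i.2 (bker v)) = at_ (nk i.1) i.2 (fun z => e i.1 i.2 (fz z)).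
  rewrite /empR /atomsH mulr_suml.
  under eq_bigr => k _ do rewrite mulr_sumr mulr_suml.
  rewrite exchange_big /=; apply: eq_bigr => j _.
  by rewrite mulr_suml mulr_sumr; apply: eq_bigr => k _; rewrite /fz; ring.
have q6 : `|at_ (nk i.1) i.2 (fun z => e i.1 i.2 (fz z) - E t (fz z))| <= Cb * (r / 4 / (Cb + 1)).
  apply: (at_le dl0 dlb TE sB dr HC PhiP) => //.
  apply: (lip_tf dl0 dlb TE (addr_ge0 Md2 Md2)) => [z w hz hw|z hz]; last exact: q3.
  have := FE_lip (pf_emp (V (nk i.1) i.2)) hz hw; have := FE_lip (pf_prob (mu t)) hz hw => h1 h2.
  rewrite (_ : _ - _ = (e i.1 i.2 (fz z) - e i.1 i.2 (fz w)) - (E t (fz z) - E t (fz w))); last by ring.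
  by apply: le_trans (ler_normB _ _) _; rewrite mulrDl; exact: lerD.
have q7 : Cb * (r / 4 / (Cb + 1)) <= r / 4.
  by rewrite mulrCA; apply: ler_piMr; [exact: ltW|rewrite ler_pdivrMr // mul1r lerDl].
rewrite at_B in q6; rewrite ex.
set a1 := empD _ _ in q5 *; set a2 := e _ _ _ in q5 q2; set a3 := E t _ in q2 *.
set b1 := at_ _ _ _ in q6 *; set b2 := at_ _ _ _ in q6 q4; set b3 := sintR _ _ in q4 *.
rewrite (_ : _ - _ = (a1 - a2) + (a2 - a3) + ((b1 - b2) + (b2 - b3))); last by ring.
apply: le_trans (ler_normD _ _) _.
by have := ler_normD (a1 - a2) (a2 - a3); have := ler_normD (b1 - b2) (b2 - b3); lra.
Unshelve. all: by end_near. Qed.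
End RealTest.

Theorem complex_equation (f : R -> C) t : C2bC f -> 0 < t < T ->
  is_cderiv (fun u => cint (mu u) (fun y => f y)) t
   (cint (mu t) (fun y1 => cint (mu t) (fun y2 => dquot f y1 y2))
    + sint (sg t) (fun z => cint (mu t) (fun y =>
         cder1 f y * (1 / (cR y - z) + 1 / (cR y - cconj z))))).
Proof.
move=> [hr hi] tT.
have key (p : R -> R) : C2b p -> der (fun u => E u p) t
    (E t (fun a => E t (dq (derive1 p) (derive1 (derive1 p)) a)) +
     sintR (sg t) (fun z => E t (fun v => derive1 p v * bker v z))).
  move=> [p1 [p2 [p3 [M hM]]]].
  have dp v : der p v (derive1 p v) by rewrite derive1E; exact: derivableP (p1 v).
  have ddp v : der (derive1 p) v (derive1 (derive1 p) v).
    by rewrite (derive1E (derive1 p)); exact: derivableP (p2 v).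
  by apply: (real_equation dp ddp p3 (M := M)) => // v; have [? [? ?]] := hM v.
have dR a y : ReC (dquot f a y) = dq (derive1 (fun y => ReC (f y))) (derive1 (derive1 (fun y => ReC (f y)))) a y.
  by rewrite /dquot /dq; case: eqP => // _; rewrite -cRV mulrC ReZ ReB mulrC.
have dI a y : ImC (dquot f a y) = dq (derive1 (fun y => ImC (f y))) (derive1 (derive1 (fun y => ImC (f y)))) a y.
  by rewrite /dquot /dq; case: eqP => // _; rewrite -cRV mulrC ImZ ImB mulrC.
have kE y z : cder1 f y * (1 / (cR y - z) + 1 / (cR y - cconj z)) = cR (bker y z) * cder1 f y.
  by rewrite !div1r bkerE mulrC.
set A := cint (mu t) _; set B := sint _ _.
have rA : ReC A = E t (fun a => E t (dq (derive1 (fun y => ReC (f y))) (derive1 (derive1 (fun y => ReC (f y)))) a)).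
  by congr (Rintegral _ _ _); apply/funext => a; congr (Rintegral _ _ _); apply/funext => y; rewrite -dR.
have iA : ImC A = E t (fun a => E t (dq (derive1 (fun y => ImC (f y))) (derive1 (derive1 (fun y => ImC (f y)))) a)).
  by congr (Rintegral _ _ _); apply/funext => a; congr (Rintegral _ _ _); apply/funext => y; rewrite -dI.
have rB : ReC B = sintR (sg t) (fun z => E t (fun v => derive1 (fun y => ReC (f y)) v * bker v z)).
  rewrite /B Re_sint; apply: eq_sintR => z.
  by congr (Rintegral _ _ _); apply/funext => y; rewrite kE ReZ mulrC.
have iB : ImC B = sintR (sg t) (fun z => E t (fun v => derive1 (fun y => ImC (f y)) v * bker v z)).
  rewrite /B Im_sint; apply: eq_sintR => z.
  by congr (Rintegral _ _ _); apply/funext => y; rewrite kE ImZ mulrC.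
have kr := key _ hr; have ki := key _ hi.
clearbody A B.
have E1 := etrans (ReD A B) (f_equal2 +%R rA rB).
have E2 := etrans (ImD A B) (f_equal2 +%R iA iB).
by apply/cderP; split; [exact (der_eq kr (esym E1))|exact (der_eq ki (esym E2))].
Qed.

Section HolomorphicTest.
Variables (h : C -> C) (part : C -> R).
Hypothesis holo : holoH h.
Hypothesis pB : forall z w, part (z - w) = part z - part w.
Hypothesis pZ : forall (c : R) z, part (cR c * z) = c * part z.
Hypothesis pS : forall n (F : 'I_n -> C), part (\sum_k F k) = \sum_k part (F k).
Hypothesis p_le : forall z, `|part z| <= nc z.
Hypothesis p_der : forall g t l, cder g t l -> der (fun u => part (g u)) t (part l).

Let kk (y : R) (z : C) : C := cR 2 * derive1 h z / (z - cR y).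

Let hd z : inH z -> hder h z (derive1 h z).
Proof. by move=> zH; apply/hderP; split => //; case: holo => hh _; exact: hh. Qed.

Let part_cont (g : C -> C) z : {for z, continuous g} -> {for z, continuous (fun w => part (g w))}.
Proof.
move=> /contCCP H; apply/contCRP => r r0; have [d d0 Hd] := H r r0; exists d => // w hw.
by rewrite -pB; apply: le_trans (p_le _) _; exact: Hd.
Qed.

Let h_cont z : inH z -> {for z, continuous h}.
Proof. by move=> zH; exact: (hder_cont (hd zH)). Qed.

Let kk_cont y z : inH z -> {for z, continuous (kk y)}.
Proof.
move=> zH; have z0 : z - cR y != 0 by apply: sub_neq0; rewrite gt_eqF.
have c1 : {for z, continuous (fun w : C => w - cR y)} 
  by apply/contCCP => r r0; exists r => // w hw; rewrite opprB addrA subrK; exact: ltW.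
have hc : {for z, continuous (derive1 h)} by case: holo => _ [H _]; exact: H.
have c2 := @continuousV (C : numFieldType) C (fun w : C => w - cR y) z z0 c1.
have c3 := @continuousM (C : numFieldType) C (fun=> cR 2) (derive1 h) z (@cst_continuous C C (cR 2) z) hc.
exact: (@continuousM (C : numFieldType) C _ _ z c3 c2).
Qed.

(** [part] stands for the real or the imaginary part. The derivative is an average over the
    particles of the functions [Fi], whose Lipschitz constant in y comes from [Cb]; their pointwise
    convergence is thus locally uniform and [weak_joint] applies. *)
Theorem holo_real_equation t : 0 < t < T ->
  der (fun u => sintR (sg u) (fun z => part (h z))) t
    (E t (fun y => sintR (sg t) (fun z => part (kk y z)))).
Proof.
move=> tT; have [d0 d00 Hd] := interval tT.
have tT' : 0 <= t <= T by case/andP: tT => ? ?; apply/andP; split; exact: ltW.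
have [M1 hM1] : exists M, forall z, inH z -> nc (derive1 h z) <= M.
  by case: holo => _ [_ [M hM]]; exists M => z zH; rewrite -lecRR -normE; exact: hM.
pose M := Num.max M1 0.
have M0 : 0 <= M by rewrite le_max lexx orbT.
have hM z : dl <= ImC z -> nc (derive1 h z) <= M.
  by move=> zd; rewrite le_max hM1 //; exact: lt_le_trans zd.
have q1 : 0 <= 2 / dl by rewrite divr_ge0 // ltW.
have q2 : 0 <= 2 / dl ^+ 2 by rewrite divr_ge0 // exprn_ge0 // ltW.
have kE y z : kk y z = derive1 h z * (cR 2 / (z - cR y)) by rewrite /kk mulrCA mulrA.
have kb y z : dl <= ImC z -> `|part (kk y z)| <= M * (2 / dl).
  move=> zd; apply: le_trans (p_le _) _; rewrite kE ncM; apply: ler_pM; rewrite ?nc_ge0 ?hM //.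
  by apply: kern_bound => //; exact: ge_norm_Im.
have kl y y' z : dl <= ImC z -> `|part (kk y z) - part (kk y' z)| <= M * (2 / dl ^+ 2) * `|y - y'|.
  move=> zd; rewrite -pB; apply: le_trans (p_le _) _; rewrite !kE -mulrBr ncM -mulrA.
  apply: ler_pM; rewrite ?nc_ge0 ?hM //.
  by apply: kern_lip => //; exact: ge_norm_Im.
have tk y : tf dl b T (fun z => part (kk y z)) (M * (2 / dl)).
  have [M' [hc _]] := cont_tf dl0 dlb TE (f := fun z => part (kk y z)) (fun z zH => @part_cont (kk y) z (@kk_cont y z zH)).
  by split => // z; apply: kb; exact: Rb_Im.
have tkB y y' : tf dl b T (fun z => part (kk y z) - part (kk y' z)) (M * (2 / dl ^+ 2) * `|y - y'|).
  split => [|z]; last by apply: kl; exact: Rb_Im.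
  have := @contC_lin _ _ _ (-1) (tk y).1 (tk y').1.
  rewrite (_ : (fun z => _ + _) = (fun z => part (kk y z) - part (kk y' z)) \o Rb) //.
  by apply/funext => w /=; rewrite mulN1r.
have [Mh th] := cont_tf dl0 dlb TE (f := fun z => part (h z)) (fun z zH => @part_cont h z (h_cont zH)).
pose Fi k u y := at_ (nk k) u (fun z => part (kk y z)).
pose G y := sintR (sg t) (fun z => part (kk y z)).
have L0 : 0 <= Cb * (M * (2 / dl ^+ 2)) by rewrite mulr_ge0 // mulr_ge0.
have Fb k u y : 0 <= u <= T -> `|Fi k u y| <= Cb * (M * (2 / dl)).
  by move=> uT; exact: (at_le dl0 dlb TE sB dr HC PhiP).
have Fl k u y y' : 0 <= u <= T -> `|Fi k u y - Fi k u y'| <= Cb * (M * (2 / dl ^+ 2)) * `|y - y'|.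
  by move=> uT; rewrite /Fi -at_B -mulrA; exact: (at_le dl0 dlb TE sB dr HC PhiP).
have Gb y : `|G y| <= Cb * (M * (2 / dl)).
  exact: (sigt_bound dl0 dlb TE HC sigma_cv).
have Gl y y' : `|G y - G y'| <= Cb * (M * (2 / dl ^+ 2)) * `|y - y'|.
  rewrite /G -(sigt_B dl0 dlb TE sigma PsiP (tk y) (tk y') tT') -mulrA.
  exact: (sigt_bound dl0 dlb TE HC sigma_cv).
apply: (@der_lim R (fun k u => at_ (nk k) u (fun z => part (h z))) (fun k u => e k u (Fi k u)) _ _ _ d0) => //.
- move=> k u /Hd uT.
  have uT' : 0 <= u <= T by case/andP: uT => ? ?; apply/andP; split; exact: ltW.
  have dj j : der (fun v => ((alpha (nk k) j)%:~R / (nk k).+1%:R) * part (h (S (nk k) v j))) u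
     (((alpha (nk k) j)%:~R / (nk k).+1%:R) * part (derive1 h (S (nk k) u j) * Mw (V (nk k)) u (S (nk k) u j))).
    have [_ [_ [_ [H _]]]] := dr (nk k).
    have [_ [HI [_ HD]]] := H j.
    by apply: derZ; apply: p_der; apply: (hder_comp (hd (HI u uT'))); apply/cderP; exact: HD.
  apply: der_eq (der_sum (index_enum _) (fun j _ => dj j)) _.
  rewrite /empR mulr_suml /Fi /atomsH.
  under [RHS]eq_bigr => l _ do rewrite mulr_suml.
  rewrite exchange_big /=; apply: eq_bigr => j _.
  rewrite /Mw mulr_sumr pS mulr_sumr; apply: eq_bigr => l _.
  have -> : derive1 h (S (nk k) u j) * (cR (2 / (nk k).+1%:R) / (S (nk k) u j - cR (V (nk k) u l))) =
     cR (nk k).+1%:R^-1 * kk (V (nk k) u l) (S (nk k) u j).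
    by rewrite kE [cR (2 / _)]cRM; ring.
  by rewrite pZ; ring.
- move=> u /Hd /andP[? ?]; apply: (@sigt_cvg _ _ _ _ _ _ _ _ _ _ dl0 dlb TE sB dr Cb Cb0 HC _ sigma_cv _ _ nkI Vmu _ PhiP _ PsiP _ _ _ th).
  by apply/andP; split; exact: ltW.
move=> r r0.
apply: (JP (Q := fun k u => `|e k u (Fi k u) - E t G| <= r)).
have H := @weak_joint R V T nk mu Vmu V_tail unit (fun=> True) t (fun i _ => Fi i.1 i.2) (fun _ => G)
   (Cb * (M * (2 / dl))) tT.
have B0 : 0 <= Cb * (M * (2 / dl)) by rewrite mulr_ge0 // mulr_ge0.
have jin : \forall i \near J t, 0 <= i.2 <= T.
  by apply: filterS (J_in tT) => i /andP[? ?]; apply/andP; split; exact: ltW.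
apply: filterS (H B0 _ _ _ _ r r0) => [i hi||||]; first exact: (hi tt).
- apply: filterS jin => i iT _ _; split; last by move=> y; exact: Fb.
  by apply: bm_lip => [y y'|y]; [exact: Fl|exact: Fb].
- by move=> _ _; split; [apply: bm_lip => [y y'|y]; [exact: Gl|exact: Gb]|].
- by move=> A u u0; have [d dd0 Hdd] := lip_luc1 Gl A u0; exists d => // _ _; exact: Hdd.
- move=> A u u0.
  have FJ : Filter (J t) by exact: filter_prod_filter.
  apply: filterS (@lip_net R _ (J t) FJ (fun i => Fi i.1 i.2) G _ L0 _ Gl _ A u u0) => [i hi _ _||]; first exact: hi.
    by apply: filterS jin => i iT y y'; exact: Fl.
  by move=> y v v0; exact: (sigt_J dl0 dlb TE sB dr Cb0 HC sigma_cv nkI Vmu PhiP PsiP (tk y) tT v0).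
Qed.
End HolomorphicTest.

Theorem holo_equation h t : holoH h -> 0 < t < T ->
  is_cderiv (fun u => sint (sg u) h) t
    (cint (mu t) (fun y => sint (sg t) (fun z => cR 2 * derive1 h z / (z - cR y)))).
Proof.
move=> holo tT; apply/cderP; split.
  have H := @holo_real_equation h (@ReC R) holo (@ReB R) (@ReZ R) _ (@Re_le_nc R) _ t tT.
  have {}H := H (fun n F => Re_sum _ _ _) (fun g t l => @proj1 _ _).
  have rE : ReC (cint (mu t) (fun y => sint (sg t) (fun z => cR 2 * derive1 h z / (z - cR y)))) =
     E t (fun y => sintR (sg t) (fun z => ReC (cR 2 * derive1 h z / (z - cR y)))).
    by congr (Rintegral _ _ _); apply/funext => y; rewrite Re_sint.
  by rewrite rE; apply: (der_ext _ erefl H) => u; rewrite Re_sint.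
have H := @holo_real_equation h (@ImC R) holo (@ImB R) (@ImZ R) _ (@Im_le_nc R) _ t tT.
have {}H := H (fun n F => Im_sum _ _ _) (fun g t l => @proj2 _ _).
have iE : ImC (cint (mu t) (fun y => sint (sg t) (fun z => cR 2 * derive1 h z / (z - cR y)))) =
   E t (fun y => sintR (sg t) (fun z => ImC (cR 2 * derive1 h z / (z - cR y)))).
  by congr (Rintegral _ _ _); apply/funext => y; rewrite Im_sint.
by rewrite iE; apply: (der_ext _ erefl H) => u; rewrite Im_sint.
Qed.
End LimitEquations.

(** * Regularisation by repulsion *)

Section PairInteraction.
Variable R : realType.
Local Notation C := R[i].

(* The forces between particles cancel pairwise, by antisymmetry. *)
Lemma pair_sum n (v : 'I_n.+1 -> R) (p : C) : (forall k l, k != l -> v k != v l) -> ImC p != 0 ->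
  \sum_k (p - cR (v k))^-1 ^+ 2 * (\sum_l (p - cR (v l))^-1 - \sum_(l | l != k) (cR (v k - v l))^-1) =
  \sum_k (p - cR (v k))^-1 ^+ 3.
Proof.
move=> vi p0; set c := fun k => (p - cR (v k))^-1.
have n0 k : p - cR (v k) != 0 by exact: sub_neq0.
pose U k l := c k ^+ 2 * (c l - (cR (v k - v l))^-1).
have -> : \sum_k (p - cR (v k))^-1 ^+ 2 * (\sum_l (p - cR (v l))^-1 - \sum_(l | l != k) (cR (v k - v l))^-1) =
   \sum_k c k ^+ 3 + \sum_k \sum_(l | l != k) U k l.
  rewrite -big_split; apply: eq_bigr => k _ /=.
  rewrite (bigD1 k) //= -addrA -sumrB mulrDr -/(c k) mulr_sumr; congr (_ + _).
  by rewrite [in RHS]exprS mulrC.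
suff -> : \sum_k \sum_(l | l != k) U k l = 0 by rewrite addr0.
have E : \sum_k \sum_(l | l != k) U k l = - \sum_k \sum_(l | l != k) U k l.
  rewrite {1}(exchange_big_dep xpredT) //= -sumrN; apply: eq_bigr => k _.
  rewrite -sumrN; apply: eq_big => l; first by rewrite eq_sym.
  move=> lk; rewrite eq_sym in lk.
  have d0 : cR (v l) - cR (v k) != 0 by rewrite -cRB cR_eq0 subr_eq0 vi // eq_sym.
  have d1 : cR (v k) - cR (v l) != 0 by rewrite -opprB oppr_eq0.
  rewrite /U /c !cRB; field.
  by rewrite d1 d0 !n0.
set X := LHS in E *.
have : X *+ 2 = 0 by rewrite mulr2n {1}E addNr.
by move/eqP; rewrite mulrn_eq0 /= => /eqP.
Qed.
End PairInteraction.

Section Regularisation.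
Variable R : realType.
Local Notation C := R[i].
Variables (n m : nat) (x : 'I_n.+1 -> R) (s : 'I_m -> C) (a : 'I_m -> int) (T : R)
  (W : R -> 'I_n.+1 -> R) (S : R -> 'I_m -> C).
Hypothesis T0 : 0 < T.
Hypothesis dr : drivingSol x s a T W S.
Local Notation bf u v := (atomsH n a (S u) (bker v)).
Variables (beta L : R).
Hypothesis L0 : 0 <= L.
Hypothesis bB : forall u v, 0 <= u <= T -> `|bf u v| <= beta.
Hypothesis bL : forall u v w, 0 <= u <= T -> `|bf u v - bf u w| <= L * `|v - w|.

Let W_cont k : {within `[0, T], continuous (fun u => W u k)}.
Proof. by case: dr => _ [_ []]. Qed.

Let W_neq u : 0 <= u <= T -> forall k l, k != l -> W u k != W u l.
Proof. by case: dr => _ [h _]; exact: h. Qed.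

Let b_cont v : {within `[0, T], continuous (fun u => bf u v)}.
Proof.
rewrite /atomsH; apply: within_sumf => j.
have [_ [_ [_ [H _]]]] := dr; have hj : gsol (Mw W) T (s j) (fun u => S u j) := H j.
have [d d0 Hd] := gsol_minIm (ltW T0) hj.
have [_ [_ [cS _]]] := hj.
apply: within_mul; first by apply: within_cont => u _; exact: cst_continuous.
apply/within_contP => u uT e e0.
have q0 : 0 < 2 / d ^+ 2 by rewrite divr_gt0 // exprn_gt0.
have [r r0 Hr] := (withinC_eps _ _ _).1 cS u uT (e / (2 / d ^+ 2)) (divr_gt0 e0 q0).
exists r => // w wT wu; have h := Hr w wT wu.
have := bker_lip v v d0 (Hd w wT) (Hd u uT); rewrite subrr normr0 addr0 => h2.
by apply: le_trans h2 _; rewrite mulrC -ler_pdivlMr.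
Qed.

Variables (t0 : R) (z : C).
Hypothesis t0T : 0 < t0 < T.
Hypothesis zH : 0 < ImC z.
Local Notation y0 := (ImC z).

Let t0p : 0 < t0. Proof. by case/andP: t0T. Qed.
Let revT (tau : R) : 0 <= tau <= t0 -> 0 <= t0 - tau <= T.
Proof. by case/andP: t0T => ? ? /andP[? ?]; apply/andP; split; lra. Qed.

Lemma Mw_Im u (w : C) : ImC (Mw W u w) = - (2 * ImC w * empR (W u) (fun v => (nc (w - cR v) ^+ 2)^-1)).
Proof.
rewrite /Mw Im_sum /empR mulrA mulr_sumr mulr_suml -sumrN; apply: eq_bigr => k _.
rewrite ImZ ImV -nc_sq ImB Im_cR subr0; ring.
Qed.

Lemma emp_inv_ge0 u (w : C) : 0 <= empR (W u) (fun v => (nc (w - cR v) ^+ 2)^-1).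
Proof. by rewrite /empR divr_ge0 // sumr_ge0 // => k _; rewrite invr_ge0 sqr_ge0. Qed.

Let F (tau : R) (X : bool -> R) (i : bool) : R :=
  let u := clampT T (t0 - tau) in
  let M := Mw W u (liftIm y0 (Complex (X true) (X false))) in
  if i then - (ReC M + bf u (X true)) else - ImC M.

(** A characteristic run backwards from z at time t0. The real drift b(Re Z) is added to the Loewner
    field so that, in the difference between Z and V_k, the drifts enter through b(Re Z) - b(V_k),
    which L controls. In reversed time the height does not decrease, so that the lift to height Im z
    never acts. *)
Let back_ex : exists p : R -> C, [/\ p 0 = z,
  forall tau, 0 < tau -> cder p tau (- (Mw W (clampT T (t0 - tau)) (liftIm y0 (p tau))
     + cR (bf (clampT T (t0 - tau)) (ReC (p tau))))) &
  exists2 K : R, 0 <= K & forall u v, nc (p u - p v) <= K * `|u - v|].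
Proof.
have cT u := clampT_in u (ltW T0).
have b0 : 0 <= beta by have := bB 0 (cT 0); exact: le_trans (normr_ge0 _).
have q1 : 0 <= 2 / y0 by rewrite divr_ge0 // ltW.
have q2 : 0 <= 2 / y0 ^+ 2 by rewrite divr_ge0 // exprn_ge0 // ltW.
have FB tau X i : `|F tau X i| <= 2 / y0 + beta.
  have [h _] := Mw_good W (clampT T (t0 - tau)) zH (lift_ge y0 (Complex (X true) (X false))) (lift_ge y0 0).
  case: i; rewrite /F normrN.
    apply: le_trans (ler_normD _ _) _; apply: lerD; last exact: bB.
    exact: le_trans (Re_le_nc _) h.
  by apply: le_trans (le_trans (Im_le_nc _) h) _; rewrite lerDl.
have FL tau X Y (d : R) i : (forall j, `|X j - Y j| <= d) -> `|F tau X i - F tau Y i| <= (2 / y0 ^+ 2 * 2 + L) * d.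
  move=> h; set zX := Complex (X true) (X false); set zY := Complex (Y true) (Y false).
  have [_ h1] := Mw_good W (clampT T (t0 - tau)) zH (lift_ge y0 zX) (lift_ge y0 zY).
  have h2 : nc (liftIm y0 zX - liftIm y0 zY) <= 2 * d.
    apply: le_trans (lift_lip _ _ _) _; apply: le_trans (nc_le _) _.
    by rewrite ReB ImB; have := h true; have := h false; rewrite /ReC /ImC /=; lra.
  have h3 := le_trans h1 (ler_wpM2l q2 h2).
  have d0 : 0 <= d := le_trans (normr_ge0 _) (h true).
  have Ld : 0 <= L * d by rewrite mulr_ge0.
  case: i; rewrite /F -/zX -/zY -opprD normrN.
    rewrite (_ : _ + _ - _ = ReC (Mw W (clampT T (t0 - tau)) (liftIm y0 zX) - Mw W (clampT T (t0 - tau)) (liftIm y0 zY)) +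
       (bf (clampT T (t0 - tau)) (X true) - bf (clampT T (t0 - tau)) (Y true))); last by rewrite ReB; ring.
    apply: le_trans (ler_normD _ _) _.
    rewrite mulrDl -mulrA; apply: lerD; first exact: le_trans (Re_le_nc _) h3.
    by apply: le_trans (bL _ _ (cT _)) _; apply: ler_wpM2l.
  rewrite -ImB mulrDl -mulrA; apply: le_trans (_ : _ <= 2 / y0 ^+ 2 * (2 * d)) _; last by rewrite lerDl.
  by apply: le_trans h3; exact: Im_le_nc.
have Fc X i : continuous (fun tau => F tau X i).
  have revc : continuous (fun tau : R => t0 - tau).
    by move=> tau; apply: cvgB; [exact: cvg_cst|exact: cvg_id].
  have lz : inH (liftIm y0 (Complex (X true) (X false))).
    by apply: lt_le_trans zH _; exact: lift_ge.
  have [cr ci] := (withinCP _ _ _).1 (Mw_tcont W_cont lz).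
  have cr' := clampT_cont (ltW T0) cr; have ci' := clampT_cont (ltW T0) ci.
  have cb' := clampT_cont (ltW T0) (@b_cont (X true)).
  case: i => tau; rewrite /F; apply: cvgN.
    apply: cvgD.
      exact: (@continuous_comp _ _ _ (fun tau : R => t0 - tau) (fun u => ReC (Mw W (clampT T u) _)) tau (revc tau) (cr' _)).
    exact: (@continuous_comp _ _ _ (fun tau : R => t0 - tau) (fun u => bf (clampT T u) (X true)) tau (revc tau) (cb' _)).
  exact: (@continuous_comp _ _ _ (fun tau : R => t0 - tau) (fun u => ImC (Mw W (clampT T u) _)) tau (revc tau) (ci' _)).
have L1 : 0 <= 2 / y0 ^+ 2 * 2 + L by rewrite addr_ge0 // mulr_ge0.
have [y [yi dy ly]] := @picard R bool F _ _ L1 FB FL Fc (fun i : bool => if i then ReC z else ImC z).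
exists (fun tau => Complex (y tau true) (y tau false)); split.
- by rewrite yi; case: (z).
- move=> tau tau0; split.
    by apply: der_eq (dy tau true tau0) _; rewrite /F ReN ReD Re_cR.
  by apply: der_eq (dy tau false tau0) _; rewrite /F ImN ImD Im_cR addr0.
exists (2 * (2 / y0 + beta)); first by rewrite mulr_ge0 // addr_ge0.
move=> u v; apply: le_trans (nc_le _) _; rewrite ReB ImB /ReC /ImC /=.
by have := ly true u v; have := ly false u v; lra.
Qed.

Section Characteristic.
Variable p : R -> C.
Hypothesis p0 : p 0 = z.
Hypothesis dp : forall tau, 0 < tau -> cder p tau (- (Mw W (clampT T (t0 - tau)) (liftIm y0 (p tau))
     + cR (bf (clampT T (t0 - tau)) (ReC (p tau))))).
Hypothesis pc : exists2 K : R, 0 <= K & forall u v, nc (p u - p v) <= K * `|u - v|.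

Let p_within (c d : R) : {within `[c, d], continuous p}.
Proof. by have [K K0 h] := pc; exact: (lip_within K0 h). Qed.

Let p_Im tau : 0 <= tau -> y0 <= ImC (p tau).
Proof.
move=> tau0; rewrite -[leLHS](congr1 (@ImC R) p0) -lerN2.
apply: (@nonincr _ (fun u => - ImC (p u)) (fun u => ImC (Mw W (clampT T (t0 - u)) (liftIm y0 (p u))))) => //.
- have [_ c] := (withinCP _ _ _).1 (@p_within 0 tau).
  by apply: (@within_comp2 _ _ _ (fun u => ImC (p u)) (fun v => - v)) => // v; apply: cvgN; exact: cvg_id.
- move=> u /andP[u0 _]; have [_ h] := dp u0; apply: der_eq (derN h) _.
  by rewrite ImN ImD Im_cR addr0 opprK.
move=> u _; rewrite Mw_Im oppr_le0 mulr_ge0 ?emp_inv_ge0 // mulr_ge0 //.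
by apply: le_trans (ltW zH) (lift_ge _ _).
Qed.

Let dp' tau : 0 < tau < t0 -> cder p tau (- (Mw W (t0 - tau) (p tau) + cR (bf (t0 - tau) (ReC (p tau))))).
Proof.
move=> /andP[h0 h1]; have h := dp h0.
by rewrite lift_id ?p_Im ?ltW // clampT_id // in h; apply: revT; apply/andP; split; exact: ltW.
Qed.

Let Mt tau := Mw W (t0 - tau) (p tau).
Let A tau := empR (W (t0 - tau)) (fun v => (nc (p tau - cR v) ^+ 2)^-1).
Let mm tau := - ImC (Mt tau).

Let mmE tau : mm tau = 2 * ImC (p tau) * A tau.
Proof. by rewrite /mm /Mt Mw_Im opprK. Qed.

Let A_ge0 tau : 0 <= A tau. Proof. exact: emp_inv_ge0. Qed.

Let Mt_within : {within `[0, t0], continuous Mt}.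
Proof.
apply/withinC_eps => u uT e e0.
have e2 : 0 < e / 2 by rewrite divr_gt0.
have pH : inH (p u) by apply: lt_le_trans zH (p_Im _); case/andP: uT.
have [d1 d10 H1] := (withinC_eps _ _ _).1 (Mw_tcont W_cont pH) (t0 - u) (revT uT) _ e2.
have [K K0 hK] := pc.
have q0 : 0 < 2 / y0 ^+ 2 * K + 1 by rewrite ltr_wpDl // mulr_ge0 // divr_ge0 // exprn_ge0 // ltW.
exists (Num.min d1 (e / 2 / (2 / y0 ^+ 2 * K + 1))); first by rewrite lt_min d10 divr_gt0.
move=> v vT; rewrite lt_min ltr_pdivlMr // => /andP[h1 h2].
have a1 := H1 (t0 - v) (revT vT) (ltac:(by rewrite (_ : t0 - v - (t0 - u) = - (v - u)) ?normrN //; ring)).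
have [_ a2] := Mw_good W (t0 - v) zH (@p_Im v (proj1 (andP vT))) (@p_Im u (proj1 (andP uT))).
have a3 : 2 / y0 ^+ 2 * nc (p v - p u) <= e / 2.
  have : 2 / y0 ^+ 2 * nc (p v - p u) <= 2 / y0 ^+ 2 * (K * `|v - u|).
    by apply: ler_wpM2l => //; rewrite divr_ge0 // exprn_ge0 // ltW.
  by have := normr_ge0 (v - u); move: h2; rewrite mulrDr mulr1 mulrC -mulrA; lra.
have := nc_tri (Mw W (t0 - v) (p v)) (Mw W (t0 - v) (p u)) (Mw W (t0 - u) (p u)).
by rewrite /Mt; lra.
Qed.

Let c k tau : C := (p tau - cR (W (t0 - tau) k))^-1.

Let dMt_val tau : C := \sum_k (cR (2 / n.+1%:R) ^+ 2 * c k tau ^+ 3 +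
   cR (2 / n.+1%:R) * (cR (bf (t0 - tau) (ReC (p tau)) - bf (t0 - tau) (W (t0 - tau) k)) * c k tau ^+ 2)).

(** By [pair_sum] the pair forces cancel up to the cubes [c k tau ^+ 3], of order 1/N; the other
    surviving terms carry the differences of the drifts. *)
Let dMt tau : 0 < tau < t0 -> cder Mt tau (dMt_val tau).
Proof.
move=> tauT; have rT : 0 < t0 - tau < T by case/andP: t0T => ? ?; case/andP: tauT => ? ?; apply/andP; split; lra.
have rT' : 0 <= t0 - tau <= T by case/andP: rT => ? ?; apply/andP; split; exact: ltW.
have pI : ImC (p tau) != 0.
  by rewrite gt_eqF //; apply: lt_le_trans zH (p_Im _); case/andP: tauT => /ltW.
pose N2 : C := cR (2 / n.+1%:R).
pose DW k := \sum_(l | l != k) (2 / n.+1%:R) / (W (t0 - tau) k - W (t0 - tau) l) + bf (t0 - tau) (W (t0 - tau) k).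
have drev : der (fun u : R => t0 - u) tau (- 1).
  by apply: der_ext (derB (derC t0 tau) (derI tau)) => //; rewrite sub0r.
have dV k : cder (fun u => cR (W (t0 - u) k)) tau (cR (- DW k)).
  apply: (cder_cR (f := fun u => W (t0 - u) k)); apply: der_eq (@der_comp R (fun u => W u k) (fun u => t0 - u) tau _ _ (driving_der dr k rT) drev) _.
  by rewrite mulrN1.
have dS := @cder_sum R _ (index_enum _) xpredT (fun k u => N2 / (p u - cR (W (t0 - u) k))) tau _
  (fun k _ => cderZ N2 (cderV (sub_neq0 _ pI) (cderB (dp' tauT) (dV k)))).
apply: cder_eq dS _ => /=.
rewrite -/(Mt tau).
have MtE : Mt tau = N2 * \sum_k c k tau by rewrite /Mt /Mw mulr_sumr.
have DE k : cR (DW k) = N2 * \sum_(l | l != k) (cR (W (t0 - tau) k - W (t0 - tau) l))^-1 + cR (bf (t0 - tau) (W (t0 - tau) k)).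
  rewrite cRD cR_sum mulr_sumr; congr (_ + _); apply: eq_bigr => l _.
  by rewrite [cR (_ / (_ - _))]cRM cRV.
rewrite /dMt_val big_split /= -!mulr_sumr -(pair_sum (W_neq rT') pI) -/(c _ _).
rewrite !mulr_sumr -big_split; apply: eq_bigr => k _ /=.
rewrite -/(c k tau) cRN opprK DE MtE cRB -/N2 /c; ring.
Qed.

Let nI : 0 <= n.+1%:R^-1 :> R. Proof. by rewrite invr_ge0. Qed.

Let nc_c k tau : 0 <= tau -> nc (c k tau) <= y0^-1.
Proof.
by move=> h; apply: res_bound => //; apply: ge_norm_Im; exact: p_Im.
Qed.

Let sumA tau : \sum_k nc (c k tau) ^+ 2 = n.+1%:R * A tau.
Proof.
rewrite /A /empR mulrCA divff ?mulr1 ?pnatr_eq0 //.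
by apply: eq_bigr => k _; rewrite /c ncV exprVn.
Qed.

Let bdiff k tau : 0 <= tau <= t0 ->
  `|bf (t0 - tau) (ReC (p tau)) - bf (t0 - tau) (W (t0 - tau) k)| <= L * `|ReC (p tau) - W (t0 - tau) k|.
Proof. by move=> h; apply: bL; exact: revT. Qed.

Let Re_c k tau : ReC (p tau - cR (W (t0 - tau) k)) = ReC (p tau) - W (t0 - tau) k.
Proof. by rewrite ReB Re_cR. Qed.

Let e1 tau : 0 <= tau <= t0 -> nc (\sum_k cR (2 / n.+1%:R) ^+ 2 * c k tau ^+ 3) <= 4 / n.+1%:R * y0^-1 * A tau.
Proof.
move=> /andP[h _]; apply: le_trans (nc_sum _ _ _) _.
have -> : 4 / n.+1%:R * y0^-1 * A tau = \sum_k (4 / n.+1%:R ^+ 2 * y0^-1 * nc (c k tau) ^+ 2).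
  have E (N Y B : R) : N != 0 -> Y != 0 -> 4 / N * Y^-1 * B = 4 / N ^+ 2 * Y^-1 * (N * B).
    by move=> N0 Y0; field; rewrite N0 Y0.
  by rewrite -mulr_sumr sumA; apply: E; [rewrite pnatr_eq0|rewrite gt_eqF].
apply: ler_sum => k _; rewrite ncM [cR _ ^+ 2]expr2 -cRM nc_cR ger0_norm; last by rewrite mulr_ge0 // divr_ge0.
have -> : nc (c k tau ^+ 3) = nc (c k tau) * nc (c k tau) ^+ 2 by rewrite exprS expr2 !ncM expr2.
have -> : 2 / n.+1%:R * (2 / n.+1%:R) = 4 / n.+1%:R ^+ 2 :> R by rewrite expr2 invfM; ring.
rewrite -[leRHS]mulrA; apply: ler_wpM2l; first by rewrite mulr_ge0 // invr_ge0 exprn_ge0.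
by apply: ler_wpM2r; [exact: sqr_ge0|exact: nc_c].
Qed.

(** With X = Re p - V_k and c = 1/(p - V_k), the imaginary part of c^2 is -2 X (Im p) |c|^4, the
    difference of the drifts is at most L |X|, and X^2 |c|^2 <= 1; the drift terms thus give at most
    2 L m. The cubes give at most m once N is at least 2 / y0^2. *)
Let m_le tau : 0 < tau < t0 -> 2 / y0 ^+ 2 <= n.+1%:R -> - ImC (dMt_val tau) <= (2 * L + 1) * mm tau.
Proof.
move=> tauT hn; have tT : 0 <= tau <= t0 by case/andP: tauT => ? ?; apply/andP; split; exact: ltW.
have yp := @p_Im tau (proj1 (andP tT)).
have Y0 : 0 < ImC (p tau) := lt_le_trans zH yp.
rewrite /dMt_val big_split /= ImD.
have h1 := le_trans (Im_le_nc _) (e1 tT).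
have h2 : - ImC (\sum_k cR (2 / n.+1%:R) * (cR (bf (t0 - tau) (ReC (p tau)) - bf (t0 - tau) (W (t0 - tau) k)) * c k tau ^+ 2))
    <= 2 * L * mm tau.
  rewrite Im_sum -sumrN mmE.
  have -> : 2 * L * (2 * ImC (p tau) * A tau) = \sum_k 4 * L * ImC (p tau) / n.+1%:R * nc (c k tau) ^+ 2.
    have E (N Y B : R) : N != 0 -> 2 * L * (2 * Y * B) = 4 * L * Y / N * (N * B) by move=> N0; field.
    by rewrite -mulr_sumr sumA; apply: E; rewrite pnatr_eq0.
  apply: ler_sum => k _; rewrite !ImZ.
  set D := _ - bf _ (W _ _); set X := ReC (p tau) - W (t0 - tau) k.
  have hD : `|D| <= L * `|X| by exact: bdiff.
  have Ic : ImC (c k tau ^+ 2) = - (2 * X * ImC (p tau)) * (nc (c k tau) ^+ 2) ^+ 2.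
    rewrite expr2 ImM /c ReV ImV -nc_sq Re_c -/X ImB Im_cR subr0 ncV exprVn; ring.
  rewrite Ic; set q := nc (c k tau) ^+ 2.
  have q0 : 0 <= q := sqr_ge0 _.
  have Xq : X ^+ 2 * q <= 1.
    rewrite /q /c ncV exprVn nc_sq Re_c -/X ImB Im_cR subr0 ler_pdivrMr ?mul1r ?lerDl ?sqr_ge0 //.
    by rewrite ltr_wpDl ?sqr_ge0 // exprn_gt0.
  have DX : D * X <= L * X ^+ 2.
    apply: le_trans (ler_norm _) _; rewrite normrM -[X ^+ 2]real_normK ?num_real // expr2 mulrA.
    by apply: ler_wpM2r.
  have DXq : D * X * q <= L.
    apply: (@le_trans _ _ (L * (X ^+ 2 * q))); first by rewrite mulrA; apply: ler_wpM2r.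
    by apply: ler_piMr.
  have -> : - (2 / n.+1%:R * (D * (- (2 * X * ImC (p tau)) * q ^+ 2))) = 4 * ImC (p tau) / n.+1%:R * q * (D * X * q).
    by ring.
  have -> : 4 * L * ImC (p tau) / n.+1%:R * q = 4 * ImC (p tau) / n.+1%:R * q * L by ring.
  apply: ler_wpM2l => //; apply: mulr_ge0 => //; apply: mulr_ge0 => //; apply: mulr_ge0 => //; exact: ltW.
have h3 : 4 / n.+1%:R * y0^-1 * A tau <= mm tau.
  rewrite mmE; apply: ler_wpM2r; first exact: A_ge0.
  have N0 : 0 < n.+1%:R :> R by rewrite ltr0n.
  rewrite mulrAC ler_pdivrMr //.
  have : 4 / y0 <= 2 * y0 * n.+1%:R.
    have -> : 4 / y0 = 2 * y0 * (2 / y0 ^+ 2) by field; rewrite gt_eqF.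
    by apply: ler_wpM2l => //; rewrite mulr_ge0 // ltW.
  have : 2 * y0 * n.+1%:R <= 2 * ImC (p tau) * n.+1%:R.
    by apply: ler_wpM2r => //; apply: ler_wpM2l.
  lra.
move: h1; rewrite ler_norml => /andP[h1 _].
by rewrite opprD [leRHS]mulrDl mul1r [leLHS]addrC; apply: lerD => //; apply: le_trans h3; rewrite lerNl.
Qed.

Let cc := 2 * L + 1.
Let Q := expR (cc * t0) / 2.
Let cc0 : 0 <= cc. Proof. by rewrite addr_ge0 // mulr_ge0. Qed.
Let Q0 : 0 < Q. Proof. by rewrite divr_gt0 // expR_gt0. Qed.

Let der_y tau : 0 < tau < t0 -> der (fun u => ImC (p u)) tau (mm tau).
Proof. by move=> h; have [_ H] := dp' h; apply: der_eq H _; rewrite ImN ImD Im_cR addr0. Qed.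

Let mm_ge0 tau : 0 <= tau -> 0 <= mm tau.
Proof.
move=> h; rewrite mmE mulr_ge0 // mulr_ge0 //.
exact: le_trans (ltW zH) (p_Im h).
Qed.

Let der_exp tau : der (fun u : R => expR (cc * u)) tau (cc * expR (cc * tau)).
Proof.
have h : der (fun u : R => cc * u) tau cc by apply: der_eq (derZ cc (derI tau)) _; rewrite mulr1.
by rewrite mulrC; apply: (der_comp (f := expR) (is_derive_expR _) h).
Qed.

(** The height y satisfies y' = m = 2 y A. As m' <= cc m, a large m at tau was already large before
    and has lifted y, so that tau m <= exp(cc tau) y. Division by 2 y leaves a bound independent of
    the starting height. *)
Let A_le tau : 2 / y0 ^+ 2 <= n.+1%:R -> 0 < tau <= t0 -> A tau <= Q / tau.
Proof.
move=> hn /andP[h0 h1].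
have [_ cI] := (withinCP _ _ _).1 (@p_within 0 tau).
have [_ cM] := (withinCP _ _ _).1 Mt_within.
have cm : {within `[0, tau], continuous mm}.
  apply: (@within_comp2 _ _ _ (fun u => ImC (Mt u)) (fun v => - v)) => [v|]; first by apply: cvgN; exact: cvg_id.
  exact: within_sub (lexx _) h1 cM.
have cid : {within `[0, tau], continuous (fun u : R => u)} by apply: within_cont => u _; exact: cvg_id.
have cexp : {within `[0, tau], continuous (fun u : R => expR (cc * u))}.
  by apply: within_cont => u _; exact: der_cont (@der_exp u).
(* u m - e^(cu) Im Z is nonpositive at u = 0, and its derivative is at most c times itself *)
have cw : {within `[0, tau], continuous (fun u => u * mm u - expR (cc * u) * ImC (p u))}.
  by apply: within_diff; apply: within_mul.
have H := @gronwall R (fun u => u * mm u - expR (cc * u) * ImC (p u))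
  (fun u => 1 * mm u + u * (- ImC (dMt_val u)) - (cc * expR (cc * u) * ImC (p u) + expR (cc * u) * mm u))
  0 tau cc 0 (ltW h0) cc0 (lexx 0) cw.
have {}H : tau * mm tau - expR (cc * tau) * ImC (p tau) <= (0 * mm 0 - expR (cc * 0) * ImC (p 0) + 0 * (tau - 0)) * expR (cc * (tau - 0)).
  apply: H => u /andP[u0 u1]; have uT : 0 < u < t0 by rewrite u0 (lt_le_trans u1).
    apply: derB; apply: derM; [exact: derI| |exact: der_exp|exact: der_y].
    by apply: derN; case: (dMt uT).
  have a1 := m_le uT hn; rewrite -/cc in a1.
  have a2 : 1 <= expR (cc * u) by rewrite -expR0 ler_expR mulr_ge0 // ltW.
  have a3 := mm_ge0 (ltW u0).
  have : u * (- ImC (dMt_val u)) <= u * (cc * mm u) by apply: ler_wpM2l => //; exact: ltW.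
  have : 0 <= (expR (cc * u) - 1) * mm u by rewrite mulr_ge0 // subr_ge0.
  rewrite !mulrBl; lra.
have {}H : tau * mm tau - expR (cc * tau) * ImC (p tau) <= 0.
  apply: le_trans H _; rewrite mul0r mulr0 expR0 mul1r p0 mul0r addr0 sub0r mulNr oppr_le0.
  by rewrite mulr_ge0 ?expR_ge0 // ltW.
have Y0 : 0 < ImC (p tau) := lt_le_trans zH (p_Im (ltW h0)).
have e2 : expR (cc * tau) <= expR (cc * t0) by rewrite ler_expR ler_wpM2l.
rewrite ler_pdivlMr // /Q ler_pdivlMr //.
have : (A tau * tau * 2) * ImC (p tau) <= expR (cc * t0) * ImC (p tau).
  apply: (@le_trans _ _ (expR (cc * tau) * ImC (p tau))); last by rewrite ler_pM2r.
  by move: H; rewrite mmE; lra.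
by rewrite ler_pM2r.
Qed.

(** Cauchy-Schwarz in the form 2 |c| <= lam + |c|^2 / lam. *)
Let avg_c tau (lam : R) : 0 < lam -> A tau <= lam ^+ 2 -> (\sum_k nc (c k tau)) / n.+1%:R <= lam.
Proof.
move=> l0 hA; rewrite ler_pdivrMr ?ltr0n //.
have h k : nc (c k tau) <= lam / 2 + nc (c k tau) ^+ 2 / (2 * lam).
  rewrite -subr_ge0.
  have -> : lam / 2 + nc (c k tau) ^+ 2 / (2 * lam) - nc (c k tau) = (lam - nc (c k tau)) ^+ 2 / (2 * lam).
    by field; rewrite gt_eqF.
  by rewrite divr_ge0 ?sqr_ge0 // mulr_ge0 // ltW.
apply: le_trans (ler_sum _ (fun k _ => h k)) _.
rewrite big_split /= sumr_const card_ord -mulr_suml sumA -mulr_natr.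
have : A tau / (2 * lam) <= lam / 2.
  rewrite ler_pdivrMr ?mulr_gt0 //; apply: le_trans hA _.
  by rewrite (_ : lam / 2 * (2 * lam) = lam ^+ 2) //; field.
have N0 : 0 <= n.+1%:R :> R by [].
move=> hh; have := ler_wpM2l N0 hh; lra.
Qed.

(** The difference of the drifts times |c|^2 is at most L |c|, and the mean of |c| is at most the
    square root of the bound on A: the singularity at tau = 0 is only of order tau^(-1/2). *)
Let dM_bound tau : 2 / y0 ^+ 2 <= n.+1%:R -> 0 < tau < t0 ->
  nc (dMt_val tau) <= 2 * L * Num.sqrt (Q / tau) + 4 / n.+1%:R * y0^-1 ^+ 3.
Proof.
move=> hn tauT; have /andP[h0 h1] := tauT.
have tT : 0 <= tau <= t0 by apply/andP; split; exact: ltW.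
rewrite /dMt_val big_split /=; apply: le_trans (ncD _ _) _; rewrite addrC; apply: lerD; last first.
  apply: le_trans (e1 tT) _; rewrite -!mulrA; apply: ler_wpM2l => //; apply: ler_wpM2l => //.
  rewrite exprS; apply: ler_wpM2l; first by rewrite invr_ge0 ltW.
  rewrite /A -[leRHS]ger0_norm ?sqr_ge0 //; apply: le_trans (ler_norm _) _; apply: le_trans (emp_bound (M := y0^-1 ^+ 2) _ _) _.
    move=> v; rewrite ger0_norm ?invr_ge0 ?sqr_ge0 // -exprVn lerXn2r ?nnegrE ?invr_ge0 ?nc_ge0 // ?(ltW zH) //.
    by rewrite -ncV; apply: res_bound => //; apply: ge_norm_Im; apply: p_Im; exact: ltW.
  exact: ler_norm.
set lam := Num.sqrt (Q / tau).
have l0 : 0 < lam by rewrite sqrtr_gt0 divr_gt0.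
have hA : A tau <= lam ^+ 2 by rewrite sqr_sqrtr; [apply: A_le => //; rewrite h0 ltW|apply: divr_ge0; exact: ltW].
apply: le_trans (nc_sum _ _ _) _.
apply: (@le_trans _ _ (2 * L * ((\sum_k nc (c k tau)) / n.+1%:R))); last first.
  by apply: ler_wpM2l; [rewrite mulr_ge0|exact: avg_c].
rewrite mulrA mulr_sumr mulr_suml; apply: ler_sum => k _.
rewrite !ncM !nc_cR ger0_norm ?divr_ge0 //.
have hX : `|ReC (p tau) - W (t0 - tau) k| * nc (c k tau) <= 1.
  have c0 : p tau - cR (W (t0 - tau) k) != 0.
    by apply: sub_neq0; rewrite gt_eqF //; apply: lt_le_trans zH (p_Im (ltW h0)).
  rewrite /c ncV ler_pdivrMr ?nc_gt0 // mul1r -Re_c; exact: Re_le_nc.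
have hD := @bdiff k tau tT.
have nc0' := nc_ge0 (c k tau).
rewrite (_ : 2 * L * nc (c k tau) / n.+1%:R = 2 / n.+1%:R * (L * nc (c k tau))); last by ring.
apply: ler_wpM2l; first by rewrite divr_ge0.
rewrite mulrA; apply: ler_wpM2r => //.
apply: le_trans (ler_wpM2r nc0' hD) _; rewrite -mulrA; exact: ler_piMr.
Qed.

Let g tau : R := 4 * L * Num.sqrt Q * Num.sqrt tau + 4 / n.+1%:R * y0^-1 ^+ 3 * tau.

Let der_g tau : 0 < tau -> der g tau (2 * L * Num.sqrt (Q / tau) + 4 / n.+1%:R * y0^-1 ^+ 3).
Proof.
move=> h; apply: der_eq (derD (derZ _ (is_derive1_sqrt h)) (derZ _ (derI tau))) _.
rewrite mulr1 (sqrtrM tau^-1 (ltW Q0)) (sqrtrV (ltW h)); congr (_ + _).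
by field; rewrite gt_eqF // sqrtr_gt0.
Qed.

Let comp_bound (f df : R -> R) : {within `[0, t0], continuous f} ->
  (forall u, 0 < u < t0 -> der f u (df u)) ->
  (forall u, 0 < u < t0 -> `|df u| <= 2 * L * Num.sqrt (Q / u) + 4 / n.+1%:R * y0^-1 ^+ 3) ->
  `|f 0| <= `|f t0| + g t0.
Proof.
move=> fc fd fb.
have gc : {within `[0, t0], continuous g}.
  apply: within_cont => u _; apply: cvgD; apply: cvgM; try exact: cvg_cst.
    exact: sqrt_continuous.
  exact: cvg_id.
have g0 : g 0 = 0 by rewrite /g sqrtr0 !mulr0 addr0.
have a1 := le_compare (ltW t0p) fc gc fd (fun u hu => der_g (proj1 (andP hu))) (fun u hu => le_trans (ler_norm _) (fb u hu)).
have fN : {within `[0, t0], continuous (fun u => - f u)}.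
  by apply: (@within_comp2 _ _ _ f (fun v => - v)) => // v; apply: cvgN; exact: cvg_id.
have a2 := le_compare (ltW t0p) fN gc (fun u hu => derN (fd u hu)) (fun u hu => der_g (proj1 (andP hu)))
  (fun u hu => le_trans (ler_norm _) (ltac:(rewrite normrN; exact: fb u hu) : `|- df u| <= _)).
rewrite g0 !subr0 in a1 a2.
have := ler_norm (f t0); have := ler_norm (- f t0); rewrite normrN => b1 b2.
by rewrite ler_norml; apply/andP; split; lra.
Qed.

(** At the far end tau = t0 the transform is bounded through A, and integrating its derivative back
    to tau = 0 costs [g t0] for each coordinate, since tau^(-1/2) is integrable. *)
Lemma char_bound : 2 / y0 ^+ 2 <= n.+1%:R ->
  nc (Mw W t0 z) <= 4 * Num.sqrt (Q / t0) + 2 * g t0.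
Proof.
move=> hn.
have [cr ci] := (withinCP _ _ _).1 Mt_within.
have h1 := comp_bound cr (fun u hu => proj1 (dMt hu)) (fun u hu => le_trans (Re_le_nc _) (dM_bound hn hu)).
have h2 := comp_bound ci (fun u hu => proj2 (dMt hu)) (fun u hu => le_trans (Im_le_nc _) (dM_bound hn hu)).
have tt : 0 < t0 <= t0 by rewrite t0p lexx.
have h3 : nc (Mt t0) <= 2 * Num.sqrt (Q / t0).
  have l0 : 0 < Num.sqrt (Q / t0) by rewrite sqrtr_gt0 divr_gt0.
  have hA : A t0 <= Num.sqrt (Q / t0) ^+ 2 by rewrite sqr_sqrtr; [exact: A_le|apply: divr_ge0; exact: ltW].
  apply: le_trans (_ : _ <= 2 * ((\sum_k nc (c k t0)) / n.+1%:R)) _; last first.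
    by apply: ler_wpM2l => //; exact: avg_c.
  apply: le_trans (nc_sum _ _ _) _; rewrite mulrA mulr_sumr mulr_suml; apply: ler_sum => k _.
  by rewrite ncM nc_cR ger0_norm ?divr_ge0 // mulrAC.
have -> : Mw W t0 z = Mt 0 by rewrite /Mt subr0 p0.
apply: le_trans (nc_le _) _.
have := Re_le_nc (Mt t0); have := Im_le_nc (Mt t0); lra.
Qed.
End Characteristic.

(* The Cauchy transform is bounded on the whole half-plane, uniformly in N, at positive times:
   the function w |-> F(G_t(w)) of the last equation must be sigma-integrable although the
   positive and negative parts of sigma may charge points near which M_t(G_t(w)) is not under control.
   Along the backward characteristic Z' = M(Z) + b(Re Z) the pair terms of M cancel, so that
   m = - Im M satisfies m' <= (2L + 1) m in reversed time, while (Im Z)' = m. *)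
Theorem Mw_reg : 2 / y0 ^+ 2 <= n.+1%:R ->
  nc (Mw W t0 z) <= 4 * Num.sqrt (expR ((2 * L + 1) * t0) / 2 / t0) +
     2 * (4 * L * Num.sqrt (expR ((2 * L + 1) * t0) / 2) * Num.sqrt t0 + 4 / n.+1%:R * y0^-1 ^+ 3 * t0).
Proof. by move=> hn; have [p [p0 dp pc]] := back_ex; exact: (char_bound p0 dp pc hn). Qed.
End Regularisation.

(** * Maximal solutions of the limiting Loewner equation *)

Section Maximal.
Variable R : realType.
Local Notation C := R[i].

(* The junk value is 0 beyond the lifetime of the solution. *)
Definition Gm (m : R -> C -> C) (u : R) (z : C) : C :=
  if pselect (exists p, gsol m u z p) is left h then projT1 (cid h) u else 0.

Lemma Gm_eq m t1 z p u : good m -> 0 <= u <= t1 -> gsol m t1 z p -> Gm m u z = p u.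
Proof.
move=> gm /andP[u0 u1] gp; rewrite /Gm; case: pselect => [h|h]; last first.
  by exfalso; apply: h; exists p; exact: gsol_sub gp.
have hp := projT2 (cid h).
by apply: (gsol_uniq gm hp (gsol_sub u1 gp)); rewrite u0 lexx.
Qed.

Lemma Gm_out m u z : ~ (exists p, gsol m u z p) -> Gm m u z = 0.
Proof. by move=> h; rewrite /Gm; case: pselect. Qed.

Lemma Gm_sol m t1 z p : good m -> 0 <= t1 -> gsol m t1 z p -> gsol m t1 z (fun u => Gm m u z).
Proof.
move=> gm t10 gp; apply: (gsol_eq _ t10 gp) => u ut; by rewrite (Gm_eq gm ut gp).
Qed.

Lemma tcont_sub m (t T : R) : t <= T -> tcont m T -> tcont m t.
Proof. by move=> tT h z zH; apply: withinC_sub (h z zH). Qed.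

(** The comparison solution is built for the field lifted to height d. As p stays above 2 d and the
    distance is at most d, it never drops below d and so solves the original equation. *)
Lemma gsol_stab m m2 (t d rho eta : R) z w p : good m -> good m2 -> tcont m2 t -> 0 <= t -> 0 < d ->
  gsol m t z p -> (forall u, 0 <= u <= t -> 2 * d <= ImC (p u)) -> 0 <= eta ->
  (forall u, 0 < u < t -> forall v, d <= ImC v -> nc (m u v - m2 u v) <= eta) ->
  nc (z - w) <= rho ->
  (rho ^+ 2 + eta ^+ 2 * t) * expR ((2 * (2 / d ^+ 2) + 1) * t) <= d ^+ 2 ->
  exists2 q, gsol m2 t w q & forall u, 0 <= u <= t ->
    nc (p u - q u) ^+ 2 <= (rho ^+ 2 + eta ^+ 2 * t) * expR ((2 * (2 / d ^+ 2) + 1) * t).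
Proof.
move=> gm gm2 tc t0 d0 gp pI e0 hm hw hK.
have [q [q0 dq lq]] := flow_ex w gm2 t0 tc d0.
have q4 : 0 <= 4 / d by rewrite divr_ge0 // ltW.
have cq : {within `[0, t], continuous q} := lip_within q4 lq.
have [p0 [_ [cp _]]] := gp.
have pI' u : 0 <= u <= t -> d <= ImC (p u) by move=> /pI; have := d0; lra.
have dp := gsol_lift pI' gp.
have H u : 0 <= u <= t -> nc (p u - q u) ^+ 2 <= (rho ^+ 2 + eta ^+ 2 * t) * expR ((2 * (2 / d ^+ 2) + 1) * t).
  move=> ut; apply: le_trans (lift_stab d0 e0 gm cp cq dp dq hm ut) _.
  rewrite ler_wpM2r ?expR_ge0 // lerD2r p0 q0 lerXn2r ?nnegrE ?nc_ge0 //.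
  exact: le_trans (nc_ge0 _) hw.
suff HI u : 0 <= u <= t -> d <= ImC (q u).
  have G := flow_gsol d0 cq dq HI; rewrite q0 in G.
  by exists q; [exact: G|exact: H].
move=> ut; have h1 : nc (p u - q u) <= d.
  rewrite -(@ler_pXn2r _ 2) ?nnegrE ?nc_ge0 ?(ltW d0) //; exact: le_trans (H u ut) hK.
have := Im_le_nc (p u - q u); rewrite ImB ler_norml => /andP[? ?].
by have := pI u ut; lra.
Qed.

Let expK (d t : R) : 0 < d -> 0 <= t -> 1 <= expR ((2 * (2 / d ^+ 2) + 1) * t).
Proof.
move=> d0 t0; rewrite -[leLHS]expR0 ler_expR; apply: mulr_ge0 => //.
by apply: addr_ge0 => //; apply: mulr_ge0 => //; apply: divr_ge0 => //; apply: exprn_ge0; exact: ltW.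
Qed.

(** [gsol_stab] with equal fields: the domain of the flow is open. The radius [c / K] keeps the
    squared error below c^2 because K >= 1. *)
Lemma gsol_nbhd m (t e : R) z p : good m -> tcont m t -> 0 <= t -> gsol m t z p -> 0 < e ->
  exists2 rho : R, 0 < rho & forall w, nc (w - z) < rho ->
    exists2 q, gsol m t w q & forall u, 0 <= u <= t -> nc (p u - q u) <= e.
Proof.
move=> gm tc t0 gp e0; have [d2 d20 Hd] := gsol_minIm t0 gp.
pose d := d2 / 2; have d0 : 0 < d by rewrite divr_gt0.
set K := expR ((2 * (2 / d ^+ 2) + 1) * t).
have K1 : 1 <= K := expK d0 t0.
have K0 : 0 < K by lra.
pose c := Num.min d e; have c0 : 0 < c by rewrite lt_min d0 e0.
have cd : c <= d by rewrite ge_min lexx.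
have ce : c <= e by rewrite ge_min lexx orbT.
exists (c / K); first by rewrite divr_gt0.
move=> w hw.
have hK : ((c / K) ^+ 2 + 0 ^+ 2 * t) * K <= c ^+ 2.
  rewrite expr0n /= mul0r addr0 exprMn -mulrA; apply: ler_piMr; first exact: sqr_ge0.
  by rewrite expr2 -mulrA mulVf ?gt_eqF // mulr1 invf_le1.
have cc (x : R) : c <= x -> c ^+ 2 <= x ^+ 2.
  by move=> h; rewrite lerXn2r // nnegrE ltW // (lt_le_trans c0 h).
have [||||q gq hq] := @gsol_stab m m t d (c / K) 0 z w p gm gm tc t0 d0 gp _ (lexx 0).
- by move=> u /Hd; rewrite /d; lra.
- by move=> u _ v _; rewrite subrr nc0.
- by rewrite ncBC ltW.
- exact: le_trans hK (cc _ cd).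
exists q => // u ut; rewrite -(@ler_pXn2r _ 2) ?nnegrE ?nc_ge0 ?(ltW e0) //.
apply: le_trans (hq u ut) _; exact: le_trans hK (cc _ ce).
Qed.

Lemma compact_minIm m (t : R) (Q : set C) : good m -> tcont m t -> 0 <= t -> compact Q ->
  (forall z, Q z -> gsol m t z (fun u => Gm m u z)) ->
  exists2 d : R, 0 < d & forall z, Q z -> forall u, 0 <= u <= t -> d <= ImC (Gm m u z).
Proof.
move=> gm tc t0 cQ HQ; apply: (@compact_unif _ _ (fun d z => forall u, 0 <= u <= t -> d <= ImC (Gm m u z)) cQ).
move=> z Qz; have [d d0 Hd] := gsol_minIm t0 (HQ z Qz).
have d2 : 0 < d / 2 by rewrite divr_gt0.
have [rho r0 Hr] := gsol_nbhd gm tc t0 (HQ z Qz) d2.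
exists (Num.min rho (d / 2)); first by rewrite lt_min r0 d2.
move=> w; rewrite lt_min => /andP[hw _] r; rewrite lt_min => /andP[_ /andP[_ rd]] u ut.
have [q gq hq] := Hr w hw.
rewrite (Gm_eq gm ut gq).
have := hq u ut; have := Im_le_nc (Gm m u z - q u); rewrite ImB ler_norml => /andP[? ?].
by have := Hd u ut; lra.
Qed.

(** Over the compact Q all trajectories stay above one height, so that a single closeness [eta] of
    the fields serves for every starting point. *)
Lemma local_uniform m (mN : nat -> R -> C -> C) (t T : R) (Q : set C) : good m -> tcont m T -> 0 <= t <= T ->
  (forall k, good (mN k)) -> (forall k, tcont (mN k) T) ->
  (forall d r : R, 0 < d -> 0 < r -> \forall k \near \oo, forall u, 0 <= u <= T -> forall z,
    d <= ImC z -> nc (mN k u z - m u z) <= r) ->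
  compact Q -> (forall z, Q z -> gsol m t z (fun u => Gm m u z)) ->
  forall e : R, 0 < e -> \forall k \near \oo, forall z, Q z ->
    exists2 q, gsol (mN k) t z q & nc (q t - Gm m t z) <= e.
Proof.
move=> gm tc /andP[t0 tT] gN tN cv cQ HQ e e0.
have [d2 d20 Hd] := compact_minIm gm (tcont_sub tT tc) t0 cQ HQ.
pose d := d2 / 2; have d0 : 0 < d by rewrite divr_gt0.
set K := expR ((2 * (2 / d ^+ 2) + 1) * t).
have K1 : 1 <= K := expK d0 t0.
have K0 : 0 < K by lra.
pose c := Num.min d e; have c0 : 0 < c by rewrite lt_min d0 e0.
have cd : c <= d by rewrite ge_min lexx.
have ce : c <= e by rewrite ge_min lexx orbT.
have t1 : 0 < t + 1 by rewrite ltr_wpDl.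
have tK : 0 < (t + 1) * K by rewrite mulr_gt0.
pose eta := c / ((t + 1) * K); have eta0 : 0 < eta by rewrite divr_gt0.
have hK : (0 ^+ 2 + eta ^+ 2 * t) * K <= c ^+ 2.
  have -> : (0 ^+ 2 + eta ^+ 2 * t) * K = c ^+ 2 * (t * K / ((t + 1) * K) ^+ 2).
    by rewrite /eta; field; rewrite !gt_eqF.
  apply: ler_piMr; first exact: sqr_ge0.
  rewrite ler_pdivrMr ?exprn_gt0 // mul1r exprMn.
  apply: ler_pM => //; [exact: ltW| |].
    by rewrite sqrrD expr1n mulr1; have := sqr_ge0 t; lra.
  by rewrite expr2 ler_peMr // ltW.
have cc (x : R) : c <= x -> c ^+ 2 <= x ^+ 2.
  by move=> h; rewrite lerXn2r // nnegrE ltW // (lt_le_trans c0 h).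
apply: filterS (cv d eta d0 eta0) => k Hk z Qz.
have [||||q gq hq] := @gsol_stab m (mN k) t d 0 eta z z _ gm (gN k) (tcont_sub tT (tN k)) t0 d0 (HQ z Qz) _ (ltW eta0).
- by move=> u ut; have := Hd z Qz u ut; rewrite /d; lra.
- move=> u /andP[u0 u1] v vd; rewrite ncBC; apply: Hk => //.
  by apply/andP; split; [exact: ltW|exact: le_trans (ltW u1) tT].
- by rewrite subrr nc0.
- exact: le_trans hK (cc _ cd).
exists q => //; rewrite ncBC -(@ler_pXn2r _ 2) ?nnegrE ?nc_ge0 ?(ltW e0) //.
apply: le_trans (hq t _) _; first by rewrite t0 lexx.
exact: le_trans hK (cc _ ce).
Qed.
End Maximal.

(** * Measurability of the limiting flow *)

Section PatchedMeasurability.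
Variable R : realType.
Local Notation C := R[i].

Lemma patch_measurable (D : set C) (f : C -> R) (c : R) :
  (forall w, D w -> exists2 r : R, 0 < r & forall w', nc (w' - w) < r -> D w') ->
  (forall w, D w -> forall e : R, 0 < e -> exists2 r : R, 0 < r & forall w', nc (w' - w) < r -> `|f w' - f w| <= e) ->
  (forall w, ~ D w -> f w = c) -> measurable_fun setT (f \o @ofpair R).
Proof.
move=> Do fc fo.
have mD : measurable [set p | D (@ofpair R p)].
  apply: open2_measurable => p /Do[r r0 Hr]; exists (r / 2); first by rewrite divr_gt0.
  by move=> q q1 q2; apply: Hr; apply: le_lt_trans (ofpair_nc p q) _; lra.
apply: (measurability _ (RGenOInfty.measurableE R)).
move=> _ [_ [y ->] <-]; rewrite setTI.
pose A := [set p | D (@ofpair R p) /\ y < f (ofpair p)].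
have mA : measurable A.
  apply: open2_measurable => p [Dp yp].
  have [r1 r10 H1] := Do _ Dp.
  have [|r2 r20 H2] := fc _ Dp ((f (ofpair p) - y) / 2); first by rewrite divr_gt0 // subr_gt0.
  exists (Num.min r1 r2 / 2); first by rewrite divr_gt0 // lt_min r10 r20.
  move=> q q1 q2.
  have h : nc (ofpair q - ofpair p) < Num.min r1 r2 by apply: le_lt_trans (ofpair_nc p q) _; lra.
  move: h; rewrite lt_min => /andP[h1 h2]; split; first exact: H1.
  by have := H2 _ h2; rewrite ler_norml => /andP[? ?]; lra.
have [yc|yc] := ltP y c.
  rewrite (_ : _ @^-1` _ = A `|` ~` [set p | D (@ofpair R p)]); first by apply: measurableU => //; exact: measurableC.
  apply/seteqP; split => p /=; rewrite in_itv /= andbT.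
    by move=> h; have [Dp|Dp] := EM (D (ofpair p)); [left|right].
  by case=> [[]//|/fo ->].
rewrite (_ : _ @^-1` _ = A) //.
apply/seteqP; split => p /=; rewrite in_itv /= andbT; last by case.
move=> h; split => //; apply: contrapT => /fo E; move: h; rewrite E; lra.
Qed.

(** The flow is continuous on its domain, which is open, and [Gm] is 0 off it. Phi may be
    discontinuous at z0, where its value is prescribed: [f1] lives on the open set where the flow is
    defined and avoids z0, and [f2] carries the junk value [Phi 0]. *)
Lemma Gm_measurable (m : R -> C -> C) (t : R) (Phi : C -> R) (z0 : C) : good m -> tcont m t -> 0 <= t ->
  (forall z, inH z -> z != z0 -> {for z, continuous Phi}) -> Phi z0 = 0 ->
  measurable_fun setT ((fun w => Phi (Gm m t w)) \o @ofpair R).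
Proof.
move=> gm tc t0 Pc P0.
have tt : 0 <= t <= t by rewrite t0 lexx.
pose D : set C := [set w | exists p, gsol m t w p].
pose D' : set C := [set w | D w /\ Gm m t w != z0].
have Gc w : D w -> forall e : R, 0 < e -> exists2 r : R, 0 < r & forall w', nc (w' - w) < r ->
    D w' /\ nc (Gm m t w' - Gm m t w) <= e.
  move=> [p gp] e e0; have [r r0 Hr] := gsol_nbhd gm tc t0 gp e0; exists r => // w' hw'.
  have [q gq hq] := Hr w' hw'; split; first by exists q.
  by rewrite (Gm_eq gm tt gp) (Gm_eq gm tt gq) ncBC; exact: hq.
have Do w : D w -> exists2 r : R, 0 < r & forall w', nc (w' - w) < r -> D w'.
  by move=> /Gc/(_ 1 ltr01)[r r0 Hr]; exists r => // w' /Hr[].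
have Do' w : D' w -> exists2 r : R, 0 < r & forall w', nc (w' - w) < r -> D' w'.
  move=> [Dw wz]; have n0 : 0 < nc (Gm m t w - z0) by rewrite nc_gt0 subr_eq0.
  have [r r0 Hr] := Gc w Dw _ (divr_gt0 n0 (ltr0n R 2)); exists r => // w' /Hr[Dw' h]; split => //.
  apply/eqP => E; move: h; rewrite E ncBC; lra.
pose f1 w := if pselect (D' w) then Phi (Gm m t w) else 0.
pose f2 w := if pselect (D w) then 0 else Phi 0.
have f1E v : D' v -> f1 v = Phi (Gm m t v) by rewrite /f1; case: pselect.
have f2E v : D v -> f2 v = 0 by rewrite /f2; case: pselect.
have E : (fun w => Phi (Gm m t w)) \o @ofpair R = (f1 \o @ofpair R) \+ (f2 \o @ofpair R).
  apply/funext => q /=; rewrite /f1 /f2; case: pselect => [[Dw wz]|nD'] /=.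
    by case: pselect => //= _; rewrite addr0.
  case: pselect => [Dw|nD] /=; last by rewrite add0r Gm_out.
  rewrite addr0; have [->//|/eqP wz] := EM (Gm m t (ofpair q) = z0).
  by exfalso; apply: nD'.
rewrite E; apply: measurable_funD.
  apply: (patch_measurable (D := D') (c := 0)) => // [w D'w e e0|w nD]; last by rewrite /f1; case: pselect.
  have [Dw wz] := D'w.
  have GH : inH (Gm m t w).
    by have [p gp] := Dw; rewrite (Gm_eq gm tt gp); case: gp => _ [h _]; exact: h.
  have [r1 r10 H1] := (contCRP Phi _).1 (Pc _ GH wz) e e0.
  have [r2 r20 H2] := Gc w Dw _ (divr_gt0 r10 (ltr0n R 2)).
  have [r3 r30 H3] := Do' w D'w.
  exists (Num.min r2 r3); first by rewrite lt_min r20 r30.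
  move=> w'; rewrite lt_min => /andP[/H2[_ h2] /H3 h3].
  rewrite !f1E //; apply: H1; by apply: le_lt_trans h2 _; lra.
apply: (patch_measurable (D := D) (c := Phi 0)) => // [w Dw e e0|w nD]; last by rewrite /f2; case: pselect.
have [r r0 Hr] := Do w Dw; exists r => // w' /Hr h.
by rewrite !f2E // subrr normr0 ltW.
Qed.
End PatchedMeasurability.

(** * The equation for the Cauchy transform *)

Section CauchyTransform.
Variable R : realType.
Local Notation C := R[i].
Variable mu : probability R R.
Local Notation E := (Rintegral mu setT).

Let pE : pf 1 E := pf_prob mu.

Lemma inv_bmC (z : C) : ImC z != 0 -> bmC (fun x : R => (z - cR x)^-1).
Proof.
rewrite -normr_gt0 => z0; apply: bmC_lip => [x y|x]; last exact: res_bound z0 (lexx _).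
have := res_lip x y z0 (lexx _) (lexx _); rewrite subrr nc0 add0r => h.
by apply: le_trans h _; rewrite mulrC.
Qed.

Lemma inv2_bmC (z : C) : ImC z != 0 -> bmC (fun x : R => (z - cR x)^-1 ^+ 2).
Proof. by move=> z0; under eq_fun do rewrite expr2; apply: bmC_M; exact: inv_bmC. Qed.

Definition cauchy1 (z : C) : C := cE E (fun x : R => (z - cR x)^-1).
Definition cauchy2 (z : C) : C := cE E (fun x : R => (z - cR x)^-1 ^+ 2).

Lemma Mfun_cauchy1 z : ImC z != 0 -> Mfun mu z = cR 2 * cauchy1 z.
Proof. by move=> z0; rewrite /cauchy1 -(cE_Z pE) //; exact: inv_bmC. Qed.

(** The remainder is the mean of 2 k^2 / ((z + k - x) (z - x)^2). For |k| below d/2 the factor z + k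
    - x has modulus at least d/2, whence the constant 4 / d^3. *)
Lemma Mfun_hder z : ImC z != 0 -> hder (Mfun mu) z (- (cR 2 * cauchy2 z)).
Proof.
move=> z0 e e0; have d0 : 0 < `|ImC z| by rewrite normr_gt0.
set d := `|ImC z| in d0.
have c0 : 0 < 4 / d ^+ 3 by rewrite divr_gt0 // exprn_gt0.
exists (Num.min (d / 2) (e / (4 / d ^+ 3))); first by rewrite lt_min (divr_gt0 d0 (ltr0n R 2)) (divr_gt0 e0 c0).
move=> k; rewrite lt_min => /andP[k1]; rewrite ltr_pdivlMr // => k2.
have kd : d / 2 <= `|ImC (z + k)|.
  have e1 : ImC (z + k) - ImC k = ImC z by rewrite ImD addrK.
  by have := Im_le_nc k; have := ler_normB (ImC (z + k)) (ImC k); rewrite e1 -/d; lra.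
have zk0 : ImC (z + k) != 0 by rewrite -normr_gt0; lra.
have -> : Mfun mu (z + k) - Mfun mu z - k * - (cR 2 * cauchy2 z) =
  cE E (fun x => cR 2 / (z + k - cR x) - cR 2 / (z - cR x) - (- (k * cR 2)) * (z - cR x)^-1 ^+ 2).
  rewrite (cE_B pE); first last.
  - by apply: bmC_M; [exact: bmC_cst|exact: inv2_bmC].
  - by apply: bmC_B; exact: kern_bmC.
  rewrite (cE_B pE); try exact: kern_bmC.
  rewrite (cE_Z pE (- (k * cR 2)) (inv2_bmC z0)).
  rewrite -[cE E (fun x => cR 2 / (z + k - cR x))]/(Mfun mu (z + k)) -[cE E (fun x => cR 2 / (z - cR x))]/(Mfun mu z).
  by rewrite -/(cauchy2 z); ring.
rewrite -[leRHS]mulr1; apply: (nc_cE pE).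
- by rewrite mulr_ge0 ?nc_ge0 // ltW.
- apply: bmC_B; first by apply: bmC_B; exact: kern_bmC.
  by apply: bmC_M; [exact: bmC_cst|exact: inv2_bmC].
move=> x.
have n1 : z - cR x != 0 by exact: sub_neq0.
have n2 : z + k - cR x != 0 by exact: sub_neq0.
have -> : cR 2 / (z + k - cR x) - cR 2 / (z - cR x) - - (k * cR 2) * (z - cR x)^-1 ^+ 2 =
   cR 2 * (k * k) * ((z + k - cR x)^-1 * ((z - cR x)^-1 * (z - cR x)^-1)).
  by field; rewrite n1 n2.
rewrite !ncM nc_cR ger0_norm //.
have b1 := res_bound x (ltac:(lra) : 0 < d / 2) kd.
have b2 := res_bound x d0 (lexx _).
have b3 : nc (z + k - cR x)^-1 * (nc (z - cR x)^-1 * nc (z - cR x)^-1) <= (d / 2)^-1 * (d^-1 * d^-1).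
  by apply: ler_pM; rewrite ?mulr_ge0 ?nc_ge0 //; apply: ler_pM; rewrite ?nc_ge0.
have -> : e * nc k = nc k * e by rewrite mulrC.
have n0 := nc_ge0 k.
apply: (@le_trans _ _ (nc k * (nc k * (4 / d ^+ 3)))); last by apply: ler_wpM2l => //; exact: (ltW k2).
have -> : 4 / d ^+ 3 = 2 * ((d / 2)^-1 * (d^-1 * d^-1)).
  by have dn : d != 0 by [rewrite gt_eqF]; field; rewrite ?dn //.
have -> : 2 * (nc k * nc k) * (nc (z + k - cR x)^-1 * (nc (z - cR x)^-1 * nc (z - cR x)^-1)) =
  nc k * (nc k * (2 * (nc (z + k - cR x)^-1 * (nc (z - cR x)^-1 * nc (z - cR x)^-1)))) by ring.
by apply: ler_wpM2l => //; apply: ler_wpM2l => //; apply: ler_wpM2l.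
Qed.

Lemma Mfun_derive z : ImC z != 0 -> derive1 (Mfun mu) z = - (cR 2 * cauchy2 z).
Proof. by move=> z0; have /hderP[] := Mfun_hder z0. Qed.

Definition Fker (z zeta : C) : C := Mfun mu z / (z - zeta) ^+ 2
  - Mfun mu zeta / (z - zeta) ^+ 2 - derive1 (Mfun mu) z / (z - zeta).

Lemma Fker_diag z : Fker z z = 0.
Proof. by rewrite /Fker subrr sub0r subrr invr0 mulr0 oppr0. Qed.

(** Partial fractions in x. The integral shows that the singularity of [Fker z] at z is removable;
    division by 0 merely assigns the value 0 at that point. *)
Lemma Fker_int z zeta : ImC z != 0 -> ImC zeta != 0 -> zeta != z ->
  Fker z zeta = cE E (fun x => (cR 2 * (z - cR x)^-1 ^+ 2) * (cR x - zeta)^-1).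
Proof.
move=> z0 w0 zw.
have zw' : z - zeta != 0 by rewrite subr_eq0 eq_sym.
have -> : (fun x => (cR 2 * (z - cR x)^-1 ^+ 2) * (cR x - zeta)^-1) =
  (fun x => cR 2 * (z - zeta)^-1 ^+ 2 * (z - cR x)^-1 - (cR 2 * (z - zeta)^-1 ^+ 2 * (zeta - cR x)^-1 -
     cR 2 * (z - zeta)^-1 * (z - cR x)^-1 ^+ 2)).
  apply/funext => x; have n1 : z - cR x != 0 by exact: sub_neq0.
  have n2 : zeta - cR x != 0 by exact: sub_neq0.
  have n3 : cR x - zeta != 0 by rewrite -opprB oppr_eq0.
  by field; rewrite n1 n2 n3 zw'.
rewrite (cE_B pE); first last.
- by apply: bmC_B; apply: bmC_M; try exact: bmC_cst; [exact: inv_bmC|exact: inv2_bmC].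
- by apply: bmC_M; [exact: bmC_cst|exact: inv_bmC].
rewrite (cE_B pE); first last.
- by apply: bmC_M; [exact: bmC_cst|exact: inv2_bmC].
- by apply: bmC_M; [exact: bmC_cst|exact: inv_bmC].
rewrite !(cE_Z pE); try exact: inv_bmC; try exact: inv2_bmC.
rewrite /Fker Mfun_derive // !Mfun_cauchy1 // -/(cauchy1 _) -/(cauchy1 _) -/(cauchy2 _) exprVn; ring.
Qed.

Lemma Mfun_conj z : ImC z != 0 -> Mfun mu (cconj z) = cconj (Mfun mu z).
Proof.
move=> z0; have [_ bI] := kern_bmC z0.
have k x : cR 2 / (cconj z - cR x) = cconj (cR 2 / (z - cR x)).
  by rewrite cconjM cconjV cconjB !cconj_cR.
apply: complexP.
  by congr (Rintegral _ _ _); apply/funext => x; rewrite k.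
rewrite [RHS](_ : _ = - E (fun x => ImC (cR 2 / (z - cR x)))) // -(pfN pE bI).
by congr (Rintegral _ _ _); apply/funext => x; rewrite k.
Qed.

Variable B : R.
Hypothesis MB : forall zeta, inH zeta -> nc (Mfun mu zeta) <= B.

Lemma Mfun_bd zeta : ImC zeta != 0 -> nc (Mfun mu zeta) <= B.
Proof.
move=> z0; have [zp|zn|ze] := ltrgt0P (ImC zeta); [exact: MB| |by rewrite ze eqxx in z0].
have cz : ImC (cconj zeta) != 0 by rewrite /ImC /= oppr_eq0.
rewrite -nc_conj -Mfun_conj //; apply: MB; rewrite /inH /ImC /= oppr_gt0 //.
Qed.

(** Near z the integral form is used, as zeta then keeps away from the real line. Elsewhere z - zeta
    is bounded below and the defining formula is used with the bound B on M, which permits zeta to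
    approach the real line. *)
Lemma Fker_bound z : ImC z != 0 -> exists D : R, forall zeta, ImC zeta != 0 -> nc (Fker z zeta) <= D.
Proof.
move=> z0; have d0 : 0 < `|ImC z| by rewrite normr_gt0.
set d := `|ImC z| in d0; have d2 : 0 < d / 2 by rewrite divr_gt0.
have B0 : 0 <= B := le_trans (nc_ge0 _) (Mfun_bd z0).
pose D1 := 2 * (d^-1 * d^-1) * (d / 2)^-1.
pose D2 := (B + B) * ((d / 2)^-1 * (d / 2)^-1) + nc (derive1 (Mfun mu) z) * (d / 2)^-1.
have d10 : 0 <= d^-1 by rewrite invr_ge0 ltW.
have d20 : 0 <= (d / 2)^-1 by rewrite invr_ge0 ltW.
have D10 : 0 <= D1 by rewrite !mulr_ge0.
have D20 : 0 <= D2 by rewrite addr_ge0 ?mulr_ge0 ?nc_ge0 // addr_ge0.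
exists (D1 + D2) => zeta w0; have [->|wz] := eqVneq zeta z.
  by rewrite Fker_diag nc0 addr_ge0.
have [near_z|far] := ltP (nc (zeta - z)) (d / 2).
  have wd : d / 2 <= `|ImC zeta|.
    have := Im_le_nc (zeta - z); rewrite ImB; have := ler_distD (ImC zeta) (ImC z) 0.
    by rewrite !subr0 -/d distrC; lra.
  rewrite Fker_int //; apply: (@le_trans _ _ D1); last by rewrite lerDl.
  rewrite -[leRHS]mulr1; apply: (nc_cE pE) => // [|x].
    apply: bmC_M; first by apply: bmC_M; [exact: bmC_cst|exact: inv2_bmC].
    have -> : (fun x => (cR x - zeta)^-1) = (fun x => (- (1 : C)) * (zeta - cR x)^-1).
      by apply/funext => x; rewrite subVN mulN1r.
    by apply: bmC_M; [exact: bmC_cst|exact: inv_bmC].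
  rewrite expr2 !ncM nc_cR ger0_norm // subVN ncN.
  have b1 := res_bound x d2 wd; have b2 := res_bound x d0 (lexx _).
  apply: ler_pM; rewrite ?mulr_ge0 ?nc_ge0 //.
  by apply: ler_wpM2l => //; apply: ler_pM; rewrite ?nc_ge0.
apply: (@le_trans _ _ D2); last by rewrite lerDr.
have nz : nc (z - zeta)^-1 <= (d / 2)^-1.
  by rewrite ncV ncBC lef_pV2 ?posrE // (lt_le_trans d2 far).
rewrite /Fker -!exprVn !expr2; apply: le_trans (ncB _ _) _; apply: lerD; last first.
  by rewrite ncM; apply: ler_wpM2l => //; exact: nc_ge0.
rewrite mulrDl; apply: le_trans (ncB _ _) _; rewrite !ncM.
have n2 : nc (z - zeta)^-1 * nc (z - zeta)^-1 <= (d / 2)^-1 * (d / 2)^-1 by apply: ler_pM; rewrite ?nc_ge0.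
by apply: lerD; apply: ler_pM; rewrite ?mulr_ge0 ?nc_ge0 ?Mfun_bd.
Qed.

Lemma Fker_cont z zeta : ImC zeta != 0 -> zeta != z -> {for zeta, continuous (Fker z)}.
Proof.
move=> w0 wz; have zw : z - zeta != 0 by rewrite subr_eq0 eq_sym.
have c1 : {for zeta, continuous (fun w : C => z - w)}.
  by apply/contCCP => r r0; exists r => // w hw; rewrite (_ : _ - _ = zeta - w); [rewrite ncBC; exact: ltW|ring].
have c2 := @continuousV (C : numFieldType) C (fun w : C => z - w) zeta zw c1.
have c3 := @continuousM (C : numFieldType) C _ _ zeta c2 c2.
have c4 := @continuousM (C : numFieldType) C _ _ zeta (hder_cont (Mfun_hder w0)) c3.
have c5 := @continuousM (C : numFieldType) C _ _ zeta (@cst_continuous C C (Mfun mu z) zeta) c3.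
have c6 := @continuousM (C : numFieldType) C _ _ zeta (@cst_continuous C C (derive1 (Mfun mu) z) zeta) c2.
apply/contCCP => r r0; have r3 : 0 < r / 3 by rewrite divr_gt0.
have [d1 d10 D1] := (contCCP _ _).1 c4 _ r3.
have [d2 d20 D2] := (contCCP _ _).1 c5 _ r3.
have [d3 d30 D3] := (contCCP _ _).1 c6 _ r3.
exists (Num.min d1 (Num.min d2 d3)); first by rewrite !lt_min d10 d20 d30.
move=> w; rewrite !lt_min => /andP[h1 /andP[h2 h3]].
have a1 := D1 w h1; have a2 := D2 w h2; have a3 := D3 w h3.
rewrite /= in a1 a2 a3; rewrite /Fker -!exprVn !expr2.
set u1 := _ - _ in a1; set u2 := _ - _ in a2; set u3 := _ - _ in a3.
rewrite (_ : _ - _ = u2 - u1 - u3); last by rewrite /u1 /u2 /u3; ring.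
by apply: le_trans (ncB _ _) _; have := ncB u2 u1; lra.
Qed.
End CauchyTransform.

(** * The test function 2/(z - x) *)

Section CauchyKernelTest.
Variable R : realType.
Local Notation C := R[i].
Variable z : C.
Hypothesis z0 : ImC z != 0.
Local Notation k y := ((z - cR y)^-1).

Lemma C2b_of (f f' f'' : R -> R) (M : R) : (forall x, der f x (f' x)) -> (forall x, der f' x (f'' x)) ->
  continuous f'' -> (forall x, `|f x| <= M) -> (forall x, `|f' x| <= M) -> (forall x, `|f'' x| <= M) ->
  [/\ C2b f, derive1 f = f' & derive1 (derive1 f) = f''].
Proof.
move=> d1 d2 c b1 b2 b3.
have e1 : derive1 f = f' by apply/funext => x; rewrite derive1E; exact: (@derive_val _ _ _ _ _ _ _ (d1 x)).
have e2 : derive1 f' = f'' by apply/funext => x; rewrite derive1E; exact: (@derive_val _ _ _ _ _ _ _ (d2 x)).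
rewrite e1 e2; split => //; split; first by move=> x; exact: (@ex_derive _ _ _ _ _ _ _ (d1 x)).
rewrite e1; split; first by move=> x; exact: (@ex_derive _ _ _ _ _ _ _ (d2 x)).
by rewrite e2; split => //; exists M.
Qed.

Let f (y : R) : C := cR 2 / (z - cR y).
Let f1 (y : R) : C := cR 2 * k y ^+ 2.
Let f2 (y : R) : C := cR 4 * k y ^+ 3.
Let f3 (y : R) : C := cR 12 * k y ^+ 4.

Let n1 y : z - cR y != 0. Proof. exact: sub_neq0. Qed.

Let dk y : cder (fun u : R => k u) y (k y ^+ 2).
Proof.
have h : cder (fun u : R => z - cR u) y (- cR 1).
  by apply: cder_eq (cderB (cderC z y) (cder_cR (derI y))) _; rewrite sub0r.
by apply: cder_eq (cderV (n1 y) h) _; rewrite opprK cR1 mul1r.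
Qed.

Let df y : cder f y (f1 y).
Proof. exact: cderZ (dk y). Qed.

Let df1 y : cder f1 y (f2 y).
Proof.
apply: cder_ext (cder_eq (cderZ (cR 2) (cderM (dk y) (dk y))) _) => [u|]; first by rewrite /f1 expr2.
rewrite /f2 (_ : cR 4 = cR 2 + cR 2); first by ring.
by rewrite -cRD; congr cR; ring.
Qed.

Let df2 y : cder f2 y (f3 y).
Proof.
apply: cder_ext (cder_eq (cderZ (cR 4) (cderM (cderM (dk y) (dk y)) (dk y))) _) => [u|]; first by rewrite /f2; ring.
rewrite /f3 (_ : cR 12 = cR 4 + cR 4 + cR 4); first by ring.
by rewrite -!cRD; congr cR; ring.
Qed.

Lemma cauchy_test : [/\ C2bC f, forall y, cder1 f y = f1 y & forall y, cder2 f y = f2 y].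
Proof.
have d0 : 0 < `|ImC z| by rewrite normr_gt0.
set d := `|ImC z| in d0.
have kb y : nc (k y) <= d^-1 := res_bound y d0 (lexx _).
have i0 : 0 <= d^-1 by rewrite invr_ge0 ltW.
pose M := 2 * d^-1 + 2 * d^-1 ^+ 2 + 4 * d^-1 ^+ 3.
have p1 : 0 <= 2 * d^-1 by rewrite mulr_ge0.
have p2 : 0 <= 2 * d^-1 ^+ 2 by rewrite mulr_ge0 // exprn_ge0.
have p3 : 0 <= 4 * d^-1 ^+ 3 by rewrite mulr_ge0 // exprn_ge0.
have k2 y : nc (k y ^+ 2) <= d^-1 ^+ 2 by rewrite !expr2 ncM; apply: ler_pM; rewrite ?nc_ge0.
have k3 y : nc (k y ^+ 3) <= d^-1 ^+ 3.
  by rewrite !(exprS _ 2) ncM; apply: ler_pM; rewrite ?nc_ge0.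
have b0 y : nc (f y) <= M.
  apply: (@le_trans _ _ (2 * d^-1)); last by rewrite /M; lra.
  by rewrite ncM nc_cR ger0_norm //; apply: ler_wpM2l.
have b1 y : nc (f1 y) <= M.
  apply: (@le_trans _ _ (2 * d^-1 ^+ 2)); last by rewrite /M; lra.
  by rewrite ncM nc_cR ger0_norm //; apply: ler_wpM2l.
have b2 y : nc (f2 y) <= M.
  apply: (@le_trans _ _ (4 * d^-1 ^+ 3)); last by rewrite /M; lra.
  by rewrite ncM nc_cR ger0_norm //; apply: ler_wpM2l.
have [cr er1 er2] := @C2b_of (fun y => ReC (f y)) (fun y => ReC (f1 y)) (fun y => ReC (f2 y)) M
  (fun y => (df y).1) (fun y => (df1 y).1) (fun y => der_cont (df2 y).1)
  (fun y => le_trans (Re_le_nc _) (b0 y)) (fun y => le_trans (Re_le_nc _) (b1 y)) (fun y => le_trans (Re_le_nc _) (b2 y)).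
have [ci ei1 ei2] := @C2b_of (fun y => ImC (f y)) (fun y => ImC (f1 y)) (fun y => ImC (f2 y)) M
  (fun y => (df y).2) (fun y => (df1 y).2) (fun y => der_cont (df2 y).2)
  (fun y => le_trans (Im_le_nc _) (b0 y)) (fun y => le_trans (Im_le_nc _) (b1 y)) (fun y => le_trans (Im_le_nc _) (b2 y)).
split => [//|y|y]; first by rewrite /cder1 er1 ei1; case: (f1 y).
by rewrite /cder2 er2 ei2; case: (f2 y).
Qed.

Lemma cauchy_dquot a b : dquot f a b = cR 2 * k a ^+ 2 * k b + cR 2 * k a * k b ^+ 2.
Proof.
have [_ e1 e2] := cauchy_test.
have E4 : cR 4 = cR 2 + cR 2 :> C by rewrite -cRD; congr cR; ring.
rewrite /dquot; case: eqVneq => [->|ab]; first by rewrite e2 /f2 E4; ring.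
have d0 : cR a - cR b != 0 by rewrite -cRB cR_eq0 subr_eq0.
rewrite !e1 /f1 cRB; field.
by rewrite !n1 d0.
Qed.

(** The difference quotient is a sum of products of a function of a and a function of b, so the
    double mean reduces to the means that define M and its derivative. *)
Lemma cauchy_double (mu : probability R R) :
  cint mu (fun a => cint mu (fun b => dquot f a b)) = - derive1 (Mfun mu) z * Mfun mu z.
Proof.
have pE := pf_prob mu.
have b1 := inv_bmC z0; have b2 := inv2_bmC z0.
rewrite Mfun_derive // Mfun_cauchy1 // opprK.
have inner a : cint mu (fun b => dquot f a b) = cR 2 * cauchy1 mu z * k a ^+ 2 + cR 2 * cauchy2 mu z * k a.
  rewrite (_ : (fun b => dquot f a b) = (fun b => cR 2 * k a ^+ 2 * k b + cR 2 * k a * k b ^+ 2)); last first.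
    by apply/funext => b; rewrite cauchy_dquot.
  rewrite [LHS](cE_D pE); [|by apply: bmC_M; [exact: bmC_cst|]|by apply: bmC_M; [exact: bmC_cst|]].
  rewrite !(cE_Z pE) // -/(cauchy1 mu z) -/(cauchy2 mu z); ring.
rewrite (_ : (fun a => _) = (fun a => cR 2 * cauchy1 mu z * k a ^+ 2 + cR 2 * cauchy2 mu z * k a)); last first.
  by apply/funext => a; exact: inner.
rewrite [LHS](cE_D pE); [|by apply: bmC_M; [exact: bmC_cst|]|by apply: bmC_M; [exact: bmC_cst|]].
rewrite !(cE_Z pE) // -/(cauchy1 mu z) -/(cauchy2 mu z).
have E2 : cR 2 = 1 + 1 :> C by rewrite -cR1 -cRD.
rewrite E2; ring.
Qed.
End CauchyKernelTest.

Section CauchyEquation.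
Variable R : realType.
Local Notation C := R[i].
Variables (x : forall n : nat, 'I_n.+1 -> R) (Mn : nat -> nat)
  (s : forall n : nat, 'I_(Mn n) -> C) (alpha : forall n : nat, 'I_(Mn n) -> int)
  (V : forall n : nat, R -> 'I_n.+1 -> R) (S : forall n : nat, R -> 'I_(Mn n) -> C).
Arguments x : clear implicits.
Arguments s : clear implicits.
Arguments alpha : clear implicits.
Arguments V : clear implicits.
Arguments S : clear implicits.
Variables (dl b T : R).
Hypothesis dl0 : 0 < dl.
Hypothesis dlb : 2 * dl <= b.
Hypothesis TE : T = dl ^+ 2 / 2.
Hypothesis sB : forall n j, boxC (2 * dl) b (s n j).
Hypothesis dr : forall n, drivingSol (x n) (s n) (alpha n) T (V n) (S n).
Variable Cb : R.
Hypothesis Cb0 : 0 <= Cb.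
Hypothesis HC : forall n f (M : R), contC f -> (forall z, `|f z| <= M) ->
    `|atomsH n (alpha n) (s n) f| <= Cb * M.
Variable sigma : smeasH R.
Hypothesis sigma_cv : forall f, bcontH f ->
  (fun n => atomsH n (alpha n) (s n) f) @ \oo --> sintR sigma f.
Variables (nk : nat -> nat) (mu : R -> probability R R).
Hypothesis nkI : strictly_incr nk.
Hypothesis Vmu : MT_conv T nk V mu.
Hypothesis V_tail : forall r : R, 0 < r -> exists2 A : R, 0 <= A & forall n t, 0 <= t <= T ->
  empR (V n t) (tl A) <= r.
Variable Phi : nat -> R -> C -> C.
Hypothesis PhiP : forall n, isflow dl b T (Mw (V n)) (Phi n).
Variable Psi : R -> C -> C.
Hypothesis PsiP : isflow dl b T (fun t => Mfun (mu t)) Psi.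

Local Notation Rb := (clampC dl (bigb dl b T)).
Local Notation at_ n t := (atomsH n (alpha n) (S n t)).
Local Notation e k t := (empR (V (nk k) t)).
Local Notation E t := (Rintegral (mu t) setT).

Let T0 : 0 < T. Proof. by rewrite TE divr_gt0 // exprn_gt0. Qed.
Let gM := Mfun_good mu.
Let gMw n := @Mw_good R n (V n).

Local Notation sg t := (sigt dl0 TE sigma PsiP t).

(** In [Mw_reg] the height of zeta enters only through a term divided by N and through the size
    required of N. For each zeta the index is taken large enough, and the resulting bound is the
    same for all zeta: the two units absorb that term and the distance to the limit. *)
Lemma Mfun_bounded t : 0 < t < T -> exists B : R, forall zeta, inH zeta -> nc (Mfun (mu t) zeta) <= B.
Proof.
move=> tT; have tT' : 0 <= t <= T by case/andP: tT => ? ?; apply/andP; split; exact: ltW.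
have q2 : 0 <= 2 / dl ^+ 2 by rewrite divr_ge0 // exprn_ge0 // ltW.
pose L := Cb * (2 / dl ^+ 2); have L0 : 0 <= L by rewrite mulr_ge0.
pose B1 := 4 * Num.sqrt (expR ((2 * L + 1) * t) / 2 / t).
pose B2 := 2 * (4 * L * Num.sqrt (expR ((2 * L + 1) * t) / 2) * Num.sqrt t).
exists (B1 + B2 + 1 + 1) => zeta zH.
have i3 : 0 <= (ImC zeta)^-1 ^+ 3 by rewrite exprn_ge0 // invr_ge0 ltW.
have t0 : 0 < t by case/andP: tT.
pose c := 8 * (ImC zeta)^-1 ^+ 3 * t.
have c0 : 0 <= c by rewrite mulr_ge0 ?(ltW t0) // mulr_ge0.
have c1 : 0 < c + 1 by rewrite ltr_wpDl.
have zz : 0 < 2 / ImC zeta ^+ 2 by rewrite divr_gt0 // exprn_gt0.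
near \oo => k.
have k1 : (nk k).+1%:R^-1 <= (c + 1)^-1 by near: k; apply: nk_inf => //; rewrite invr_gt0.
have k2 : (nk k).+1%:R^-1 <= (2 / ImC zeta ^+ 2)^-1 by near: k; apply: nk_inf => //; rewrite invr_gt0.
have k3 : forall u, 0 <= u <= T -> forall z, ImC zeta <= ImC z -> nc (Mw (V (nk k)) u z - Mfun (mu u) z) <= 1.
  by near: k; apply: (M_unif Vmu).
have hn : 2 / ImC zeta ^+ 2 <= (nk k).+1%:R by rewrite -lef_pV2 ?posrE ?ltr0n.
have H := @Mw_reg R _ _ _ _ _ T (V (nk k)) (S (nk k)) T0 (dr (nk k)) (Cb * (2 / dl)) L L0
   (fun u v uT => atoms_bker dl0 dlb TE sB dr PhiP HC (nk k) v uT)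
   (fun u v w uT => ltac:(rewrite /L -mulrA; exact: (atoms_bker_lip dl0 dlb TE sB dr PhiP HC (nk k) v w uT)))
   t zeta tT zH hn.
have h4 := k3 t tT' zeta (lexx _).
have h5 : 2 * (4 / (nk k).+1%:R * (ImC zeta)^-1 ^+ 3 * t) <= 1.
  have -> : 2 * (4 / (nk k).+1%:R * (ImC zeta)^-1 ^+ 3 * t) = c * (nk k).+1%:R^-1 by rewrite /c; ring.
  apply: le_trans (ler_wpM2l c0 k1) _.
  by rewrite ler_pdivrMr // mul1r lerDl.
have h6 : nc (Mfun (mu t) zeta) <= nc (Mw (V (nk k)) t zeta) + 1.
  have := nc_tri (Mfun (mu t) zeta) (Mw (V (nk k)) t zeta) 0; rewrite !subr0 (ncBC (Mfun _ _)).
  by rewrite addrC => h; apply: le_trans h _; rewrite lerD2l.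
apply: (le_trans h6); rewrite lerD2r; apply: (le_trans H).
by rewrite [X in _ + X <= _]mulrDr addrA; apply: lerD.
Unshelve. all: by end_near. Qed.

Variable K : set C.
Hypothesis cK : compact K.
Hypothesis KB : forall w, K w -> boxC (2 * dl) b w.
Hypothesis sK : forall n j, K (s n j).
Hypothesis sgH : supported_in_H sigma.

Local Notation G := (Gm (fun u => Mfun (mu u))).

Section Part.
Variable part : C -> R.
Hypothesis pt0 : part 0 = 0.
Hypothesis ptD : forall z w, part (z + w) = part z + part w.
Hypothesis ptB : forall z w, part (z - w) = part z - part w.
Hypothesis ptZ : forall (c : R) z, part (cR c * z) = c * part z.
Hypothesis pt_le : forall z, `|part z| <= nc z.
Hypothesis ptE : forall t f, part (cE (E t) f) = E t (fun y => part (f y)).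
Hypothesis pt_bm : forall f : R -> C, bmC f -> bm (fun y => part (f y)).

(** Transported back to sigma, the two integrands agree on K by [Fker_int], since there G coincides
    with [Psi]. Off K they may differ, and [sigma_ext] equates the integrals once both are bounded
    and measurable on the whole plane; for the integrand with G this comes from [Mfun_bounded] and
    [Gm_measurable]. *)
Lemma cauchy_sigma t z : 0 < t < T -> ImC z != 0 ->
  (forall w, K w -> z != G t w /\ z != cconj (G t w)) ->
  sintR (sg t) (fun zeta => E t (fun y => part ((cR 2 * (z - cR y)^-1 ^+ 2) * (1 / (cR y - zeta) + 1 / (cR y - cconj zeta))))) =
  sintR sigma (fun w => part (Fker (mu t) z (G t w) + Fker (mu t) z (cconj (G t w)))).
Proof.
move=> tT z0 Kz.
have tT' : 0 <= t <= T by case/andP: tT => ? ?; apply/andP; split; exact: ltW.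
have t0 : 0 <= t by case/andP: tT'.
have gm : good (fun u => Mfun (mu u)) := Mfun_good mu.
have tc : tcont (fun u => Mfun (mu u)) t := tcont_sub (proj2 (andP tT')) (@Mfun_tcont R V T nk mu Vmu).
pose f1 y : C := cR 2 * (z - cR y)^-1 ^+ 2.
have bf1 : bmC f1 by apply: bmC_M; [exact: bmC_cst|exact: inv2_bmC].
have bp : bm (fun y => part (f1 y)) := pt_bm bf1.
have kE y zeta : part (f1 y * (1 / (cR y - zeta) + 1 / (cR y - cconj zeta))) = bker y zeta * part (f1 y).
  by rewrite !div1r bkerE mulrC ptZ.
pose H zeta := E t (fun y => bker y zeta * part (f1 y)).
transitivity (sintR (sg t) H).
  by apply: eq_sintR => zeta; congr (Rintegral _ _ _); apply/funext => y; exact: kE.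
have [bm1 [M1 hM1]] := bp.
have M10 : 0 <= M1 := le_trans (normr_ge0 _) (hM1 0).
have q1 : 0 <= 2 / dl by rewrite divr_ge0 // ltW.
have q2 : 0 <= 2 / dl ^+ 2 by rewrite divr_ge0 // exprn_ge0 // ltW.
have bbk zeta : dl <= ImC zeta -> bm (fun y => bker y zeta).
  move=> hz; apply: (bm_lip (L := 2 / dl ^+ 2) (M := 2 / dl)) => [y y'|y]; last exact: bker_bound.
  by have := bker_lip y y' dl0 hz hz; rewrite subrr nc0 add0r.
have tH : tf dl b T H (2 / dl * M1).
  have L0 : 0 <= 2 / dl ^+ 2 * M1 by rewrite mulr_ge0.
  apply: (lip_tf dl0 dlb TE L0) => [u v hu hv|u hu].
    rewrite /H -(pfB (pf_prob _)); try by apply: bmM => //; exact: bbk.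
    rewrite -[leRHS]mulr1; apply: (pf_bound (pf_prob _)).
      by apply: bmB; apply: bmM => //; exact: bbk.
    move=> y; rewrite -mulrBl normrM mulrAC; apply: ler_pM => //.
    by have := bker_lip y y dl0 hu hv; rewrite subrr normr0 addr0.
  rewrite -[leRHS]mulr1; apply: (pf_bound (pf_prob _)); first by apply: bmM => //; exact: bbk.
  by move=> y; rewrite normrM; apply: ler_pM => //; exact: bker_bound.
rewrite (sigt_int dl0 dlb TE sigma PsiP tH tT').
have [B MB] := Mfun_bounded tT.
have [D FD] := Fker_bound MB z0.
have at0 n f : (forall z, K z -> f z = 0) -> atomsH n (alpha n) (s n) f = 0.
  by move=> h; rewrite /atomsH big1 // => j _; rewrite h ?mulr0.
have b1 : bm ((H \o Psi t) \o @ofpair R).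
  have -> : H \o Psi t = (H \o Rb) \o Psi t.
    by apply/funext => w /=; rewrite (isflow_clamp dl0 dlb TE gm PsiP).
  apply: (contC_bm (M := 2 / dl * M1)) => [w|w]; last exact: tH.2.
  by apply: continuous_comp; [exact: (isflow_cont dl0 TE gm PsiP tT')|exact: tH.1].
have GI w : G t w = 0 \/ inH (G t w).
  have [[p gp]|h] := EM (exists p, gsol (fun u => Mfun (mu u)) t w p); last by left; exact: Gm_out.
  have tt : 0 <= t <= t by rewrite t0 lexx.
  by right; rewrite (Gm_eq gm tt gp); case: gp => _ [h _]; exact: h.
have FP (u : C) : inH u -> nc (Fker (mu t) z u) <= D by move=> h; apply: FD; rewrite gt_eqF.
have FPc (u : C) : inH u -> nc (Fker (mu t) z (cconj u)) <= D.
  by move=> h; apply: FD; rewrite /ImC /= oppr_eq0 gt_eqF.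
have b2 : bm ((fun w => part (Fker (mu t) z (G t w) + Fker (mu t) z (cconj (G t w)))) \o @ofpair R).
  have m1 := @Gm_measurable R _ t (fun u => part (Fker (mu t) z u)) z gm tc t0.
  have m2 := @Gm_measurable R _ t (fun u => part (Fker (mu t) z (cconj u))) (cconj z) gm tc t0.
  have pc (F : C -> C) u : {for u, continuous F} -> {for u, continuous (fun v => part (F v))}.
    move=> /contCCP h; apply/contCRP => r r0; have [d d0 Hd] := h r r0; exists d => // w hw.
    by rewrite -ptB; apply: le_trans (pt_le _) _; exact: Hd.
  have cc (u : C) : {for u, continuous (@cconj R)}.
    by apply/contCCP => r r0; exists r => // w hw; rewrite -cconjB nc_conj ltW.
  have {}m1 := m1 _ _; have {}m2 := m2 _ _.
  have m1' := m1 (fun u uH uz => pc _ _ (Fker_cont (ltac:(by rewrite gt_eqF) : ImC u != 0) uz)) (ltac:(by rewrite Fker_diag)).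
  have m2' : measurable_fun setT ((fun w => part (Fker (mu t) z (cconj (G t w)))) \o @ofpair R).
    apply: m2; last by rewrite cconjK Fker_diag.
    move=> u uH uz; apply: (pc (Fker (mu t) z \o @cconj R)); apply: continuous_comp; first exact: cc.
    apply: Fker_cont; first by rewrite /ImC /= oppr_eq0 gt_eqF.
    by apply: contra_neq uz => <-; rewrite cconjK.
  split.
    rewrite (_ : _ \o _ = ((fun w => part (Fker (mu t) z (G t w))) \o @ofpair R) \+
      ((fun w => part (Fker (mu t) z (cconj (G t w)))) \o @ofpair R)); first exact: measurable_funD.
    by apply/funext => q /=; rewrite ptD.
  have D0 : 0 <= D := le_trans (nc_ge0 _) (FD 'i%C (ltac:(by rewrite /ImC /= oner_eq0))).
  (* The last summand covers the starting points whose solution has ended, where G is 0. *)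
  exists (D + D + nc (Fker (mu t) z 0 + Fker (mu t) z (cconj 0))) => q; apply: le_trans (pt_le _) _.
  have [->|h] := GI (ofpair q); first by rewrite lerDr addr_ge0.
  apply: le_trans (ncD _ _) _; apply: (@le_trans _ _ (D + D)); last by rewrite lerDl nc_ge0.
  by apply: lerD; [exact: FP|exact: FPc].
apply: (@sigma_ext R sigma K (fun n f => atomsH n (alpha n) (s n) f) cK sgH at0 sigma_cv _ _ b1 b2).
move=> q Kq /=; set w := ofpair q in Kq *.
have gw : gsol (fun u => Mfun (mu u)) T w (fun u => Psi u w).
  by have := isflow_gsol dl0 dlb TE gm PsiP w; rewrite (clampC_id (KB Kq)).
have Gw : G t w = Psi t w := Gm_eq gm tT' gw.
have [h1 h2] := Kz w Kq; rewrite -Gw.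
have GH : inH (G t w) by rewrite Gw; case: gw => _ [h _]; exact: h.
have i1 : ImC (G t w) != 0 by rewrite gt_eqF.
have i2 : ImC (cconj (G t w)) != 0 by rewrite /ImC /= oppr_eq0 gt_eqF.
rewrite (Fker_int _ z0 i1); last by rewrite eq_sym.
rewrite (Fker_int _ z0 i2); last by rewrite eq_sym.
have binv zeta : ImC zeta != 0 -> bmC (fun y : R => (cR y - zeta)^-1).
  move=> hz; have -> : (fun y : R => (cR y - zeta)^-1) = (fun y : R => (- (1 : C)) * (zeta - cR y)^-1).
    by apply/funext => y; rewrite subVN mulN1r.
  by apply: bmC_M; [exact: bmC_cst|exact: inv_bmC].
rewrite -(cE_D (pf_prob _)); [|by apply: bmC_M => //; exact: binv|by apply: bmC_M => //; exact: binv].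
rewrite ptE /H; congr (Rintegral _ _ _); apply/funext => y.
by rewrite -kE !div1r mulrDr.
Qed.
End Part.

Theorem cauchy_equation t z : 0 < t < T -> ImC z != 0 ->
  (forall w, K w -> z != G t w /\ z != cconj (G t w)) ->
  is_cderiv (fun u => Mfun (mu u) z) t
    (- derive1 (Mfun (mu t)) z * Mfun (mu t) z
      + sint sigma (fun w => Fker (mu t) z (G t w) + Fker (mu t) z (cconj (G t w)))).
Proof.
move=> tT z0 Kz.
have [C2 e1 _] := cauchy_test z0.
have H := complex_equation (dl0 := dl0) dlb (TE := TE) sB dr Cb0 HC sigma_cv nkI Vmu V_tail PhiP (PsiP := PsiP) C2 tT.
rewrite (cauchy_double z0) in H.
have E1 : sint (sg t) (fun zeta => cint (mu t) (fun y =>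
    cder1 (fun y => cR 2 / (z - cR y)) y * (1 / (cR y - zeta) + 1 / (cR y - cconj zeta)))) =
  sint sigma (fun w => Fker (mu t) z (G t w) + Fker (mu t) z (cconj (G t w))).
  have e2 zeta : cint (mu t) (fun y => cder1 (fun y => cR 2 / (z - cR y)) y * (1 / (cR y - zeta) + 1 / (cR y - cconj zeta))) =
     cE (E t) (fun y => (cR 2 * (z - cR y)^-1 ^+ 2) * (1 / (cR y - zeta) + 1 / (cR y - cconj zeta))).
    by congr (cE _ _); apply/funext => y; rewrite e1.
  rewrite (eq_sint _ e2).
  apply: complexP.
    rewrite !Re_sint.
    by apply: (cauchy_sigma (part := @ReC R)) => //; [exact: ReD|exact: ReB|exact: ReZ|exact: Re_le_nc|move=> f []].
  rewrite !Im_sint.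
  by apply: (cauchy_sigma (part := @ImC R)) => //; [exact: ImD|exact: ImB|exact: ImZ|exact: Im_le_nc|move=> f []].
by rewrite E1 in H.
Qed.
End CauchyEquation.

Unset Implicit Arguments.

(* N = n.+1 ranges over the positive integers. *)
Theorem mainTheorem6 (R : realType)
  (x : forall n : nat, 'I_n.+1 -> R)
  (Mn : nat -> nat)
  (s : forall n : nat, 'I_(Mn n) -> R[i])
  (alpha : forall n : nat, 'I_(Mn n) -> int)
  (V : forall n : nat, R -> 'I_n.+1 -> R)
  (g : forall n : nat, R -> R[i] -> R[i])
  (mu0 : probability R R) (phi : R -> R)
  (K : set R[i]) (sigma : smeasH R) :
  (* ordered initial points, s_{N,j} in H *)
  (forall n (i j : 'I_n.+1), (i < j)%N -> x n i < x n j) ->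
  (forall n j, inH (s n j)) ->
  (* (V_N, g_N) is the (maximal) solution of the Loewner system *)
  (forall n t1 W S, 0 <= t1 -> drivingSol (x n) (s n) (alpha n) t1 W S ->
     drivingSol (x n) (s n) (alpha n) t1 (V n) (fun u j => g n u (s n j))) ->
  (forall n t1 z gam, 0 <= t1 -> inH z -> loewnerSol (V n) t1 z gam ->
     loewnerSol (V n) t1 z (fun u => g n u z)) ->
  (* mu_{N,0} --> mu0 weakly *)
  (forall f, bcontR f -> (fun n => empR (x n) f) @ \oo --> Rintegral mu0 setT f) ->
  (* the weight function phi *)
  (forall y, derivable phi y 1) -> (forall y, derivable (derive1 phi) y 1) ->
  continuous (derive1 (derive1 phi)) ->
  (forall y, 1 <= phi y) ->
  (exists B : R, forall y, `|derive1 phi y| <= B /\ `|derive1 (derive1 phi) y| <= B) ->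
  (forall A : R, exists B : R, forall y, B <= `|y| -> A <= phi y) ->
  (exists B : R, forall n, empR (x n) phi <= B) ->
  (* supports of sigma_{N,0} in a fixed compact K of H *)
  compact K -> K `<=` inH (R:=R) ->
  (forall n j, K (s n j)) ->
  (* sigma_{N,0} --> sigma weakly, sigma a finite signed measure on H *)
  supported_in_H sigma ->
  (forall f, bcontH f ->
     (fun n => atomsH n (alpha n) (s n) f) @ \oo --> sintR sigma f) ->
  exists T : R, 0 < T /\
  (* the solutions exist on [0,T] *)
  (forall n, drivingSol (x n) (s n) (alpha n) T (V n) (fun u j => g n u (s n j))) /\
  (* tightness in M(T) *)
  (exists (nk : nat -> nat) (mu : R -> probability R R),
     strictly_incr nk /\ MT_conv T nk V mu) /\
  (* properties of subsequential limits *)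
  (forall (nk : nat -> nat) (mu : R -> probability R R),
     strictly_incr nk -> MT_conv T nk V mu ->
     (* (i) *)
     (exists sig : R -> smeasH R,
        (forall t, 0 <= t <= T -> supported_in_H (sig t)) /\
        (forall t, 0 <= t <= T -> forall f, bcontH f ->
           (fun k => atomsH (nk k) (alpha (nk k)) (fun j => g (nk k) t (s (nk k) j)) f)
             @ \oo --> sintR (sig t) f) /\
        (forall f, C2bC f -> forall t, 0 < t < T ->
           is_cderiv (fun u => cint (mu u) (fun y => f y)) t
             (cint (mu t) (fun y1 => cint (mu t) (fun y2 => dquot f y1 y2))
              + sint (sig t) (fun z => cint (mu t) (fun y =>
                   cder1 f y * (1 / (cR y - z) + 1 / (cR y - cconj z)))))) /\
        (forall h, holoH h -> forall t, 0 < t < T ->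
           is_cderiv (fun u => sint (sig u) h) t
             (cint (mu t) (fun y => sint (sig t) (fun z =>
                 cR 2 * derive1 h z / (z - cR y)))))) /\
     (* (ii) *)
     (exists G : R -> R[i] -> R[i],
        (* G is the maximal solution of d/dt G_t(z) = M_t(G_t(z)) in H *)
        (forall t1 z gam, 0 <= t1 <= T -> inH z -> limLoewnerSol mu t1 z gam ->
           limLoewnerSol mu t1 z (fun u => G u z)) /\
        (forall w, K w -> limLoewnerSol mu T w (fun u => G u w)) /\
        (* g_{N_k,t} --> G_t locally uniformly on the domain of G_t *)
        (forall t (Q : set R[i]), 0 <= t <= T -> compact Q ->
           (forall z, Q z -> inH z /\ limLoewnerSol mu t z (fun u => G u z)) ->
           (\forall k \near \oo, forall z, Q z ->
               loewnerSol (V (nk k)) t z (fun u => g (nk k) u z)) /\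
           (forall e : R, 0 < e -> \forall k \near \oo, forall z, Q z ->
               `|g (nk k) t z - G t z| <= cR e)) /\
        (* the equation for M_t *)
        (forall t z, 0 < t < T -> ImC z != 0 ->
           (forall w, K w -> z != G t w /\ z != cconj (G t w)) ->
           is_cderiv (fun u => Mfun (mu u) z) t
             (- derive1 (Mfun (mu t)) z * Mfun (mu t) z
              + sint sigma (fun w =>
                  let F := fun zeta : R[i] =>
                    Mfun (mu t) z / (z - zeta) ^+ 2
                    - Mfun (mu t) zeta / (z - zeta) ^+ 2
                    - derive1 (Mfun (mu t)) z / (z - zeta) in
                  F (G t w) + F (cconj (G t w))))))).
Proof.
move=> xlt sH Vmax gmax mu_cv dphi ddphi _ phi1 phiB phiInf phi0 cK KH sK sgH sg_cv.
have [d d0 HdK] := compact_box cK KH.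
pose dl := d / 2; have dl0 : 0 < dl by rewrite divr_gt0.
have dlE : 2 * dl = d by rewrite /dl mulrC divfK // pnatr_eq0.
have di0 : 0 < d^-1 by rewrite invr_gt0.
(* [d^-1] bounds the coordinates of K; adding d ensures [2 * dl <= b]. *)
pose b := d^-1 + d.
have dlb : 2 * dl <= b by rewrite dlE /b; lra.
have KB w : K w -> boxC (2 * dl) b w.
  by move=> /HdK[h1 h2 h3]; rewrite /boxC dlE /b; split => //; lra.
pose T := dl ^+ 2 / 2; have TE : T = dl ^+ 2 / 2 by [].
have T0 : 0 < T by rewrite divr_gt0 // exprn_gt0.
have T00 : 0 <= T := ltW T0.
have sB n j : boxC (2 * dl) b (s n j) := KB _ (sK n j).
pose S n u j := g n u (s n j).
(* Some solution exists up to time T, and maximality makes the given V and g a solution on the same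
   interval. *)
have dr n : drivingSol (x n) (s n) (alpha n) T (V n) (S n).
  have [W [S' h]] := @driving_exists R n (Mn n) (x n) (s n) (alpha n) dl T dl0 T00 (xlt n)
    (fun j => (let: And3 h _ _ := sB n j in h)) (lexx _).
  exact: Vmax T00 h.
have [Cb Cb0 HC] := atoms_unif sg_cv.
have [Phi PhiP] := Mw_flow b dl0 TE dr.
have Vt := V_tail dl0 dlb TE sB dr PhiP HC Cb0 dphi ddphi phi1 phiB phiInf phi0.
exists T; split => //; split => //; split.
  by apply: (MT_compact T00 _ Vt) => a h h0; exact: (V_lip dl0 dlb TE sB dr PhiP HC Cb0 a h0).
move=> nk mu nkI Vmu.
have gm : good (fun t => Mfun (mu t)) := Mfun_good mu.
have tcM : tcont (fun t => Mfun (mu t)) T := @Mfun_tcont R V T nk mu Vmu.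
have [Psi PsiP] := isflow_ex b dl0 TE gm tcM.
split.
  exists (sigt dl0 TE sigma PsiP); split; first by move=> t _; exact: sigt_supp.
  split.
    move=> t tT f /(bcontH_tf dl0 dlb TE)[M hf].
    exact: (sigt_cvg dlb sB dr Cb0 HC sg_cv nkI Vmu PhiP (PsiP := PsiP) hf tT).
  split; first by move=> f hf t tT; exact: (complex_equation dlb sB dr Cb0 HC sg_cv nkI Vmu Vt PhiP (PsiP := PsiP) hf tT).
  by move=> h hh t tT; exact: (holo_equation dlb sB dr Cb0 HC sg_cv nkI Vmu Vt PhiP (PsiP := PsiP) hh tT).
exists (Gm (fun t => Mfun (mu t))); split.
  by move=> t1 z gam /andP[t10 _] _ hz; exact: (Gm_sol gm t10 (hz : gsol (fun t => Mfun (mu t)) t1 z gam)).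
split.
  move=> w Kw; have h := isflow_gsol dl0 dlb TE gm PsiP w.
  by rewrite (clampC_id (KB w Kw)) in h; exact: (Gm_sol gm T00 h).
split.
  move=> t Q tT cQ HQ.
  have t0 : 0 <= t by case/andP: tT.
  have gN k : good (Mw (V (nk k))) by exact: Mw_good.
  have tN k : tcont (Mw (V (nk k))) T by apply: Mw_tcont; case: (dr (nk k)) => _ [_ []].
  have HQ' z : Q z -> gsol (fun u => Mfun (mu u)) t z (fun u => Gm (fun t => Mfun (mu t)) u z).
    by move=> /HQ[].
  have LU := @local_uniform R _ (fun k => Mw (V (nk k))) t T Q gm tcM tT gN tN
    (fun d r d0 r0 => M_unif Vmu d0 r0) cQ HQ'.
  have gs k z q : Q z -> gsol (Mw (V (nk k))) t z q -> loewnerSol (V (nk k)) t z (fun u => g (nk k) u z).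
    by move=> Qz hq; apply: (gmax _ _ _ q) => //; case: (HQ z Qz).
  split.
    by apply: filterS (LU 1 ltr01) => k Hk z Qz; have [q hq _] := Hk z Qz; exact: gs Qz hq.
  move=> e e0; apply: filterS (LU e e0) => k Hk z Qz; have [q hq he] := Hk z Qz.
  have hg : gsol (Mw (V (nk k))) t z (fun u => g (nk k) u z) := gs k z q Qz hq.
  have tt : 0 <= t <= t by rewrite t0 lexx.
  by rewrite normE lecRR (gsol_uniq (gN k) hg hq tt).
move=> t z tT z0 Kz.
exact: (cauchy_equation dl0 dlb TE sB dr Cb0 HC sg_cv nkI Vmu Vt PhiP PsiP cK KB sK sgH tT z0 Kz).
Qed.
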